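(* Let $N\ge1$, assume (H2)–(H5) of the context, and let $(q_k,p_k)_{1\le k\le N}$ be a solution of the $N$-particle system (P) of the context. If $\lim_{|x|\to\infty}V(x)=+\infty$, or more generally if $(q_k,p_k)_{1\le k\le N}\in C_b(\mathbb{R}_+,(\mathbb{R}^d\times\mathbb{R}^d)^N)$, then $$\lim_{t\to\infty}D\big((q_k(t),p_k(t))_{1\le k\le N},Eq^N\big)=0,$$ where $D$ is the Euclidean distance to a set in $(\mathbb{R}^d\times\mathbb{R}^d)^N$ and, with $\kappa=-P(0)$, $$Eq^N=\Big\{(x_k,v_k)_{1\le k\le N}\ \Big|\ \nabla V(x_k)-\frac{\kappa}{N}\sum_{j=1}^N\nabla\Sigma(x_k-x_j)=0\ \text{ and }\ v_k=0\ \text{ for all }k\Big\}.$$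
   Context: $N$-particle system (P): for $t\ge0$ and all $k\in\{1,\dots,N\}$, $$\dot q_k(t)=p_k(t),\qquad \dot p_k(t)=-\nabla_x\big(V+\Phi_0(t)\big)(q_k(t))+\int_0^tp(t-s)\Big(\frac1N\sum_{j=1}^N\nabla_x\Sigma(q_k(t)-q_j(s))\Big)ds,$$ with $q_k(t),p_k(t)\in\mathbb{R}^d$ and given initial data. (The scalar function $p$ is the memory kernel; $p_k$ is the velocity of particle $k$.) The function $p$ is extended to $\mathbb{R}$ by $p(-t)=-p(t)$. Fourier transforms are $\hat h(\omega)=\int h(t)e^{-i\omega t}\,dt$ (in the sense of tempered distributions when needed). $C_b$ denotes bounded continuous functions. Assumptions. (H2): $\Phi_0\in C(\mathbb{R}_+,W^{2,\infty}(\mathbb{R}^d))$, $p\in L^1_{loc}(\mathbb{R})$, $\Sigma\in C^2_0(\mathbb{R}^d)$ (real-valued, with derivatives up to order 2 continuous and vanishing at infinity), $V\in W^{2,\infty}_{loc}(\mathbb{R}^d)$, $V\ge0$. (H3): $\nabla_x\Phi_0\in L^1(\mathbb{R}_+,L^\infty(\mathbb{R}^d))$, $p=P'$ with $P\in L^1(\mathbb{R})$, $\hat P\le0$, $\hat\Sigma\ge0$. (H4): $\nabla_x\Phi_0\in L^\infty(\mathbb{R}_+\times\mathbb{R}^d)$, $P\in L^\infty(\mathbb{R})$, $|\nabla V|\le\alpha+\beta V$ for some constants $\alpha,\beta$. (H5): $\hat P(\omega)\ne0$ for all $\omega\neq0$, and $\mathrm{supp}(\hat\Sigma)=\mathbb{R}^d$.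 (The paper's further assumption (H1), that the initial distribution is a finite measure of finite energy $\int(V+|v|^2/2)$, is automatic for the empirical measure of the initial data.) *)

(* Defs.v *)
From HB Require Import structures.
From mathcomp Require Import all_boot all_order all_algebra.
From mathcomp Require Import all_classical all_reals all_analysis.
From mathcomp Require Import complex.
Set Implicit Arguments. Unset Strict Implicit. Unset Printing Implicit Defensive.
Import Order.TTheory GRing.Theory Num.Theory.
Import numFieldNormedType.Exports.
Local Open Scope classical_set_scope.
Local Open Scope ring_scope.
Local Open Scope complex_scope.

Definition rV_display : measure_display.
Proof. exact: default_measure_display. Qed.

(* The sigma-algebra generated by the coordinates, i.e. the Borel one. *)
Section measurable_rV.
Context (R : realType) (n : nat).

Let coord (i : 'I_n) (x : 'rV[R]_n) : R := x 0 i.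

Let rV_set0 : g_sigma_preimage coord set0.
Proof. exact: sigma_algebra0. Qed.

Let rV_setC A : g_sigma_preimage coord A -> g_sigma_preimage coord (~` A).
Proof. exact: sigma_algebraC. Qed.

Let rV_bigcup (F : _^nat) : (forall i, g_sigma_preimage coord (F i)) ->
  g_sigma_preimage coord (\bigcup_i (F i)).
Proof. exact: sigma_algebra_bigcup. Qed.

HB.instance Definition _ := @isMeasurable.Build rV_display
  'rV[R]_n (g_sigma_preimage coord) rV_set0 rV_setC rV_bigcup.

Lemma measurable_coord (i : 'I_n) :
  measurable_fun [set: 'rV[R]_n] (fun x : 'rV[R]_n => x 0 i).
Proof.
move=> _ Y mY; rewrite setTI; apply: sub_sigma_algebra => /=.
rewrite -bigcup_seq/=; exists i => /=; first by rewrite mem_index_enum.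
by exists Y => //; rewrite setTI.
Qed.

Lemma measurable_fun_coordP d (T : measurableType d) (f : T -> 'rV[R]_n) :
  (forall i, measurable_fun [set: T] (fun t => f t 0 i)) ->
  measurable_fun [set: T] f.
Proof.
move=> mf.
have : g_sigma_preimage (fun i => coord i \o f) `<=` measurable.
  apply: smallest_sub; first exact: sigma_algebra_measurable.
  rewrite -bigcup_seq; apply: bigcup_sub => i _.
  by move=> A [B mB <-]; exact: mf.
by rewrite g_sigma_preimage_comp => prefS _ A mA; apply: prefS; exists A.
Qed.

End measurable_rV.

Section sigma_finite_transfer.
Local Open Scope ereal_scope.
Context d1 d2 d3 (T1 : measurableType d1) (T2 : measurableType d2)
  (T3 : measurableType d3) (R : realType).

Lemma sigma_finite_pushforward (m : set T1 -> \bar R) (f : T1 -> T2)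
    (g : T2 -> T1) : measurable_fun setT g -> cancel f g ->
  sigma_finite setT m -> sigma_finite setT (pushforward m f).
Proof.
move=> mg fK [F FT Ffin]; exists (fun k => g @^-1` (F k)).
  by rewrite -preimage_bigcup -FT preimage_setT.
move=> k; have [mF Foo] := Ffin k; split.
  by rewrite -[X in measurable X]setTI; exact: mg.
rewrite /pushforward -comp_preimage (_ : g \o f = id)//.
by apply/funext => x /=; rewrite fK.
Qed.

Lemma sigma_finite_product (m1 : {sigma_finite_measure set T1 -> \bar R})
  (m2 : {sigma_finite_measure set T3 -> \bar R}) :
  sigma_finite setT (m1 \x m2).
Proof.
have /sigma_finiteP[F [TF ndF Foo]] := sigma_finiteT m1.
have /sigma_finiteP[G [TG ndG Goo]] := sigma_finiteT m2.
exists (fun n => F n `*` G n).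
  rewrite -setXTT TF TG predeqE => -[x y]; split.
    move=> [/= [n _ Fnx] [k _ Gky]]; exists (maxn n k) => //; split.
    - by move: x Fnx; exact/subsetPset/ndF/leq_maxl.
    - by move: y Gky; exact/subsetPset/ndG/leq_maxr.
  by move=> [n _ []/= ? ?]; split; exists n.
move=> k; have [? ?] := Foo k; have [? ?] := Goo k.
split; first exact: measurableX.
by rewrite product_measure1E// lte_mul_pinfty// ge0_fin_numE.
Qed.

End sigma_finite_transfer.

Section lebesgue_rV.
Context (R : realType).

Definition rV_cons n (z : measurableTypeR R * 'rV[R]_n) : 'rV[R]_n.+1 :=
  row_mx (z.1 : R)%:M z.2.

Definition rV_uncons n (x : 'rV[R]_n.+1) : measurableTypeR R * 'rV[R]_n :=
  (x 0 ord0, \row_i x 0 (lift ord0 i)).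

Lemma rV_consK n : cancel (@rV_cons n) (@rV_uncons n).
Proof.
move=> [a x]; congr pair => /=.
  rewrite /rV_cons /= (_ : (ord0 : 'I_n.+1) = lshift n (ord0 : 'I_1)); last exact/val_inj.
  by rewrite (row_mxEl (a : R)%:M x) mxE eqxx mulr1n.
apply/rowP => i; rewrite mxE /rV_cons /=.
rewrite (_ : lift (ord0 : 'I_n.+1) i = rshift 1 i); last exact/val_inj.
by rewrite (row_mxEr (a : R)%:M x).
Qed.

Lemma measurable_rV_cons n : measurable_fun setT (@rV_cons n).
Proof.
apply: measurable_fun_coordP => i.
case: (splitP (i : 'I_(1 + n))) => j ij.
  have -> : (fun t => @rV_cons n t 0 i) = fst.
    apply/funext => -[a x] /=; rewrite (_ : i = lshift n j); last exact/val_inj.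
    by rewrite /rV_cons (row_mxEl (a : R)%:M x) mxE (ord1 j) eqxx mulr1n.
  exact: measurable_fst.
have -> : (fun t => @rV_cons n t 0 i) = (fun x : 'rV[R]_n => x 0 j) \o snd.
  apply/funext => -[a x] /=; rewrite (_ : i = rshift 1 j); last exact/val_inj.
  by rewrite /rV_cons (row_mxEr (a : R)%:M x).
apply: measurableT_comp; [exact: measurable_coord | exact: measurable_snd].
Qed.

Lemma measurable_rV_uncons n : measurable_fun setT (@rV_uncons n).
Proof.
apply: measurable_fun_pair; first exact: measurable_coord.
apply: measurable_fun_coordP => i.
under eq_fun do rewrite mxE.
exact: measurable_coord.
Qed.

Section lebesgue_rV_step.
Context (n : nat) (m : {sigma_finite_measure set 'rV[R]_n -> \bar R}).

Definition lebesgue_rV_step : set 'rV[R]_n.+1 -> \bar R :=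
  pushforward (@lebesgue_measure R \x m)%E (@rV_cons n).

HB.instance Definition _ := Measure.copy lebesgue_rV_step
  (measure_function_pushforward__canonical__measure_function_Measure
     (@lebesgue_measure R \x m)%E (@measurable_rV_cons n)).

Let lebesgue_rV_step_sigma_finite : sigma_finite setT lebesgue_rV_step.
Proof.
apply: (sigma_finite_pushforward (@measurable_rV_uncons n) (@rV_consK n)).
exact: sigma_finite_product.
Qed.

HB.instance Definition _ :=
  Measure_isSigmaFinite.Build _ _ _ lebesgue_rV_step
    lebesgue_rV_step_sigma_finite.

End lebesgue_rV_step.

Fixpoint lebesgue_rV (n : nat) :
    {sigma_finite_measure set 'rV[R]_n -> \bar R} :=
  if n is n'.+1 then lebesgue_rV_step (lebesgue_rV n')
  else dirac (0 : 'rV[R]_0).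

End lebesgue_rV.
Arguments lebesgue_rV {R} n.

Section euclidean.
Context {R : realType} {n : nat}.
Implicit Types (x y : 'rV[R]_n) (f : 'rV[R]_n -> R).

Definition dotr x y : R := \sum_i x 0 i * y 0 i.

(* The library norm on 'rV[R]_n is the sup norm. *)
Definition enorm x : R := Num.sqrt (dotr x x).

Definition at_infty : set_system 'rV[R]_n :=
  [set A | exists M : R, forall x, M < enorm x -> A x].

Definition basis_rV (i : 'I_n) : 'rV[R]_n := delta_mx 0 i.

Definition grad f x : 'rV[R]_n := \row_i 'D_(basis_rV i) f x.

(* A multi-index alpha is represented by the sequence s of the directions of
   differentiation; |alpha| = size s. *)
Definition pderiv (s : seq 'I_n) f : 'rV[R]_n -> R :=
  foldr (fun i g x => 'D_(basis_rV i) g x) f s.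

Definition Cm (m : nat) f : Prop :=
  (forall s, (size s <= m)%N -> continuous (pderiv s f)) /\
  (forall s, (size s < m)%N ->
     forall x i, derivable (pderiv s f) x (basis_rV i)).

Definition smooth f : Prop := forall m, Cm m f.

Definition C0m (m : nat) f : Prop :=
  Cm m f /\ forall s, (size s <= m)%N -> pderiv s f @ at_infty --> (0 : R).

Definition test_function (U : set 'rV[R]_n) f : Prop :=
  [/\ smooth f, compact (closure [set x | f x != 0]) &
      closure [set x | f x != 0] `<=` U].

Definition schwartz f : Prop :=
  smooth f /\
  forall s m, exists C : R, forall x, enorm x ^+ m * `|pderiv s f x| <= C.

(* g is the distributional derivative of f along s. *)
Definition weak_pderiv (s : seq 'I_n) f g : Prop :=
  forall phi, test_function setT phi ->
    \int[lebesgue_rV n]_x (f x * pderiv s phi x) =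
    (-1) ^+ size s * \int[lebesgue_rV n]_x (g x * phi x).

(* ||f||_(W^{m,oo}) <= C, for the norm max_(|alpha| <= m) ||D^alpha f||_oo. *)
Definition sobolev_infty_le (m : nat) (C : R) f : Prop :=
  forall s, (size s <= m)%N -> exists g,
    [/\ g \in Lfun (lebesgue_rV n) +oo%E, weak_pderiv s f g &
        ('N[lebesgue_rV n]_+oo [EFin \o g] <= C%:E)%E].

Definition sobolev_infty (m : nat) f : Prop :=
  exists C, sobolev_infty_le m C f.

Definition sobolev_infty_loc (m : nat) f : Prop :=
  forall s, (size s <= m)%N -> exists g,
    [/\ measurable_fun setT g, weak_pderiv s f g &
        forall K : set 'rV[R]_n, compact K ->
          exists C : R, {ae lebesgue_rV n, forall x, K x -> `|g x| <= C}].

End euclidean.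
Arguments at_infty {R} n.

Section fourier.
Context {R : realType}.

Definition expi (a : R) : R[i] := cos a +i* sin a.

Definition Cintegral d (T : measurableType d)
    (mu : {measure set T -> \bar R}) (f : T -> R[i]) : R[i] :=
  (\int[mu]_x complex.Re (f x)) +i* (\int[mu]_x complex.Im (f x)).

Definition fourier (f : R -> R) (w : R) : R[i] :=
  Cintegral (@lebesgue_measure R) (fun t => (f t)%:C * expi (- (w * t))).

Definition fourier_rV n (f : 'rV[R]_n -> R) (xi : 'rV[R]_n) : R[i] :=
  Cintegral (lebesgue_rV n) (fun x => (f x)%:C * expi (- dotr xi x)).

(* Tempered distributions are given by their values on the real-valued Schwartz
   functions, which determine them by complex linearity. Here f is a bounded
   measurable function, so that it defines a tempered distribution, and
   <f^, phi> = <f, phi^> = \int f phi^. *)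
Definition fourier_dist n (f : 'rV[R]_n -> R) (phi : 'rV[R]_n -> R) : R[i] :=
  Cintegral (lebesgue_rV n) (fun xi => (f xi)%:C * fourier_rV phi xi).

(* z >= 0 in R[i] means that z is real and nonnegative. *)
Definition dist_ge0 n (T : ('rV[R]_n -> R) -> R[i]) : Prop :=
  forall phi, schwartz phi -> (forall x, 0 <= phi x) -> 0 <= T phi.

Definition dist_supp n (T : ('rV[R]_n -> R) -> R[i]) : set 'rV[R]_n :=
  [set x | forall U, open U -> U x ->
     exists2 phi, test_function U phi & T phi != 0].

End fourier.

Section hypotheses.
Context {R : realType} {n : nat}.
Implicit Types (V Sigma : 'rV[R]_n -> R) (p P : R -> R).

(* Elements of W^{2,oo} and W^{2,oo}_loc are represented by their continuous
   representative, which is of class C^1: [grad] is then the classical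
   gradient, as needed in the equations of motion. Phi0 is used on t >= 0
   only. *)
Definition hypH2 (Phi0 : R -> 'rV[R]_n -> R) p Sigma V : Prop :=
  [/\ forall t, 0 <= t -> continuous (Phi0 t) /\ sobolev_infty 2 (Phi0 t),
      forall t : R, 0 <= t -> forall e : R, 0 < e -> \forall s \near t,
        0 <= s -> sobolev_infty_le 2 e (Phi0 s \- Phi0 t),
      locally_integrable setT p,
      C0m 2 Sigma &
      [/\ continuous V, sobolev_infty_loc 2 V & forall x, 0 <= V x]].

(* p = P' means that P is the locally absolutely continuous primitive of the
   locally integrable p; in particular P is continuous and P(0) makes sense.
   z <= 0 in R[i] means that z is real and nonpositive. *)
Definition hypH3 (Phi0 : R -> 'rV[R]_n -> R) p P Sigma : Prop :=
  [/\ (@lebesgue_measure R).-integrable `[0, +oo[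
        (fun t => 'N[lebesgue_rV n]_+oo
                    [EFin \o (fun x => enorm (grad (Phi0 t) x))])%E,
      forall a b, a <= b ->
        P b - P a = \int[lebesgue_measure]_(t in `[a, b]) p t,
      P \in Lfun (@lebesgue_measure R) 1%E,
      forall w, fourier P w <= 0 &
      dist_ge0 (fourier_dist Sigma)].

Definition hypH4 (Phi0 : R -> 'rV[R]_n -> R) P V : Prop :=
  [/\ exists M : R, {ae (@lebesgue_measure R \x lebesgue_rV n)%E,
        forall z, 0 <= (z.1 : R) -> enorm (grad (Phi0 z.1) z.2) <= M},
      P \in Lfun (@lebesgue_measure R) +oo%E &
      exists alpha beta : R, forall x, enorm (grad V x) <= alpha + beta * V x].

Definition hypH5 P Sigma : Prop :=
  (forall w, w != 0 -> fourier P w != 0) /\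
  dist_supp (fourier_dist Sigma) = setT.

End hypotheses.

Section particles.
Context {R : realType} {n N : nat}.
Implicit Types (q v : 'I_N -> R -> 'rV[R]_n).

(* Derivative on [0, +oo[, hence one-sided at t = 0. *)
Definition derive_ge0 (f : R -> 'rV[R]_n) (t : R) (l : 'rV[R]_n) : Prop :=
  (s - t)^-1 *: (f s - f t) @[s --> within [set s | 0 <= s] t^'] --> l.

Definition memory_force (p : R -> R) (Sigma : 'rV[R]_n -> R) q
    (k : 'I_N) (t : R) : 'rV[R]_n :=
  \row_i \int[lebesgue_measure]_(s in `[0, t])
    (p (t - s) * (N%:R^-1 *: \sum_j grad Sigma (q k t - q j s)) 0 i).

Definition solution (V : 'rV[R]_n -> R) (Phi0 : R -> 'rV[R]_n -> R)
    (p : R -> R) (Sigma : 'rV[R]_n -> R) q v : Prop :=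
  forall t k, 0 <= t ->
    derive_ge0 (q k) t (v k t) /\
    derive_ge0 (v k) t
      (- grad (fun x => V x + Phi0 t x) (q k t) + memory_force p Sigma q k t).

Definition bounded_continuous_ge0 (f : R -> 'rV[R]_n) : Prop :=
  {within `[0, +oo[, continuous f} /\
  exists M : R, forall t, 0 <= t -> enorm (f t) <= M.

Definition phase : Type := 'I_N -> 'rV[R]_n * 'rV[R]_n.

Definition edist (z w : phase) : R :=
  Num.sqrt (\sum_k (enorm ((z k).1 - (w k).1) ^+ 2 +
                    enorm ((z k).2 - (w k).2) ^+ 2)).

(* Valued in the extended reals: the distance to the empty set is +oo. *)
Definition edist_set (z : phase) (A : set phase) : \bar R :=
  ereal_inf [set (edist z w)%:E | w in A].

Definition equilibria (V Sigma : 'rV[R]_n -> R) (kappa : R) : set phase :=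
  [set z | forall k,
    grad V (z k).1 -
      (kappa / N%:R) *: \sum_j grad Sigma ((z k).1 - (z j).1) = 0 /\
    (z k).2 = 0].

End particles.

(* Main.v *)
Require Import Defs.
From mathcomp Require Import all_boot all_order all_algebra.
From mathcomp Require Import all_classical all_reals all_analysis.
From mathcomp Require Import complex.
From mathcomp Require Import measurable_realfun ess_sup_inf.
From mathcomp Require Import ring lra.
Set Implicit Arguments.
Unset Strict Implicit.
Unset Printing Implicit Defensive.
Import Order.TTheory GRing.Theory Num.Theory.
Import numFieldNormedType.Exports.
Local Open Scope classical_set_scope.
Local Open Scope ring_scope.

(** A dissipation estimate followed by a compactness argument.

Integrating the memory force by parts in time replaces the kernel p by its
primitive P ([memory_parts]): it becomes the gradient of the interaction at
equal times with weight - P(0), plus P(t) times the force exerted by the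
initial positions, plus the convolution of P with the rate of change of the
pair forces. Let K(t, s) = N^-2 sum_(k, j) Sigma (q_k(t) - q_j(s)), and let
the energy at time t be
    N^-1 sum_k (|v_k|^2 / 2 + V (q_k)) + P(0) / 2 K(t, t).
Then the energy at time T plus half of the integral over [0, T]^2 of
- P(t - s) d_t d_s K(t, s) is the initial energy plus the work of two forces
that are integrable in time. Since Sigma has a nonnegative Fourier transform,
K is positive definite ([Sigma_pd], [pair_kernel_pd]), hence so is d_t d_s K
([pdkernel_mixed]); since the transform of - P is nonnegative, the double
integral, the dissipation, is nonnegative. So the velocities, the potential
energy and the dissipation remain bounded ([energy_bounds]).

For a fixed point y let psi(t) = N^-1 sum_k Sigma (y - q_k(t)). The kernel
Sigma(0) K(t, s) - psi(t) psi(s) is still positive definite, as a Schur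
complement ([schur_pd]), so that the dissipation controls the same quadratic
form of psi' ([potential_dissipation]). The transform of P vanishes at
most at 0, hence the part of psi' in any band of frequencies away from 0 is square
integrable; the remaining frequencies do not matter since psi is bounded and
Lipschitz, and psi (t + tau) - psi(t) tends to 0 ([increment_vanish]).

Let the positions at times t and t + tau accumulate at x and x', along the
same ultrafilter of times. Then sum_k Sigma (y - x_k) = sum_k Sigma (y - x'_k)
for every y; as the transform of Sigma has full support, x and x' occupy the
same set of points ([translates_independent], [same_support]). On the other
hand x' - x = tau w + O(tau^2), with w the limit of the velocities; a finite
set leaves no room for small displacements other than 0, so w = 0
([velocity_vanish]). Once the velocities vanish, the convolution term vanishes
too, the conservative force averages to 0 over unit intervals of time, and it
varies slowly, so that it tends to 0 ([residual_vanish]): every accumulation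
point of the trajectory is an equilibrium ([trajectories_converge]).

Two facts support this. A continuous function of class W^(2,oo)_loc is C^1
([sobolev_loc_C1]), which gives the chain rule for V and the external
potential. And the transform of Sigma is a distribution, tested here against
products of a Gaussian and the squared modulus of a trigonometric polynomial:
these test functions, whose transforms are explicit, suffice both for the
positive definiteness of Sigma and for the independence of its translates. *)

(** * Uniform continuity, measurability and integrals of real functions *)

Lemma compact_unif_cont (R : realType) (X : pseudoMetricType R) (K : set X)
    (f : X -> R) (e : R) :
  compact K -> continuous f -> 0 < e ->
  exists2 d : R, 0 < d &
    forall x y, K x -> ball x d y -> `|f x - f y| < e.
Proof.
move=> /compact_near_coveringP cK cf e0.
have := cK R (0^'+) (fun d x => forall y, ball x d y -> `|f x - f y| < e) _.
case.
  move=> x Kx.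
  have /cvgrPdist_lt/(_ (e / 2)) := cf x; rewrite divr_gt0// => /(_ isT).
  move=> /nbhs_ballP[d /= d0 dP].
  have d20 : 0 < d / 2 by rewrite divr_gt0.
  near=> z i => y /= zy.
  have xz : ball x (d / 2) z by near: z; exact: nbhsx_ballx.
  have xy : ball x d y.
    rewrite (splitr d); apply: ball_triangle xz _.
    by apply: le_ball zy; near: i; apply: nbhs_right_le.
  have := dP z (le_ball _ xz); rewrite ler_pdivrMr// mulr2n mulrDr mulr1 lerDl.
  move=> /(_ (ltW d0)) /= h1; have /= h2 := dP y xy.
  rewrite (_ : f z - f y = - (f x - f z) + (f x - f y)); last by ring.
  apply: (le_lt_trans (ler_normD _ _)); rewrite normrN (splitr e).
  exact: ltrD.
move=> d /= d0 dP; exists (d / 2); first by rewrite divr_gt0.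
move=> x y Kx; apply: dP Kx y => //=; last by rewrite divr_gt0.
by rewrite sub0r normrN gtr0_norm ?divr_gt0// ltr_pdivrMr// ltr_pMr// ltr1n.
Unshelve. all: by end_near. Qed.

(** A continuous function is the pointwise limit of its values at rounded
points, and rounding takes only countably many values. *)
Lemma measurable_fun_countable_approx d (T : measurableType d) (R : realType)
    (f : T -> R) (K : nat -> countType) (r : forall n, T -> K n)
    (g : forall n, K n -> R) :
  (forall n k, measurable (r n @^-1` [set k])) ->
  (forall x, g n (r n x) @[n --> \oo] --> f x) ->
  measurable_fun setT f.
Proof.
move=> mr gf; apply: (@measurable_realfun.measurable_fun_cvg _ _ _ _ (fun n x => g n (r n x))); last first.
  by move=> x _; exact: gf.
move=> n _ Y mY; rewrite setTI.
have -> : (fun x => g n (r n x)) @^-1` Y =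
    \bigcup_(k in [set k | Y (g n k)]) (r n @^-1` [set k]).
  apply/seteqP; split=> [x Yx|x [k /= Yk] rk]; first by exists (r n x).
  by rewrite /= rk.
rewrite bigcup_mkcond; apply: countable_bigcupT_measurable => // k.
by case: ifPn => // _; exact: mr.
Qed.

Section real_integrals.
Context {R : realType}.

Definition rint d (T : measurableType d) (m : {measure set T -> \bar R})
  (D : set T) (f : T -> R) := m.-integrable D (EFin \o f).

Section one.
Context d (T : measurableType d) (m : {measure set T -> \bar R}).
Variables (D : set T) (mD : measurable D).
Implicit Types f g : T -> R.

Lemma rint_meas f : rint m D f -> measurable_fun D f.
Proof. by move=> /measurable_int/measurable_EFinP. Qed.

Lemma rint_le f g : measurable_fun D f -> rint m D g ->
  (forall x, D x -> `|f x| <= g x) -> rint m D f.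
Proof.
move=> mf ig fg; apply: (le_integrable mD _ _ ig); first exact/measurable_EFinP.
by move=> x Dx /=; rewrite lee_fin (le_trans (fg _ Dx))// ler_norm.
Qed.

Lemma rintD f g : rint m D f -> rint m D g -> rint m D (fun x => f x + g x).
Proof. by move=> fi gi; have := integrableD mD fi gi. Qed.

Lemma rintB f g : rint m D f -> rint m D g -> rint m D (fun x => f x - g x).
Proof. by move=> fi gi; have := integrableB mD fi gi. Qed.

Lemma rintZ k f : rint m D f -> rint m D (fun x => k * f x).
Proof. by move=> fi; have := integrableZl mD k fi. Qed.

Lemma rintZr k f : rint m D f -> rint m D (fun x => f x * k).
Proof. by move=> /(rintZ k); under eq_fun do rewrite mulrC. Qed.

Lemma rintN f : rint m D f -> rint m D (fun x => - f x).
Proof. by move=> fi; have := integrableN fi. Qed.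

Lemma rint_norm f : rint m D f -> rint m D (fun x => `|f x|).
Proof. exact: integrable_norm. Qed.

Lemma rint_sum (I : finType) (F : I -> T -> R) :
  (forall i, rint m D (F i)) -> rint m D (fun x => \sum_i F i x).
Proof.
move=> Fi; have := @integrable_sum _ _ _ m D mD _ (index_enum I) xpredT
  (fun i => EFin \o F i) (fun i _ => Fi i).
rewrite /rint; congr (_.-integrable _ _); apply/funext => x /=.
by rewrite sumEFin.
Qed.

Lemma Rintegral_sum (I : finType) (F : I -> T -> R) :
  (forall i, rint m D (F i)) ->
  \int[m]_(x in D) (\sum_i F i x) = \sum_i \int[m]_(x in D) F i x.
Proof.
move=> Fi; suff H (r : seq I) : rint m D (fun x => \sum_(i <- r) F i x) /\
    \int[m]_(x in D) (\sum_(i <- r) F i x) = \sum_(i <- r) \int[m]_(x in D) F i x.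
  by have [] := H (index_enum I).
elim: r => [|i r [IH1 IH2]].
  have -> : (fun x => \sum_(i <- [::]) F i x) = cst 0.
    by apply/funext => x; rewrite big_nil.
  split; first exact: integrable0.
  by rewrite big_nil /Rintegral integral0.
have -> : (fun x => \sum_(j <- i :: r) F j x) =
    (fun x => F i x + \sum_(j <- r) F j x).
  by apply/funext => x; rewrite big_cons.
by split; [exact: rintD|rewrite big_cons -IH2; exact: (RintegralD mD (Fi i) IH1)].
Qed.

Lemma rint_ext f g : (forall x, D x -> f x = g x) -> rint m D f -> rint m D g.
Proof.
move=> fg; apply: eq_integrable => // x; rewrite inE => Dx /=.
by rewrite fg.
Qed.

Lemma RintegralN f : rint m D f ->
  \int[m]_(x in D) (- f x) = - \int[m]_(x in D) f x.
Proof.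
move=> fi; transitivity (\int[m]_(x in D) (-1 * f x)).
  by apply: eq_Rintegral => x _; rewrite mulN1r.
by rewrite RintegralZl// mulN1r.
Qed.

Lemma Rintegral_ext f g : (forall x, D x -> f x = g x) ->
  \int[m]_(x in D) f x = \int[m]_(x in D) g x.
Proof. by move=> fg; apply: eq_Rintegral => x /[!inE] Dx; exact: fg. Qed.

Lemma Rintegral_norm_le f g : rint m D f -> rint m D g ->
  (forall x, D x -> `|f x| <= g x) ->
  `|\int[m]_(x in D) f x| <= \int[m]_(x in D) g x.
Proof.
move=> fi gi fg; apply: (le_trans (le_normr_Rintegral _ _)) => //.
by apply: le_Rintegral => //; exact: rint_norm.
Qed.

Lemma Rintegral_le f g : rint m D f -> rint m D g ->
  (forall x, D x -> f x <= g x) ->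
  \int[m]_(x in D) f x <= \int[m]_(x in D) g x.
Proof. exact: le_Rintegral. Qed.

Lemma rintS (E : set T) f : measurable E -> E `<=` D -> rint m D f -> rint m E f.
Proof. by move=> mE ED; exact: integrableS. Qed.

Lemma rint_restrict f : rint m D f <-> rint m setT (f \_ D).
Proof. by rewrite /rint -restrict_EFin; exact: integrable_mkcond. Qed.

End one.

Section fubini.
Context d1 d2 (T1 : measurableType d1) (T2 : measurableType d2).
Variable m1 : {sigma_finite_measure set T1 -> \bar R}.
Variable m2 : {sigma_finite_measure set T2 -> \bar R}.

Lemma rint_product (G : T1 * T2 -> R) (u : T1 -> R) (w : T2 -> R) :
  measurable_fun setT G -> rint m1 setT u -> rint m2 setT w ->
  (forall x, 0 <= u x) -> (forall y, 0 <= w y) ->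
  (forall x y, `|G (x, y)| <= u x * w y) ->
  rint (m1 \x m2)%E setT G.
Proof.
move=> mG iu' iw' u'0 w'0 Guw.
apply/integrable12ltyP => /=; first exact/measurable_EFinP.
apply: (@le_lt_trans _ _ (\int[m1]_x ((u x)%:E * \int[m2]_y (w y)%:E)))%E.
  apply: ge0_le_integral => //=.
  - by move=> x _; apply: integral_ge0 => y _; rewrite lee_fin.
  - apply: (@measurable_fun_fubini_tonelli_F _ _ _ _ R m2
      (fun z => (`|G z|)%:E)) => //=.
      exact/measurable_EFinP/measurableT_comp.
  - apply: emeasurable_funM; last exact: measurable_cst.
    exact: measurable_int iu'.
  - move=> x _; rewrite -ge0_integralZl_EFin//=.
    + apply: ge0_le_integral => //=.
      * apply/measurable_EFinP/measurableT_comp => //.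
        exact: (measurableT_comp mG (pair1_measurable x)).
      * apply/measurable_EFinP/measurable_funM => //.
        exact: (rint_meas iw').
      * by move=> y _; rewrite lee_fin; exact: Guw.
    + by move=> y _; rewrite lee_fin.
    + by apply/measurable_EFinP; exact: (rint_meas iw').
have fw := integrable_fin_num (measurableT) iw'.
rewrite -(fineK fw); set c := fine _.
rewrite (eq_integral (fun x => c%:E * (u x)%:E)%E); last first.
  by move=> x _; rewrite muleC.
rewrite integralZl//; apply: lte_mul_pinfty => //.
  by rewrite lee_fin fine_ge0// integral_ge0// => y _; rewrite lee_fin.
exact: integrable_lty iu'.
Qed.

(** The domination by a product makes the integrand integrable on the product
space, so that Fubini applies without any further condition. *)
Lemma Rfubini (A : set T1) (B : set T2) (F : T1 -> T2 -> R) (u : T1 -> R)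
    (w : T2 -> R) :
  measurable A -> measurable B ->
  measurable_fun setT (fun z : T1 * T2 => F z.1 z.2) ->
  rint m1 A u -> rint m2 B w ->
  (forall x y, A x -> B y -> `|F x y| <= u x * w y) ->
  rint m1 A (fun x => \int[m2]_(y in B) F x y) /\
  \int[m1]_(x in A) \int[m2]_(y in B) F x y =
  \int[m2]_(y in B) \int[m1]_(x in A) F x y.
Proof.
move=> mA mB mF iu iw Fuw.
pose G (z : T1 * T2) := F z.1 z.2 * (\1_A z.1 * \1_B z.2).
pose u' := (fun x => `|u x|) \_ A; pose w' := (fun x => `|w x|) \_ B.
have iu' : rint m1 setT u' by apply: (rint_restrict m1 mA _).1; exact: rint_norm.
have iw' : rint m2 setT w' by apply: (rint_restrict m2 mB _).1; exact: rint_norm.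
have mG : measurable_fun setT G.
  apply: measurable_funM => //; apply: measurable_funM.
    exact: measurableT_comp (@measurable_fst _ _ _ _).
  exact: measurableT_comp (@measurable_snd _ _ _ _).
have GE x y : G (x, y) = ((fun x => (F x \_ B) y) \_ A) x.
  rewrite /G /= /patch !indicE; case: (x \in A); case: (y \in B);
  by rewrite ?(mulr1,mulr0,mul0r).
have Guw x y : `|G (x, y)| <= u' x * w' y.
  rewrite GE /patch /u' /w' /patch; case: ifPn => [|_].
    rewrite inE => Ax; case: ifPn => [|_]; last by rewrite normr0 mulr0.
    rewrite inE => By; rewrite -normrM; apply: (le_trans (Fuw _ _ Ax By)).
    exact: ler_norm.
  by rewrite normr0 mul0r.
have u'0 x : 0 <= u' x by rewrite /u' /patch; case: ifP.
have w'0 x : 0 <= w' x by rewrite /w' /patch; case: ifP.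
have iG := rint_product mG iu' iw' u'0 w'0 Guw.
have Fy x : A x -> rint m2 B (F x).
  move=> Ax; apply: (@rint_le _ _ m2 B mB _ (fun y => u x * w y)).
  - exact: measurable_funTS (measurable_fun_pair2 x mF).
  - exact: rintZ.
  - by move=> y By; exact: Fuw.
have Fx y : B y -> rint m1 A (F^~ y).
  move=> By; apply: (@rint_le _ _ m1 A mA _ (fun x => u x * w y)).
  - exact: measurable_funTS (measurable_fun_pair1 y mF).
  - exact: rintZr.
  - by move=> x Ax; exact: Fuw.
have E1 x : fubini_F m2 (EFin \o G) x =
   (((fun x => \int[m2]_(y in B) F x y) \_ A) x)%:E.
  rewrite /fubini_F /=; under eq_integral do rewrite GE.
  rewrite /patch; case: ifPn => [|_]; last by rewrite integral0.
  rewrite inE => Ax; rewrite /Rintegral fineK; last exact: integrable_fin_num (Fy x Ax).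
  rewrite [RHS]integral_mkcond; apply: eq_integral => y _.
  by rewrite /patch; case: ifP.
have E2 y : fubini_G m1 (EFin \o G) y =
   (((fun y => \int[m1]_(x in A) F x y) \_ B) y)%:E.
  rewrite /fubini_G /=; under eq_integral do rewrite GE.
  rewrite /patch; case: ifPn => [|_]; last first.
    by rewrite (eq_integral (cst 0%E)) ?integral0// => x _; case: ifP.
  rewrite inE => By; rewrite /Rintegral fineK; last exact: integrable_fin_num (Fx y By).
  rewrite [RHS]integral_mkcond; apply: eq_integral => x _.
  by rewrite /patch; case: ifP.
split.
  apply: (rint_restrict m1 mA _).2; rewrite /rint.
  have iF := integrable_fubini_F iG.
  by apply: (eq_integrable measurableT _ _ _ iF) => x _; exact: E1.
rewrite Rintegral_mkcond [RHS]Rintegral_mkcond /Rintegral; congr fine.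
rewrite -(eq_integral _ _ (fun x _ => E1 x)) -(eq_integral _ _ (fun x _ => E2 x)).
by rewrite integral12_prod_meas1// integral21_prod_meas1.
Qed.

End fubini.
End real_integrals.

(** * Integration on the line *)

Section line.
Context {R : realType}.
Notation mu := (@lebesgue_measure R).
Implicit Types (f g : R -> R) (a b c : R).

Section affine.
Variables a b : R.
Hypothesis a0 : a != 0.
Let phi (x : measurableTypeR R) : measurableTypeR R := a * x + b.

Let mphi : measurable_fun setT phi.
Proof. by apply: measurable_funD => //; exact: measurable_funM. Qed.

Let na : {nonneg R} := NngNum (normr_ge0 a).

Let m0 : {measure set (measurableTypeR R) -> \bar R} :=
  measure_function_pushforward__canonical__measure_function_Measure mu mphi.
Let m : {measure set (measurableTypeR R) -> \bar R} := mscale na m0.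

Let pushE (A : set (measurableTypeR R)) : measurable A -> m A = mu A.
Proof.
move=> mA; apply/esym/(@lebesgue_measure_unique _ m) => //= _ [[c d]] _ <-.
rewrite /m /mscale/= /pushforward.
have [ap|an] : 0 < a \/ a < 0 by case: (ltgtP a 0) a0 => // *; [right|left].
  rewrite (_ : _ @^-1` _ = `](c - b) / a, (d - b) / a]%classic); last first.
    apply/seteqP; split => x /=; rewrite !in_itv/= ltr_pdivrMr// ler_pdivlMr//;
    by rewrite ltrBlDr lerBrDr mulrC.
  rewrite !lebesgue_measure_itv/= !lte_fin ltr_pM2r ?invr_gt0// ltrD2r.
  case: ifPn => _; last by rewrite mule0.
  rewrite -!EFinD -EFinM gtr0_norm//; congr EFin.
  by field; rewrite gt_eqF.
rewrite (_ : _ @^-1` _ = `[(d - b) / a, (c - b) / a[%classic); last first.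
  apply/seteqP; split => x /=; rewrite !in_itv/= ltr_ndivlMr// ler_ndivrMr//;
  by rewrite ltrBlDr lerBrDr mulrC andbC.
rewrite !lebesgue_measure_itv/= !lte_fin ltr_nM2r ?invr_lt0// ltrD2r.
case: ifPn => _; last by rewrite mule0.
rewrite -!EFinD -EFinM ltr0_norm//; congr EFin.
by field; rewrite lt_eqF.
Qed.

Let ge0_affine (f : measurableTypeR R -> \bar R) : measurable_fun setT f ->
  (forall x, 0 <= f x)%E ->
  (\int[mu]_x f x = `|a|%:E * \int[mu]_x f (a * x + b)%R)%E.
Proof.
move=> mf f0.
rewrite (@eq_measure_integral _ _ _ _ m);
  last by move=> A mA _; rewrite pushE.
rewrite ge0_integral_mscale//; congr (_ * _)%E.
by rewrite ge0_integral_pushforward.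
Qed.

Lemma rint_affine f : rint mu setT f -> rint mu setT (fun x => f (a * x + b)).
Proof.
move=> fi; have mf := rint_meas fi.
apply/integrableP; split.
  apply/measurable_EFinP; exact: (measurableT_comp mf mphi).
have /integrableP[_] := fi.
rewrite ge0_affine//=; last by apply/measurable_EFinP/measurableT_comp.
move=> lty; have [//|] := ltP (\int[mu]_x (`|f (a * x + b)|%:E))%E +oo%E.
rewrite leye_eq => /eqP e; move: lty.
by rewrite e mulry gtr0_sg ?normr_gt0// mul1e ltxx.
Qed.

Lemma Rintegral_affine f : rint mu setT f ->
  \int[mu]_x f x = `|a| * \int[mu]_x f (a * x + b).
Proof.
move=> fi; have mf := rint_meas fi.
have fi' := rint_affine fi.
rewrite /Rintegral; transitivity (fine (`|a|%:E * \int[mu]_x (f (a * x + b))%:E)%E).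
  congr fine; rewrite [LHS]integralE [in RHS]integralE.
  rewrite ge0_affine//; last by apply: measurable_funepos; exact/measurable_EFinP.
  rewrite [X in (_ - X)%E]ge0_affine//; last first.
    by apply: measurable_funeneg; exact/measurable_EFinP.
  have fa := integrable_add_def measurableT fi'.
  rewrite -(eq_integral _ _ (fun x _ => congr1 (@^~ x) (funepos_comp (EFin \o f) phi))).
  rewrite -[X in (_ - _ * X)%E](eq_integral _ _ (fun x _ => congr1 (@^~ x) (funeneg_comp (EFin \o f) phi))).
  by rewrite -muleBr.
by rewrite fineM//; exact: integrable_fin_num.
Qed.
End affine.

Lemma Rintegral_shift f c : rint mu setT f ->
  \int[mu]_x f (x + c) = \int[mu]_x f x.
Proof.
move=> fi; rewrite [RHS](Rintegral_affine c (oner_neq0 _) fi) normr1 mul1r.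
by under [RHS]eq_Rintegral do rewrite mul1r.
Qed.

Lemma rint_shift f c : rint mu setT f -> rint mu setT (fun x => f (x + c)).
Proof.
move=> /(rint_affine c (oner_neq0 _)); under eq_fun do rewrite mul1r.
exact.
Qed.

Lemma rint_reflect f c : rint mu setT f -> rint mu setT (fun x => f (c - x)).
Proof.
move=> fi; have := rint_affine (a := -1) c _ fi; rewrite oppr_eq0 oner_neq0.
by move=> /(_ isT); under eq_fun do rewrite mulN1r addrC.
Qed.

Lemma Rintegral_reflect f c : rint mu setT f ->
  \int[mu]_x f (c - x) = \int[mu]_x f x.
Proof.
move=> fi; have := Rintegral_affine (a := -1) c _ fi; rewrite oppr_eq0 oner_neq0.
move=> /(_ isT) ->; rewrite normrN1 mul1r.
by under [RHS]eq_Rintegral do rewrite mulN1r addrC.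
Qed.

(** The indicator of [a, b] carries the reflection of the line over to segments. *)
Lemma Rintegral_reflect_itv f a b c : rint mu `[a, b] f ->
  rint mu `[c - b, c - a] (fun x => f (c - x)) /\
  \int[mu]_(x in `[c - b, c - a]) f (c - x) = \int[mu]_(x in `[a, b]) f x.
Proof.
move=> fi0; have mI (I : interval R) : measurable [set` I] by exact: measurable_itv.
have fi := (rint_restrict mu (mI _) _).1 fi0.
have E x : (f \_ `[a, b]) (c - x) = ((fun x => f (c - x)) \_ `[c - b, c - a]) x.
  rewrite /patch; congr (if _ then _ else _).
  by apply/idP/idP; rewrite !inE/= !in_itv/= => /andP[h1 h2]; apply/andP; split; lra.
have := rint_reflect c fi; have := Rintegral_reflect c fi.
rewrite -Rintegral_mkcond => <-.
rewrite (_ : (fun x => _) = (fun x => f (c - x)) \_ `[c - b, c - a]); last first.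
  by apply/funext => x; exact: E.
move=> h; split; first exact: (rint_restrict mu (mI _) _).2.
by rewrite Rintegral_mkcond; apply: eq_Rintegral => x _; rewrite -E.
Qed.

Lemma rint_itv f a b : continuous f -> rint mu `[a, b] f.
Proof.
move=> cf; apply: continuous_compact_integrable; first exact: segment_compact.
exact: continuous_subspaceT.
Qed.

Lemma rint_cst (k : R) a b : rint mu `[a, b] (cst k).
Proof. by apply: rint_itv => x; exact: cvg_cst. Qed.

Lemma Rintegral_itv_cst (k : R) a b : a <= b ->
  \int[mu]_(x in `[a, b]) k = k * (b - a).
Proof.
move=> ab; rewrite Rintegral_cst//= lebesgue_measure_itv/= lte_fin.
by case: ltgtP ab => // -> _; rewrite subrr.
Qed.

Lemma Rintegral_itv_bound f (M : R) a b : a <= b -> rint mu `[a, b] f ->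
  (forall x, a <= x <= b -> `|f x| <= M) ->
  `|\int[mu]_(x in `[a, b]) f x| <= M * (b - a).
Proof.
move=> ab fi fM; rewrite -(Rintegral_itv_cst M ab).
by apply: Rintegral_norm_le => //; exact: rint_cst.
Qed.

Lemma Rintegral_itv_split f a b c : a <= b -> b <= c -> rint mu `[a, c] f ->
  \int[mu]_(x in `[a, c]) f x =
  \int[mu]_(x in `[a, b]) f x + \int[mu]_(x in `[b, c]) f x.
Proof.
move=> ab bc fi; rewrite -[LHS](subrK (\int[mu]_(x in `[a, b]) f x)) addrC.
congr (_ + _); rewrite Rintegral_itvB ?bnd_simp//.
rewrite Rintegral_itv_obnd_cbnd//; apply: rintS fi => // x /=.
by rewrite !in_itv/= => /andP[/ltW/(le_trans ab)-> ->].
Qed.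

Lemma Rintegral_itv_itv0 f a : \int[mu]_(x in `[a, a]) f x = 0.
Proof. by rewrite set_itv1 Rintegral_set1. Qed.

Lemma Rintegral_itv_ge0 f a b : (forall x, a <= x <= b -> 0 <= f x) ->
  0 <= \int[mu]_(x in `[a, b]) f x.
Proof. by move=> f0; apply: Rintegral_ge0 => x /=; rewrite in_itv/=; exact: f0. Qed.

Lemma FTC2_itv (F f : R -> R) a b : a <= b -> continuous f ->
  (forall x, a < x < b -> is_derive x 1 F (f x)) -> continuous F ->
  \int[mu]_(x in `[a, b]) f x = F b - F a.
Proof.
rewrite le_eqVlt => /predU1P[<- *|ab cf Ff cF].
  by rewrite Rintegral_itv_itv0 subrr.
rewrite /Rintegral (@continuous_FTC2 _ f F)//.
- exact: continuous_subspaceT.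
- split; first by move=> x; rewrite in_itv/= => /Ff[].
  + by apply: cvg_at_right_filter; exact: cF.
  + by apply: cvg_at_left_filter; exact: cF.
- by move=> x; rewrite in_itv/= => /Ff[? <-]; rewrite derive1E.
Qed.

Lemma Rintegral_itv_lin_sum n f a (h : R) : 0 <= h -> continuous f ->
  \int[mu]_(x in `[a, a + n%:R * h]) f x =
  \sum_(i < n) \int[mu]_(x in `[a + i%:R * h, a + i.+1%:R * h]) f x.
Proof.
move=> h0 cf; elim: n => [|n IH].
  by rewrite big_ord0 mul0r addr0 Rintegral_itv_itv0.
rewrite big_ord_recr/= -IH; apply: Rintegral_itv_split; last exact: rint_itv.
- by rewrite lerDl mulr_ge0.
- by rewrite lerD2l ler_wpM2r// ler_nat.
Qed.

Lemma cont_pair (X Y Z : topologicalType) (f : X -> Y) (g : X -> Z) (x : X) :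
  {for x, continuous f} -> {for x, continuous g} ->
  {for x, continuous (fun t => (f t, g t))}.
Proof. by move=> cf cg; exact: (cvg_pair cf cg). Qed.

Lemma compact_cont_bounded (X : topologicalType) (K : set X) (f : X -> R) :
  compact K -> continuous f -> exists2 M : R, 0 < M & forall x, K x -> `|f x| <= M.
Proof.
move=> cK cf.
have : compact (f @` K).
  by apply: continuous_compact => //; exact: continuous_subspaceT.
move=> /compact_bounded[M [_ MP]]; exists (`|M| + 1) => [|x Kx].
  by rewrite ltr_wpDl.
by apply: MP; [rewrite (le_lt_trans (ler_norm M))// ltrDl|exists x].
Qed.

Lemma bounded_rect (F : R -> R -> R) a b c d :
  continuous (fun z : R * R => F z.1 z.2) ->
  exists2 M : R, 0 < M &
    forall x y, a <= x <= b -> c <= y <= d -> `|F x y| <= M.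
Proof.
move=> cF.
have [M M0 MP] := compact_cont_bounded
  (compact_setX (@segment_compact R a b) (@segment_compact R c d)) cF.
by exists M => // x y xab ycd; apply: (MP (x, y)); split; rewrite /= in_itv.
Qed.

Lemma round_cvg (x : R) :
  (Num.floor (x * n.+1%:R))%:~R / n.+1%:R @[n --> \oo] --> x.
Proof.
apply/cvgrPdist_le => e e0; near=> n.
have n0 : (0 : R) < n.+1%:R by rewrite ltr0n.
have /andP[h1 h2] := floor_itv (x * n.+1%:R).
have h3 : n.+1%:R^-1 <= e.
  by apply: ltW; near: n; exact: (near_infty_natSinv_lt (PosNum e0)).
apply: le_trans h3.
rewrite -{1}(mulfK (lt0r_neq0 n0) x) -mulrBl normrM normfV (gtr0_norm n0).
rewrite -[leRHS]mul1r ler_pM2r ?invr_gt0// ger0_norm ?subr_ge0// lerBlDr.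
by apply: ltW; rewrite (lt_le_trans h2)// intrD addrC.
Unshelve. all: by end_near. Qed.

Lemma measurable_floor_fiber d (T : measurableType d) (f : T -> R) (c : R) (k : int) :
  measurable_fun setT f ->
  measurable ((fun x => Num.floor (f x * c)) @^-1` [set k]).
Proof.
move=> mf; rewrite (_ : _ @^-1` _ =
  (fun x => f x * c) @^-1` `[k%:~R, (k + 1)%:~R[%classic); last first.
  apply/seteqP; split => x /=; rewrite in_itv/=.
    by move=> <-; exact: floor_itv.
  by move=> h; apply: floor_def.
by rewrite -[X in measurable X]setTI; apply: measurable_funM.
Qed.

Lemma measurable_cont2 (F : R -> R -> R) :
  continuous (fun z : R * R => F z.1 z.2) ->
  measurable_fun setT
    (fun z : measurableTypeR R * measurableTypeR R => F z.1 z.2).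
Proof.
move=> cF; pose g n (k : int * int) : R := F (k.1%:~R / n.+1%:R) (k.2%:~R / n.+1%:R).
pose r (n : nat) (z : measurableTypeR R * measurableTypeR R) : int * int :=
  (Num.floor ((z.1 : R) * n.+1%:R), Num.floor ((z.2 : R) * n.+1%:R)).
apply: (@measurable_fun_countable_approx _ _ _ _ (fun=> (int * int)%type) r g).
  move=> n [k1 k2].
  rewrite (_ : _ @^-1` _ =
    ((fun z => Num.floor ((z.1 : R) * n.+1%:R)) @^-1` [set k1]) `&`
    ((fun z => Num.floor ((z.2 : R) * n.+1%:R)) @^-1` [set k2])); last first.
    by apply/seteqP; split => z /=; [case=> <- <-|case=> <- <-].
  by apply: measurableI; apply: measurable_floor_fiber;
    [exact: measurable_fst|exact: measurable_snd].
move=> [x y]; rewrite /g /r /=.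
apply: (@continuous_cvg _ _ _ _ _ (fun n => (((Num.floor (x * n.+1%:R))%:~R / n.+1%:R, (Num.floor (y * n.+1%:R))%:~R / n.+1%:R) : R * R)) (fun z : R * R => F z.1 z.2) (x, y)).
  exact: cF.
have cx := @round_cvg x; have cy := @round_cvg y.
by move=> A; exact: (cvg_pair cx cy).
Qed.

Lemma cont2_1 (F : R -> R -> R) x : continuous (fun z : R * R => F z.1 z.2) ->
  continuous (F x).
Proof.
move=> cF y; apply: (@continuous_comp _ _ _ (fun y => (x, y)) (fun z => F z.1 z.2)).
  by apply: cont_pair; [exact: cvg_cst|exact: cvg_id].
exact: cF.
Qed.

Lemma cont2_swap (F : R -> R -> R) : continuous (fun z : R * R => F z.1 z.2) ->
  continuous (fun z : R * R => F z.2 z.1).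
Proof.
move=> cF z; apply: (@continuous_comp _ _ _ (fun z : R * R => (z.2, z.1)) (fun z : R * R => F z.1 z.2)).
  by apply: cont_pair; [exact: cvg_snd|exact: cvg_fst].
exact: cF.
Qed.

Lemma cont2_2 (F : R -> R -> R) y : continuous (fun z : R * R => F z.1 z.2) ->
  continuous (F^~ y).
Proof. by move=> cF; exact: (@cont2_1 (fun a b => F b a) y (cont2_swap cF)). Qed.

Lemma Rfubini_itv (F : R -> R -> R) a b c d :
  continuous (fun z : R * R => F z.1 z.2) ->
  \int[mu]_(x in `[a, b]) \int[mu]_(y in `[c, d]) F x y =
  \int[mu]_(y in `[c, d]) \int[mu]_(x in `[a, b]) F x y.
Proof.
move=> cF; have [M M0 FM] := bounded_rect a b c d cF.
apply: (Rfubini (u := cst M) (w := cst 1) _ _ (measurable_cont2 cF) _ _ _).2 => //.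
- exact: rint_cst.
- exact: rint_cst.
- by move=> x y /=; rewrite !in_itv/= mulr1 => /FM; exact.
Qed.

Lemma param_continuous (X : topologicalType) (F : X -> R -> R) c d : c <= d ->
  continuous (fun z : X * R => F z.1 z.2) ->
  continuous (fun x => \int[mu]_(y in `[c, d]) F x y).
Proof.
move=> cd cF x0.
have cF1 x : continuous (F x).
  move=> y; apply: (@continuous_comp _ _ _ (fun y => (x, y)) (fun z => F z.1 z.2)).
    by apply: cont_pair; [exact: cvg_cst|exact: cvg_id].
  exact: cF.
apply/cvgrPdist_le => e e0.
have e1 : 0 < e / (d - c + 1) by rewrite divr_gt0// ltr_wpDl// subr_ge0.
have cov := (compact_near_coveringP `[c, d]%classic).1 (@segment_compact R c d).
suff : \forall x \near x0, `[c, d]%classic `<=`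
    (fun y => `|F x0 y - F x y| < e / (d - c + 1)); last first.
  apply: cov.
  move=> y _; pose e2 := e / (d - c + 1) / 2.
  have e20 : 0 < e2 by rewrite divr_gt0.
  have /cvgrPdist_lt/(_ _ e20) h1 := cF (x0, y).
  have /cvgrPdist_lt/(_ _ e20) h2 := cF1 x0 y.
  rewrite /= in h1 h2.
  have h1' : \forall z \near (y, x0), `|F x0 y - F z.2 z.1| < e2.
    case: h1 => -[U W] /= [nU nW] UW; exists (W, U) => //= -[a b] /= [Wa Ub].
    by apply: (UW (b, a)).
  have h2' : \forall z \near (y, x0), `|F x0 y - F x0 z.1| < e2.
    by exists ([set t | `|F x0 y - F x0 t| < e2], setT) => //=; [split => //; exact: filterT|move=> -[a b] [/=]].
  near=> z; rewrite /= (_ : F x0 _ - F _ _ = - (F x0 y - F x0 z.1) + (F x0 y - F z.2 z.1)); last by ring.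
  rewrite (splitr (e / _)) (le_lt_trans (ler_normD _ _))// normrN ltrD//.
  - by near: z.
  - by near: z.
apply: filterS => x H.
rewrite -RintegralB//; [|exact: rint_itv|exact: rint_itv].
apply: le_trans (Rintegral_itv_bound (M := e / (d - c + 1)) cd _ _) _.
- by apply: rintB => //; exact: rint_itv.
- by move=> y ycd; apply/ltW/H; rewrite /= in_itv.
- rewrite -mulrA ler_piMr ?(ltW e0)// mulrC ler_pdivrMr ?ltr_wpDl ?subr_ge0//.
  by rewrite mul1r lerDl.
Unshelve. all: by end_near. Qed.

Lemma Rintegral_scale_itv f a b k : 0 < k -> rint mu `[k * a, k * b] f ->
  \int[mu]_(x in `[k * a, k * b]) f x = k * \int[mu]_(x in `[a, b]) f (k * x).
Proof.
move=> k0 fi.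
have fi' := (rint_restrict mu (measurable_itv _) f).1 fi.
rewrite Rintegral_mkcond (Rintegral_affine 0 (lt0r_neq0 k0) fi') gtr0_norm//.
congr (_ * _); rewrite [RHS]Rintegral_mkcond; apply: eq_Rintegral => x _.
rewrite addr0 /patch; congr (if _ then _ else _).
by apply/idP/idP; rewrite !inE/= !in_itv/= !ler_pM2l.
Qed.

(** The substitution s = t r moves the variable endpoint into the integrand. *)
Lemma param_continuous_tri (F : R -> R -> R) :
  continuous (fun z : R * R => F z.1 z.2) ->
  continuous (fun t : R => \int[mu]_(s in `[0, t]) F t s).
Proof.
move=> cF; pose m (t : R) := Num.max t 0.
have cm : continuous m by move=> t; apply: continuous_max; [exact: cvg_id|exact: cvg_cst].
have -> : (fun t => \int[mu]_(s in `[0, t]) F t s) =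
    (fun t => \int[mu]_(r in `[0, 1]) (m t * F (m t) (m t * r))).
  apply/funext => t; rewrite /m; case: (ltgtP t 0) => [t0|t0|->].
  - under [RHS]eq_Rintegral do rewrite mul0r.
    rewrite (_ : `[0, t] = set0)%classic; last first.
      by apply/seteqP; split => x //=; rewrite in_itv/= => /andP[/le_trans h /h]; rewrite leNgt t0.
    by rewrite Rintegral_set0 Rintegral_itv_cst// mul0r.
  - rewrite RintegralZl//; last first.
      apply: rint_itv => x; apply: continuous_comp; last exact: (cont2_1 cF).
      by apply: continuousM => //; exact: cvg_cst.
    rewrite -Rintegral_scale_itv ?mulr0 ?mulr1//.
    exact/rint_itv/(cont2_1 cF).
  - under [RHS]eq_Rintegral do rewrite mul0r.
    by rewrite Rintegral_itv_itv0 Rintegral_itv_cst// mul0r.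
apply: (@param_continuous R (fun t r => m t * F (m t) (m t * r))) => // z.
have c1 : {for z, continuous (fun z : R * R => m z.1)}.
  by apply: continuous_comp; [exact: cvg_fst|exact: cm].
apply: cvgM => //.
apply: (@continuous_comp _ _ _ (fun z : R * R => (m z.1, m z.1 * z.2)) (fun z : R * R => F z.1 z.2)); last exact: cF.
apply: cont_pair => //; apply: cvgM => //; exact: cvg_snd.
Qed.

Lemma rint_oneDsqrV : rint mu setT (fun x => (1 + x ^+ 2)^-1).
Proof.
have c1 : continuous (fun x : R => (1 + x ^+ 2)^-1) by exact: continuous_oneDsqrV.
apply/integrableP; split.
  by apply/measurable_EFinP; exact: continuous_measurable_fun.
under eq_integral => x _.
  rewrite /= ger0_norm; last by rewrite invr_ge0 addr_ge0// sqr_ge0.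
  over.
rewrite ge0_symfun_integralT//.
- rewrite -set_itvcy integral0y_oneDsqr//= -EFinM ltry//.
- by move=> x; rewrite invr_ge0 addr_ge0// sqr_ge0.
- by move=> x /=; rewrite sqrrN.
Qed.

Lemma tail_small f e : rint mu setT f -> 0 < e -> exists2 M : R, 0 < M &
  forall A : set R, measurable A -> (forall x : R, A x -> M <= `|x|) ->
    \int[mu]_(x in A) `|f x| <= e.
Proof.
move=> fi e0; have mI (i : interval R) : measurable [set` i] by exact: measurable_itv.
pose g n : R -> R := (fun x => `|f x|) \_ `[- n%:R, n%:R].
pose fn (n : nat) (x : R) : \bar R := (g n x)%:E.
have fin := rint_norm fi.
have gi n : rint mu setT (g n).
  by apply: (rint_restrict mu (mI _) _).1; exact: rintS fin.
have cv : \int[mu]_x g n x @[n --> \oo] --> \int[mu]_x `|f x|.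
  apply: fine_cvg; rewrite /Rintegral fineK; last exact: integrable_fin_num.
  have [||] // := @dominated_convergence _ _ _ mu _ measurableT fn
   (fun x => (`|f x|)%:E) (fun x => (`|f x|)%:E) (fun n => measurable_int _ (gi n))
   (measurable_int _ fin) _ fin.
  - apply: aeW => x _; rewrite /fn /g; apply: cvg_near_cst; near=> n; rewrite /patch ifT//.
    rewrite inE/= in_itv/= -ler_norml; near: n.
    exact: nbhs_infty_ger.
  - apply: aeW => x n _; rewrite /fn /g lee_fin /patch; case: ifP => _.
      by rewrite normr_id.
    by rewrite normr0.
move/cvgrPdist_le/(_ _ e0) : cv => [n _ /(_ n (leqnn n))/= cn].
exists n.+1%:R => // A mA AM; rewrite -(lerD2r (\int[mu]_x g n x)).
have gE : \int[mu]_x g n x = \int[mu]_(x in `[- n%:R, n%:R]) `|f x|.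
  by rewrite [RHS]Rintegral_mkcond.
have le1 : \int[mu]_(x in A) `|f x| + \int[mu]_x g n x <= \int[mu]_x `|f x|.
  rewrite gE -Rintegral_setU//.
  - rewrite Rintegral_mkcond; apply: Rintegral_le => //.
      apply: (rint_restrict mu _ _).1; first exact: measurableU.
      by apply: rintS fin => //; exact: measurableU.
    by move=> x _; rewrite /patch; case: ifP => // _; exact: normr_ge0.
  - by apply: (rintS _ _ _ fin) => //; exact: measurableU.
  - apply/disj_setPS => x [/AM h]; rewrite /= in_itv/= -ler_norml => /(le_trans h).
    by rewrite ler_nat ltnn.
apply: (le_trans le1); rewrite -lerBlDr.
by apply: le_trans cn; exact: ler_norm.
Unshelve. all: by end_near. Qed.

Lemma square_integral_lower a : 0 < a ->
  \int[mu]_(x in `[a, +oo[) (x ^+ 2)^-1 = a^-1 /\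
  rint mu `[a, +oo[ (fun x => (x ^+ 2)^-1).
Proof.
move=> a0.
have dF x : a < x -> is_derive x (1 : R) (fun x => - x^-1) ((x ^+ 2)^-1).
  move=> ax; have x0 : x != 0 by rewrite gt_eqF// (lt_trans a0).
  apply: is_derive_eq; first exact: is_deriveN (is_deriveV x0 (is_derive_id x 1)).
  by rewrite /GRing.scale/= mulr1 opprK.
have fE : (\int[mu]_(x in `[a, +oo[) ((x ^+ 2)^-1)%:E = (0 - - a^-1)%:E)%E.
  rewrite EFinB; apply: (@ge0_continuous_FTC2y _ _ (fun x => - x^-1)).
  - by move=> x _; rewrite invr_ge0 sqr_ge0.
  - apply: continuous_in_subspaceT => x; rewrite inE/= in_itv/= andbT => ax.
    apply: cvgV; first by rewrite sqrf_eq0 gt_eqF// (lt_le_trans a0).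
    exact: exprn_continuous.
  - rewrite -oppr0; apply: cvgN; by apply/gtr0_cvgV0 => //; near=> x; near: x; exact: nbhs_pinfty_gt.
  - by move=> x /dF[].
  - apply: cvg_at_right_filter; apply: cvgN; apply: cvgV; first by rewrite gt_eqF.
    exact: cvg_id.
  - by move=> x; rewrite in_itv/= andbT => /dF h; rewrite derive1E derive_val.
split; first by rewrite /Rintegral fE/= sub0r opprK.
apply/integrableP; split.
  apply/measurable_EFinP.
  apply: (eq_measurable_fun (fun x : R => (Num.max x a ^+ 2)^-1)).
    by move=> x; rewrite inE/= in_itv/= andbT => ax; rewrite max_l.
  apply: measurable_funTS; apply: continuous_measurable_fun => x.
  apply: cvgV.
    by rewrite sqrf_eq0 gt_eqF// lt_max a0 orbT.
  have cm : {for x, continuous (fun x : R => Num.max x a)}.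
    by apply: continuous_max; [exact: cvg_id|exact: cvg_cst].
  by rewrite expr2; under eq_fun do rewrite expr2; exact: (cvgM cm cm).
under eq_integral => x _.
  rewrite /= ger0_norm; last by rewrite invr_ge0 sqr_ge0.
  over.
by rewrite fE ltry.
Unshelve. all: by end_near. Qed.

End line.

(** * The Fejer kernel *)

Section fejer.
Context {R : realType}.
Notation mu := (@lebesgue_measure R).
Implicit Types (f g h : R -> R) (a b c t w : R).

Definition cosint g b t := \int[mu]_(w in `[0, b]) (g w * cos (w * t)).

Lemma continuous_cosM t : continuous (fun w : R => cos (w * t)).
Proof.
move=> w; apply: (@continuous_comp _ _ _ (fun w => w * t) cos); last exact: continuous_cos.
by apply: cvgM; [exact: cvg_id|exact: cvg_cst].
Qed.

Lemma rint_cosint g b t : continuous g -> rint mu `[0, b] (fun w => g w * cos (w * t)).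
Proof.
by move=> cw; apply: rint_itv => w; apply: cvgM; [exact: cw|exact: continuous_cosM].
Qed.

Lemma cos_normle1 (x : R) : `|cos x| <= 1.
Proof. by rewrite ler_norml cos_geN1 cos_le1. Qed.

Lemma sin_normle1 (x : R) : `|sin x| <= 1.
Proof. by rewrite ler_norml sin_geN1 sin_le1. Qed.

Lemma cos_lipschitz (x y : R) : `|cos x - cos y| <= `|x - y|.
Proof.
wlog xy : x y / x <= y.
  move=> H; case: (leP x y) => [|/ltW]; first exact: H.
  by rewrite distrC (distrC x); exact: H.
have [c _] := @MVT_segment R cos (fun x => - sin x) x y xy (fun z _ => is_derive_cos z) (continuous_subspaceT (@continuous_cos R)).
rewrite distrC (distrC x) => ->; rewrite normrM normrN ler_piMl//.
exact: sin_normle1.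
Qed.

Definition fejer_weight (b w : R) := 1 - w / b.

Lemma continuous_fejer_weight b : continuous (fejer_weight b).
Proof.
move=> w; apply: cvgB; first exact: cvg_cst.
by apply: cvgM; [exact: cvg_id|exact: cvg_cst].
Qed.

Definition fejer b t := cosint (fejer_weight b) b t.

Lemma fejer_closed b t : 0 < b -> t != 0 ->
  fejer b t = (1 - cos (b * t)) / (b * t ^+ 2).
Proof.
move=> b0 t0.
pose F w := (1 - w / b) * (sin (w * t) / t) - cos (w * t) / (b * t ^+ 2).
rewrite /fejer /cosint.
have dF w : is_derive w (1 : R) F (fejer_weight b w * cos (w * t)).
  rewrite /F; apply: is_derive_eq.
  rewrite /fejer_weight /GRing.scale/=.
  by field; rewrite t0 gt_eqF.
rewrite (@FTC2_itv R F).
- rewrite /F !mul0r cos0 sin0 divff ?gt_eqF// subrr !mul0r mulr0 sub0r.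
  by rewrite mulrBl; field; rewrite t0 gt_eqF.
- exact: ltW.
- move=> w; apply: cvgM; [exact: continuous_fejer_weight|exact: continuous_cosM].
- move=> w; apply: differentiable_continuous; apply/derivable1_diffP.
  by case: (dF w).
Qed.

Lemma fejer0 b : 0 < b -> fejer b 0 = b / 2.
Proof.
move=> b0; rewrite /fejer /cosint.
under eq_Rintegral do rewrite mulr0 cos0 mulr1.
pose F w := w - w ^+ 2 / (2 * b).
have dF w : is_derive w (1 : R) F (fejer_weight b w).
  rewrite /F; apply: is_derive_eq.
  rewrite /fejer_weight /GRing.scale/=.
  by field; rewrite gt_eqF.
rewrite (@FTC2_itv R F).
- by rewrite /F; field; rewrite gt_eqF.
- exact: ltW.
- exact: continuous_fejer_weight.
- move=> w; apply: differentiable_continuous; apply/derivable1_diffP.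
  by case: (dF w).
Qed.

Lemma fejer_scale b t : 0 < b -> fejer b t = b * fejer 1 (b * t).
Proof.
move=> b0; have [->|t0] := eqVneq t 0.
  by rewrite mulr0 !fejer0// mul1r.
have bt0 : b * t != 0 by rewrite mulf_neq0// gt_eqF.
rewrite (fejer_closed b0 t0) (fejer_closed ltr01 bt0) !mul1r.
by field; rewrite t0 gt_eqF.
Qed.

Lemma fejer_ge0 b t : 0 < b -> 0 <= fejer b t.
Proof.
move=> b0; have [->|t0] := eqVneq t 0; first by rewrite fejer0// divr_ge0// ltW.
rewrite fejer_closed// divr_ge0 ?subr_ge0 ?cos_le1// mulr_ge0 ?(ltW b0)//.
exact: sqr_ge0.
Qed.

Lemma cosint_bound g b t (M : R) : 0 <= b -> continuous g ->
  (forall w, 0 <= w <= b -> `|g w| <= M) -> `|cosint g b t| <= M * b.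
Proof.
move=> b0 cw wM; rewrite -{2}(subr0 b); apply: Rintegral_itv_bound => //.
  exact: rint_cosint.
move=> w wb; rewrite normrM (le_trans _ (wM _ wb))// ler_piMr//.
exact: cos_normle1.
Qed.

Lemma cosint_lipschitz g b s t (M : R) : 0 <= b -> continuous g ->
  (forall w, 0 <= w <= b -> `|g w| <= M) ->
  `|cosint g b s - cosint g b t| <= M * b * b * `|s - t|.
Proof.
move=> b0 cw wM; rewrite /cosint -RintegralB//; try exact: rint_cosint.
rewrite (_ : M * b * b * _ = M * b * `|s - t| * (b - 0)); last by ring.
apply: Rintegral_itv_bound => //.
  by apply: rintB => //; exact: rint_cosint.
move=> w /andP[w0 wb]; rewrite -mulrBr normrM -mulrA ler_pM//.
  by apply: wM; rewrite w0.
apply: le_trans (cos_lipschitz _ _) _.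
by rewrite -mulrBr normrM ler_wpM2r// ger0_norm.
Qed.

Lemma lipschitz_continuous f (M : R) :
  (forall s t, `|f s - f t| <= M * `|s - t|) -> continuous f.
Proof.
move=> fM s; apply/cvgrPdist_le => e e0.
have M1 : 0 < `|M| + 1 by rewrite ltr_wpDl.
near=> t; apply: le_trans (fM _ _) _.
apply: (@le_trans _ _ ((`|M| + 1) * `|s - t|)).
  by rewrite ler_wpM2r// (le_trans (ler_norm _))// lerDl.
rewrite mulrC -ler_pdivlMr//; near: t.
exact: (@cvgr_dist_le _ _ _ (nbhs s) _ id s cvg_id _ (divr_gt0 e0 M1)).
Unshelve. all: by end_near. Qed.

Lemma fejer_weight_bound b w : 0 < b -> 0 <= w <= b -> `|fejer_weight b w| <= 1.
Proof.
move=> b0 /andP[w0 wb]; rewrite /fejer_weight ler_norml.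
have h1 : w / b <= 1 by rewrite ler_pdivrMr// mul1r.
have h2 : 0 <= w / b by rewrite divr_ge0// ltW.
by apply/andP; split; lra.
Qed.

Lemma fejer_continuous b : 0 < b -> continuous (fejer b).
Proof.
move=> b0; apply: (@lipschitz_continuous _ (1 * b * b)) => s t.
by apply: cosint_lipschitz; [exact: ltW|exact: continuous_fejer_weight|move=> w; exact: fejer_weight_bound].
Qed.

Lemma fejer1_decay t : fejer 1 t <= 4 / (1 + t ^+ 2).
Proof.
have p : 0 < 1 + t ^+ 2 by rewrite ltr_pwDl// sqr_ge0.
rewrite ler_pdivlMr//; have f0 := @fejer_ge0 1 t ltr01.
have f1 : fejer 1 t <= 1.
  rewrite (le_trans (ler_norm _))// -[leRHS](mulr1 1).
  apply: cosint_bound => //; first exact: continuous_fejer_weight.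
  by move=> w; exact: fejer_weight_bound.
have f2 : fejer 1 t * t ^+ 2 <= 2.
  have [->|t0] := eqVneq t 0; first by rewrite expr0n/= mulr0.
  rewrite fejer_closed// !mul1r divfK ?sqrf_eq0// lerBlDr.
  by have := cos_geN1 t; lra.
by rewrite mulrDr mulr1; lra.
Qed.

Lemma fejer_decay b t : 0 < b -> t != 0 -> fejer b t <= 2 / (b * t ^+ 2).
Proof.
move=> b0 t0; rewrite fejer_closed// ler_pM2r; last first.
  by rewrite invr_gt0 mulr_gt0// lt_def sqr_ge0 sqrf_eq0 t0.
by have := cos_geN1 (b * t); lra.
Qed.

Lemma rint_fejer1 : rint mu setT (fejer 1).
Proof.
apply: (@rint_le _ _ _ mu _ measurableT _ (fun t : R => 4 * (1 + t ^+ 2)^-1)).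
- by apply: continuous_measurable_fun; exact: fejer_continuous.
- by apply: rintZ => //; exact: rint_oneDsqrV.
- by move=> t _; rewrite ger0_norm ?fejer_ge0// fejer1_decay.
Qed.

Let fejerE b : 0 < b -> fejer b = (fun t => b * fejer 1 (b * t + 0)).
Proof. by move=> b0; apply/funext => t; rewrite addr0 fejer_scale. Qed.

Lemma rint_fejer b : 0 < b -> rint mu setT (fejer b).
Proof.
move=> b0; rewrite fejerE//; apply: (rintZ measurableT).
exact: (rint_affine 0 (lt0r_neq0 b0) rint_fejer1).
Qed.

Definition fejer_mass := \int[mu]_t fejer 1 t.

Lemma Rintegral_fejer b : 0 < b -> \int[mu]_t fejer b t = fejer_mass.
Proof.
move=> b0; rewrite fejerE//.
rewrite (RintegralZl b measurableT (rint_affine 0 (lt0r_neq0 b0) rint_fejer1)).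
rewrite /fejer_mass (Rintegral_affine 0 (lt0r_neq0 b0) rint_fejer1).
by rewrite gtr0_norm.
Qed.

Lemma Rintegral_subset_ge0 (A : set R) f : measurable A ->
  rint mu setT f -> (forall x, 0 <= f x) ->
  \int[mu]_(x in A) f x <= \int[mu]_x f x.
Proof.
move=> mA fi f0; rewrite Rintegral_mkcond.
apply: (@Rintegral_le _ _ _ mu _ measurableT) => //.
  by apply: (rint_restrict mu mA _).1; exact: rintS fi.
by move=> x _; rewrite /patch; case: ifP.
Qed.

Lemma fejer_mass_gt0 : 0 < fejer_mass.
Proof.
have h t : 0 <= t <= 4^-1 -> 4^-1 <= fejer 1 t.
  move=> /andP[t0 t1].
  have := @cosint_lipschitz (fejer_weight 1) 1 0 t 1 ler01 (@continuous_fejer_weight 1)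
     (fun w => @fejer_weight_bound 1 w ltr01).
  rewrite -/(fejer 1 0) -/(fejer 1 t) fejer0// !mul1r sub0r normrN (ger0_norm t0) ler_norml.
  by move=> /andP[_ h]; lra.
apply: (@lt_le_trans _ _ (\int[mu]_(t in `[0, 4^-1]) 4^-1)).
  by rewrite Rintegral_itv_cst ?invr_ge0// subr0 mulr_gt0// invr_gt0.
apply: le_trans (Rintegral_subset_ge0 (measurable_itv `[0, 4^-1]) rint_fejer1 _); last first.
  by move=> x; exact: fejer_ge0.
apply: (Rintegral_le (m := mu)) => //; first exact: rint_cst.
by apply: rint_itv; exact: fejer_continuous.
Qed.

End fejer.

(** * Kernels acting positively on the square *)

Section pdk.
Context {R : realType}.
Notation mu := (@lebesgue_measure R).
Implicit Types (f g h : R -> R) (L : R -> R -> R) (a b c t : R).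

Definition jcont L := continuous (fun z : R * R => L z.1 z.2).

Definition dint (T : R) L := \int[mu]_(t in `[0, T]) \int[mu]_(s in `[0, T]) L t s.

(** Continuous kernels whose frequency content against every cosine is
nonnegative; the positive combinations of cosines, and their limits, act
positively on them. *)
Definition cospos (T : R) L := forall w : R, 0 <= dint T (fun t s => cos (w * (t - s)) * L t s).

(** The functions f whose convolution form is nonnegative against every
kernel L of nonnegative cosine content, not only against the squares
h(t) h(s); the larger class of L covers the kernel of a system of particles. *)
Definition pdk f := forall (T : R) L, 0 <= T -> jcont L -> cospos T L ->
  0 <= dint T (fun t s => f (t - s) * L t s).

Lemma jcontM L1 L2 : jcont L1 -> jcont L2 -> jcont (fun t s => L1 t s * L2 t s).
Proof. by move=> c1 c2 z; apply: cvgM; [exact: c1|exact: c2]. Qed.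

Lemma jcontD L1 L2 : jcont L1 -> jcont L2 -> jcont (fun t s => L1 t s + L2 t s).
Proof. by move=> c1 c2 z; apply: cvgD; [exact: c1|exact: c2]. Qed.

Lemma jcontB L1 L2 : jcont L1 -> jcont L2 -> jcont (fun t s => L1 t s - L2 t s).
Proof. by move=> c1 c2 z; apply: cvgB; [exact: c1|exact: c2]. Qed.

Lemma jcontZ k L : jcont L -> jcont (fun t s => k * L t s).
Proof. by move=> c1 z; apply: cvgM; [exact: cvg_cst|exact: c1]. Qed.

Lemma jcont_fst f : continuous f -> jcont (fun t s => f t).
Proof.
move=> cf z; apply: (@continuous_comp _ _ _ (fun z : R * R => z.1) f); last exact: cf.
exact: cvg_fst.
Qed.

Lemma jcont_snd f : continuous f -> jcont (fun t s => f s).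
Proof.
move=> cf z; apply: (@continuous_comp _ _ _ (fun z : R * R => z.2) f); last exact: cf.
exact: cvg_snd.
Qed.

Lemma jcont_diff f : continuous f -> jcont (fun t s => f (t - s)).
Proof.
move=> cf z; apply: (@continuous_comp _ _ _ (fun z : R * R => z.1 - z.2) f); last exact: cf.
by apply: cvgB; [exact: cvg_fst|exact: cvg_snd].
Qed.

Lemma jcont_inner (T : R) L : 0 <= T -> jcont L -> continuous (fun t => \int[mu]_(s in `[0, T]) L t s).
Proof. by move=> T0 cL; exact: param_continuous. Qed.

Lemma dintD (T : R) L1 L2 : 0 <= T -> jcont L1 -> jcont L2 ->
  dint T (fun t s => L1 t s + L2 t s) = dint T L1 + dint T L2.
Proof.
move=> T0 c1 c2; rewrite /dint -(@RintegralD _ _ _ mu)//.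
- apply: eq_Rintegral => t _; apply: (@RintegralD _ _ _ mu) => //.
    exact/rint_itv/(cont2_1 c1).
  exact/rint_itv/(cont2_1 c2).
- exact/rint_itv/jcont_inner.
- exact/rint_itv/jcont_inner.
Qed.

Lemma dintZ (T : R) k L : 0 <= T -> jcont L ->
  dint T (fun t s => k * L t s) = k * dint T L.
Proof.
move=> T0 c1; rewrite /dint -(@RintegralZl _ _ _ mu)//; last exact/rint_itv/jcont_inner.
apply: eq_Rintegral => t _; apply: (@RintegralZl _ _ _ mu) => //.
exact/rint_itv/(cont2_1 c1).
Qed.

Lemma dintB (T : R) L1 L2 : 0 <= T -> jcont L1 -> jcont L2 ->
  dint T (fun t s => L1 t s - L2 t s) = dint T L1 - dint T L2.
Proof.
move=> T0 c1 c2; rewrite -mulN1r -(dintZ (-1) T0 c2) -(dintD T0 c1 (@jcontZ (-1) L2 c2)).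
by congr dint; apply/funext => t; apply/funext => s; rewrite mulN1r.
Qed.

Lemma dint_ext (T : R) L1 L2 : (forall t s, 0 <= t <= T -> 0 <= s <= T -> L1 t s = L2 t s) ->
  dint T L1 = dint T L2.
Proof.
move=> L12; rewrite /dint; apply: eq_Rintegral => t; rewrite inE/= in_itv/= => tT.
by apply: eq_Rintegral => s; rewrite inE/= in_itv/= => sT; exact: L12.
Qed.

Lemma dint_le (T : R) L1 L2 : 0 <= T -> jcont L1 -> jcont L2 ->
  (forall t s, 0 <= t <= T -> 0 <= s <= T -> L1 t s <= L2 t s) ->
  dint T L1 <= dint T L2.
Proof.
move=> T0 c1 c2 L12; rewrite /dint; apply: (Rintegral_le (m := mu)) => //.
- exact/rint_itv/jcont_inner.
- exact/rint_itv/jcont_inner.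
- move=> t /=; rewrite in_itv/= => tT; apply: (Rintegral_le (m := mu)) => //.
  + exact/rint_itv/(cont2_1 c1).
  + exact/rint_itv/(cont2_1 c2).
  + by move=> s /=; rewrite in_itv/= => sT; exact: L12.
Qed.

Lemma dint_cst (T : R) k : 0 <= T -> dint T (fun _ _ => k) = k * T * T.
Proof.
move=> T0; rewrite /dint; under eq_Rintegral do rewrite Rintegral_itv_cst// subr0.
by rewrite Rintegral_itv_cst// subr0.
Qed.

Lemma dint_bound (T : R) L k : 0 <= T -> jcont L ->
  (forall t s, 0 <= t <= T -> 0 <= s <= T -> `|L t s| <= k) ->
  `|dint T L| <= k * T * T.
Proof.
move=> T0 cL Lk; have ck (x : R) : jcont (fun _ _ => x) by move=> z; exact: cvg_cst.
rewrite ler_norml -(dint_cst k T0) -mulN1r -(dintZ (-1) T0 (ck k)).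
apply/andP; split; apply: dint_le => // t s tT sT; have := Lk t s tT sT.
  by rewrite mulN1r ler_norml => /andP[].
by rewrite ler_norml => /andP[].
Qed.

Lemma dint_sym (T : R) L : jcont L -> dint T L = dint T (fun t s => L s t).
Proof. by move=> cL; rewrite /dint Rfubini_itv. Qed.

Lemma dint_prod (T : R) f g : continuous f -> continuous g ->
  dint T (fun t s => f t * g s) =
  (\int[mu]_(t in `[0, T]) f t) * (\int[mu]_(s in `[0, T]) g s).
Proof.
move=> cf cg; rewrite /dint -(@RintegralZr _ _ _ mu)//; last exact: rint_itv.
apply: eq_Rintegral => t _; apply: (@RintegralZl _ _ _ mu) => //.
exact: rint_itv.
Qed.

Lemma continuous_cosZ w : continuous (fun t : R => cos (w * t)).
Proof.
move=> t; apply: (@continuous_comp _ _ _ (fun t => w * t) cos); last exact: continuous_cos.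
by apply: cvgM; [exact: cvg_cst|exact: cvg_id].
Qed.

Lemma continuous_sinZ w : continuous (fun t : R => sin (w * t)).
Proof.
move=> t; apply: (@continuous_comp _ _ _ (fun t => w * t) sin); last exact: continuous_sin.
by apply: cvgM; [exact: cvg_cst|exact: cvg_id].
Qed.

Lemma cospos_square (T : R) h : 0 <= T -> continuous h -> cospos T (fun t s => h t * h s).
Proof.
move=> T0 ch w.
have c1 : continuous (fun t => cos (w * t) * h t).
  by move=> t; apply: cvgM; [exact: continuous_cosZ|exact: ch].
have c2 : continuous (fun t => sin (w * t) * h t).
  by move=> t; apply: cvgM; [exact: continuous_sinZ|exact: ch].
rewrite (_ : dint _ _ = dint T (fun t s => (cos (w * t) * h t) * (cos (w * s) * h s) +
    (sin (w * t) * h t) * (sin (w * s) * h s))); last first.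
  by apply: dint_ext => t s _ _; rewrite mulrBr cosB; ring.
rewrite dintD// ?dint_prod//; last 2 first.
- by apply: jcontM; [exact: jcont_fst|exact: jcont_snd].
- by apply: jcontM; [exact: jcont_fst|exact: jcont_snd].
by rewrite addr_ge0// -expr2 sqr_ge0.
Qed.

Lemma pdk_cosint g b : 0 <= b -> continuous g -> (forall w, 0 <= w <= b -> 0 <= g w) ->
  pdk (cosint g b).
Proof.
move=> b0 cg g0 T L T0 cL cpL.
pose G (z : R * R) w := g w * cos (w * (z.1 - z.2)) * L z.1 z.2.
have cG : continuous (fun y : (R * R) * R => G y.1 y.2).
  move=> y; apply: cvgM.
    apply: cvgM.
      by apply: (@continuous_comp _ _ _ snd g); [exact: cvg_snd|exact: cg].
    apply: (@continuous_comp _ _ _ (fun y : (R * R) * R => y.2 * (y.1.1 - y.1.2)) cos); last exact: continuous_cos.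
    apply: cvgM; first exact: cvg_snd.
    apply: cvgB.
      by apply: (@continuous_comp _ _ _ fst fst); exact: cvg_fst.
    by apply: (@continuous_comp _ _ _ fst snd); [exact: cvg_fst|exact: cvg_snd].
  by apply: (@continuous_comp _ _ _ fst (fun z : R * R => L z.1 z.2)); [exact: cvg_fst|exact: cL].
have E1 : dint T (fun t s => cosint g b (t - s) * L t s) =
    dint T (fun t s => \int[mu]_(w in `[0, b]) G (t, s) w).
  apply: dint_ext => t s _ _; rewrite /cosint -(@RintegralZr _ _ _ mu)//.
  exact: rint_cosint.
pose H t w := \int[mu]_(s in `[0, T]) G (t, s) w.
have cH : jcont H.
  apply: (@param_continuous _ _ (fun (z : R * R) s => G (z.1, s) z.2)) => // y.
  apply: (@continuous_comp _ _ _ (fun y : (R * R) * R => ((y.1.1, y.2), y.1.2)) (fun y : (R * R) * R => G y.1 y.2)); last exact: cG.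
  apply: cont_pair; first apply: cont_pair.
  - by apply: (@continuous_comp _ _ _ fst fst); exact: cvg_fst.
  - exact: cvg_snd.
  - by apply: (@continuous_comp _ _ _ fst snd); [exact: cvg_fst|exact: cvg_snd].
have E2 : dint T (fun t s => \int[mu]_(w in `[0, b]) G (t, s) w) =
    \int[mu]_(t in `[0, T]) \int[mu]_(w in `[0, b]) H t w.
  apply: eq_Rintegral => t _; apply: Rfubini_itv => y.
  apply: (@continuous_comp _ _ _ (fun y : R * R => ((t, y.1), y.2)) (fun y : (R * R) * R => G y.1 y.2)); last exact: cG.
  apply: cont_pair; first apply: cont_pair; [exact: cvg_cst|exact: cvg_fst|exact: cvg_snd].
rewrite E1 E2 (Rfubini_itv 0 T 0 b cH); apply: Rintegral_itv_ge0 => w wb.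
rewrite (_ : \int[mu]_(t in _) _ = g w * dint T (fun t s => cos (w * (t - s)) * L t s)).
  by rewrite mulr_ge0 ?g0.
have cc : jcont (fun t s => cos (w * (t - s)) * L t s).
  exact: (jcontM (jcont_diff (@continuous_cosZ w)) cL).
rewrite -(dintZ (g w) T0 cc).
by apply: dint_ext => t s _ _; rewrite /G/= mulrA.
Qed.

(** For fixed T the form depends only on f on [- T, T], where it is a uniform
limit. *)
Lemma pdk_limit f : continuous f ->
  (forall T e : R, 0 <= T -> 0 < e -> exists g, [/\ pdk g, continuous g &
     forall t, `|t| <= T -> `|f t - g t| <= e]) -> pdk f.
Proof.
move=> cf fg T L T0 cL cpL.
have [M M0 LM] := bounded_rect 0 T 0 T cL.
have TM : 0 < M * T * T + 1 by rewrite ltr_wpDl// !mulr_ge0// ltW.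
apply/ler_addgt0Pl => e e0; rewrite addrC -lerBlDl sub0r.
have [g [pg cg fge]] := fg T (e / (M * T * T + 1)) T0 (divr_gt0 e0 TM).
have := pg T L T0 cL cpL.
have cfL : jcont (fun t s => f (t - s) * L t s) by apply: jcontM => //; exact: jcont_diff.
have cgL : jcont (fun t s => g (t - s) * L t s) by apply: jcontM => //; exact: jcont_diff.
have : `|dint T (fun t s => f (t - s) * L t s - g (t - s) * L t s)| <=
    e / (M * T * T + 1) * M * T * T.
  apply: dint_bound => //; first exact: jcontB.
  move=> t s tT sT; rewrite -mulrBl normrM ler_pM//; last exact: LM.
  apply: fge; rewrite ler_norml; lra.
rewrite (dintB T0 cfL cgL) ler_norml => /andP[h1 h2] h3.
move: (dint _ _) (dint _ _) h1 h2 h3 => x y h1 h2 h3.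
have h4 : e / (M * T * T + 1) * M * T * T <= e.
  rewrite (_ : e / (M * T * T + 1) * M * T * T = e * ((M * T * T) / (M * T * T + 1))); last by ring.
  by rewrite ler_piMr ?(ltW e0)// ler_pdivrMr// mul1r lerDl.
lra.
Qed.

End pdk.
Arguments fejer_mass R : clear implicits.

(** * The de la Vallee Poussin kernel and spectral domination *)

Section vallee_poussin.
Context {R : realType}.
Notation mu := (@lebesgue_measure R).
Implicit Types (f g h : R -> R) (a b c t : R).

Lemma cosint_lin (k : R) f g b t : continuous f -> continuous g ->
  cosint (fun w => k * f w - g w) b t = k * cosint f b t - cosint g b t.
Proof.
move=> cf cg; rewrite /cosint -(@RintegralZl _ _ _ mu)//; last exact: rint_cosint.
rewrite -(@RintegralB _ _ _ mu)//.
- by apply: eq_Rintegral => w _; ring.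
- by apply: (rintZ (m := mu)) => //; exact: rint_cosint.
- exact: rint_cosint.
Qed.

Lemma cosint_widen g a b t : 0 <= a -> a <= b -> continuous g ->
  (forall w, a <= w -> g w = 0) -> cosint g b t = cosint g a t.
Proof.
move=> a0 ab cg g0; rewrite /cosint (Rintegral_itv_split a0 ab (rint_cosint _ _ cg)).
rewrite [X in _ + X](_ : _ = \int[mu]_(w in `[a, b]) 0).
  by rewrite Rintegral_itv_cst// mul0r addr0.
apply: eq_Rintegral => w; rewrite inE/= in_itv/= => /andP[aw _].
by rewrite g0// mul0r.
Qed.

Definition tent (a w : R) := Num.max 0 (1 - w / a).

Lemma continuous_tent a : continuous (tent a).
Proof.
move=> w; apply: (@continuous_max R R (fun=> 0) (fejer_weight a)).
  exact: cvg_cst.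
exact: continuous_fejer_weight.
Qed.

Lemma tent_out a w : 0 < a -> a <= w -> tent a w = 0.
Proof. by move=> a0 aw; rewrite /tent max_l// subr_le0 ler_pdivlMr// mul1r. Qed.

Lemma fejer_tent a b t : 0 < a -> a <= b -> fejer a t = cosint (tent a) b t.
Proof.
move=> a0 ab; rewrite (cosint_widen _ (ltW a0) ab (@continuous_tent a)); last first.
  by move=> w; exact: tent_out.
apply: eq_Rintegral => w; rewrite inE/= in_itv/= => /andP[w0 wa].
by rewrite /tent max_r// subr_ge0 ler_pdivrMr// mul1r.
Qed.

(** The de la Vallee Poussin kernel: its transform is 1 on [0, a] and
vanishes beyond 2a. *)
Definition vp a t := 2 * fejer (2 * a) t - fejer a t.

(** The transform of the difference of two de la Vallee Poussin kernels, a
continuous window supported in [a, 2 b]. *)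
Definition bandpass_weight a b w :=
  (2 * tent (2 * b) w - tent b w) - (2 * tent (2 * a) w - tent a w).

Lemma continuous_bandpass a b : continuous (bandpass_weight a b).
Proof.
have c2 (k x : R) : continuous (fun w => k * tent x w).
  by move=> w; apply: cvgM; [exact: cvg_cst|exact: continuous_tent].
by move=> w; apply: cvgB; apply: cvgB; do ?[exact: c2|exact: continuous_tent].
Qed.

Lemma tent2 a w : 0 < a -> tent (2 * a) w = Num.max 0 (1 - w / a / 2).
Proof. by move=> a0; rewrite /tent; congr (Num.max 0 (1 - _)); field; rewrite gt_eqF. Qed.

Lemma bandpass_ge0 a b w : 0 < a -> 2 * a <= b -> 0 <= w ->
  0 <= bandpass_weight a b w.
Proof.
move=> a0 ab w0; have b0 : 0 < b by lra.
rewrite /bandpass_weight !tent2// /tent.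
have h : 2 * (w / b) <= w / a.
  by rewrite mulrA ler_pdivrMr// mulrAC ler_pdivlMr//; nra.
have h' : 0 <= w / b by rewrite divr_ge0// ltW.
move: (w / a) (w / b) h h' => x y h h'; rewrite /Num.max.
by do ![case: ifPn => ?]; lra.
Qed.

Lemma bandpass_low a b w : 0 < a -> 2 * a <= b -> 0 <= w <= a ->
  bandpass_weight a b w = 0.
Proof.
move=> a0 ab /andP[w0 wa]; have b0 : 0 < b by lra.
rewrite /bandpass_weight !tent2// /tent.
have h : w / a <= 1 by rewrite ler_pdivrMr// mul1r.
have h' : w / b <= 1 by rewrite ler_pdivrMr// mul1r; lra.
rewrite !max_r; lra.
Qed.

Lemma bandpass_high a b w : 0 < a -> 2 * a <= b -> 2 * b <= w ->
  bandpass_weight a b w = 0.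
Proof.
move=> a0 ab bw; rewrite /bandpass_weight !tent_out//; lra.
Qed.

Lemma bandpassE a b t : 0 < a -> 2 * a <= b ->
  vp b t - vp a t = cosint (bandpass_weight a b) (2 * b) t.
Proof.
move=> a0 ab; have b0 : 0 < b by lra.
have ct x : continuous (tent x) by exact: continuous_tent.
have c2 (x : R) : continuous (fun w => 2 * tent (2 * x) w - tent x w).
  by move=> w; apply: cvgB; [apply: cvgM; [exact: cvg_cst|]|]; exact: ct.
rewrite /vp !(@fejer_tent _ (2 * b))//; try lra.
rewrite -!cosint_lin// -[X in X - _]mul1r -cosint_lin//.
by congr (cosint _ _ _); apply/funext => w; rewrite mul1r.
Qed.

Lemma vp_scale a t : 0 < a -> vp a t = a * vp 1 (a * t).
Proof.
move=> a0; rewrite /vp (@fejer_scale _ a)// (@fejer_scale _ (2 * a)) ?mulr_gt0//.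
rewrite mulr1 (@fejer_scale _ 2)// (mulrA 2 a t); ring.
Qed.

Lemma rint_vp a : 0 < a -> rint mu setT (vp a).
Proof.
move=> a0; apply: (rintB measurableT); last exact: rint_fejer.
by apply: (rintZ measurableT); apply: rint_fejer; rewrite mulr_gt0.
Qed.

Lemma Rintegral_vp a : 0 < a -> \int[mu]_t vp a t = fejer_mass R.
Proof.
move=> a0; have a20 : 0 < 2 * a by rewrite mulr_gt0.
rewrite /vp (RintegralB measurableT (rintZ measurableT 2 (rint_fejer a20)) (rint_fejer a0)).
by rewrite (RintegralZl 2 measurableT (rint_fejer a20)) !Rintegral_fejer//; ring.
Qed.

Lemma continuous_vp a : 0 < a -> continuous (vp a).
Proof.
move=> a0 t; apply: cvgB; last exact: fejer_continuous.
by apply: cvgM; [exact: cvg_cst|apply: fejer_continuous; rewrite mulr_gt0].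
Qed.

Lemma vp1_decay t : `|vp 1 t| <= 20 / (1 + t ^+ 2).
Proof.
have p : 0 < 1 + t ^+ 2 by rewrite ltr_pwDl// sqr_ge0.
have p4 : 0 < 1 + (2 * t) ^+ 2 by rewrite ltr_pwDl// sqr_ge0.
have h1 := @fejer1_decay R t; have h2 := @fejer1_decay R (2 * t).
have h3 : 4 / (1 + (2 * t) ^+ 2) <= 4 / (1 + t ^+ 2).
  rewrite ler_pM2l// lef_pV2 ?posrE//; nra.
have h4 := @fejer_ge0 R 1 t ltr01; have h5 := @fejer_ge0 R 1 (2 * t) ltr01.
rewrite /vp mulr1 (@fejer_scale _ 2)//.
rewrite (_ : 20 / (1 + t ^+ 2) = 5 * (4 / (1 + t ^+ 2))); last by ring.
move: (fejer 1 t) (fejer 1 (2 * t)) (4 / (1 + t ^+ 2)) (4 / _) h1 h2 h3 h4 h5 => x y z u *.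
by rewrite ler_norml; apply/andP; split; lra.
Qed.

Lemma vp_decay a t : 0 < a -> `|vp a t| <= 20 * (a + a^-1) / (1 + t ^+ 2).
Proof.
move=> a0; have p : 0 < 1 + t ^+ 2 by rewrite ltr_pwDl// sqr_ge0.
have pa : 0 < 1 + (a * t) ^+ 2 by rewrite ltr_pwDl// sqr_ge0.
rewrite vp_scale// normrM gtr0_norm//.
apply: (@le_trans _ _ (a * (20 / (1 + (a * t) ^+ 2)))).
  by rewrite ler_pM2l// vp1_decay.
rewrite ler_pdivlMr// mulrA mulrAC ler_pdivrMr//.
rewrite (_ : 20 * (a + a^-1) * _ = 20 * (a + a^-1 + (a ^+ 3 + a) * t ^+ 2)); last first.
  by field; rewrite gt_eqF.
have := invr_gt0 a; rewrite a0 => /esym h; have a3 : 0 < a ^+ 3 by rewrite exprn_gt0.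
have t2 := sqr_ge0 t; nra.
Qed.

End vallee_poussin.
Arguments vp {R}.

Section negative_kernel.
Context {R : realType}.
Notation mu := (@lebesgue_measure R).
Variable P : R -> R.
Hypothesis cP : continuous P.
Hypothesis iP : rint mu setT P.
Implicit Types (a b c t w : R).

Definition costrans w := \int[mu]_s (P s * cos (w * s)).
Definition sintrans w := \int[mu]_s (P s * sin (w * s)).

Hypothesis P_sin : forall w, sintrans w = 0.
Hypothesis P_cos : forall w, costrans w <= 0.
Hypothesis P_cos0 : forall w, w != 0 -> costrans w != 0.

Let mP : measurable_fun setT P. Proof. exact: rint_meas iP. Qed.

Let iPcos w : rint mu setT (fun s => P s * cos (w * s)).
Proof.
apply: (rint_le measurableT _ (rint_norm iP)).
  by apply: measurable_funM => //; apply: continuous_measurable_fun; exact: continuous_cosZ.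
by move=> s _; rewrite normrM ler_piMr// cos_normle1.
Qed.

Let iPsin w : rint mu setT (fun s => P s * sin (w * s)).
Proof.
apply: (rint_le measurableT _ (rint_norm iP)).
  by apply: measurable_funM => //; apply: continuous_measurable_fun; exact: continuous_sinZ.
by move=> s _; rewrite normrM ler_piMr// sin_normle1.
Qed.

Lemma continuous_costrans : continuous costrans.
Proof.
move=> w.
have := @continuity_under_integral R _ _ mu (fun w s => P s * cos (w * s)) setT measurableT
  (w - 1) (w + 1) (fun x _ => iPcos x) (aeW _ (fun y _ x _ => _)) (fun s => `|P s|) (rint_norm iP)
  (fun x _ => aeW _ (fun y _ => _)).
move=> H; apply: (H _ _ w).
- move=> y x; apply: cvgM; first exact: cvg_cst.
  apply: (@continuous_comp _ _ _ (fun x : R => x * y) cos); last exact: continuous_cos.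
  by apply: cvgM; [exact: cvg_id|exact: cvg_cst].
- by move=> x y; rewrite normrM ler_piMr// cos_normle1.
- by rewrite inE/= in_itv/= ltrDl ltr01 ltrBlDr ltrDl ltr01.
Qed.

Definition spectrum w := - costrans w.

Lemma continuous_spectrum : continuous spectrum.
Proof. by move=> w; apply: cvgN; exact: continuous_costrans. Qed.

(** The convolution of P with the Fejer kernel is the cosine integral of a
truncation of the transform of P: exchange the two integrals. *)
Lemma fejer_mean b t : 0 < b -> \int[mu]_s (P s * fejer b (t - s)) =
  - cosint (fun w => fejer_weight b w * spectrum w) b t.
Proof.
move=> b0.
pose F s w := P s * (fejer_weight b w * cos (w * (t - s))).
have mF : measurable_fun setT (fun z : measurableTypeR R * measurableTypeR R => F z.1 z.2).
  apply: measurable_funM.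
    exact: (measurableT_comp mP (@measurable_fst _ _ _ _)).
  apply: (@measurable_cont2 R (fun s w => fejer_weight b w * cos (w * (t - s)))) => z.
  apply: cvgM.
    by apply: (@continuous_comp _ _ _ snd (fejer_weight b)); [exact: cvg_snd|exact: continuous_fejer_weight].
  apply: (@continuous_comp _ _ _ (fun y : R * R => y.2 * (t - y.1)) cos); last exact: continuous_cos.
  apply: cvgM; first exact: cvg_snd.
  by apply: cvgB; [exact: cvg_cst|exact: cvg_fst].
have E := @Rfubini R _ _ _ _ mu mu setT `[0, b] F (fun s => `|P s|) (cst 1) measurableT
  (measurable_itv _) mF (rint_norm iP) (rint_cst 1 0 b).
rewrite (_ : \int[mu]_s (P s * fejer b (t - s)) = \int[mu]_s \int[mu]_(w in `[0, b]) F s w); last first.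
  apply: eq_Rintegral => s _; rewrite /fejer /cosint -(@RintegralZl _ _ _ mu)//.
  by apply: rint_cosint; exact: continuous_fejer_weight.
rewrite (E _).2; last first.
  move=> s w _; rewrite /= in_itv/= mulr1 => wb; rewrite /F normrM ler_piMr// normrM mulr_ile1//.
    exact: fejer_weight_bound.
  exact: cos_normle1.
rewrite -[RHS](@RintegralN R _ _ mu _ (measurable_itv _)); last first.
  apply: rint_cosint => w; apply: cvgM; [exact: continuous_fejer_weight|exact: continuous_spectrum].
apply: eq_Rintegral => w _; rewrite /F.
rewrite (_ : (fun s => _) = (fun s => (fejer_weight b w * cos (w * t)) * (P s * cos (w * s)) +
   (fejer_weight b w * sin (w * t)) * (P s * sin (w * s)))); last first.
  by apply/funext => s; rewrite mulrBr cosB; ring.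
rewrite (RintegralD measurableT (rintZ measurableT _ (iPcos w)) (rintZ measurableT _ (iPsin w))).
rewrite (RintegralZl _ measurableT (iPcos w)) (RintegralZl _ measurableT (iPsin w)).
by rewrite -/(costrans w) -/(sintrans w) P_sin /spectrum; ring.
Qed.

(** Fourier inversion in Fejer mean: the Fejer kernels concentrate at 0. *)
Lemma fejer_mean_cvg (T e : R) : 0 <= T -> 0 < e -> exists2 b0, 0 < b0 &
  forall b t, b0 <= b -> `|t| <= T ->
  `|\int[mu]_s (P s * fejer b (t - s)) - fejer_mass R * P t| <= e.
Proof.
move=> T0 e0.
pose m := fejer_mass R; have m0 : 0 < m by exact: fejer_mass_gt0.
pose e1 := e / (2 * m); have e10 : 0 < e1 by rewrite divr_gt0// mulr_gt0.
have [dl dl0 Pdl] := compact_unif_cont (@segment_compact R (- T) T) cP e10.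
have [K K0 PK] := compact_cont_bounded (@segment_compact R (- T) T) cP.
pose c1 := \int[mu]_s `|P s|; pose c2 := \int[mu]_s (1 + (s : R) ^+ 2)^-1.
have c10 : 0 <= c1 by apply: Rintegral_ge0 => s _; exact: normr_ge0.
have c20 : 0 <= c2.
  by apply: Rintegral_ge0 => s _; rewrite invr_ge0 addr_ge0// sqr_ge0.
pose q := 2 / dl ^+ 2 * c1 + 2 * (1 + dl ^- 2) * K * c2.
have dl2 : 0 < dl ^+ 2 by rewrite exprn_gt0.
have q0 : 0 <= q.
  rewrite addr_ge0// !mulr_ge0 ?invr_ge0 ?(ltW dl2) ?(ltW K0)//.
  by rewrite addr_ge0// invr_ge0 ltW.
exists (2 * (q + 1) / e); first by rewrite divr_gt0// mulr_gt0// ltr_wpDl.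
move=> b t bb tT.
have b0 : 0 < b by rewrite (lt_le_trans _ bb)// divr_gt0// mulr_gt0// ltr_wpDl.
have KT : `[- T, T]%classic t by rewrite /= in_itv/= -ler_norml.
have iPt : rint mu setT (fun r => P (t - r)) by exact: rint_reflect.
pose G r := e1 * fejer b r + (2 / (b * dl ^+ 2) * `|P (t - r)| + 2 / b * (1 + dl ^- 2) * K * (1 + r ^+ 2)^-1).
have iG : rint mu setT G.
  apply: (rintD measurableT); first by apply: (rintZ measurableT); exact: rint_fejer.
  apply: (rintD measurableT); apply: (rintZ measurableT); last exact: rint_oneDsqrV.
  exact: rint_norm.
have bnd r : `|fejer b r * (P (t - r) - P t)| <= G r.
  have f0 := fejer_ge0 r b0.
  have g1 : 0 <= 2 / (b * dl ^+ 2) * `|P (t - r)|.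
    by rewrite !mulr_ge0// invr_ge0 ltW// mulr_gt0.
  have g2 : 0 <= 2 / b * (1 + dl ^- 2) * K * (1 + r ^+ 2)^-1.
    rewrite !mulr_ge0 ?invr_ge0 ?(ltW b0) ?(ltW K0)// addr_ge0 ?invr_ge0 ?sqr_ge0//.
  rewrite normrM ger0_norm// /G; have [rd|rd] := ltP `|r| dl.
    apply: (@le_trans _ _ (e1 * fejer b r)); last by rewrite lerDl addr_ge0.
    rewrite mulrC ler_wpM2r// distrC ltW//; apply: Pdl => //.
    by rewrite /ball/= opprB addrC subrK.
  apply: (@le_trans _ _ (2 / (b * dl ^+ 2) * `|P (t - r)| + 2 / b * (1 + dl ^- 2) * K * (1 + r ^+ 2)^-1)); last first.
    by rewrite lerDr mulr_ge0// ltW.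
  have r0 : r != 0 by rewrite -normr_gt0 (lt_le_trans dl0).
  have r2 : dl ^+ 2 <= r ^+ 2 by rewrite -(real_normK (num_real r)) lerXn2r ?nnegrE// ltW.
  have r20 : 0 < r ^+ 2 by rewrite (lt_le_trans dl2).
  have fd := fejer_decay b0 r0.
  apply: (@le_trans _ _ (fejer b r * (`|P (t - r)| + `|P t|))).
    by rewrite ler_wpM2l// ler_normB.
  rewrite mulrDr lerD//.
    rewrite ler_wpM2r// (le_trans fd)// ler_pM2l// lef_pV2 ?posrE ?(mulr_gt0 b0)//.
    by rewrite ler_pM2l.
  apply: (@le_trans _ _ (2 / (b * r ^+ 2) * K)).
    by rewrite ler_pM// PK.
  rewrite (_ : 2 / b * (1 + dl ^- 2) * K * (1 + r ^+ 2)^-1 = 2 / b * ((1 + dl ^- 2) * (1 + r ^+ 2)^-1) * K); last by ring.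
  rewrite ler_wpM2r ?(ltW K0)// (_ : 2 / (b * r ^+ 2) = 2 / b * r ^- 2); last by rewrite invfM mulrA.
  rewrite ler_wpM2l ?divr_ge0 ?(ltW b0)//.
  rewrite ler_pdivlMr ?ltr_pwDl ?sqr_ge0// mulrDr mulr1 mulVf ?gt_eqF// addrC lerD2l.
  by rewrite lef_pV2 ?posrE.
have iL : rint mu setT (fun r => fejer b r * (P (t - r) - P t)).
  apply: (rint_le measurableT _ iG) => //.
  apply: measurable_funM; first exact: rint_meas (rint_fejer b0).
  by apply: measurable_funB => //; exact: rint_meas iPt.
have iF : rint mu setT (fun r => fejer b r * P (t - r)).
  apply: (rint_ext measurableT _ (rintD measurableT iL (rintZ measurableT (P t) (rint_fejer b0)))).
  by move=> r _; ring.
have E1 : \int[mu]_s (P s * fejer b (t - s)) = \int[mu]_r (fejer b r * P (t - r)).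
  rewrite -(Rintegral_reflect t iF); apply: eq_Rintegral => s _.
  by rewrite subKr mulrC.
have E2 : \int[mu]_s (P s * fejer b (t - s)) - fejer_mass R * P t =
    \int[mu]_r (fejer b r * (P (t - r) - P t)).
  rewrite E1 -(Rintegral_fejer b0) -(RintegralZr _ measurableT (rint_fejer b0)).
  rewrite -(RintegralB measurableT iF (rintZr measurableT (P t) (rint_fejer b0))).
  by apply: eq_Rintegral => r _; ring.
rewrite E2; apply: (le_trans (Rintegral_norm_le measurableT iL iG (fun r _ => bnd r))).
rewrite /G (RintegralD measurableT (rintZ measurableT e1 (rint_fejer b0))); last first.
  apply: (rintD measurableT); apply: (rintZ measurableT); last exact: rint_oneDsqrV.
  exact: rint_norm.
rewrite (RintegralD measurableT (rintZ measurableT _ (rint_norm iPt)) (rintZ measurableT _ (@rint_oneDsqrV R))).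
rewrite (RintegralZl _ measurableT (rint_fejer b0)) (RintegralZl _ measurableT (rint_norm iPt)).
rewrite (RintegralZl _ measurableT (@rint_oneDsqrV R)) Rintegral_fejer// -/m -/c2.
rewrite (_ : \int[mu]_x `|P (t - x)| = c1); last first.
  by rewrite (Rintegral_reflect t (rint_norm iP)).
rewrite (_ : _ + _ = e / 2 + q / b); last by rewrite /q /e1; field; rewrite !gt_eqF.
rewrite [leRHS](splitr e) lerD2l ler_pdivrMr// mulrC -ler_pdivrMr ?divr_gt0//.
apply: le_trans bb; rewrite invf_div mulrA (mulrC _ 2) ler_pM2r ?invr_gt0//.
by rewrite ler_pM2l// lerDl.
Qed.

(** On [a, b] the continuous function - P^ is bounded below by a positive
constant, so a large multiple of it dominates g; the difference is a
positive combination of cosines, up to the passage from P to its Fejer means. *)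
Lemma pdk_spectral_dominates (g : R -> R) a b : 0 < a -> a <= b -> continuous g ->
  (forall w, 0 <= w -> 0 <= g w) -> (forall w, 0 <= w <= a -> g w = 0) ->
  (forall w, b <= w -> g w = 0) ->
  exists2 C, 0 < C & pdk (fun t => C * - P t - cosint g b t).
Proof.
move=> a0 ab cg g0 ga gb; have b0 : 0 < b by exact: lt_le_trans ab.
pose m := fejer_mass R; have m0 : 0 < m by exact: fejer_mass_gt0.
have sp0 w : w != 0 -> 0 < spectrum w.
  by move=> w0; rewrite /spectrum oppr_gt0 lt_neqAle P_cos0// P_cos.
have sp w : 0 <= spectrum w by rewrite oppr_ge0 P_cos.
have [c cab cmin] := EVT_min ab (continuous_subspaceT continuous_spectrum).
have c0 : 0 < spectrum c.
  by apply: sp0; rewrite gt_eqF// (lt_le_trans a0)//; move: cab; rewrite in_itv/= => /andP[].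
have [G G0 gG] := compact_cont_bounded (@segment_compact R a b) cg.
(* The factor 2 makes up for the Fejer weight, at least 1 / 2 on [0, b] as soon
as its parameter is at least 2 b. *)
pose C1 := 2 * G / spectrum c.
have C10 : 0 < C1 by rewrite divr_gt0// mulr_gt0.
exists (C1 * m); first by rewrite mulr_gt0.
have cgi : continuous (cosint g b).
  have [Mg Mg0 gM] := compact_cont_bounded (@segment_compact R 0 b) cg.
  apply: (@lipschitz_continuous _ _ (Mg * b * b)) => s t; apply: cosint_lipschitz => //.
  exact: ltW.
apply: pdk_limit.
  by move=> t; apply: cvgB; [apply: cvgM; [exact: cvg_cst|apply: cvgN; exact: cP]|exact: cgi].
move=> T e T0 e0.
have [b1 b10 b1P] := fejer_mean_cvg T0 (divr_gt0 e0 C10).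
pose B := Num.max b1 (2 * b).
have B1 : b1 <= B by rewrite le_max lexx.
have B2 : 2 * b <= B by rewrite le_max lexx orbT.
have B0 : 0 < B by exact: lt_le_trans B1.
have bB : b <= B by lra.
pose k w := C1 * (fejer_weight B w * spectrum w) - g w.
have cfs : continuous (fun w => fejer_weight B w * spectrum w).
  by move=> w; apply: cvgM; [exact: continuous_fejer_weight|exact: continuous_spectrum].
have ck : continuous k.
  by move=> w; apply: cvgB; [apply: cvgM; [exact: cvg_cst|exact: cfs]|exact: cg].
have kE t : cosint k B t = C1 * cosint (fun w => fejer_weight B w * spectrum w) B t - cosint g b t.
  by rewrite -(cosint_widen t (ltW b0) bB cg gb) -cosint_lin.
exists (cosint k B); split.
- apply: pdk_cosint => //; first exact: ltW.
  move=> w /andP[w0 wB]; rewrite /k subr_ge0.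
  have fw0 : 0 <= fejer_weight B w.
    by rewrite /fejer_weight subr_ge0 ler_pdivrMr// mul1r.
  have C1fs : 0 <= C1 * (fejer_weight B w * spectrum w) by exact: (mulr_ge0 (ltW C10) (mulr_ge0 fw0 (sp w))).
  have [wa|aw] := leP w a; first by rewrite ga// w0.
  have [bw|wb] := leP b w; first by rewrite gb.
  have wab : a <= w <= b by rewrite !ltW.
  apply: (@le_trans _ _ G).
    by rewrite (le_trans (ler_norm _))// gG//= in_itv.
  have hw : 2^-1 <= fejer_weight B w.
    rewrite /fejer_weight; suff : w / B <= 2^-1 by lra.
    by rewrite ler_pdivrMr//; lra.
  have hs : spectrum c <= spectrum w by apply: cmin; rewrite in_itv.
  rewrite (_ : G = C1 * (2^-1 * spectrum c)); last first.
    by rewrite /C1; field; rewrite gt_eqF.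
  by rewrite ler_pM2l// ler_pM// ltW.
- have [Mg Mg0 gM] := compact_cont_bounded (@segment_compact R 0 B) ck.
  apply: (@lipschitz_continuous _ _ (Mg * B * B)) => s t; apply: cosint_lipschitz => //.
  exact: ltW.
- move=> t tT; rewrite kE opprD addrACA opprK.
  rewrite (_ : - _ + _ = 0) ?addr0; last by ring.
  have := b1P B t B1 tT; rewrite fejer_mean// ler_pdivlMr// mulrC => h.
  rewrite -mulrA -mulrBr normrM gtr0_norm//.
  rewrite (_ : m * - P t - _ = - cosint (fun w => fejer_weight B w * spectrum w) B t - m * P t)//.
  by ring.
Qed.

End negative_kernel.

(** * Filtering a signal of bounded dissipation *)

Section tails.
Context {R : realType}.
Notation mu := (@lebesgue_measure R).
Implicit Types (f g h : R -> R) (a b c t x : R).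

Lemma continuous_sqr f : continuous f -> continuous (fun t => f t ^+ 2).
Proof.
move=> cf t; have : {for t, continuous (fun t => f t * f t)} by apply: cvgM; exact: cf.
exact.
Qed.

Lemma le_mean (x y z m : R) : y <= m -> z <= m -> x <= 2^-1 * (y + z) -> x <= m.
Proof. lra. Qed.

Lemma le_quad_bound (x y z m : R) : 0 <= x - z - z + y -> y <= z -> x <= m -> z <= m.
Proof. lra. Qed.

Lemma norm_mul_le_sqr (x y : R) : `|x * y| <= 2^-1 * (x ^+ 2 + y ^+ 2).
Proof.
have h1 := sqr_ge0 (x - y); have h2 := sqr_ge0 (x + y).
by rewrite ler_norml; apply/andP; split; lra.
Qed.

Lemma Rintegral_oneDsqrV : \int[mu]_x (1 + (x : R) ^+ 2)^-1 = pi.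
Proof.
have c1 : continuous (fun x : R => (1 + x ^+ 2)^-1) by exact: continuous_oneDsqrV.
rewrite /Rintegral ge0_symfun_integralT//.
- by rewrite -set_itvcy integral0y_oneDsqr/= mulrC divfK.
- by move=> x; rewrite invr_ge0 addr_ge0// sqr_ge0.
- by move=> x /=; rewrite sqrrN.
Qed.

Lemma atan_tail x : 0 < x -> pi / 2 - atan x <= x^-1.
Proof.
move=> x0; have [E i2] := square_integral_lower x0; rewrite -E.
have c1 : continuous (fun x : R => (1 + x ^+ 2)^-1) by exact: continuous_oneDsqrV.
rewrite -(@Rintegral_ge0_continuous_FTC2y R (fun s => (1 + s ^+ 2)^-1) (@atan R) x (pi / 2)).
- apply: (Rintegral_le (m := mu)) => //.
    by apply: (rintS measurableT) (@rint_oneDsqrV R).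
  move=> s /=; rewrite in_itv/= andbT => xs.
  have s0 : 0 < s ^+ 2 by rewrite exprn_gt0// (lt_le_trans x0).
  by rewrite lef_pV2 ?posrE ?ltr_wpDl// lerDr.
- by move=> s _; rewrite invr_ge0 addr_ge0// sqr_ge0.
- exact: continuous_subspaceT.
- exact: cvgy_atan.
- by move=> s _; exact: derivable_atan.
- by apply: cvg_at_right_filter; exact: continuous_atan.
- by move=> s _; rewrite derive1_atan.
Qed.

Lemma complement_integral_le (A : set R) f g : measurable A ->
  rint mu setT f -> rint mu setT g -> (forall x, `|f x| <= g x) ->
  `|\int[mu]_x f x - \int[mu]_(x in A) f x| <=
  \int[mu]_x g x - \int[mu]_(x in A) g x.
Proof.
move=> mA fi gi fg.
have fA : rint mu setT (f \_ A) by apply: (rint_restrict mu mA _).1; exact: rintS fi.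
have gA : rint mu setT (g \_ A) by apply: (rint_restrict mu mA _).1; exact: rintS gi.
rewrite (Rintegral_mkcond mu A f) (Rintegral_mkcond mu A g).
rewrite -(RintegralB measurableT fi fA) -(RintegralB measurableT gi gA).
apply: (Rintegral_norm_le measurableT).
- exact: rintB.
- exact: rintB.
- by move=> x _; rewrite /patch; case: ifP => _; rewrite ?subrr ?normr0 ?subr0.
Qed.

Lemma cauchy_tail x (T : R) : 0 < x -> x < T ->
  \int[mu]_s (1 + (x - (s : R)) ^+ 2)^-1 -
  \int[mu]_(s in `[0, T]) (1 + (x - s) ^+ 2)^-1 <= x^-1 + (T - x)^-1.
Proof.
move=> x0 xT.
have c1 : continuous (fun x : R => (1 + x ^+ 2)^-1) by exact: continuous_oneDsqrV.
rewrite (Rintegral_reflect x (@rint_oneDsqrV R)) Rintegral_oneDsqrV.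
have [_] := @Rintegral_reflect_itv R (fun s => (1 + s ^+ 2)^-1) (x - T) x x (rint_itv _ _ c1).
rewrite subrr subKr => ->.
rewrite (@FTC2_itv R (@atan R))//.
- have := atan_tail x0; have := @atan_tail (T - x); rewrite subr_gt0 => /(_ xT).
  by rewrite -[x - T]opprB atanN; lra.
- by rewrite lerBlDr lerDl ltW// (lt_trans x0).
- by move=> s; exact: continuous_atan.
Qed.

(** The integrals over [1, S] approach their supremum, so only a small mass is
left beyond some X. *)
Lemma window_vanish g C : continuous g -> (forall x, 0 <= g x) ->
  (forall S, 1 <= S -> \int[mu]_(x in `[1, S]) g x <= C) ->
  forall e, 0 < e -> exists2 X, 1 <= X & forall x t, X <= x -> 0 <= t ->
    \int[mu]_(y in `[x, x + t]) g y <= e.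
Proof.
move=> cg g0 gC e e0.
pose A := [set \int[mu]_(x in `[1, S]) g x | S in [set S | 1 <= S]].
have hA : has_sup A.
  split; first by exists (\int[mu]_(x in `[1, 1]) g x), 1 => //=.
  by exists C => _ [S S1 <-]; exact: gC.
have [_ [X X1 <-] XA] := sup_adherent e0 hA.
exists X => // x t Xx t0.
have h1 : \int[mu]_(y in `[1, x + t]) g y <= sup A.
  by apply: ub_le_sup; [case: hA|exists (x + t) => //=; rewrite (le_trans X1)// (le_trans Xx)// lerDl].
have xt : x <= x + t by rewrite lerDl.
move: h1; rewrite (@Rintegral_itv_split R g 1 X)//; last 2 first.
- exact: le_trans xt.
- exact: rint_itv.
rewrite (@Rintegral_itv_split R g X x)//; last exact: rint_itv.
have : 0 <= \int[mu]_(y in `[X, x]) g y by apply: Rintegral_itv_ge0.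
move: XA; lra.
Qed.

End tails.

Section filter.
Context {R : realType}.
Notation mu := (@lebesgue_measure R).
Variables (P phi h : R -> R) (c K H C0 : R).
Hypotheses (cP : continuous P) (cphi : continuous phi) (ch : continuous h).
Hypothesis phi_even : forall t, phi (- t) = phi t.
Hypothesis c0 : 0 < c.
Hypothesis phi_decay : forall t, `|phi t| <= c / (1 + t ^+ 2).
Hypothesis pphi : pdk phi.
Hypothesis K0 : 0 < K.
Hypothesis pKP : pdk (fun t => K * - P t - phi t).
Hypothesis H0 : 0 < H.
Hypothesis hH : forall t, `|h t| <= H.
Hypothesis dissip : forall T, 0 <= T ->
  dint T (fun t s => - P (t - s) * (h t * h s)) <= C0.

Let hh : jcont (fun t s => h t * h s).
Proof. by apply: jcontM; [exact: jcont_fst|exact: jcont_snd]. Qed.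

(** The kernel phi is dominated by a multiple of - P, whose form is bounded. *)
Lemma filter_quad (T : R) : 0 <= T ->
  dint T (fun t s => phi (t - s) * (h t * h s)) <= K * C0.
Proof.
move=> T0; have := pKP T0 hh (cospos_square T0 ch).
have cN : continuous (fun t => - P t) by move=> t; apply: cvgN; exact: cP.
have c1 := jcontM (jcont_diff cN) hh; have c2 := jcontM (jcont_diff cphi) hh.
rewrite (_ : dint _ _ = K * dint T (fun t s => - P (t - s) * (h t * h s)) -
   dint T (fun t s => phi (t - s) * (h t * h s))); last first.
  rewrite -(dintZ K T0 c1) -(dintB T0 (@jcontZ R K _ c1) c2).
  by apply: dint_ext => t s _ _; ring.
have := dissip T0; rewrite -(ler_pM2l K0).
by move=> h1; rewrite subr_ge0 => /le_trans; exact.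
Qed.

Let M := c * pi + 1.
Let M0 : 0 < M. Proof. by rewrite ltr_wpDl// mulr_ge0 ?pi_ge0 ?ltW. Qed.

Lemma rint_phi : rint mu setT phi.
Proof.
apply: (rint_le measurableT _ (rintZ measurableT c (@rint_oneDsqrV R))).
  exact: continuous_measurable_fun.
by move=> x _; exact: phi_decay.
Qed.

Lemma phi_mass (T : R) t : \int[mu]_(s in `[0, T]) `|phi (t - s)| <= M.
Proof.
have i1 := rint_norm rint_phi.
apply: le_trans (Rintegral_subset_ge0 (measurable_itv `[0, T]) (rint_reflect t i1) _) _ => //.
rewrite (Rintegral_reflect t i1) (le_trans (Rintegral_le measurableT i1 (rintZ measurableT c (@rint_oneDsqrV R)) _))//.
by rewrite (RintegralZl c measurableT (@rint_oneDsqrV R)) Rintegral_oneDsqrV lerDl.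
Qed.

Definition filt T t := \int[mu]_(s in `[0, T]) (phi (t - s) * h s).

Let jphi : jcont (fun t s => phi (t - s)). Proof. exact: jcont_diff. Qed.

Lemma continuous_filt (T : R) : 0 <= T -> continuous (filt T).
Proof.
move=> T0; apply: (@param_continuous R _ (fun t s => phi (t - s) * h s)) => //.
exact: (jcontM jphi (jcont_snd ch)).
Qed.

(** With w = phi * h, expand the nonnegative form of phi at h - w / M: its
cross terms are the square integral of w, and its last term is at most
that integral over M by Young's inequality. *)
Lemma filt_l2 (T : R) : 0 <= T -> \int[mu]_(t in `[0, T]) (filt T t ^+ 2) <= M * (K * C0).
Proof.
move=> T0; set W := Rintegral _ _ _.
have cw := continuous_filt T0; pose w := filt T; rewrite -/w in cw.
pose u t := h t - M^-1 * w t.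
have cu : continuous u.
  by move=> t; apply: cvgB; [exact: ch|apply: cvgM; [exact: cvg_cst|exact: cw]].
have jp (f g : R -> R) : continuous f -> continuous g -> jcont (fun t s => phi (t - s) * (f t * g s)).
  by move=> cf cg; exact: (jcontM jphi (jcontM (jcont_fst cf) (jcont_snd cg))).
have Ewh : dint T (fun t s => phi (t - s) * (w t * h s)) = W.
  apply: eq_Rintegral => t _; rewrite expr2 /w {2}/filt -(@RintegralZl _ _ _ mu)//.
    by apply: eq_Rintegral => s _; rewrite -/(filt T t); ring.
  exact/rint_itv/(cont2_1 (jcontM jphi (jcont_snd ch))).
have Ehw : dint T (fun t s => phi (t - s) * (h t * w s)) = W.
  rewrite (dint_sym _ (jp _ _ ch cw)) -Ewh; apply: dint_ext => t s _ _.
  by rewrite -phi_even opprB (mulrC (h s)).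
have Eww : dint T (fun t s => phi (t - s) * (w t * w s)) <= M * W.
  have cww := continuous_sqr cw.
  have japhi : jcont (fun t s => `|phi (t - s)|).
    by move=> z; apply: cvg_norm; exact: jphi.
  have j1 := jcontM japhi (jcont_fst cww); have j2 := jcontM japhi (jcont_snd cww).
  have B1 : dint T (fun t s => `|phi (t - s)| * w t ^+ 2) <= M * W.
    rewrite /W -(@RintegralZl _ _ _ mu)//; last exact: rint_itv.
    apply: (Rintegral_le (m := mu)) => //.
    - by apply: rint_itv; exact: jcont_inner.
    - by apply: (rintZ (m := mu)) => //; exact: rint_itv.
    - move=> t _; rewrite (@RintegralZr _ _ _ mu)//; last exact/rint_itv/(cont2_1 japhi).
      by rewrite ler_wpM2r ?sqr_ge0// phi_mass.
  have B2 : dint T (fun t s => `|phi (t - s)| * w s ^+ 2) <= M * W.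
    rewrite (dint_sym _ j2); apply: le_trans B1; rewrite le_eqVlt; apply/orP; left.
    by apply/eqP/dint_ext => t s _ _; rewrite -phi_even opprB.
  have : dint T (fun t s => phi (t - s) * (w t * w s)) <=
      dint T (fun t s => 2^-1 * (`|phi (t - s)| * w t ^+ 2 + `|phi (t - s)| * w s ^+ 2)).
    apply: dint_le => //; [exact: jp|exact: (@jcontZ R 2^-1 _ (jcontD j1 j2))|].
    move=> t s _ _; apply: le_trans (ler_norm _) _; rewrite normrM -mulrDr.
    by rewrite mulrCA ler_wpM2l// norm_mul_le_sqr.
  rewrite (dintZ _ T0 (jcontD j1 j2)) (dintD T0 j1 j2).
  exact: (le_mean B1 B2).
have := pphi T0 (jcontM (jcont_fst cu) (jcont_snd cu)) (cospos_square T0 cu).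
have jhh := jp _ _ ch ch; have jwh := jp _ _ cw ch; have jhw := jp _ _ ch cw; have jww := jp _ _ cw cw.
rewrite (_ : dint _ _ = dint T (fun t s => phi (t - s) * (h t * h s)) -
  M^-1 * dint T (fun t s => phi (t - s) * (w t * h s)) -
  M^-1 * dint T (fun t s => phi (t - s) * (h t * w s)) +
  M^-1 ^+ 2 * dint T (fun t s => phi (t - s) * (w t * w s))); last first.
  rewrite -(dintZ (M^-1) T0 jwh) -(dintZ (M^-1) T0 jhw) -(dintZ (M^-1 ^+ 2) T0 jww).
  rewrite -(dintB T0 jhh (@jcontZ R M^-1 _ jwh)) -(dintB T0 (jcontB jhh (@jcontZ R M^-1 _ jwh)) (@jcontZ R M^-1 _ jhw)).
  rewrite -(dintD T0 (jcontB (jcontB jhh (@jcontZ R M^-1 _ jwh)) (@jcontZ R M^-1 _ jhw)) (@jcontZ R (M^-1 ^+ 2) _ jww)).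
  by apply: dint_ext => t s _ _; rewrite /u; ring.
rewrite Ewh Ehw => q.
have q2 : M^-1 ^+ 2 * dint T (fun t s => phi (t - s) * (w t * w s)) <= M^-1 * W.
  apply: le_trans (ler_wpM2l _ Eww) _; first exact: sqr_ge0.
  by rewrite expr2 mulrA -(mulrA M^-1) mulVf ?gt_eqF// mulr1.
have q3 := filter_quad T0.
have q4 : M^-1 * W <= K * C0.
  exact: (le_quad_bound q q2 q3).
by rewrite -(ler_pM2l (_ : 0 < M^-1)) ?invr_gt0// mulKf ?gt_eqF.
Qed.

Definition filtered x := \int[mu]_s (phi (x - s) * h s).

Lemma rint_filtered x : rint mu setT (fun s => phi (x - s) * h s).
Proof.
apply: (rint_le measurableT _ (rintZr measurableT H (rint_norm (rint_reflect x rint_phi)))).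
  apply: continuous_measurable_fun; exact: (cont2_1 (jcontM jphi (jcont_snd ch)) (x := x)).
by move=> s _; rewrite normrM ler_wpM2l.
Qed.

(** Away from the ends of [0, T] the quadratic decay of phi makes truncation
to [0, T] harmless. *)
Lemma filt_filtered (T : R) x : 0 < x -> x < T ->
  `|filtered x - filt T x| <= H * c * (x^-1 + (T - x)^-1).
Proof.
move=> x0 xT.
have i1 := rint_reflect x (@rint_oneDsqrV R).
apply: le_trans (complement_integral_le (g := fun s => H * c * (1 + (x - s) ^+ 2)^-1) _ (rint_filtered x) _ _) _.
- exact: measurable_itv.
- exact: (rintZ measurableT).
- move=> s; rewrite normrM mulrC -mulrA ler_pM//.
- rewrite (RintegralZl _ measurableT i1) (RintegralZl _ _ (rintS measurableT _ _ i1))//.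
  by rewrite -mulrBr ler_wpM2l ?cauchy_tail// mulr_ge0// ltW.
Qed.

Lemma continuous_filtered : continuous filtered.
Proof.
have E x : filtered x = \int[mu]_r (phi r * h (x - r)).
  have := Rintegral_reflect x (rint_filtered x).
  by rewrite -/(filtered x) => <-; apply: eq_Rintegral => s _; rewrite subKr.
rewrite (_ : filtered = fun x => \int[mu]_r (phi r * h (x - r))); last exact/funext.
have ip x : rint mu setT (fun r => phi r * h (x - r)).
  apply: (rint_le measurableT _ (rintZr measurableT H (rint_norm rint_phi))).
    apply: continuous_measurable_fun => r; apply: cvgM; first exact: cphi.
    apply: (@continuous_comp _ _ _ (fun r => x - r) h); last exact: ch.
    by apply: cvgB; [exact: cvg_cst|exact: cvg_id].
  by move=> r _; rewrite normrM ler_wpM2l.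
move=> x.
have := @continuity_under_integral R _ _ mu (fun x r => phi r * h (x - r)) setT measurableT
  (x - 1) (x + 1) (fun x _ => ip x) (aeW _ (fun y _ x _ => _)) (fun s => `|phi s| * H) (rintZr measurableT H (rint_norm rint_phi))
  (fun x _ => aeW _ (fun y _ => _)).
move=> F; apply: (F _ _ x).
- move=> r y; apply: cvgM; first exact: cvg_cst.
  apply: (@continuous_comp _ _ _ (fun y => y - r) h); last exact: ch.
  by apply: cvgB; [exact: cvg_id|exact: cvg_cst].
- by move=> y r; rewrite normrM ler_wpM2l.
- by rewrite inE/= in_itv/= ltrDl ltr01 ltrBlDr ltrDl ltr01.
Qed.

Lemma filtered_l2 S : 1 <= S ->
  \int[mu]_(x in `[1, S]) (filtered x ^+ 2) <= 3 * (M * (K * C0)) + 6 * (H * c) ^+ 2.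
Proof.
move=> S1; pose T := 2 * S; have T0 : 0 <= T by rewrite /T; lra.
have cw := continuous_filt T0.
have csq := @continuous_sqr R.
pose D := H * c; have D0 : 0 < D by rewrite mulr_gt0.
pose g x := 3 * filt T x ^+ 2 + (3 * D ^+ 2) * ((Num.max x 1 ^+ 2)^-1 + S ^- 2).
have cmax : continuous (fun x : R => (Num.max x 1 ^+ 2)^-1).
  move=> x; apply: cvgV; first by rewrite sqrf_eq0 gt_eqF// lt_max ltr01 orbT.
  apply: (csq (fun x : R => Num.max x 1)) => y.
  by apply: continuous_max; [exact: cvg_id|exact: cvg_cst].
have c1 : continuous (fun x => 3 * filt T x ^+ 2).
  by move=> x; apply: cvgM; [exact: cvg_cst|exact: (csq _ cw)].
have c2 : continuous (fun x : R => (3 * D ^+ 2) * ((Num.max x 1 ^+ 2)^-1 + S ^- 2)).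
  by move=> x; apply: cvgM; [exact: cvg_cst|apply: cvgD; [exact: cmax|exact: cvg_cst]].
apply: (@le_trans _ _ (\int[mu]_(x in `[1, S]) g x)).
  apply: (Rintegral_le (m := mu)) => //.
  - exact/rint_itv/csq/continuous_filtered.
  - by apply: rint_itv => x; apply: cvgD; [exact: c1|exact: c2].
  - move=> x /=; rewrite in_itv/= => /andP[x1 xS].
    have x0 : 0 < x by rewrite (lt_le_trans ltr01).
    have xT : x < T by rewrite /T; lra.
    have := filt_filtered x0 xT; rewrite -/D.
    have TS : (T - x)^-1 <= S^-1 by rewrite lef_pV2 ?posrE; rewrite /T; lra.
    have TS0 : 0 <= (T - x)^-1 by rewrite invr_ge0; lra.
    rewrite /g max_l// -!exprVn; move: (x^-1) (T - x)^-1 (S^-1) (filtered x) (filt T x) (invr_ge0 x) TS TS0.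
    rewrite (ltW x0) => p r s y z p0 rs r0 yz.
    have h1 : (y - z) ^+ 2 <= (D * (p + r)) ^+ 2.
      by rewrite -(real_normK (num_real (y - z))) lerXn2r ?nnegrE// mulr_ge0 ?(ltW D0)// addr_ge0.
    have h2 : (D * (p + r)) ^+ 2 <= D ^+ 2 * (2 * (p ^+ 2 + s ^+ 2)).
      rewrite exprMn ler_wpM2l ?sqr_ge0//; have := sqr_ge0 (p - r); nra.
    have h3 := sqr_ge0 (2 * z - (y - z)); lra.
rewrite (@RintegralD _ _ _ mu)//; [|exact: rint_itv|exact: rint_itv].
apply: lerD.
  rewrite (@RintegralZl _ _ _ mu)//; last exact/rint_itv/csq.
  rewrite ler_pM2l// (le_trans _ (filt_l2 T0))//.
  rewrite (@Rintegral_itv_split R _ 0 1 T)//; last 2 first.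
  - by rewrite /T; lra.
  - exact/rint_itv/csq.
  rewrite (@Rintegral_itv_split R _ 1 S T)//; last 2 first.
  - by rewrite /T; lra.
  - exact/rint_itv/csq.
  rewrite addrCA lerDl addr_ge0//; apply: Rintegral_itv_ge0 => x _; exact: sqr_ge0.
rewrite (@RintegralZl _ _ _ mu)//; last first.
  by apply: rint_itv => x; apply: cvgD; [exact: cmax|exact: cvg_cst].
rewrite (_ : 6 * _ = 3 * D ^+ 2 * 2); last by rewrite /D; ring.
have D20 : 0 <= 3 * D ^+ 2 by rewrite mulr_ge0// sqr_ge0.
rewrite (ler_wpM2l D20)//.
rewrite (@RintegralD _ _ _ mu)//; [|exact: rint_itv|exact: rint_cst].
rewrite Rintegral_itv_cst// (_ : 2 = 1 + 1)// lerD//; last first.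
  rewrite mulrC ler_pdivrMr ?exprn_gt0 ?(lt_le_trans ltr01)// mul1r; nra.
have [E1 i1] := square_integral_lower (@ltr01 R).
rewrite -[leRHS](invr1 R) -E1.
rewrite (@Rintegral_ext _ _ _ mu _ _ (fun x : R => (x ^+ 2)^-1)); last first.
  by move=> x /=; rewrite in_itv/= => /andP[x1 _]; rewrite max_l.
rewrite Rintegral_mkcond [leRHS]Rintegral_mkcond.
apply: (Rintegral_le measurableT).
- apply: (rint_restrict mu (measurable_itv _) _).1.
  by apply: rintS i1 => // x /=; rewrite !in_itv/= => /andP[->].
- exact: (rint_restrict mu (measurable_itv _) _).1.
- move=> x _; rewrite /patch; case: ifPn => [|_].
    rewrite inE/= in_itv/= => /andP[x1 _]; rewrite ifT//.
    by rewrite inE/= in_itv/= x1.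
  by case: ifP => // _; rewrite invr_ge0 sqr_ge0.
Qed.

(** A continuous function that is square integrable near infinity has integrals
over windows of bounded length that vanish at infinity: the windows of its
square do, by [window_vanish]. *)
Lemma filtered_window (e tau : R) : 0 < e -> 0 < tau -> exists2 X, 1 <= X &
  forall x, X <= x -> `|\int[mu]_(y in `[x, x + tau]) filtered y| <= e.
Proof.
move=> e0 t0; pose y := e / tau; have y0 : 0 < y by rewrite divr_gt0.
have cf := continuous_filtered.
have csq := continuous_sqr cf.
have [X X1 XP] := window_vanish csq (fun x => sqr_ge0 _) filtered_l2 (mulr_gt0 e0 y0).
exists X => // x Xx; have := XP x tau Xx (ltW t0) => hw.
apply: le_trans (Rintegral_norm_le (m := mu) (g := fun s => 2^-1 * y + (2 * y)^-1 * filtered s ^+ 2) _ _ _ _) _ => //.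
- exact: rint_itv.
- apply: rint_itv => s; apply: cvgD; first exact: cvg_cst.
  by apply: cvgM; [exact: cvg_cst|exact: csq].
- move=> s _; have := sqr_ge0 (`|filtered s| - y).
  rewrite -(real_normK (num_real (filtered s))); set z : R := `|filtered s| => z2.
  have y20 : 0 < 2 * y by rewrite mulr_gt0.
  rewrite -(ler_pM2l y20) mulrDr mulVKf ?gt_eqF//; nra.
rewrite (@RintegralD _ _ _ mu)//; [|exact: rint_cst|]; last first.
  by apply: rint_itv => s; apply: cvgM; [exact: cvg_cst|exact: csq].
rewrite (@RintegralZl _ _ _ mu _ (fun s => filtered s ^+ 2))//; last exact: rint_itv.
rewrite Rintegral_itv_cst ?lerDl ?(ltW t0)// addrAC subrr add0r.
have h2 : (2 * y)^-1 * \int[mu]_(s in `[x, x + tau]) filtered s ^+ 2 <= (2 * y)^-1 * (e * y).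
  by rewrite ler_wpM2l// invr_ge0 mulr_ge0// ltW.
apply: le_trans (lerD (lexx _) h2) _.
by rewrite le_eqVlt; apply/orP; left; apply/eqP; rewrite /y; field; rewrite !gt_eqF.
Qed.

End filter.

(** * Vanishing increments: a Tauberian theorem *)

Section tauberian.
Context {R : realType}.
Notation mu := (@lebesgue_measure R).

Lemma cont_comp (f g : R -> R) : continuous f -> continuous g ->
  continuous (fun x => f (g x)).
Proof.
by move=> cf cg x; apply: (@continuous_comp _ _ _ g f); [exact: cg|exact: cf].
Qed.

Lemma cont_affine (a b : R) : continuous (fun u : R => a + u * b).
Proof.
move=> u; apply: cvgD; first exact: cvg_cst.
by apply: cvgM; [exact: cvg_id|exact: cvg_cst].
Qed.

Lemma is_derive_shift (f g : R -> R) (y r : R) :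
  (forall t : R, is_derive t (1 : R) f (g t)) ->
  is_derive y (1 : R) (fun y => f (y - r)) (g (y - r)).
Proof.
move=> fg; have d1 : is_derive y (1 : R) (fun y => y - r) 1.
  by apply: is_derive_eq; rewrite subr0.
have := @is_derive1_comp R f (fun y => y - r) y (g (y - r)) 1 (fg _) d1.
by rewrite mulr1.
Qed.

Lemma shift_oneDsqr (u s : R) : -1 < s -> s < 1 ->
  20 / (1 + (u + s) ^+ 2) <= 60 / (1 + u ^+ 2).
Proof.
move=> s1 s2; have p1 : 0 < 1 + u ^+ 2 by rewrite ltr_pwDl// sqr_ge0.
have p2 : 0 < 1 + (u + s) ^+ 2 by rewrite ltr_pwDl// sqr_ge0.
rewrite ler_pdivrMr// mulrAC ler_pdivlMr//.
have h1 := sqr_ge0 (u + 2 * s); have h3 := sqr_ge0 (u + s); have h2 : s ^+ 2 <= 1 by nra.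
lra.
Qed.

Lemma fejer_even b (t : R) : fejer b (- t) = fejer b t.
Proof. by apply: eq_Rintegral => w _; rewrite mulrN cosN. Qed.

Lemma vp_even a (t : R) : vp a (- t) = vp a t.
Proof. by rewrite /vp !fejer_even. Qed.

Variables (psi h : R -> R) (H Psi : R).
Hypothesis ch : continuous h.
Hypothesis dpsi : forall t : R, is_derive t (1 : R) psi (h t).
Hypothesis H0 : 0 < H.
Hypothesis hH : forall t, `|h t| <= H.
Hypothesis Psi0 : 0 < Psi.
Hypothesis psiH : forall t, `|psi t| <= Psi.

Let cpsi : continuous psi.
Proof.
move=> t; apply: differentiable_continuous; apply/derivable1_diffP.
by case: (dpsi t).
Qed.

Lemma derive_lipschitz (x y : R) : `|psi x - psi y| <= H * `|x - y|.
Proof.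
wlog xy : x y / x <= y.
  move=> W; case: (leP x y) => [|/ltW]; first exact: W.
  by rewrite distrC (distrC x); exact: W.
have [z _] := @MVT_segment R psi h x y xy (fun z _ => dpsi z) (continuous_subspaceT cpsi).
by rewrite distrC (distrC x) => ->; rewrite normrM ler_wpM2r.
Qed.

Variable tau : R.
Hypothesis tau0 : 0 < tau.

Let D x := psi (x + tau) - psi x.

Let cD : continuous D.
Proof.
move=> x; apply: cvgB; last exact: cpsi.
apply: (@continuous_comp _ _ _ (fun x => x + tau) psi); last exact: cpsi.
by apply: cvgD; [exact: cvg_id|exact: cvg_cst].
Qed.

Let DP x : `|D x| <= 2 * Psi.
Proof.
apply: (le_trans (ler_normB _ _)); have := psiH (x + tau); have := psiH x; lra.
Qed.

Lemma filtered_increment (k : R -> R) x : continuous k -> rint mu setT k ->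
  \int[mu]_(y in `[x, x + tau]) filtered k h y = \int[mu]_r (k r * D (x - r)).
Proof.
move=> ck ik.
have cF : continuous (fun z : R * R => k z.2 * h (z.1 - z.2)).
  by apply: (jcontM (jcont_snd ck) (jcont_diff ch)).
have iF y : rint mu setT (fun s => k (y - s) * h s).
  apply: (rint_le measurableT _ (rintZr measurableT H (rint_norm (rint_reflect y ik)))).
    apply: continuous_measurable_fun; exact: (cont2_1 (jcontM (jcont_diff ck) (jcont_snd ch)) (x := y)).
  by move=> s _; rewrite normrM ler_wpM2l.
have E y : filtered k h y = \int[mu]_r (k r * h (y - r)).
  have := Rintegral_reflect y (iF y).
  by rewrite -/(filtered k h y) => <-; apply: eq_Rintegral => s _; rewrite subKr.
under eq_Rintegral do rewrite E.
have := @Rfubini R _ _ _ _ mu mu `[x, x + tau] setT (fun y r => k r * h (y - r)) (cst H) (fun r => `|k r|)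
  (measurable_itv _) measurableT (measurable_cont2 cF) (rint_cst H _ _) (rint_norm ik) _.
move=> -[y r _ _|_ ->].
  by rewrite normrM mulrC ler_wpM2r.
apply: eq_Rintegral => r _; rewrite (@RintegralZl _ _ _ mu)//; last first.
  exact/rint_itv/(cont2_2 (F := fun y r => h (y - r)))/jcont_diff.
congr (_ * _); rewrite /D.
rewrite (_ : x - r + tau = x + tau - r); last by ring.
apply: (@FTC2_itv R (fun y => psi (y - r)) (fun y => h (y - r))).
- by rewrite lerDl ltW.
- exact: (cont2_2 (F := fun y r => h (y - r)) (y := r) (jcont_diff ch)).
- by move=> y _; exact: is_derive_shift.
- exact: (cont2_2 (F := fun y r => psi (y - r)) (y := r) (jcont_diff cpsi)).
Qed.

Let i1 : rint mu setT (vp 1 : R -> R). Proof. exact: rint_vp. Qed.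
Let c1 : continuous (vp 1 : R -> R). Proof. exact: continuous_vp. Qed.

Let ivD (k : R) (f : R -> R) (x M : R) : continuous f -> (forall x, `|f x| <= M) ->
  rint mu setT (fun u => vp 1 u * f (x - u / k)).
Proof.
move=> cf fM.
apply: (rint_le measurableT _ (rintZr measurableT M (rint_norm i1))).
  have cfk := cont_comp cf (@cont_affine x (- k^-1)).
  apply: continuous_measurable_fun => u; apply: cvgM; first exact: c1.
  by under eq_fun do rewrite -mulrN; rewrite -mulrN; exact: cfk.
by move=> u _; rewrite normrM ler_wpM2l.
Qed.

Lemma vp_rescale a x : 0 < a ->
  \int[mu]_r (vp a r * D (x - r)) = \int[mu]_u (vp 1 u * D (x - u / a)).
Proof.
move=> a0.
rewrite (Rintegral_affine 0 (lt0r_neq0 a0) (ivD a x cD DP)) gtr0_norm//.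
rewrite -(RintegralZl _ measurableT (rint_affine 0 (lt0r_neq0 a0) (ivD a x cD DP))).
apply: eq_Rintegral => r _; rewrite vp_scale// addr0 mulrA; congr (_ * D (_ - _)).
by rewrite mulrC mulrA mulVf ?mul1r// gt_eqF.
Qed.

(** High frequencies: as its bandwidth grows, the kernel concentrates. *)
Lemma vp_high (e : R) : 0 < e -> exists2 b0, 0 < b0 & forall b x, b0 <= b ->
  `|\int[mu]_r (vp b r * D (x - r)) - fejer_mass R * D x| <= e.
Proof.
move=> e0.
pose N := \int[mu]_u `|vp 1 (u : R)|.
have N0 : 0 <= N by apply: Rintegral_ge0 => u _; exact: normr_ge0.
have e1 : 0 < e / (8 * Psi) by rewrite divr_gt0// mulr_gt0.
have [M M0 MP] := tail_small i1 e1.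
pose b0 := 4 * H * M * (N + 1) / e.
have b00 : 0 < b0 by rewrite divr_gt0// !mulr_gt0// ltr_wpDl.
exists b0 => // b x bb; have bp : 0 < b by exact: lt_le_trans bb.
rewrite vp_rescale// -(@Rintegral_vp R 1)// -(RintegralZr _ measurableT i1).
rewrite -(RintegralB measurableT (ivD b x cD DP) (rintZr measurableT _ i1)).
pose A : set R := [set u | M <= `|u|].
have mA : measurable A.
  rewrite (_ : A = (fun u : R => `|u|) @^-1` `[M, +oo[); last by apply/seteqP; split => u /=; rewrite in_itv/= andbT.
  rewrite -[X in measurable X]setTI; apply: continuous_measurable_fun => //.
  exact: norm_continuous.
have iA : rint mu setT ((fun u => `|vp 1 u|) \_ A).
  by apply: (rint_restrict mu mA _).1; apply: rintS (rint_norm i1).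
pose g u := 2 * H * M / b * `|vp 1 u| + 4 * Psi * ((fun u => `|vp 1 u|) \_ A) u.
have ig : rint mu setT g.
  by apply: (rintD measurableT); apply: (rintZ measurableT) => //; exact: rint_norm.
have If := rintB measurableT (ivD b x cD DP) (rintZr measurableT (D x) i1).
have bnd (u : R) : setT u -> `|vp 1 u * D (x - u / b) - vp 1 u * D x| <= g u.
  move=> _; rewrite -mulrBr normrM /g /patch; case: ifPn => [|].
    move=> _; apply: (@le_trans _ _ (4 * Psi * `|vp 1 u|)).
      rewrite mulrC ler_wpM2r// (le_trans (ler_normB _ _))//.
      by have := DP (x - u / b); have := DP x; lra.
    rewrite lerDr mulr_ge0// divr_ge0 ?(ltW bp)// !mulr_ge0// ltW//.
  rewrite notin_setE/= => /negP; rewrite -ltNge => uM.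
  rewrite [leRHS](_ : _ = 2 * H * M / b * `|vp 1 u|); last first.
    by rewrite /point/= mulr0 addr0.
  rewrite mulrC ler_wpM2r//.
  rewrite (_ : D _ - D x = (psi (x - u / b + tau) - psi (x + tau)) +
    (psi x - psi (x - u / b))); last by rewrite /D; ring.
  apply: (@le_trans _ _ (H * `|u / b| + H * `|u / b|)).
    apply: (le_trans (ler_normD _ _)); apply: lerD.
      apply: le_trans (derive_lipschitz _ _) _; rewrite ler_wpM2l ?(ltW H0)//.
      by rewrite le_eqVlt -[X in X == _]normrN; apply/orP; left; apply/eqP; congr `|_|; ring.
    apply: le_trans (derive_lipschitz _ _) _; rewrite ler_wpM2l ?(ltW H0)//.
    by rewrite le_eqVlt; apply/orP; left; apply/eqP; congr `|_|; ring.
  rewrite normrM normfV (gtr0_norm bp).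
  rewrite (_ : _ + _ = 2 * H * `|u| / b); last by ring.
  by rewrite ler_pM2r ?invr_gt0// ler_pM2l ?mulr_gt0// ltW.
apply: (le_trans (Rintegral_norm_le measurableT If ig bnd)).
rewrite /g (RintegralD measurableT (rintZ measurableT _ (rint_norm i1)) (rintZ measurableT _ iA)).
rewrite (RintegralZl _ measurableT (rint_norm i1)) (RintegralZl _ measurableT iA) -/N.
rewrite -Rintegral_mkcond.
have t1 := MP A mA (fun u h => h).
have t2 : 4 * Psi * \int[mu]_(u in A) `|vp 1 u| <= e / 2.
  rewrite (_ : e / 2 = 4 * Psi * (e / (8 * Psi))); last by field; rewrite gt_eqF.
  by rewrite ler_pM2l// mulr_gt0.
rewrite [leRHS](splitr e) lerD//.
rewrite mulrAC ler_pdivrMr// -ler_pdivrMl ?divr_gt0//.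
apply: le_trans bb; rewrite invf_div /b0.
rewrite (_ : 4 * H * M * (N + 1) / e = 2 / e * (2 * H * M * (N + 1))); last by ring.
rewrite ler_pM2l ?divr_gt0// ler_pM2l ?mulr_gt0//.
by rewrite lerDl.
Qed.

(** Low frequencies: the derivative of a bounded function carries few of them. *)
Lemma vp_low (e : R) : 0 < e -> exists2 a0, 0 < a0 & forall a x, 0 < a -> a <= a0 ->
  `|\int[mu]_r (vp a r * D (x - r))| <= e.
Proof.
move=> e0.
pose eta s := \int[mu]_u `|vp 1 (u + s) - vp 1 (u : R)|.
have id s : rint mu setT (fun u => `|vp 1 (u + s) - vp 1 u|).
  by apply: rint_norm; apply: (rintB measurableT) => //; exact: rint_shift.
pose G (u : R) : R := 80 * (1 + u ^+ 2)^-1.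
have ceta : {for 0, continuous eta}.
  have := @continuity_under_integral R _ _ mu (fun s u => `|vp 1 (u + s) - vp 1 u|) setT measurableT
    (-1) 1 (fun s _ => id s) (aeW _ (fun y _ x _ => _)) G (rintZ measurableT 80 (@rint_oneDsqrV R)).
  move=> F; apply: (F _ _ 0).
  - move=> u s; apply: cvg_norm; apply: cvgB; last exact: cvg_cst.
    apply: (@continuous_comp _ _ _ (fun s => u + s) (vp 1)); last exact: c1.
    by apply: cvgD; [exact: cvg_cst|exact: cvg_id].
  - move=> s; rewrite /= in_itv/= => /andP[s1 s2]; apply: aeW => u _.
    rewrite normr_id (le_trans (ler_normB _ _))//.
    have h1 := vp1_decay u; have h2 := vp1_decay (u + s).
    have h3 := @shift_oneDsqr u s s1 s2.
    rewrite /G (_ : 80 * _ = 60 / (1 + u ^+ 2) + 20 / (1 + u ^+ 2)); last by ring.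
    by apply: lerD => //; exact: le_trans h3.
  - by rewrite inE/= in_itv/= ltr01 oppr_lt0 ltr01.
have eta0 : eta 0 = 0.
  rewrite /eta; under eq_Rintegral do rewrite addr0 subrr normr0.
  by rewrite /Rintegral integral0.
have e1 : 0 < e / Psi by rewrite divr_gt0.
move/cvgrPdist_le/(_ _ e1) : ceta => /nbhs_ballP[d /= d0 dP].
exists (d / (2 * tau)); first by rewrite divr_gt0// mulr_gt0.
move=> a x a0 ad; rewrite vp_rescale//.
have ip (y : R) := ivD a y cpsi psiH.
have E : \int[mu]_u (vp 1 u * D (x - u / a)) =
    \int[mu]_u ((vp 1 (u + a * tau) - vp 1 u) * psi (x - u / a)).
  transitivity (\int[mu]_u (vp 1 u * psi (x + tau - u / a)) - \int[mu]_u (vp 1 u * psi (x - u / a))).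
    rewrite -(RintegralB measurableT (ip _) (ip _)); apply: eq_Rintegral => u _.
    by rewrite /D mulrBr addrAC.
  rewrite -(Rintegral_shift (a * tau) (ip _)).
  rewrite -(RintegralB measurableT (rint_shift _ (ip _)) (ip _)); apply: eq_Rintegral => u _.
  have -> : x + tau - (u + a * tau) / a = x - u / a by field; rewrite gt_eqF.
  by apply/esym; exact: mulrBl.
have ig := rintZr measurableT Psi (id (a * tau)).
have If : rint mu setT (fun u => (vp 1 (u + a * tau) - vp 1 u) * psi (x - u / a)).
  apply: (rint_le measurableT _ (rintZr measurableT Psi (id (a * tau)))).
    apply: continuous_measurable_fun => u; apply: cvgM.
      apply: cvgB; last exact: c1.
      apply: (@continuous_comp _ _ _ (fun u => u + a * tau) (vp 1)); last exact: c1.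
      by apply: cvgD; [exact: cvg_id|exact: cvg_cst].
    have cfk := cont_comp cpsi (@cont_affine x (- a^-1)).
    by under eq_fun do rewrite -mulrN; rewrite -mulrN; exact: cfk.
  by move=> u _; rewrite normrM ler_wpM2l.
have bnd (u : R) : setT u -> `|(vp 1 (u + a * tau) - vp 1 u) * psi (x - u / a)| <=
    `|vp 1 (u + a * tau) - vp 1 u| * Psi.
  by move=> _; rewrite normrM ler_wpM2l.
rewrite E; apply: (le_trans (Rintegral_norm_le measurableT If ig bnd)).
rewrite (RintegralZr _ measurableT (id _)) -/(eta (a * tau)) -ler_pdivlMr//.
have ats : ball (0 : R) d (a * tau).
  rewrite /ball/= sub0r normrN gtr0_norm ?mulr_gt0//.
  apply: (@le_lt_trans _ _ (d / (2 * tau) * tau)); first by rewrite ler_pM2r.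
  rewrite (_ : d / (2 * tau) * tau = d / 2); last by field; rewrite gt_eqF.
  lra.
have := dP _ ats; rewrite /= eta0 sub0r normrN; exact: le_trans (ler_norm _).
Qed.

Variables (P : R -> R) (C0 : R).
Hypothesis cP : continuous P.
Hypothesis iP : rint mu setT P.
Hypothesis P_sin : forall w, sintrans P w = 0.
Hypothesis P_cos : forall w, costrans P w <= 0.
Hypothesis P_cos0 : forall w, w != 0 -> costrans P w != 0.
Hypothesis dissip : forall T, 0 <= T ->
  dint T (fun t s => - P (t - s) * (h t * h s)) <= C0.

(** Bounded dissipation forces the increments of psi to vanish: the part of
its derivative in any frequency band away from 0 is square integrable, the
high frequencies are negligible because psi is Lipschitz, and the low ones
because psi is bounded. *)
Lemma increment_vanish (e : R) : 0 < e ->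
  exists X, forall x, X <= x -> `|psi (x + tau) - psi x| <= e.
Proof.
move=> e0; pose m := fejer_mass R; have m0 : 0 < m by exact: fejer_mass_gt0.
have e1 : 0 < m * e / 3 by rewrite divr_gt0// mulr_gt0.
(* b disposes of the high frequencies and a of the low ones, with one third of
the error each. *)
have [b b0 bP] := vp_high e1; have [a1 a10 a1P] := vp_low e1.
pose a := Num.min a1 (b / 2).
have a0 : 0 < a by rewrite lt_min a10 divr_gt0.
have ab : 2 * a <= b.
  have ab2 : a <= b / 2 by rewrite ge_min lexx orbT.
  lra.
have aa : a <= a1 by rewrite ge_min lexx.
pose phi t := vp b t - vp a t.
have phiE : phi = cosint (bandpass_weight a b) (2 * b).
  by apply/funext => t; exact: bandpassE.
have cphi : continuous phi.
  by move=> t; apply: cvgB; exact: continuous_vp.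
have bw0 w : 0 <= w -> 0 <= bandpass_weight a b w by exact: bandpass_ge0.
have pphi : pdk phi.
  rewrite phiE; apply: pdk_cosint; [lra|exact: continuous_bandpass|].
  by move=> w /andP[w0 _]; exact: bw0.
have a2b : a <= 2 * b by lra.
have [K K0 pK] := pdk_spectral_dominates cP iP P_sin P_cos P_cos0 a0 a2b
  (@continuous_bandpass R a b) bw0 (fun w h => bandpass_low a0 ab h) (fun w h => bandpass_high a0 ab h).
rewrite -phiE in pK.
have pe t : phi (- t) = phi t by rewrite /phi !vp_even.
pose c := 20 * (b + b^-1) + 20 * (a + a^-1).
have c0 : 0 < c by rewrite addr_gt0// mulr_gt0// addr_gt0// invr_gt0.
have pd t : `|phi t| <= c / (1 + t ^+ 2).
  rewrite /phi /c mulrDl (le_trans (ler_normB _ _))//.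
  by rewrite lerD// vp_decay.
have [X X1 XP] := filtered_window cP cphi ch pe c0 pd pphi K0 pK H0 hH dissip e1 tau0.
exists X => x Xx; have := XP x Xx.
have ib := rint_vp b0; have ia := rint_vp a0.
have cvb := continuous_vp b0; have cva := continuous_vp a0.
rewrite filtered_increment//; last exact: (rintB measurableT).
have iD (k : R -> R) : continuous k -> rint mu setT k -> rint mu setT (fun r => k r * D (x - r)).
  move=> ck ik; apply: (rint_le measurableT _ (rintZr measurableT (2 * Psi) (rint_norm ik))).
    apply: continuous_measurable_fun => u; apply: cvgM; first exact: ck.
    apply: (@continuous_comp _ _ _ (fun u => x - u) D); last exact: cD.
    by apply: cvgB; [exact: cvg_cst|exact: cvg_id].
  by move=> u _; rewrite normrM ler_wpM2l.
have -> : \int[mu]_r (phi r * D (x - r)) =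
    \int[mu]_r (vp b r * D (x - r)) - \int[mu]_r (vp a r * D (x - r)).
  rewrite -(RintegralB measurableT (iD _ cvb ib) (iD _ cva ia)).
  by apply: eq_Rintegral => r _; rewrite mulrBl.
have hb := bP b x (lexx _); have ha := a1P a x a0 aa.
move=> hc; rewrite -/(D x) -(ler_pM2l m0) -{1}(gtr0_norm m0) -normrM.
move: hb ha hc; rewrite -/m !ler_norml.
move: (\int[mu]_r (vp b r * _)) (\int[mu]_r (vp a r * _)) => y z.
move=> /andP[h1 h2] /andP[h3 h4] /andP[h5 h6]; apply/andP; split; lra.
Qed.

End tauberian.

(** * Continuity and integration in several variables *)

Section rV_topology.
Context {R : realType}.

Section continuity.
Context (T : topologicalType).
Implicit Types f g : T -> R.

Lemma contD f g : continuous f -> continuous g -> continuous (fun x => f x + g x).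
Proof. by move=> cf cg x; apply: cvgD; [exact: cf|exact: cg]. Qed.

Lemma contB f g : continuous f -> continuous g -> continuous (fun x => f x - g x).
Proof. by move=> cf cg x; apply: cvgB; [exact: cf|exact: cg]. Qed.

Lemma contM f g : continuous f -> continuous g -> continuous (fun x => f x * g x).
Proof. by move=> cf cg x; apply: cvgM; [exact: cf|exact: cg]. Qed.

Lemma contN f : continuous f -> continuous (fun x => - f x).
Proof. by move=> cf x; apply: cvgN; exact: cf. Qed.

Lemma contV f : (forall x, f x != 0) -> continuous f -> continuous (fun x => (f x)^-1).
Proof. by move=> f0 cf x; apply: cvgV; [exact: f0|exact: cf]. Qed.

Lemma contcst (k : R) : continuous (fun _ : T => k).
Proof. exact: cst_continuous. Qed.

Lemma contcomp (U V : topologicalType) (h : U -> V) (k : T -> U) :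
  continuous h -> continuous k -> continuous (fun x => h (k x)).
Proof. by move=> ch ck x; apply: continuous_comp; [exact: ck|exact: ch]. Qed.

Lemma continuous_sum (I : finType) (F : I -> T -> R) :
  (forall i, continuous (F i)) -> continuous (fun x => \sum_i F i x).
Proof.
move=> cF; elim: (index_enum I) => [|i s IH].
  by under eq_fun do rewrite big_nil; exact: contcst.
by under eq_fun do rewrite big_cons; exact: contD.
Qed.

Lemma continuous_prod (I : finType) (F : I -> T -> R) :
  (forall i, continuous (F i)) -> continuous (fun x => \prod_i F i x).
Proof.
move=> cF; elim: (index_enum I) => [|i s IH].
  by under eq_fun do rewrite big_nil; exact: contcst.
by under eq_fun do rewrite big_cons; exact: contM.
Qed.

End continuity.

Lemma coord_le_norm n (x : 'rV[R]_n) i : `|x 0 i| <= `|x|.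
Proof.
rewrite [leRHS]/Num.norm /= mx_normrE; apply/bigmax_geP; right => /=.
by exists (0, i).
Qed.

Lemma norm_le_coord n (x : 'rV[R]_n) r : 0 <= r ->
  (forall i, `|x 0 i| <= r) -> `|x| <= r.
Proof.
move=> r0 xr; rewrite [leLHS]/Num.norm /= mx_normrE; apply/bigmax_leP; split => //.
by move=> [i j] _ /=; rewrite (ord1 i).
Qed.

Lemma dotrr_ge0 n (x : 'rV[R]_n) : 0 <= dotr x x.
Proof. by apply: sumr_ge0 => i _; rewrite -expr2 sqr_ge0. Qed.

Lemma enorm_ge0 n (x : 'rV[R]_n) : 0 <= enorm x. Proof. exact: sqrtr_ge0. Qed.

Lemma enorm_sqr n (x : 'rV[R]_n) : enorm x ^+ 2 = dotr x x.
Proof. by rewrite sqr_sqrtr// dotrr_ge0. Qed.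

Lemma coord_le_enorm n (x : 'rV[R]_n) i : `|x 0 i| <= enorm x.
Proof.
rewrite -(@ler_pXn2r _ 2) ?nnegrE ?enorm_ge0// enorm_sqr /dotr (bigD1 i)//=.
rewrite real_normK ?num_real// expr2 lerDl sumr_ge0// => j _.
by rewrite -expr2 sqr_ge0.
Qed.

Lemma dotr_le n (x y : 'rV[R]_n) : `|dotr x y| <= n%:R * (`|x| * `|y|).
Proof.
apply: (le_trans (ler_norm_sum _ _ _)).
apply: (@le_trans _ _ (\sum_(i < n) `|x| * `|y|)).
  by apply: ler_sum => i _; rewrite normrM ler_pM// coord_le_norm.
by rewrite sumr_const card_ord mulr_natl.
Qed.

Lemma enorm_le_norm n (x : 'rV[R]_n) : enorm x <= n%:R * `|x|.
Proof.
rewrite -(@ler_pXn2r _ 2) ?nnegrE ?enorm_ge0// ?mulr_ge0//.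
rewrite enorm_sqr (le_trans (ler_norm _))// (le_trans (dotr_le _ _))//.
rewrite exprMn -expr2 ler_wpM2r ?sqr_ge0//.
by rewrite -natrX ler_nat; case: n {x} => // n; rewrite leq_pmulr.
Qed.

Lemma cvg_rV (T : Type) (F : set_system T) {FF : Filter F} n
    (f : T -> 'rV[R]_n) (l : 'rV[R]_n) :
  (forall i, f t 0 i @[t --> F] --> l 0 i) -> f t @[t --> F] --> l.
Proof.
move=> fl; apply/cvgrPdist_le => e e0.
have : \forall t \near F, forall i, `|l 0 i - f t 0 i| <= e.
  by apply: filter_forall => i; move/cvgrPdist_le : (fl i); exact.
apply: filterS => t te; apply: norm_le_coord => [|i]; first exact: ltW.
by rewrite !mxE.
Qed.

Lemma cvg_coord (T : Type) (F : set_system T) {FF : Filter F} n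
    (f : T -> 'rV[R]_n) (l : 'rV[R]_n) i :
  f t @[t --> F] --> l -> f t 0 i @[t --> F] --> l 0 i.
Proof.
by move=> fl; have := cvg_comp _ _ fl (@coord_continuous R 1 n 0 i l).
Qed.

Lemma continuous_rV (T : topologicalType) n (f : T -> 'rV[R]_n) :
  (forall i, continuous (fun t => f t 0 i)) -> continuous f.
Proof. by move=> cf t; apply: cvg_rV => i; exact: cf. Qed.

Lemma continuous_coord n i : continuous (fun x : 'rV[R]_n => x 0 i).
Proof. exact: coord_continuous. Qed.

Lemma continuous_addr n (c : 'rV[R]_n) : continuous (fun x : 'rV[R]_n => x + c).
Proof.
apply: continuous_rV => i; under eq_fun do rewrite mxE.
by apply: contD; [exact: continuous_coord|exact: contcst].
Qed.

(** Rounding each coordinate exhibits a continuous function as a limit of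
functions with countably many measurable level sets. *)
Lemma measurable_rV n (f : 'rV[R]_n -> R) : continuous f -> measurable_fun setT f.
Proof.
move=> cf; pose r (k : nat) (x : 'rV[R]_n) : 'rV[int]_n := \row_i Num.floor (x 0 i * k.+1%:R).
pose g (k : nat) (z : 'rV[int]_n) : R := f (\row_i ((z 0 i)%:~R / k.+1%:R)).
apply: (@measurable_fun_countable_approx _ _ _ f (fun=> 'rV[int]_n) r g).
- move=> k z; rewrite (_ : _ @^-1` _ = \bigcap_(i in [set: 'I_n])
      ((fun x : 'rV[R]_n => Num.floor (x 0 i * k.+1%:R)) @^-1` [set z 0 i])).
    apply: fin_bigcap_measurable => // i _.
    exact: measurable_floor_fiber (measurable_coord i).
  apply/seteqP; split => [x /= <- i _|x /= h]; first by rewrite mxE.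
  by apply/rowP => i; rewrite mxE; exact: h.
- move=> x; rewrite /g /r.
  have : (fun k : nat => \row_i (((\row_j Num.floor (x 0 j * k.+1%:R) : 'rV[int]_n) 0 i)%:~R / k.+1%:R) : 'rV[R]_n)
      @ \oo --> (x : 'rV[R]_n).
    apply: cvg_rV => i; under eq_fun do rewrite !mxE; exact: round_cvg.
  by move=> h; apply: cvg_comp h _; exact: cf.
Qed.

End rV_topology.

Section rV_integral.
Context {R : realType}.
Notation mu := (@lebesgue_measure R).
Notation leb := (@lebesgue_rV R).

Lemma rV_consE0 n (a : R) (x : 'rV[R]_n) : rV_cons (a, x) 0 ord0 = a.
Proof. by have [] := congr1 fst (rV_consK ((a : measurableTypeR R), x)). Qed.

Lemma rV_consES n (a : R) (x : 'rV[R]_n) i : rV_cons (a, x) 0 (lift ord0 i) = x 0 i.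
Proof.
have /(congr1 snd)/= /rowP/(_ i) := rV_consK ((a : measurableTypeR R), x).
by rewrite mxE.
Qed.

Lemma rV_consD n (a b : R) (x y : 'rV[R]_n) :
  rV_cons (a, x) + rV_cons (b, y) = rV_cons (a + b, x + y).
Proof.
apply/rowP => i; rewrite mxE; case: (unliftP ord0 i) => [j|] ->.
  by rewrite !rV_consES mxE.
by rewrite !rV_consE0.
Qed.

Lemma rV_consP n (x : 'rV[R]_n.+1) : exists (a : R) y, x = rV_cons (a, y).
Proof.
exists (x 0 ord0), (\row_i x 0 (lift ord0 i)); apply/rowP => i.
case: (unliftP ord0 i) => [j|] ->; last by rewrite rV_consE0.
by rewrite rV_consES mxE.
Qed.

Lemma continuous_rV_cons n : continuous (fun z : R * 'rV[R]_n => rV_cons (z.1, z.2)).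
Proof.
apply: continuous_rV => i; case: (unliftP ord0 i) => [j|] ->.
  under eq_fun do rewrite rV_consES.
  move=> z; apply: (@continuous_comp _ _ _ snd (fun x : 'rV[R]_n => x 0 j)).
    exact: cvg_snd.
  exact: continuous_coord.
under eq_fun do rewrite rV_consE0; move=> z; exact: cvg_fst.
Qed.

Lemma continuous_cons2 n (f : 'rV[R]_n.+1 -> R) (a : R) : continuous f ->
  continuous (fun x => f (rV_cons (a, x))).
Proof.
move=> cf; apply: (contcomp cf); apply: (contcomp (@continuous_rV_cons n) (k := fun x => (a, x))).
by move=> x; apply: cont_pair; [exact: cst_continuous|exact: cvg_id].
Qed.

(** Tonelli, one coordinate at a time. *)
Lemma rint_cons n (f : 'rV[R]_n.+1 -> R) (u : R -> R) (w : 'rV[R]_n -> R) :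
  measurable_fun setT f -> rint mu setT u -> rint (leb n) setT w ->
  (forall a x, `|f (rV_cons (a, x))| <= u a * w x) ->
  (forall a, 0 <= u a) -> (forall x, 0 <= w x) ->
  [/\ rint (leb n.+1) setT f,
      rint mu setT (fun a => \int[leb n]_x f (rV_cons (a, x))) &
      \int[leb n.+1]_x f x = \int[mu]_a \int[leb n]_x f (rV_cons (a, x))].
Proof.
move=> mf iu iw fuw u0 w0.
have mfc : measurable_fun setT (fun z => f (rV_cons z)).
  by apply: measurableT_comp mf (@measurable_rV_cons R n).
have iG := @rint_product R _ _ _ _ mu (leb n) (fun z => f (rV_cons z)) u w mfc iu iw u0 w0 fuw.
have mfe : measurable_fun setT (EFin \o f) by exact/measurable_EFinP.
have iF : rint (leb n.+1) setT f.
  exact: (integrable_pushforward (@measurable_rV_cons R n) mfe iG measurableT).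
have [iI _] := @Rfubini R _ _ _ _ mu (leb n) setT setT (fun a x => f (rV_cons (a, x))) u w
  measurableT measurableT (eq_measurable_fun _ (fun _ _ => erefl) mfc) iu iw (fun a x _ _ => fuw a x).
split => //.
rewrite /Rintegral.
rewrite (integral_pushforward (@measurable_rV_cons R n) mfe iG measurableT).
rewrite preimage_setT -integral12_prod_meas1//; congr fine.
apply: eq_integral => a _; rewrite /fubini_F fineK//.
apply: integrable_fin_num => //.
apply: (@rint_le _ _ _ _ _ measurableT (fun x => f (rV_cons (a, x))) (fun x => u a * w x)).
- exact: (measurableT_comp mfc (pair1_measurable (a : measurableTypeR R))).
- exact: rintZ.
- by move=> x _; exact: fuw.
Qed.

Lemma integral_rV0 (f : 'rV[R]_0 -> R) : measurable_fun setT f ->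
  rint (leb 0) setT f /\ \int[leb 0]_x f x = f 0.
Proof.
move=> mf; split.
  apply/integrableP; split; first exact/measurable_EFinP.
  rewrite integral_dirac//; last exact/measurableT_comp/measurable_EFinP.
  by rewrite diracT mul1e ltry.
by rewrite /Rintegral integral_dirac ?diracT ?mul1e//; exact/measurable_EFinP.
Qed.

Lemma rV0E (x : 'rV[R]_0) : x = 0.
Proof. by apply/rowP => -[]. Qed.

(** A majorant of every function decaying like a Schwartz function; as a product
of functions of one variable, it makes iterated integrals converge. *)
Definition cauchyw n (x : 'rV[R]_n) : R := \prod_i (1 + x 0 i ^+ 2)^-1.

Lemma cauchyw_cons n (a : R) (x : 'rV[R]_n) :
  cauchyw (rV_cons (a, x)) = (1 + a ^+ 2)^-1 * cauchyw x.
Proof.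
rewrite /cauchyw big_ord_recl rV_consE0; congr (_ * _).
by apply: eq_bigr => i _; rewrite rV_consES.
Qed.

Lemma oneDsqr_gt0 (a : R) : 0 < 1 + a ^+ 2.
Proof. by rewrite ltr_pwDl// sqr_ge0. Qed.

Lemma cauchyw_gt0 n (x : 'rV[R]_n) : 0 < cauchyw x.
Proof. by apply: prodr_gt0 => i _; rewrite invr_gt0 oneDsqr_gt0. Qed.

Lemma continuous_cauchyw n : continuous (@cauchyw n).
Proof.
apply: continuous_prod => i; apply: contV => [x|]; first by rewrite gt_eqF// oneDsqr_gt0.
by apply: contD; [exact: contcst|apply: contM; exact: continuous_coord].
Qed.

Lemma rint_cauchyw n : rint (leb n) setT (@cauchyw n).
Proof.
elim: n => [|n IH]; first exact: (integral_rV0 (measurable_rV (@continuous_cauchyw 0))).1.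
have [] // := rint_cons (measurable_rV (@continuous_cauchyw n.+1)) (@rint_oneDsqrV R) IH.
- by move=> a x; rewrite cauchyw_cons ger0_norm// mulr_ge0// ?invr_ge0 ltW// ?oneDsqr_gt0 ?cauchyw_gt0.
- by move=> a; rewrite invr_ge0 ltW// oneDsqr_gt0.
- by move=> x; rewrite ltW// cauchyw_gt0.
Qed.

Lemma rint_rV n (f : 'rV[R]_n -> R) (C : R) : continuous f ->
  (forall x, `|f x| <= C * cauchyw x) -> rint (leb n) setT f.
Proof.
move=> cf fC; apply: (rint_le measurableT (measurable_rV cf) (rintZ measurableT C (rint_cauchyw n))).
by move=> x _; exact: fC.
Qed.

Lemma rV_dominated_ge0 n (f : 'rV[R]_n -> R) (C : R) :
  (forall x, `|f x| <= C * cauchyw x) -> 0 <= C.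
Proof.
move=> /(_ 0) h; have := le_trans (normr_ge0 _) h.
by rewrite pmulr_lge0// cauchyw_gt0.
Qed.

Lemma Rintegral_cons n (f : 'rV[R]_n.+1 -> R) (C : R) : continuous f ->
  (forall x, `|f x| <= C * cauchyw x) ->
  \int[leb n.+1]_x f x = \int[mu]_a \int[leb n]_x f (rV_cons (a, x)).
Proof.
move=> cf fC; have C0 := rV_dominated_ge0 fC.
have [] // := @rint_cons n f (fun a => C * (1 + a ^+ 2)^-1) (@cauchyw n) (measurable_rV cf).
- exact: (rintZ measurableT C (@rint_oneDsqrV R)).
- exact: rint_cauchyw.
- by move=> a x; rewrite -mulrA -cauchyw_cons.
- by move=> a; rewrite mulr_ge0// invr_ge0 ltW// oneDsqr_gt0.
- by move=> x; rewrite ltW// cauchyw_gt0.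
Qed.

Lemma continuous_affine n (k : R) (c : 'rV[R]_n) : continuous (fun x : 'rV[R]_n => k *: x + c).
Proof.
apply: continuous_rV => i; under eq_fun do rewrite !mxE.
by apply: contD; [apply: contM; [exact: contcst|exact: continuous_coord]|exact: contcst].
Qed.

Lemma rV_affine n (f : 'rV[R]_n -> R) (C k : R) (c : 'rV[R]_n) : 0 < k -> continuous f ->
  (forall x, `|f x| <= C * cauchyw x) ->
  rint (leb n) setT (fun x => f (k *: x + c)) /\
  k ^+ n * \int[leb n]_x f (k *: x + c) = \int[leb n]_x f x.
Proof.
move=> k0; elim: n f C c => [|n IH] f C c cf fC; have C0 := rV_dominated_ge0 fC.
  have E : (fun x : 'rV[R]_0 => f (k *: x + c)) = f.
    by apply/funext => x; rewrite (rV0E (_ + c)) (rV0E x).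
  by rewrite E mul1r; split => //; exact: rint_rV fC.
have [b [d cE]] := rV_consP c.
have cfc : continuous (fun x : 'rV[R]_n.+1 => f (k *: x + c)).
  exact: (contcomp cf (@continuous_affine _ k c)).
pose w (a : R) := (1 + a ^+ 2)^-1.
have w0 (a : R) : 0 <= w a by rewrite invr_ge0 ltW// oneDsqr_gt0.
have W0 (x : 'rV[R]_n) : 0 <= cauchyw x by rewrite ltW// cauchyw_gt0.
have fcons (a : R) x : `|f (rV_cons (a, x))| <= C * w a * cauchyw x.
  by rewrite -mulrA -cauchyw_cons.
have k0' : k != 0 by rewrite gt_eqF.
have consE (a : R) x : k *: rV_cons (a, x) + c = rV_cons (k * a + b, k *: x + d).
  rewrite cE -rV_consD; congr (_ + _); apply/rowP => i; rewrite mxE.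
  by case: (unliftP ord0 i) => [j|] ->; rewrite ?rV_consES ?rV_consE0// mxE.
have [iW _] := IH (@cauchyw n) 1 d (@continuous_cauchyw n)
  (fun x => eq_ind_r (fun z => z <= _) (lexx _) (etrans (ger0_norm (W0 x)) (esym (mul1r _)))).
have [|||||i1 i2 ->] := @rint_cons n (fun x => f (k *: x + c)) (fun a => C * w (k * a + b))
  (fun x => cauchyw (k *: x + d)) (measurable_rV cfc).
- by apply: (rintZ measurableT); apply: (rint_affine b k0' (@rint_oneDsqrV R)).
- exact: iW.
- by move=> a x; rewrite consE.
- by move=> a; rewrite mulr_ge0.
- by [].
split=> //.
have [_ iF ->] := rint_cons (measurable_rV cf) (rintZ measurableT C (@rint_oneDsqrV R))
  (rint_cauchyw n) fcons (fun a => mulr_ge0 C0 (w0 a)) W0.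
have Ea (a : R) : k ^+ n * \int[leb n]_x f (k *: rV_cons (a, x) + c) =
    \int[leb n]_x f (rV_cons (k * a + b, x)).
  have [_ <-] := IH (fun x => f (rV_cons (k * a + b, x))) (C * w (k * a + b)) d
    (@continuous_cons2 n f (k * a + b) cf) (fcons (k * a + b)).
  by congr (_ * _); apply: eq_Rintegral => x _; rewrite consE.
rewrite (Rintegral_affine b k0' iF) (gtr0_norm k0) exprS -mulrA; congr (_ * _).
by rewrite -(RintegralZl _ measurableT i2); apply: eq_Rintegral => a _; exact: Ea.
Qed.

Lemma rV_translate n (f : 'rV[R]_n -> R) (C : R) (c : 'rV[R]_n) : continuous f ->
  (forall x, `|f x| <= C * cauchyw x) ->
  rint (leb n) setT (fun x => f (x + c)) /\
  \int[leb n]_x f (x + c) = \int[leb n]_x f x.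
Proof.
move=> cf fC; have := rV_affine c (@ltr01 R) cf fC.
rewrite expr1n mul1r (_ : (fun x => f (1 *: x + c)) = (fun x => f (x + c)))//.
by apply/funext => x; rewrite scale1r.
Qed.

Definition box n (x : 'rV[R]_n) (r : R) := [set y : 'rV[R]_n | forall i, `|y 0 i - x 0 i| <= r].

Lemma measurable_box n (x : 'rV[R]_n) r : measurable (box x r).
Proof.
rewrite (_ : box x r = \bigcap_(i in [set: 'I_n])
    ((fun y : 'rV[R]_n => y 0 i) @^-1` `[x 0 i - r, x 0 i + r])).
  apply: fin_bigcap_measurable => // i _; rewrite -[X in measurable X]setTI.
  exact: (measurable_coord i).
by apply/seteqP; split => y /= h i => [_|]; have := h i; rewrite /= in_itv/= ler_distl//; exact.
Qed.

Lemma box_measure_gt0 n (x : 'rV[R]_n) r : 0 < r -> (0 < leb n (box x r))%E.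
Proof.
move=> r0; elim: n x => [|n IH] x.
  rewrite /= diracE (_ : _ \in _ = true) ?lte01//.
  by apply/mem_set => -[].
have [a [y xE]] := rV_consP x.
rewrite /= /lebesgue_rV_step /pushforward.
rewrite (_ : _ @^-1` _ = `[a - r, a + r]%classic `*` box y r); last first.
  apply/seteqP; split => [[b z]|[b z]] /=.
    move=> h; split; first by have := h ord0; rewrite xE !rV_consE0 in_itv/= ler_distl.
    by move=> i; have := h (lift ord0 i); rewrite xE !rV_consES.
  rewrite in_itv/= => -[h1 h2] i; rewrite xE.
  case: (unliftP ord0 i) => [j|] ->; first by rewrite !rV_consES; exact: h2.
  by rewrite !rV_consE0 ler_distl.
rewrite product_measure1E//; last exact: measurable_box.
apply: mule_gt0; last exact: IH.
have := @lebesgue_measure_itv R `[a - r, a + r]; rewrite /= lte_fin ifT => [E|]; last lra.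
rewrite [X in (_ < X)%E]E -EFinB lte_fin; lra.
Qed.

(** A violation at one point would persist in a box, which has positive measure. *)
Lemma continuous_ae_le n (f : 'rV[R]_n -> R) (C : R) : continuous f ->
  {ae leb n, forall x, f x <= C} -> forall x, f x <= C.
Proof.
move=> cf [N [mN N0 fN]] x; apply/negP => /negP; rewrite -ltNge => Cx.
have : \forall y \near x, C < f y by exact: (cf x (fun z => C < z)) (lt_nbhsr Cx).
move=> /nbhs_ballP[r /= r0 xr].
have r20 : 0 < r / 2 by rewrite divr_gt0.
have BN : box x (r / 2) `<=` N.
  move=> y xy; apply: fN => /= h.
  have : C < f y; last by rewrite ltNge h.
  apply: xr; rewrite mx_norm_ball /ball_/=.
  apply: (@le_lt_trans _ _ (r / 2)); last by lra.
  by apply: norm_le_coord => [|i]; [exact: ltW|rewrite !mxE distrC; exact: xy].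
have := box_measure_gt0 x r20; rewrite ltNge => /negP; apply.
by rewrite -N0; apply: le_measure => //; rewrite inE//; exact: measurable_box.
Qed.

End rV_integral.

(** * Partial derivatives *)

Section calculus.
Context {R : realType}.

Lemma eq_fcvg (T : Type) (F : set_system T) (f g : T -> R) (l : R) :
  f =1 g -> f t @[t --> F] --> l -> g t @[t --> F] --> l.
Proof. by move=> /funext ->. Qed.

Lemma is_derive_cvg (V : normedModType R) (f : V -> R) (x v : V) (l : R) :
  h^-1 * (f (x + h *: v) - f x) @[h --> 0^'] --> l -> is_derive x v f l.
Proof.
move=> fl; have fl' : h^-1 *: ((f \o shift x) (h *: v) - f x) @[h --> 0^'] --> l.
  by apply: eq_fcvg fl => h /=; rewrite [x + _]addrC.
by split; [apply: cvgP fl'|apply: cvg_lim fl'].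
Qed.

Lemma is_derive_quotient (V : normedModType R) (f : V -> R) (x v : V) (l : R) :
  is_derive x v f l -> h^-1 * (f (x + h *: v) - f x) @[h --> 0^'] --> l.
Proof.
move=> [df <-]; have : h^-1 *: ((f \o shift x) (h *: v) - f x) @[h --> 0^'] --> 'D_v f x := df.
by apply: eq_fcvg => h /=; rewrite [x + _]addrC.
Qed.

Lemma is_derive_line (V : normedModType R) (f : V -> R) (x v : V) (t l : R) :
  is_derive (x + t *: v) v f l <-> is_derive t (1 : R) (fun t : R => f (x + t *: v)) l.
Proof.
split=> /is_derive_quotient fl; apply: is_derive_cvg; apply: eq_fcvg fl => h /=;
by rewrite scalerDl -addrA [h *: 1]mulr1.
Qed.

Lemma is_derive_line0 (V : normedModType R) (f : V -> R) (x v : V) (l : R) :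
  is_derive 0 (1 : R) (fun t : R => f (x + t *: v)) l -> is_derive x v f l.
Proof. by move=> /is_derive_line; rewrite scale0r addr0. Qed.

Lemma is_derive_continuous (f : R -> R) (x l : R) : is_derive x (1 : R) f l ->
  {for x, continuous f}.
Proof. by case=> df _; apply: differentiable_continuous; apply/derivable1_diffP. Qed.

Section partials.
Context (n : nat).
Notation rV := 'rV[R]_n.
Notation e_ i := (@basis_rV R n i).
Implicit Types (f : rV -> R) (x y : rV).

Lemma basis_rVE i j : (e_ i) 0 j = (j == i)%:R.
Proof. by rewrite mxE eqxx. Qed.

Lemma is_derive_coord i j x : is_derive x (e_ i) (fun x : rV => x 0 j) (j == i)%:R.
Proof.
apply: is_derive_line0; under eq_fun do rewrite mxE mxE basis_rVE.
by apply: is_derive_eq; rewrite add0r; case: eqP => _; rewrite /= ?scaler1 ?scaler0 ?addr0 ?add0r ?mulr1 ?mulr0.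
Qed.

Lemma line_mvt f x i (dl : R) : (forall x, derivable f x (e_ i)) ->
  exists2 th : R, `|th| <= `|dl| &
    f (x + dl *: e_ i) - f x = 'D_(e_ i) f (x + th *: e_ i) * dl.
Proof.
move=> df; pose g (t : R) := f (x + t *: e_ i).
have dg (t : R) : is_derive t (1 : R) g ('D_(e_ i) f (x + t *: e_ i)).
  exact: (is_derive_line f x (e_ i) t _).1 (derivableP (df _)).
have cg : continuous g by move=> t; exact: is_derive_continuous (dg t).
have g0 : g 0 = f x by rewrite /g scale0r addr0.
case: (leP 0 dl) => dl0.
  have [th tI E] := @MVT_segment R g _ 0 dl dl0 (fun z _ => dg z) (continuous_subspaceT cg).
  exists th; last by rewrite -g0 E subr0.
  by move: tI; rewrite in_itv/= => /andP[t0 t1]; rewrite !ger0_norm.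
have [th tI E] := @MVT_segment R g _ dl 0 (ltW dl0) (fun z _ => dg z) (continuous_subspaceT cg).
exists th; last by rewrite -g0 -opprB E sub0r mulrN opprK.
by move: tI; rewrite in_itv/= => /andP[t0 t1]; rewrite !ler0_norm ?lerN2// ltW.
Qed.

(** The increment of a function is resolved along the coordinate directions. *)
Lemma partial_mvt f x y : (forall x i, derivable f x (e_ i)) ->
  exists xi : 'I_n -> rV, (forall i, `|xi i - x| <= `|y - x|) /\
    f y - f x = \sum_i 'D_(e_ i) f (xi i) * (y 0 i - x 0 i).
Proof.
move=> df; pose p (k : nat) : rV := \row_i (if (i < k)%N then y 0 i else x 0 i).
have pS (k : 'I_n) : p k.+1 = p k + (y 0 k - x 0 k) *: e_ k.
  apply/rowP => i; rewrite !mxE ltnS leq_eqVlt.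
  case: (eqVneq i k) => [->|ik] /=; first by rewrite eqxx ltnn /= mulr1 addrC subrK.
  have -> : ((i : nat) == k) = false by apply/negP => /eqP/val_inj/eqP; exact/negP.
  by rewrite mulr0 addr0.
have H (k : 'I_n) : exists xi : rV, `|xi - x| <= `|y - x| /\
    f (p k.+1) - f (p k) = 'D_(e_ k) f xi * (y 0 k - x 0 k).
  have [th th1 E] := line_mvt (p k) (y 0 k - x 0 k) (fun x => df x k).
  exists (p k + th *: e_ k); split; last by rewrite pS.
  apply: norm_le_coord => // i; rewrite !mxE.
  have yx j : `|y 0 j - x 0 j| <= `|y - x|.
    by have := coord_le_norm (y - x) j; rewrite !mxE.
  case: (eqVneq i k) => [->|ik] /=.
    by rewrite ltnn mulr1 addrAC subrr add0r (le_trans th1).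
  by rewrite mulr0 addr0; case: ifP => _; rewrite ?subrr ?normr0.
have [xi xiP] := fin_all_exists H; exists xi; split => [i|]; first by have [] := xiP i.
have -> : y = p n by apply/rowP => i; rewrite mxE ltn_ord.
have <- : p 0 = x by apply/rowP => i; rewrite mxE ltn0.
rewrite -(telescope_sumr (fun k => f (p k)) (leq0n n)) big_mkord.
apply: eq_bigr => i _; have [_ ->] := xiP i.
by rewrite !mxE ltn_ord.
Qed.

Lemma cvg_sumr (T : Type) (F : set_system T) {FF : Filter F} (I : finType)
    (g : I -> T -> R) (l : I -> R) :
  (forall i, g i t @[t --> F] --> l i) -> \sum_i g i t @[t --> F] --> \sum_i l i.
Proof.
move=> gl; elim: (index_enum I) => [|i s IH].
  by rewrite big_nil; under eq_fun do rewrite big_nil; exact: cvg_cst.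
by rewrite big_cons; under eq_fun do rewrite big_cons; apply: cvgD.
Qed.

(** The increment is resolved along the axes by [partial_mvt]. *)
Lemma C1_chain f (c : R -> rV) (c' : rV) (t : R) :
  (forall x i, derivable f x (e_ i)) ->
  (forall i, continuous (fun x => 'D_(e_ i) f x)) ->
  (forall i, is_derive t (1 : R) (fun t => c t 0 i) (c' 0 i)) ->
  is_derive t (1 : R) (fun t => f (c t)) (\sum_i 'D_(e_ i) f (c t) * c' 0 i).
Proof.
move=> df cdf dc; apply: is_derive_cvg.
have /choice[xi xiP] := fun h : R => partial_mvt (c t) (c (t + h *: 1)) df.
rewrite (_ : (fun _ => _) = fun h : R => \sum_i 'D_(e_ i) f (xi h i) *
    (h^-1 * (c (t + h *: 1) 0 i - c t 0 i))); last first.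
  apply/funext => h; have [_ ->] := xiP h.
  by rewrite mulr_sumr; apply: eq_bigr => i _; rewrite mulrCA.
apply: cvg_sumr => i; apply: cvgM; last exact: is_derive_quotient.
have th : t + h *: (1 : R) @[h --> (0 : R)^'] --> t.
  apply: cvg_within_filter.
  have {2}-> : t = t + 0 *: (1 : R) by rewrite scale0r addr0.
  by apply: cvgD; [exact: cvg_cst|apply: cvgM; [exact: cvg_id|exact: cvg_cst]].
have ct : c (t + h *: 1) @[h --> 0^'] --> c t.
  apply: cvg_rV => j; exact: (cvg_comp _ _ th (is_derive_continuous (dc j))).
have xt : xi h i @[h --> 0^'] --> c t.
  apply/cvgrPdist_le => e e0; move/cvgrPdist_le : ct => /(_ e e0).
  apply: filterS => h he; have [/(_ i) xh _] := xiP h.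
  by rewrite distrC (le_trans xh)// distrC.
exact: (cvg_comp _ _ xt (cdf i (c t))).
Qed.

Lemma gradD f g x : (forall i, derivable f x (e_ i)) -> (forall i, derivable g x (e_ i)) ->
  grad (fun x => f x + g x) x = grad f x + grad g x.
Proof. by move=> df dg; apply/rowP => i; rewrite !mxE deriveD. Qed.

(** Algebra generated over the coordinates by a family of functions; it is
closed under partial derivatives as soon as it contains those of the
generators. *)
Inductive polyspan (B : set (rV -> R)) : (rV -> R) -> Prop :=
| polyspan_gen f : B f -> polyspan B f
| polyspanD f g : polyspan B f -> polyspan B g -> polyspan B (fun x => f x + g x)
| polyspanZ k f : polyspan B f -> polyspan B (fun x => k * f x)
| polyspanX j f : polyspan B f -> polyspan B (fun x => x 0 j * f x).

Section smooth.
Variable B : set (rV -> R).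
Hypothesis B_cont : forall f, B f -> continuous f.
Hypothesis B_derive : forall f i, B f ->
  exists2 g, polyspan B g & forall x, is_derive x (e_ i) f (g x).

Lemma polyspan_continuous f : polyspan B f -> continuous f.
Proof.
elim=> [{}f /B_cont//|{}f g _ cf _ cg|k {}f _ cf|j {}f _ cf].
- exact: contD.
- by apply: contM => //; exact: contcst.
- by apply: contM => //; exact: continuous_coord.
Qed.

Lemma polyspan_derive f i : polyspan B f ->
  exists2 g, polyspan B g & forall x, is_derive x (e_ i) f (g x).
Proof.
elim=> [{}f /B_derive|{}f g _ [f' pf df] _ [g' pg dg]|k {}f _ [f' pf df]|j {}f Bf [f' pf df]].
- exact.
- exists (fun x => f' x + g' x); first exact: polyspanD.
  by move=> x; exact: is_deriveD.
- exists (fun x => k * f' x); first exact: polyspanZ.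
  by move=> x; exact: is_deriveZ.
- exists (fun x => x 0 j * f' x + (j == i)%:R * f x).
    by apply: polyspanD; [exact: polyspanX|exact: polyspanZ].
  move=> x; have := @is_deriveM _ _ _ _ x (e_ i) _ _ (is_derive_coord i j x) (df x).
  by rewrite /GRing.scale/= (mulrC (f x)).
Qed.

Lemma polyspan_pderiv f s : polyspan B f -> polyspan B (pderiv s f).
Proof.
move=> Bf; elim: s => [//|i s IH] /=.
have [g Bg dg] := polyspan_derive i IH.
rewrite (_ : (fun x => _) = g)//; apply/funext => x.
by have [_ ->] := dg x.
Qed.

Lemma polyspan_smooth f : polyspan B f -> smooth f.
Proof.
move=> Bf m; split=> [s _|s _ x i]; first exact/polyspan_continuous/polyspan_pderiv.
by have [g _ dg] := polyspan_derive i (polyspan_pderiv s Bf); have [] := dg x.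
Qed.

End smooth.

End partials.
End calculus.

Section boxes.
Context {R : realType} (n : nat).
Notation leb := (@lebesgue_rV R).
Notation rV := 'rV[R]_n.

Lemma closed_box (x1 : rV) (r1 : R) : closed (box x1 r1).
Proof.
rewrite (_ : box x1 r1 = \bigcap_(i in [set: 'I_n]) ((fun y : rV => `|y 0 i - x1 0 i|) @^-1` [set u | u <= r1])).
  apply: closed_bigI => i _; apply: closed_comp; last exact: closed_le.
  have cn : continuous (fun y : rV => `|y 0 i - x1 0 i|).
    apply: (contcomp (@norm_continuous R R)).
    by apply: contB; [exact: continuous_coord|exact: contcst].
  by move=> x _; exact: cn.
by apply/seteqP; split => y /= h i => [_|]; have := h i; exact.
Qed.

Lemma compact_box (x1 : rV) (r1 : R) : compact (box x1 r1).
Proof.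
apply: bounded_closed_compact; last exact: closed_box.
exists (`|x1| + `|r1|); split; first exact: num_real.
move=> M xM x /= xr; apply: le_trans (ltW xM); apply: norm_le_coord; first by rewrite addr_ge0.
move=> i; rewrite -[x 0 i](subrK (x1 0 i)) (le_trans (ler_normD _ _))// addrC lerD//.
  exact: coord_le_norm.
by apply: le_trans (xr i) (ler_norm _).
Qed.

Lemma box_dominated (f : rV -> R) (M : R) (x1 : rV) (r1 : R) :
  (forall x, `|f x| <= M) -> (forall x, ~ box x1 r1 x -> f x = 0) ->
  exists C : R, forall x, `|f x| <= C * cauchyw x.
Proof.
move=> fM fb; have [c c0 cP] := compact_cont_bounded (@compact_box x1 r1)
  (contV (fun x => lt0r_neq0 (cauchyw_gt0 x)) (@continuous_cauchyw R n)).
have M0 : 0 <= M by apply: le_trans (fM 0).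
exists (M * c) => x; have [xb|xb] := pselect (box x1 r1 x); last first.
  by rewrite fb// normr0 !mulr_ge0// ltW// cauchyw_gt0.
apply: (le_trans (fM x)); rewrite -mulrA ler_peMr//.
have := cP x xb; rewrite normfV gtr0_norm ?cauchyw_gt0// => h.
by rewrite -ler_pdivrMr ?cauchyw_gt0// mul1r.
Qed.

Lemma box_bounded (f : rV -> R) (x1 : rV) (r1 : R) : continuous f ->
  (forall x, ~ box x1 r1 x -> f x = 0) ->
  exists2 M : R, 0 < M & forall x, `|f x| <= M.
Proof.
move=> cf fb; have [M M0 MP] := compact_cont_bounded (@compact_box x1 r1) cf.
exists M => // x; have [|xb] := pselect (box x1 r1 x); first exact: MP.
by rewrite fb// normr0 ltW.
Qed.

Lemma rint_box (f : rV -> R) (x1 : rV) (r1 : R) : continuous f ->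
  (forall x, ~ box x1 r1 x -> f x = 0) -> rint (leb n) setT f.
Proof.
move=> cf fb; have [M M0 fM] := box_bounded cf fb.
have [C fC] := box_dominated fM fb; exact: rint_rV fC.
Qed.

End boxes.

(** * Bump functions *)

Section bumpf.
Context {R : realType}.
Notation leb := (@lebesgue_rV R).

Lemma expRN_pow (n : nat) (y : R) : 0 <= y -> expR (- y) * y ^+ n <= n`!%:R.
Proof.
move=> y0; rewrite expRN mulrC ler_pdivrMr ?expR_gt0//.
case: n => [|n].
  by rewrite expr0 fact0 mul1r (le_trans _ (expR_ge1Dx y))// lerDl.
rewrite mulrC -ler_pdivrMr ?ltr0n ?fact_gt0//.
by apply: le_trans (expR_ge1Dxn n y0); rewrite lerDr.
Qed.

Lemma is_derive_pow k (u : R) :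
  is_derive u (1 : R) (fun u : R => u ^+ k.+1) (k.+1%:R * u ^+ k).
Proof.
elim: k => [|k IH]; first by rewrite expr0 mulr1; exact: is_derive_id.
under eq_fun do rewrite exprS.
have := is_deriveM (is_derive_id u (1 : R)) IH.
rewrite /GRing.scale/= => h; apply: is_derive_eq.
by rewrite mulr1 exprS -(natr1 k.+1) -/(GRing.scale _ _) /GRing.scale/=; ring.
Qed.

(** The functions s |-> e^(-1/s) s^(-k) on the right half line; the family is
stable under derivation, and all its members are flat at 0. *)
Definition flat (k : nat) (s : R) : R := if 0 < s then expR (- s^-1) * s^-1 ^+ k else 0.

Lemma flat_ge0 k s : 0 <= flat k s.
Proof.
rewrite /flat; case: ifP => // s0.
by rewrite mulr_ge0 ?expR_ge0// exprn_ge0// invr_ge0 ltW.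
Qed.

Lemma flat_le k s : flat k s <= k`!%:R.
Proof.
rewrite /flat; case: ifP => [s0|_]; last by [].
by rewrite expRN_pow// invr_ge0 ltW.
Qed.

Lemma flatS k s : flat k s = s * flat k.+1 s.
Proof.
rewrite /flat; case: ifP => s0; last by rewrite mulr0.
by rewrite exprS [RHS]mulrCA (mulrA s) divff ?mul1r// gt_eqF.
Qed.

Lemma is_derive_flat k (s : R) : is_derive s (1 : R) (flat k) (flat k.+2 s - k%:R * flat k.+1 s).
Proof.
have [s0|s0|<-] := ltgtP 0 s.
- apply: (@near_eq_is_derive _ _ _ (fun s : R => expR (- s^-1) * s^-1 ^+ k)).
    near=> u; rewrite /flat ifT//; near: u; exact: lt_nbhsr.
  have dV : is_derive s (1 : R) (fun s : R => s^-1) (- s^-1 ^+ 2).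
    have := @is_deriveV R id s 1 1 (lt0r_neq0 s0) (is_derive_id _ _).
    by move=> h; apply: is_derive_eq; rewrite exprVn /GRing.scale/= mulr1.
  have dE : is_derive s (1 : R) (fun s : R => expR (- s^-1)) (expR (- s^-1) * s^-1 ^+ 2).
    have := @is_derive1_comp R expR (fun s => - s^-1) s _ _ (is_derive_expR _) (is_deriveN dV).
    by rewrite opprK.
  have dX : is_derive s (1 : R) (fun s : R => s^-1 ^+ k) (- (k%:R * s^-1 ^+ k.+1)).
    case: k => [|k]; first by under eq_fun do rewrite expr0; rewrite mul0r oppr0; exact: is_derive_cst.
    have := @is_derive1_comp R (fun u => u ^+ k.+1) (fun s => s^-1) s _ _
      (is_derive_pow k _) dV.
    by rewrite mulrN -mulrA -exprD addn2.
  apply: is_derive_eq; rewrite /flat s0 /GRing.scale/=.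
  by rewrite !exprS; ring.
- apply: (@near_eq_is_derive _ _ _ (cst 0)).
    near=> u; rewrite /flat ifF//; apply/negbTE; rewrite -leNgt; apply/ltW.
    by near: u; exact: lt_nbhsl.
  by rewrite /flat !ltNge (ltW s0)/= mulr0 subr0; exact: is_derive_cst.
- rewrite {2 3}/flat ltxx mulr0 subr0; apply: is_derive_cvg.
  apply/cvgrPdist_le => e e0; near=> h; rewrite sub0r normrN add0r [h *: 1]mulr1.
  rewrite {2}/flat ltxx subr0 flatS mulrA mulVf; last by near: h; exact: nbhs_dnbhs_neq.
  rewrite mul1r ger0_norm ?flat_ge0// flatS (le_trans (ler_norm _))// normrM.
  rewrite (ger0_norm (flat_ge0 _ _)).
  apply: (@le_trans _ _ (`|h| * k.+2`!%:R)); first by rewrite ler_wpM2l// flat_le.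
  rewrite -ler_pdivlMr ?ltr0n ?fact_gt0//; near: h; apply: nbhs_dnbhs.
  apply/nbhs_ballP; exists (e / k.+2`!%:R) => /=; first by rewrite divr_gt0// ltr0n fact_gt0.
  by move=> h; rewrite /ball/= sub0r normrN => /ltW.
Unshelve. all: by end_near.
Qed.

Context (n : nat).
Notation rV := 'rV[R]_n.
Notation e_ i := (@basis_rV R n i).

Definition sqdist (x0 x : rV) : R := \sum_j (x 0 j - x0 0 j) ^+ 2.

Lemma sqdist_line x0 x i t :
  sqdist x0 (x + t *: e_ i) = sqdist x0 x + (2 * t * (x 0 i - x0 0 i) + t ^+ 2).
Proof.
have E j : (x + t *: e_ i) 0 j = x 0 j + t * (j == i)%:R by rewrite mxE mxE basis_rVE.
rewrite /sqdist (bigD1 i)//= [in RHS](bigD1 i)//= E eqxx mulr1.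
rewrite (eq_bigr (fun j => (x 0 j - x0 0 j) ^+ 2)); first by ring.
by move=> j ji; rewrite E (negbTE ji) mulr0 addr0.
Qed.

Lemma continuous_sqdist x0 : continuous (sqdist x0).
Proof.
apply: continuous_sum => i; under eq_fun do rewrite expr2.
by apply: contM; apply: contB; [exact: continuous_coord|exact: contcst|exact: continuous_coord|exact: contcst].
Qed.

Definition bump_fun (x0 : rV) (r : R) (k : nat) (x : rV) : R := flat k (r ^+ 2 - sqdist x0 x).

Variables (x0 : rV) (r : R).
Hypothesis r0 : 0 < r.

Definition bump_class : set (rV -> R) := [set f | exists k, f = bump_fun x0 r k].

Lemma bump_cont f : bump_class f -> continuous f.
Proof.
move=> [k ->]; apply: contcomp; last by apply: contB; [exact: contcst|exact: continuous_sqdist].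
by move=> s; exact: is_derive_continuous (is_derive_flat k s).
Qed.

Lemma bump_derive f i : bump_class f ->
  exists2 g, polyspan bump_class g & forall x, is_derive x (e_ i) f (g x).
Proof.
move=> [k ->].
pose F x := bump_fun x0 r k.+2 x + - k%:R * bump_fun x0 r k.+1 x.
have BF : polyspan bump_class F.
  by apply: polyspanD; last apply: polyspanZ; apply: polyspan_gen; eexists.
exists (fun x : rV => -2 * (x 0 i * F x) + 2 * x0 0 i * F x).
  by apply: polyspanD; apply: polyspanZ => //; exact: polyspanX.
move=> x; apply: is_derive_line0; rewrite /bump_fun; under eq_fun do rewrite sqdist_line.
have d1 : is_derive (0 : R) (1 : R)
    (fun t : R => r ^+ 2 - (sqdist x0 x + (2 * t * (x 0 i - x0 0 i) + t ^+ 2))) (-2 * (x 0 i - x0 0 i)).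
  by apply: is_derive_eq; rewrite /GRing.scale/=; ring.
have := @is_derive1_comp R (flat k) _ 0 _ _ (is_derive_flat k _) d1.
move=> h; apply: is_derive_eq; rewrite mulr0 mul0r add0r expr0n/= addr0.
by rewrite /F /bump_fun; ring.
Qed.

Lemma bump_class_out f x : polyspan bump_class f -> ~ box x0 r x -> f x = 0.
Proof.
move=> Bf xr; elim: Bf => [{}f [k ->]|{}f g _ -> _ ->|k {}f _ ->|j {}f _ ->]; rewrite ?mulr0 ?addr0//.
rewrite /bump_fun /flat ifF//; apply/negbTE; rewrite -leNgt subr_le0.
have /existsNP[i /negP] : ~ (forall i, `|x 0 i - x0 0 i| <= r) := xr.
rewrite -ltNge => ri; rewrite /sqdist (bigD1 i)//=.
apply: (@le_trans _ _ ((x 0 i - x0 0 i) ^+ 2)).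
  by rewrite -[leRHS]real_normK ?num_real// ler_pXn2r ?nnegrE ?normr_ge0 ?(ltW r0) ?(ltW ri).
by rewrite lerDl sumr_ge0// => j _; exact: sqr_ge0.
Qed.

Lemma bump_test f : polyspan bump_class f -> test_function setT f.
Proof.
move=> Bf.
have sub : closure [set x | f x != 0] `<=` box x0 r.
  move=> x xf; have /closure_id -> := @closed_box R n x0 r.
  apply: closureS xf => y /= /eqP fy; apply: contrapT => yb.
  by apply: fy; exact: bump_class_out.
split => //; first exact: polyspan_smooth bump_cont bump_derive _ Bf.
apply: subclosed_compact sub; [exact: closed_closure|exact: compact_box].
Qed.

(** The radial form keeps the partial derivatives in a class stable under
derivation. *)
Definition bumpf := bump_fun x0 r 0.

Lemma polyspan_bump : polyspan bump_class bumpf.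
Proof. by apply: polyspan_gen; exists 0%N. Qed.

Lemma bump_ge0 x : 0 <= bumpf x. Proof. exact: flat_ge0. Qed.

Lemma continuous_bump : continuous bumpf.
Proof. exact: polyspan_continuous bump_cont _ polyspan_bump. Qed.

Lemma rint_bump : rint (leb n) setT bumpf.
Proof.
apply: (rint_box (x1 := x0) (r1 := r) continuous_bump) => x xb; exact: bump_class_out polyspan_bump xb.
Qed.

Lemma bump_mass_gt0 : 0 < \int[leb n]_x bumpf x.
Proof.
rewrite lt_neqAle Rintegral_ge0 ?andbT => [|x _]; last exact: bump_ge0.
apply/negP => /eqP B0.
have E : (\int[leb n]_x `|(EFin \o bumpf) x| = 0)%E.
  rewrite -[LHS]fineK.
    congr (_%:E); rewrite [RHS]B0; congr fine; apply: eq_integral => x _ /=.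
    by rewrite ger0_norm// bump_ge0.
  exact: integrable_fin_num (rint_norm rint_bump).
have /(ae_eq_integral_abs _ measurableT) ae0 := E.
have {ae0} : {ae leb n, forall x, bumpf x <= 0}.
  apply: filterS (ae0 _) => [x /(_ I)[->]//|].
  by apply/measurable_EFinP; exact: (measurable_rV continuous_bump).
move=> /(continuous_ae_le continuous_bump)/(_ x0); rewrite leNgt => /negP; apply.
rewrite /bumpf /bump_fun /sqdist big1 ?subr0 => [|i _]; last by rewrite subrr expr0n.
by rewrite /flat exprn_gt0// expr0 mulr1 expR_gt0.
Qed.

End bumpf.

Lemma bump_addr (R : realType) n (x0 c : 'rV[R]_n) r x : bumpf (x0 + c) r x = bumpf x0 r (x - c).
Proof.
rewrite /bumpf /bump_fun; congr (flat _ (_ - _)); apply: eq_bigr => i _.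
by rewrite !mxE; congr (_ ^+ 2); ring.
Qed.

Lemma bump_mass_addr (R : realType) n (x0 c : 'rV[R]_n) r : 0 < r ->
  \int[lebesgue_rV n]_x bumpf (x0 + c) r x = \int[lebesgue_rV n]_x bumpf x0 r x.
Proof.
move=> r0; under eq_Rintegral do rewrite bump_addr.
have cb := @continuous_bump R n x0 r.
have out x : ~ box x0 r x -> bumpf x0 r x = 0 by exact: (bump_class_out r0 (polyspan_bump x0 r)).
have [M M0 fM] := box_bounded cb out; have [C fC] := box_dominated fM out.
by have [_] := rV_translate (- c) cb fC.
Qed.

(** * Sobolev functions of order two are continuously differentiable *)

Lemma cont_near (R : realType) (T : topologicalType) (f : T -> R) x (e : R) :
  continuous f -> 0 < e -> \forall y \near x, `|f x - f y| <= e.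
Proof. by move=> cf; move/cvgrPdist_le : (cf x); exact. Qed.

Lemma near_cont (R : realType) (T : topologicalType) (f : T -> R) x :
  (forall e : R, 0 < e -> \forall y \near x, `|f x - f y| <= e) -> {for x, continuous f}.
Proof. by move=> H; apply/cvgrPdist_le. Qed.

Section sobolev.
Context {R : realType} (n : nat).
Notation leb := (@lebesgue_rV R).
Notation rV := 'rV[R]_n.
Notation e_ i := (@basis_rV R n i).

Lemma box_shift (x c y : rV) r : box (x + c) r y <-> box x r (y - c).
Proof.
by split=> h i; have := h i; rewrite !mxE; congr (`|_| <= _); ring.
Qed.

Lemma norm_basis_rV i : `|e_ i| <= 1.
Proof.
apply: norm_le_coord => // j; rewrite basis_rVE.
by case: (j == i); rewrite ?normr1 ?normr0.
Qed.

Lemma rint_box_mul (f chi : rV -> R) (x0 c : rV) (r : R) : continuous f -> continuous chi ->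
  (forall y, ~ box x0 r y -> chi y = 0) -> rint (leb n) setT (fun y => f y * chi (y - c)).
Proof.
move=> cf cchi out; apply: (@rint_box R n _ (x0 + c) r).
  by apply: contM => //; apply: (contcomp cchi); exact: continuous_addr.
by move=> y yb; rewrite out ?mulr0// => h; apply: yb; exact/box_shift.
Qed.

Lemma is_derive_translate (f chi chi' : rV -> R) (x0 : rV) (r : R) i (t : R) :
  continuous f -> continuous chi -> continuous chi' ->
  (forall y, is_derive y (e_ i) chi (chi' y)) ->
  (forall y, ~ box x0 r y -> chi y = 0) -> (forall y, ~ box x0 r y -> chi' y = 0) ->
  is_derive t (1 : R) (fun t : R => \int[leb n]_y (f y * chi (y - t *: e_ i)))
    (- \int[leb n]_y (f y * chi' (y - t *: e_ i))).
Proof.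
move=> cf cchi cchi' dchi out out'.
pose F (s : R) (y : rV) := f y * chi (y - s *: e_ i).
have dF (s : R) (y : rV) : is_derive s (1 : R) (F ^~ y) (- (f y * chi' (y - s *: e_ i))).
  have d1 := (is_derive_line chi y (e_ i) (- s) _).1 (dchi (y + - s *: e_ i)).
  have d2 := @is_derive1_comp R (fun t => chi (y + t *: e_ i)) (fun s => - s) s _ _ d1
    (is_deriveN (is_derive_id s (1 : R))).
  rewrite /F; under eq_fun do rewrite -scaleNr.
  apply: is_derive_eq (is_deriveZ (f y) d2) _.
  by rewrite mulrN1 /GRing.scale/= mulrN; congr (- (_ * chi' (y + _))); exact: scaleNr.
pose K := box (x0 + t *: e_ i) (r + 1).
have inK (s : R) (y : rV) : t - 1 < s < t + 1 -> ~ K y -> ~ box x0 r (y - s *: e_ i).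
  move=> st Ky yb; apply: Ky => j; have := yb j; rewrite !mxE => h.
  have : `|(s - t) * e_ i 0 j| <= 1.
    rewrite basis_rVE normrM; apply: (@le_trans _ _ (1 * 1)); last by rewrite mul1r.
    apply: ler_pM => //; last by case: (j == i); rewrite ?normr1 ?normr0.
    by rewrite ler_norml; move: st => /andP[s1 s2]; apply/andP; split; lra.
  rewrite basis_rVE => h2.
  move: h h2; set d := (_)%:R; rewrite !ler_norml => /andP[h1 h2] /andP[h3 h4].
  by apply/andP; split; nra.
have [M M0 fM] := compact_cont_bounded (@compact_box R n (x0 + t *: e_ i) (r + 1)) cf.
have [M' M'0 chiM] := box_bounded cchi' out'.
pose k y := M * M' * \1_K y.
have [y|y yK|C kC] := @box_dominated R n k (M * M') (x0 + t *: e_ i) (r + 1).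
- have MM := ltW (mulr_gt0 M0 M'0); rewrite /k normrM (ger0_norm MM) ler_piMr// indicE.
  by case: (_ \in _); rewrite ?normr1 ?normr0.
- by rewrite /k indicE memNset// mulr0.
have C0 : 0 <= C by exact: rV_dominated_ge0 kC.
have Fb (s : R) (y : rV) : t - 1 < s < t + 1 -> `|partial1of2 F s y| <= C * cauchyw y.
  move=> st; rewrite partial1of2E; have [_ ->] := dF s y; rewrite normrN.
  apply: le_trans (kC y); rewrite /k indicE.
  have [yK|yK] := pselect (K y); last first.
    by rewrite (out' _ (inK s y st yK)) mulr0 normr0.
  by rewrite mem_set// mulr1 (ger0_norm (ltW (mulr_gt0 M0 M'0))) normrM ler_pM//; exact: fM.
have ta : `]t - 1, t + 1[%classic t by rewrite /= in_itv/=; apply/andP; split; lra.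
have := @cvg_differentiation_under_integral R _ _ (leb n) F setT measurableT t (t - 1) (t + 1) ta
  _ _ (fun y => C * cauchyw y) _ _ _.
move=> H; apply: is_derive_cvg; rewrite -(RintegralN measurableT (rint_box_mul (t *: e_ i) cf cchi' out')).
have : h^-1 *: (\int[leb n]_y F (h + t) y - \int[leb n]_y F t y) @[h --> 0^'] -->
    \int[leb n]_y partial1of2 F t y.
  apply: H.
  - by move=> s _; exact: (rint_box_mul _ cf cchi out).
  - by move=> s y _ _; have [] := dF s y.
  - by move=> y; rewrite mulr_ge0// ltW// cauchyw_gt0.
  - by apply: (rintZ measurableT); exact: rint_cauchyw.
  - by move=> s y; rewrite /= in_itv/= => st _; exact: Fb.
have -> : \int[leb n]_y partial1of2 F t y = \int[leb n]_y (- (f y * chi' (y - t *: e_ i))).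
  by apply: eq_Rintegral => y _; rewrite partial1of2E; have [_ ->] := dF t y.
by apply: eq_fcvg => h /=; rewrite [h *: 1]mulr1 [t + h]addrC.
Qed.

Lemma Rintegral_ae_bound (g phi : rV -> R) (C : R) : measurable_fun setT g ->
  rint (leb n) setT phi -> (forall x, 0 <= phi x) -> 0 <= C ->
  {ae leb n, forall x, phi x != 0 -> `|g x| <= C} ->
  `|\int[leb n]_x (g x * phi x)| <= C * \int[leb n]_x phi x.
Proof.
move=> mg iphi phi0 C0 gC; pose A : set rV := [set x | `|g x| <= C].
have mA : measurable A.
  rewrite (_ : A = (fun x => `|g x|) @^-1` `]-oo, C]).
    have mn : measurable_fun setT (fun x => `|g x|) by exact: measurableT_comp.
    by rewrite -[X in measurable X]setTI; exact: mn.
  by apply/seteqP; split => x; rewrite /A/= in_itv.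
pose g' x := g x * \1_A x.
have mg' : measurable_fun setT g' by apply: measurable_funM.
have mphi := rint_meas iphi.
have g'C x : `|g' x| <= C.
  rewrite /g' indicE; case: (pselect (A x)) => xA; first by rewrite mem_set// mulr1.
  by rewrite memNset// mulr0 normr0.
have bnd (x : rV) : setT x -> `|g' x * phi x| <= C * phi x.
  by move=> _; rewrite normrM (ger0_norm (phi0 x)) ler_wpM2r.
have ig' : rint (leb n) setT (fun x => g' x * phi x).
  exact: (rint_le measurableT (measurable_funM mg' mphi) (rintZ measurableT C iphi) bnd).
have -> : \int[leb n]_x (g x * phi x) = \int[leb n]_x (g' x * phi x).
  rewrite /Rintegral; congr fine; apply: ae_eq_integral => //.
  - exact/measurable_EFinP/measurable_funM.
  - exact/measurable_EFinP/measurable_funM.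
  - apply: filterS gC => x xC _; rewrite /g' indicE; congr EFin.
    have [->|px] := eqVneq (phi x) 0; first by rewrite !mulr0.
    by rewrite mem_set ?mulr1//; exact: xC.
rewrite -(RintegralZl _ measurableT iphi).
exact: (Rintegral_norm_le measurableT ig' (rintZ measurableT C iphi) bnd).
Qed.

Section increments.
Variables (f : rV -> R) (i : 'I_n) (x : rV).
Hypothesis cf : continuous f.

Let m r := \int[leb n]_y bumpf x r y.
Let S r t := \int[leb n]_y (f y * bumpf x r (y - t *: e_ i)).

(** Averages against bumps of vanishing radius recover a continuous function. *)
Lemma mollify t (e : R) : 0 < e -> exists2 r0, 0 < r0 & forall r, 0 < r -> r <= r0 ->
  `|S r t - f (x + t *: e_ i) * m r| <= e * m r.
Proof.
have [z zE] : exists z : rV, z = x + t *: e_ i by eexists.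
move=> e0; rewrite -zE.
have : \forall y \near z, `|f z - f y| <= e by exact: cont_near.
move=> /nbhs_ballP[r0 /= r00 H]; exists (r0 / 2); first by rewrite divr_gt0.
move=> r r1 rr0.
have out y : ~ box x r y -> bumpf x r y = 0 by exact: (bump_class_out r1 (polyspan_bump x r)).
have outz y : ~ box z r y -> bumpf z r y = 0 by exact: (bump_class_out r1 (polyspan_bump z r)).
have cz := @continuous_bump R n z r.
rewrite /m -(bump_mass_addr x (t *: e_ i) r1) -zE.
have iz := rint_bump z r1.
have E : S r t = \int[leb n]_y (f y * bumpf z r y).
  by apply: eq_Rintegral => y _; rewrite zE bump_addr.
have if1 : rint (leb n) setT (fun y => f y * bumpf z r y).
  have h := rint_box_mul 0 cf cz outz.
  by apply: (rint_ext measurableT _ h) => y _; rewrite subr0.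
rewrite E -(RintegralZl _ measurableT iz) -(RintegralB measurableT if1 (rintZ measurableT _ iz)).
rewrite -(RintegralZl _ measurableT iz).
apply: (Rintegral_norm_le measurableT (rintB measurableT if1 (rintZ measurableT _ iz)) (rintZ measurableT _ iz)).
have close (a b c : R) : 0 <= c -> `|a - b| <= e -> `|b * c - a * c| <= e * c.
  by move=> c0 ab; rewrite -mulrBl normrM (ger0_norm c0) distrC; exact: ler_wpM2r.
move=> y _; have [yb|/outz ->] := pselect (box z r y); last first.
  by rewrite !mulr0 subrr normr0.
apply: close; first exact: bump_ge0.
apply: H; rewrite mx_norm_ball /ball_/=; apply: (@le_lt_trans _ _ r); last by lra.
by rewrite distrC; apply: norm_le_coord => [|j]; [exact: ltW|rewrite !mxE; exact: yb].
Qed.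

Let E1 r (r0 : 0 < r) : exists2 chi, polyspan (bump_class x r) chi &
  forall y, is_derive y (e_ i) (bumpf x r) (chi y).
Proof. exact: (polyspan_derive (@bump_derive R n x r) i (polyspan_bump x r)). Qed.

Let shiftE r t y : bumpf x r (y - t *: e_ i) = bumpf (x + t *: e_ i) r y.
Proof. by rewrite bump_addr. Qed.

Lemma derive_shift (f1 : rV -> R) c y l : is_derive (y - c) (e_ i) f1 l ->
  is_derive y (e_ i) (fun y => f1 (y - c)) l.
Proof.
move=> /is_derive_quotient h; apply: is_derive_cvg.
by apply: eq_fcvg h => k; rewrite addrAC.
Qed.

Let shift_derive r t y l : is_derive (y - t *: e_ i) (e_ i) (bumpf x r) l ->
  is_derive y (e_ i) (bumpf (x + t *: e_ i) r) l.
Proof.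
have -> : bumpf (x + t *: e_ i) r = (fun y => bumpf x r (y - t *: e_ i)).
  by apply/funext => z; rewrite shiftE.
exact: derive_shift.
Qed.

Let dS r (t : R) (g : rV -> R) : 0 < r -> weak_pderiv [:: i] f g ->
  is_derive t (1 : R) (S r) (\int[leb n]_y (g y * bumpf x r (y - t *: e_ i))).
Proof.
move=> r0 wg; have [chi pchi dchi] := E1 r0.
have out (f1 : rV -> R) y := @bump_class_out R n x r r0 f1 y.
have := is_derive_translate t cf (@continuous_bump R n x r) (polyspan_continuous (@bump_cont R n x r) pchi)
  dchi (fun y => out _ y (polyspan_bump x r)) (fun y => out _ y pchi).
move=> h; apply: is_derive_eq h _.
have := wg _ (bump_test r0 (polyspan_bump (x + t *: e_ i) r)); rewrite /= expr1 mulN1r.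
under [X in _ = - X]eq_Rintegral do rewrite -shiftE.
move=> h2; rewrite -[RHS]opprK -h2; congr (- _); apply: eq_Rintegral => y _; congr (_ * _).
by have [_ ->] := shift_derive (dchi (y - t *: e_ i)).
Qed.

Let ddS r (g : rV -> R) : 0 < r -> weak_pderiv [:: i; i] f g -> exists2 S' : R -> R,
  (forall t : R, is_derive t (1 : R) (S r) (S' t)) &
  forall t : R, is_derive t (1 : R) S' (\int[leb n]_y (g y * bumpf x r (y - t *: e_ i))).
Proof.
move=> r0 wg; have [chi pchi dchi] := E1 r0.
have [xi pxi dxi] := polyspan_derive (@bump_derive R n x r) i pchi.
have out (f1 : rV -> R) y := @bump_class_out R n x r r0 f1 y.
have cchi := polyspan_continuous (@bump_cont R n x r) pchi.
exists (fun t => - \int[leb n]_y (f y * chi (y - t *: e_ i))) => s.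
  exact: (is_derive_translate s cf (@continuous_bump R n x r) cchi
    dchi (fun y => out _ y (polyspan_bump x r)) (fun y => out _ y pchi)).
have := is_derive_translate s cf cchi (polyspan_continuous (@bump_cont R n x r) pxi)
  dxi (fun y => out _ y pchi) (fun y => out _ y pxi).
move=> /is_deriveN h; apply: is_derive_eq h _; rewrite opprK.
have := wg _ (bump_test r0 (polyspan_bump (x + s *: e_ i) r)); rewrite /= sqrrN expr1n mul1r.
under [X in _ = X]eq_Rintegral do rewrite -shiftE.
move=> <-; apply: eq_Rintegral => y _; congr (_ * _).
have [_ <-] := derive_shift (dxi (y - s *: e_ i)).
suff -> : (fun y0 => chi (y0 - s *: e_ i)) = 'D_(e_ i) (bumpf (x + s *: e_ i) r) by [].
apply/funext => z.
by have [_ ->] := shift_derive (dchi (z - s *: e_ i)).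
Qed.

Let bound r (t : R) (g : rV -> R) (C B : R) : 0 < r -> measurable_fun setT g -> 0 <= C -> r + `|t| <= B ->
  {ae leb n, forall y, box x B y -> `|g y| <= C} ->
  `|\int[leb n]_y (g y * bumpf x r (y - t *: e_ i))| <= C * m r.
Proof.
move=> r0 mg C0 rtB gC; rewrite /m -(bump_mass_addr x (t *: e_ i) r0).
under eq_Rintegral do rewrite shiftE.
apply: Rintegral_ae_bound => //; first exact: rint_bump.
  by move=> y; exact: bump_ge0.
apply: filterS gC => y yC yb; apply: yC => j.
have [xb|/(bump_class_out r0 (polyspan_bump (x + t *: e_ i) r))] := pselect (box (x + t *: e_ i) r y); last first.
  by move=> h; rewrite -/(bumpf _ _ _) h eqxx in yb.
have := xb j; rewrite !mxE => h.
rewrite (_ : y 0 j - x 0 j = (y 0 j - (x 0 j + t * e_ i 0 j)) + t * e_ i 0 j); last by ring.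
apply: (le_trans (ler_normD _ _)); apply: le_trans rtB; apply: lerD.
  by move: h; rewrite !mxE.
by rewrite normrM ler_piMr// (le_trans (coord_le_norm _ _))// norm_basis_rV.
Qed.

Let m0 r : 0 < r -> 0 < m r. Proof. by move=> r0; exact: bump_mass_gt0. Qed.

Let mvt (G G' : R -> R) (a b : R) (C : R) : (forall t : R, is_derive t (1 : R) G (G' t)) ->
  (forall t, `|t| <= Num.max `|a| `|b| -> `|G' t| <= C) -> `|G b - G a| <= C * `|b - a|.
Proof.
move=> dG; wlog ab : a b / a <= b.
  move=> W; case: (leP a b) => [|/ltW]; first exact: W.
  by move=> ba GC; rewrite distrC (distrC b); apply: W => // t; rewrite maxC; exact: GC.
move=> GC; have cG : continuous G by move=> t; exact: is_derive_continuous (dG t).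
have [th tI ->] := @MVT_segment R G G' a b ab (fun z _ => dG z) (continuous_subspaceT cG).
rewrite normrM ler_wpM2r// GC//.
move: tI; rewrite in_itv/= => /andP[t1 t2].
rewrite le_max; case: (leP 0 th) => th0.
  by apply/orP; right; rewrite (ger0_norm th0); exact: le_trans (ler_norm b).
by apply/orP; left; rewrite (ltr0_norm th0); have := ler_norm (- a); rewrite normrN; lra.
Qed.

Let mvt0 (G G' : R -> R) (b C : R) : (forall t : R, is_derive t (1 : R) G (G' t)) ->
  (forall t, `|t| <= `|b| -> `|G' t| <= C) -> `|G b - G 0| <= C * `|b|.
Proof.
move=> dG GC; have mx : Num.max `|0 : R| `|b| <= `|b| by rewrite normr0 max_r.
have := @mvt G G' 0 b C dG (fun s hs => GC s (le_trans hs mx)).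
by rewrite subr0.
Qed.

Let taylor1 (G G' : R -> R) (t C : R) : (forall t : R, is_derive t (1 : R) G (G' t)) ->
  (forall s, `|s| <= `|t| -> `|G' s - G' 0| <= C) -> `|G t - G 0 - G' 0 * t| <= C * `|t|.
Proof.
move=> dG GC; have dT (s : R) : is_derive s (1 : R) (fun s => G s - G' 0 * s) (G' s - G' 0).
  have := is_deriveB (dG s) (is_deriveZ (G' 0) (is_derive_id s (1 : R))).
  by rewrite [G' 0 *: 1]mulr1.
have := mvt0 dT GC; congr (`|_| <= _).
by rewrite mulr0 subr0 addrAC.
Qed.

(** The average of f against a translated bump has a derivative given by the
weak derivative of f, hence the mean value theorem applies to it; let the
radius tend to 0. *)
Lemma weak_increment (g : rV -> R) (h C : R) : measurable_fun setT g -> weak_pderiv [:: i] f g ->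
  0 <= C -> {ae leb n, forall y, box x (1 + `|h|) y -> `|g y| <= C} ->
  `|f (x + h *: e_ i) - f x| <= C * `|h|.
Proof.
move=> mg wg C0 gC; apply/ler_addgt0Pr => e e0.
have e20 : 0 < e / 2 by rewrite divr_gt0.
have [r1 r10 H1] := mollify h e20; have [r2 r20 H2] := mollify 0 e20.
pose r := Num.min 1 (Num.min r1 r2).
have r0 : 0 < r by rewrite !lt_min ltr01 r10 r20.
have rr1 : r <= r1 by rewrite !ge_min lexx !orbT.
have rr2 : r <= r2 by rewrite !ge_min lexx !orbT.
have rl1 : r <= 1 by rewrite ge_min lexx.
have := H1 r r0 rr1; have := H2 r r0 rr2; rewrite scale0r addr0.
have : `|S r h - S r 0| <= C * m r * `|h - 0|.
  rewrite subr0; apply: (mvt0 (fun t => dS t r0 wg)) => t th.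
  by apply: bound gC => //; exact: lerD.
rewrite subr0 mulrAC => h1 h2 h3; have mr0 := m0 r0.
rewrite -(ler_pM2r mr0) -{1}(gtr0_norm mr0) -normrM mulrBl mulrDl; move: h1 h2 h3.
move: (f (x + h *: e_ i) * m r) (f x * m r) (S r h) (S r 0) (C * `|h| * m r) => a b c d k.
rewrite [e / 2 * _]mulrAC; move: (e * m r) => w.
rewrite !ler_norml => /andP[? ?] /andP[? ?] /andP[? ?]; apply/andP; split; lra.
Qed.

Let quotient_close (a b a' b' h d : R) : h != 0 -> `|a - a'| <= d * `|h| -> `|b - b'| <= d * `|h| ->
  `|(a - b) / h - (a' - b') / h| <= 2 * d.
Proof.
move=> h0 ad bd; rewrite -mulrBl normrM normfV ler_pdivrMr ?normr_gt0//.
rewrite (_ : a - b - (a' - b') = (a - a') - (b - b')); last by ring.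
apply: (le_trans (ler_normB _ _)); rewrite -mulrA mulr_natl mulr2n; exact: lerD.
Qed.

Let quotient_scale (a b s t M C : R) : 0 < M -> t != 0 ->
  `|a - b - s * t| <= C * M * `|t| * `|t| -> `|(a / M - b / M) / t - s / M| <= C * `|t|.
Proof.
move=> M0 t0 h.
rewrite (_ : _ - _ = (a - b - s * t) / (M * t)); last by field; rewrite t0 gt_eqF.
rewrite normrM normfV ler_pdivrMr ?normr_gt0 ?mulf_neq0// ?(gt_eqF M0)//.
by rewrite normrM (gtr0_norm M0) mulrA -(mulrA C) (mulrC `|t|) mulrA.
Qed.

(** The difference quotients form a Cauchy family, at a rate given by the size
of the weak second derivative. *)
Lemma weak_quotient (g : rV -> R) (h k C : R) : measurable_fun setT g ->
  weak_pderiv [:: i; i] f g ->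
  0 <= C -> {ae leb n, forall y, box x 2 y -> `|g y| <= C} ->
  0 < `|h| <= 1 -> 0 < `|k| <= 1 ->
  `|(f (x + h *: e_ i) - f x) / h - (f (x + k *: e_ i) - f x) / k| <= C * (`|h| + `|k|).
Proof.
move=> mg wg C0 gC; rewrite !normr_gt0 => /andP[h0 h1] /andP[k0 k1].
apply/ler_addgt0Pr => e e0.
have approx t : t != 0 -> `|t| <= 1 -> exists2 r0, 0 < r0 & forall r, 0 < r -> r <= r0 -> r <= 1 ->
    forall S' : R -> R, (forall t : R, is_derive t (1 : R) (S r) (S' t)) ->
      (forall t : R, is_derive t (1 : R) S' (\int[leb n]_y (g y * bumpf x r (y - t *: e_ i)))) ->
    `|(f (x + t *: e_ i) - f x) / t - S' 0 / m r| <= C * `|t| + e / 2.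
  move=> t0 t1; have d0 : 0 < e / 4 * `|t| by rewrite mulr_gt0 ?divr_gt0 ?normr_gt0.
  have [r1 r10 H1] := mollify t d0; have [r2 r20 H2] := mollify 0 d0.
  exists (Num.min r1 r2); first by rewrite lt_min r10 r20.
  move=> r r0; rewrite le_min => /andP[rr1 rr2] rl1 S' dS1 dS2; have mr0 := m0 r0.
  have close s b : `|S r s - b * m r| <= e / 4 * `|t| * m r -> `|b - S r s / m r| <= e / 4 * `|t|.
    move=> h2; rewrite distrC -(ler_pM2r mr0); apply: le_trans h2.
    by rewrite -{2}(gtr0_norm mr0) -normrM mulrBl divfK// gt_eqF.
  have c1 := close _ _ (H1 r r0 rr1); have := close _ _ (H2 r r0 rr2).
  rewrite scale0r addr0 => c2; have := quotient_close t0 c1 c2.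
  have S'b (s : R) : `|s| <= `|t| -> `|S' s - S' 0| <= C * m r * `|t|.
    move=> st; apply: (@le_trans _ _ (C * m r * `|s|)); last first.
      by rewrite ler_wpM2l// mulr_ge0// ltW.
    apply: (mvt0 dS2) => u us; have u1 := le_trans us (le_trans st t1).
    by apply: (bound r0 mg C0 _ gC); exact: (lerD rl1 u1).
  have T1 := taylor1 dS1 S'b.
  have T2 : `|(S r t / m r - S r 0 / m r) / t - S' 0 / m r| <= C * `|t|
    by exact: (quotient_scale mr0 t0 T1).
  have e42 : 2 * (e / 4) = e / 2 by field.
  by rewrite e42 => h2; rewrite [leRHS]addrC; exact: (le_trans (ler_distD ((S r t / m r - S r 0 / m r) / t) _ _) (lerD h2 T2)).
have [r1 r10 H1] := approx h h0 h1; have [r2 r20 H2] := approx k k0 k1.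
pose r := Num.min 1 (Num.min r1 r2).
have r0 : 0 < r by rewrite !lt_min ltr01 r10 r20.
have rr1 : r <= r1 by rewrite !ge_min lexx !orbT.
have rr2 : r <= r2 by rewrite !ge_min lexx !orbT.
have rl1 : r <= 1 by rewrite ge_min lexx.
have [S' dS1 dS2] := ddS r0 wg.
have h3 := H1 r r0 rr1 rl1 S' dS1 dS2; have h4 := H2 r r0 rr2 rl1 S' dS1 dS2.
apply: (le_trans (ler_distD (S' 0 / m r) _ _)); rewrite [X in _ + X]distrC.
rewrite mulrDr (splitr e) addrACA; exact: (lerD h3 h4).
Qed.

End increments.

(** A family of numbers q h, Cauchy as h -> 0, has the limit
sup (q h - C |h|). *)
Lemma cauchy_rate (q : R -> R) (C : R) :
  (forall h k, 0 < `|h| <= 1 -> 0 < `|k| <= 1 -> `|q h - q k| <= C * (`|h| + `|k|)) ->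
  exists l, forall h, 0 < `|h| <= 1 -> `|q h - l| <= C * `|h|.
Proof.
move=> qC; pose A := [set q h - C * `|h| | h in [set h | 0 < `|h| <= 1]].
have ub h : 0 < `|h| <= 1 -> ubound A (q h + C * `|h|).
  move=> h1 _ [k k1 <-]; have := qC _ _ h1 k1.
  by rewrite mulrDr ler_norml => /andP[? ?]; lra.
have one1 : 0 < `|1 : R| <= 1 by rewrite normr1 ltr01 lexx.
have A0 : A !=set0 by exists (q 1 - C * `|1|), 1.
exists (sup A) => h h1; rewrite ler_distlC; apply/andP; split.
  by apply: ub_le_sup; [exists (q 1 + C * `|1|); exact: ub|exists h].
by apply: ge_sup => //; exact: ub.
Qed.

(** By [weak_quotient] the difference quotients converge locally uniformly, and a
locally uniform limit of continuous functions is continuous. *)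
Lemma weak_C1 (f : rV -> R) (i : 'I_n) (g : rV -> R) : continuous f -> measurable_fun setT g ->
  weak_pderiv [:: i; i] f g ->
  (forall K : set rV, compact K -> exists C : R, {ae leb n, forall x, K x -> `|g x| <= C}) ->
  (forall x, derivable f x (e_ i)) /\ continuous (fun x => 'D_(e_ i) f x).
Proof.
move=> cf mg wg gK.
pose q x h := (f (x + h *: e_ i) - f x) / h.
have main x0 : exists (C : R) (l : rV -> R), 0 < C /\
    forall x, box x0 1 x -> forall h, 0 < `|h| <= 1 -> `|q x h - l x| <= C * `|h|.
  have [C0 gC0] := gK _ (@compact_box R n x0 3).
  pose C := Num.max 1 C0; have C1 : 0 < C by rewrite lt_max ltr01.
  have gC x : box x0 1 x -> {ae leb n, forall y, box x 2 y -> `|g y| <= C}.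
    move=> xb; apply: filterS gC0 => y yC yb; rewrite le_max yC ?orbT// => j.
    rewrite (_ : _ - _ = (y 0 j - x 0 j) + (x 0 j - x0 0 j)); last by ring.
    apply: (le_trans (ler_normD _ _)); have := yb j; have := xb j; lra.
  have H x : exists l, box x0 1 x -> forall h, 0 < `|h| <= 1 -> `|q x h - l| <= C * `|h|.
    have [xb|xb] := pselect (box x0 1 x); last by exists 0.
    have [l lP] := @cauchy_rate (q x) C (fun h k h1 k1 => weak_quotient cf mg wg (ltW C1) (gC x xb) h1 k1).
    by exists l.
  have [l lP] := choice H; exists C, l; split => //.
have dl x0 C l x : box x0 1 x -> 0 < C ->
    (forall h, 0 < `|h| <= 1 -> `|q x h - l| <= C * `|h|) -> is_derive x (e_ i) f l.
  move=> xb C0 ql; apply: is_derive_cvg; apply/cvgrPdist_le => e e0; near=> h.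
  rewrite distrC mulrC; apply: (le_trans (ql h _)).
    apply/andP; split; first by rewrite normr_gt0; near: h; exact: nbhs_dnbhs_neq.
    near: h; apply: nbhs_dnbhs; apply/nbhs_ballP; exists 1 => //= h.
    by rewrite /ball/= sub0r normrN => /ltW.
  rewrite mulrC -ler_pdivlMr//; near: h; apply: nbhs_dnbhs; apply/nbhs_ballP.
  exists (e / C) => /=; first by rewrite divr_gt0.
  by move=> h; rewrite /ball/= sub0r normrN => /ltW.
have xx (x : rV) : box x 1 x by move=> j; rewrite subrr normr0.
split=> [x|x0].
  have [C [l [C0 H]]] := main x.
  by have [] := dl x C (l x) x (xx x) C0 (H x (xx x)).
have [C [l [C0 H]]] := main x0.
apply: near_cont => e e0.
pose h := Num.min 1 (e / (4 * C)).
have h0 : 0 < h by rewrite lt_min ltr01 divr_gt0// mulr_gt0.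
have h1 : 0 < `|h| <= 1 by rewrite gtr0_norm// h0 ge_min lexx.
have he : C * `|h| <= e / 4.
  rewrite gtr0_norm// (_ : e / 4 = C * (e / (4 * C))); last by field; rewrite gt_eqF.
  by rewrite ler_pM2l// ge_min lexx orbT.
have cq : continuous (fun x => q x h).
  apply: contM; last exact: contcst.
  by apply: contB => //; apply: (contcomp cf); exact: continuous_addr.
have e20 : 0 < e / 2 by rewrite divr_gt0.
have Dl x : box x0 1 x -> 'D_(e_ i) f x = l x.
  by move=> xb; have [] := dl x0 C (l x) x xb C0 (H x xb).
near=> x.
have xb : box x0 1 x.
  near: x; apply/nbhs_ballP; exists 1 => //= y; rewrite mx_norm_ball /ball_/= => yb j.
  by have := coord_le_norm (x0 - y) j; rewrite !mxE distrC => /le_trans; apply; exact: ltW.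
rewrite !Dl//.
have := H x xb h h1; have := H x0 (xx x0) h h1.
have : `|q x0 h - q x h| <= e / 2.
  by near: x; exact: (@cont_near _ _ _ x0 _ cq e20).
rewrite distrC => h2 h3 h4.
rewrite distrC (splitr e); apply: (le_trans (ler_distD (q x0 h) _ _)).
apply: (le_trans (lerD (ler_distD (q x h) _ _) (le_trans h3 he))).
rewrite distrC; apply: (le_trans (lerD (lerD (le_trans h4 he) h2) (lexx _))).
lra.
Unshelve. all: by end_near.
Qed.

Lemma sobolev_loc_C1 (f : rV -> R) : continuous f -> sobolev_infty_loc 2 f ->
  (forall x i, derivable f x (e_ i)) /\
  (forall i, continuous (fun x => 'D_(e_ i) f x)).
Proof.
move=> cf sf; have H i : (forall x, derivable f x (e_ i)) /\ continuous (fun x => 'D_(e_ i) f x).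
  have [g [mg wg gK]] := sf [:: i; i] isT; exact: weak_C1 mg wg gK.
by split=> [x i|i]; have [] := H i.
Qed.

Lemma Lnorm_oo_ae (g : rV -> R) (C : R) :
  ('N[leb n]_+oo [EFin \o g] <= C%:E)%E -> {ae leb n, forall x, `|g x| <= C}.
Proof.
rewrite unlock ifT; last first.
  apply: lt_le_trans (box_measure_gt0 (0 : rV) (@ltr01 R)) _.
  by apply: le_measure; rewrite ?inE//; exact: measurable_box.
by move=> /ess_supP; apply: filterS => x /=; rewrite lee_fin.
Qed.

Lemma sobolev_le_loc (C : R) (f : rV -> R) : sobolev_infty_le 2 C f -> sobolev_infty_loc 2 f.
Proof.
move=> sf s s2; have [g [gL wg gC]] := sf s s2; exists g; split => //.
  by move: gL => /andP[]; rewrite inE.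
by move=> K _; exists C; apply: filterS (Lnorm_oo_ae gC).
Qed.

(** The weak first derivative bounds the difference quotients, hence their limit. *)
Lemma sobolev_le_derive (C : R) (f : rV -> R) : continuous f -> sobolev_infty_le 2 C f ->
  forall x i, `|'D_(e_ i) f x| <= C.
Proof.
move=> cf sf x i; have [g [gL wg gC]] := sf [:: i] isT.
have mg : measurable_fun setT g by move: gL => /andP[]; rewrite inE.
have C0 : 0 <= C by rewrite -lee_fin; apply: le_trans gC; exact: Lnorm_ge0.
have [df _] := sobolev_loc_C1 cf (sobolev_le_loc sf).
have /is_derive_quotient dq := derivableP (df x i).
have qC h : h != 0 -> `|h^-1 * (f (x + h *: e_ i) - f x)| <= C.
  move=> h0; rewrite normrM normfV mulrC ler_pdivrMr ?normr_gt0//.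
  by apply: weak_increment mg wg C0 _ => //; apply: filterS (Lnorm_oo_ae gC).
apply: (cvgr_to_le (cvg_norm dq)); near=> h; apply: qC; near: h; exact: nbhs_dnbhs_neq.
Unshelve. all: by end_near.
Qed.

End sobolev.

(** * The Fourier transform of the Gaussian on the line *)

Section gauss1.
Context {R : realType}.
Notation mu := (@lebesgue_measure R).
Variable eps : R.
Hypothesis eps0 : 0 < eps.

Definition gauss1 (a : R) : R := expR (- (eps / 2 * a ^+ 2)).

Lemma gauss1_gt0 a : 0 < gauss1 a. Proof. exact: expR_gt0. Qed.

Lemma gauss1_decay : exists C : R, forall a, gauss1 a * (1 + a ^+ 2) ^+ 2 <= C.
Proof.
exists (2 * (1 + (2 / eps) ^+ 2 * 2)) => a; pose y := eps / 2 * a ^+ 2.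
have y0 : 0 <= y by rewrite mulr_ge0 ?sqr_ge0// divr_ge0// ltW.
have e1 : gauss1 a <= 1 by have := @expRN_pow R 0 y y0; rewrite mulr1.
have e2 : gauss1 a * a ^+ 4 <= (2 / eps) ^+ 2 * 2.
  rewrite (_ : gauss1 a * _ = (2 / eps) ^+ 2 * (expR (- y) * y ^+ 2)); last first.
    by rewrite /gauss1 /y; field; rewrite gt_eqF.
  by rewrite ler_wpM2l ?sqr_ge0//; exact: (@expRN_pow R 2 y y0).
have g0 := gauss1_gt0 a.
have : (1 + a ^+ 2) ^+ 2 <= 2 * (1 + a ^+ 4).
  by have := sqr_ge0 (1 - a ^+ 2); rewrite (_ : a ^+ 4 = a ^+ 2 * a ^+ 2)//; [nra|rewrite -exprD].
rewrite -(ler_pM2l g0) => /le_trans; apply.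
by rewrite mulrCA ler_pM2l// mulrDr mulr1 lerD.
Qed.

Lemma gauss1_cauchy : exists C : R, forall a : R,
  gauss1 a <= C * (1 + a ^+ 2)^-1 /\ `|a| * gauss1 a <= C * (1 + a ^+ 2)^-1.
Proof.
have [C CP] := gauss1_decay; exists C => a.
have p1 : 1 <= 1 + a ^+ 2 by rewrite lerDl sqr_ge0.
have p0 : 0 < 1 + a ^+ 2 by exact: lt_le_trans p1.
have ap : `|a| <= 1 + a ^+ 2.
  rewrite -(real_normK (num_real a)); have := sqr_ge0 (`|a| - 1); have := normr_ge0 a; nra.
have g0 := gauss1_gt0 a.
split; rewrite ler_pdivlMr//; apply: le_trans (CP a); rewrite [(1 + _) ^+ 2]expr2.
  by rewrite mulrA ler_peMr// mulr_ge0// ltW.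
rewrite (mulrC `|a|) -mulrA ler_pM2l// ler_pM2r//.
Qed.

Lemma continuous_gauss1 : continuous gauss1.
Proof.
apply: (contcomp (@continuous_expR R)); apply: contN; apply: contM; first exact: contcst.
by move=> x; apply: exprn_continuous.
Qed.

Lemma gauss1_rint (f : R -> R) (M : R) : continuous f -> (forall a, `|f a| <= M * (1 + `|a|)) ->
  rint mu setT (fun a => gauss1 a * f a).
Proof.
move=> cf fM; have [C CP] := gauss1_cauchy.
have M0 : 0 <= M.
  by have := le_trans (normr_ge0 _) (fM 0); rewrite normr0 addr0 mulr1.
apply: (rint_le measurableT _ (rintZ measurableT (M * (2 * C)) (@rint_oneDsqrV R))).
  by apply: continuous_measurable_fun; apply: contM => //; exact: continuous_gauss1.
move=> a _; rewrite normrM (gtr0_norm (gauss1_gt0 a)) mulrC.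
apply: (@le_trans _ _ (M * (1 + `|a|) * gauss1 a)).
  by rewrite ler_wpM2r// ltW// gauss1_gt0.
rewrite -[leLHS]mulrA -[leRHS]mulrA ler_wpM2l// mulrDl mul1r.
by have [h1 h2] := CP a; rewrite -mulrA mulr_natl mulr2n lerD.
Qed.

Lemma Rintegral_derive0 (f f' : R -> R) (C : R) : (forall x : R, is_derive x (1 : R) f (f' x)) ->
  continuous f' -> rint mu setT f' -> (forall x, `|f x| <= C * (1 + x ^+ 2)^-1) ->
  \int[mu]_x f' x = 0.
Proof.
move=> df cf' if' fC; apply/eqP; rewrite -normr_le0; apply/ler_addgt0Pr => e e0; rewrite add0r.
have C0 : 0 <= C.
  by have := le_trans (normr_ge0 _) (fC 0); rewrite expr0n/= addr0 invr1 mulr1.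
have e20 : 0 < e / 2 by rewrite divr_gt0.
have [M M0 MP] := tail_small if' e20.
pose N := M + 4 * C / e.
have N0 : 0 < N by rewrite ltr_wpDr// divr_ge0 ?mulr_ge0// ltW.
have fN x : `|x| = N -> `|f x| <= e / 4.
  move=> xN; apply: (le_trans (fC x)); rewrite ler_pdivrMr ?oneDsqr_gt0//.
  rewrite -(real_normK (num_real x)) xN.
  have h : C <= e / 4 * N.
    rewrite mulrDr (_ : e / 4 * (4 * C / e) = C); last by field; rewrite gt_eqF.
    by rewrite lerDr mulr_ge0// ?divr_ge0 ?ltW.
  apply: (le_trans h); rewrite ler_pM2l ?divr_gt0//; have := sqr_ge0 (N - 1); nra.
have cf : continuous f by move=> x; exact: is_derive_continuous (df x).
pose A : set R := ~` `[- N, N].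
have mA : measurable A by apply: measurableC; exact: measurable_itv.
have NM : M <= N by rewrite lerDl divr_ge0 ?mulr_ge0// ltW.
have AM x : A x -> M <= `|x|.
  rewrite /A/= in_itv/= => /negP; rewrite negb_and -!ltNge => /orP[] h.
    by have := ler_norm (- x); rewrite normrN; lra.
  by have := ler_norm x; lra.
have -> : \int[mu]_x f' x = \int[mu]_(x in `[- N, N]) f' x + \int[mu]_(x in A) f' x.
  rewrite -Rintegral_setU//; first by rewrite setUv.
  - by rewrite setUv.
  - by apply/disj_setPS; rewrite setICr.
rewrite (FTC2_itv _ cf' (fun x _ => df x) cf); last by lra.
have h1 : `|\int[mu]_(x in A) f' x| <= e / 2.
  apply: le_trans (MP A mA AM).
  have iA : rint mu A f' by apply: rintS if'.
  apply: le_normr_Rintegral.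
  exact: mA.
  exact: iA.
have h2 := fN N (gtr0_norm N0); have h3 : `|f (- N)| <= e / 4 by apply: fN; rewrite normrN gtr0_norm.
apply: (le_trans (ler_normD _ _)); have := ler_normB (f N) (f (- N)); lra.
Qed.

Let cosz z : continuous (fun a : R => cos (z * a)).
Proof. exact: continuous_cosZ. Qed.
Let sinz z : continuous (fun a : R => sin (z * a)).
Proof. exact: continuous_sinZ. Qed.

Let rint_cosz z : rint mu setT (fun a => gauss1 a * cos (z * a)).
Proof.
apply: (gauss1_rint (M := 1)); [exact: cosz|move=> a; rewrite mul1r].
by apply: (le_trans (cos_normle1 _)); rewrite lerDl.
Qed.

Let rint_sinz z : rint mu setT (fun a => gauss1 a * sin (z * a)).
Proof.
apply: (gauss1_rint (M := 1)); [exact: sinz|move=> a; rewrite mul1r].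
by apply: (le_trans (sin_normle1 _)); rewrite lerDl.
Qed.

Let cont_id : continuous (fun a : R => a). Proof. by move=> a; exact: cvg_id. Qed.

Let rint_asinz z : rint mu setT (fun a => gauss1 a * (a * sin (z * a))).
Proof.
apply: (gauss1_rint (M := 1)); first by apply: contM => //; exact: sinz.
move=> a; rewrite mul1r normrM; apply: (@le_trans _ _ (`|a| * 1)).
  by rewrite ler_wpM2l// sin_normle1.
by rewrite mulr1 lerDr.
Qed.

Definition gauss_mass := \int[mu]_a gauss1 a.

Lemma rint_gauss1 : rint mu setT gauss1.
Proof.
have := rint_cosz 0; apply: rint_ext => // a _.
by rewrite mul0r cos0 mulr1.
Qed.

Lemma gauss_mass_gt0 : 0 < gauss_mass.
Proof.
have h : \int[mu]_(a in `[0, 1]) expR (- (eps / 2)) <= gauss_mass.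
  apply: le_trans (Rintegral_subset_ge0 (measurable_itv `[0, 1]) rint_gauss1 _); last first.
    by move=> x; rewrite ltW// gauss1_gt0.
  apply: Rintegral_le => //; [exact: rint_cst|exact: rint_itv continuous_gauss1|].
  move=> x; rewrite /= in_itv/= => /andP[x0 x1]; rewrite ler_expR lerN2 ler_piMr//.
    by rewrite divr_ge0// ltW.
  by rewrite exprn_ile1.
apply: lt_le_trans h; rewrite Rintegral_itv_cst// subr0 mulr1 expR_gt0//.
Qed.

Let is_derive_gauss1 (a : R) : is_derive a (1 : R) gauss1 (- eps * a * gauss1 a).
Proof.
have d : is_derive a (1 : R) (fun a : R => - (eps / 2 * a ^+ 2)) (- (eps * a)).
  have h := is_deriveN (is_deriveZ (eps / 2) (is_derive_pow 1 a)).
  by apply: is_derive_eq h _; rewrite expr1 /GRing.scale/=; field.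
have := @is_derive1_comp R expR _ a _ _ (is_derive_expR _) d.
by move=> h; apply: is_derive_eq h _; rewrite /gauss1; ring.
Qed.

Let is_derive_sinz z (a : R) : is_derive a (1 : R) (fun a : R => sin (z * a)) (cos (z * a) * z).
Proof.
have h := is_deriveZ z (is_derive_id a (1 : R)).
have := @is_derive1_comp R sin (fun a => z * a) a _ _ (is_derive_sin _) h.
by rewrite [z *: 1]mulr1.
Qed.

Let is_derive_cosz a (z : R) : is_derive z (1 : R) (fun z : R => cos (z * a)) (- sin (z * a) * a).
Proof.
have h : is_derive z (1 : R) (fun z : R => z * a) a.
  have := is_deriveM (is_derive_id z (1 : R)) (is_derive_cst a z (1 : R)).
  by rewrite scaler0 add0r [a *: 1]mulr1.
exact: (@is_derive1_comp R cos (fun z => z * a) z _ _ (is_derive_cos _) h).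
Qed.

(** Integration by parts gives the first-order linear equation satisfied by
the Fourier transform of the Gaussian. *)
Let parts z : eps * \int[mu]_a (gauss1 a * (a * sin (z * a))) = z * \int[mu]_a (gauss1 a * cos (z * a)).
Proof.
have [C CP] := gauss1_cauchy.
pose f (a : R) := gauss1 a * sin (z * a).
pose f' (a : R) := z * (gauss1 a * cos (z * a)) - eps * (gauss1 a * (a * sin (z * a))).
have i1 := rintZ measurableT z (rint_cosz z); have i2 := rintZ measurableT eps (rint_asinz z).
have df (a : R) : is_derive a (1 : R) f (f' a).
  have := is_deriveM (is_derive_gauss1 a) (is_derive_sinz z a).
  by move=> h; apply: is_derive_eq h _; rewrite /f' /GRing.scale/=; ring.
have : \int[mu]_a f' a = 0.
  apply: (@Rintegral_derive0 f f' C df); last first.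
  - move=> a; rewrite normrM (gtr0_norm (gauss1_gt0 a)); have [h _] := CP a.
    by apply: le_trans h; rewrite ler_piMr ?sin_normle1// ltW// gauss1_gt0.
  - exact: (rintB measurableT i1 i2).
  - apply: contB; apply: contM => //; first exact: contcst.
      by apply: contM; [exact: continuous_gauss1|exact: cosz].
    exact: contcst.
    by apply: contM; [exact: continuous_gauss1|apply: contM => //; exact: sinz].
rewrite (RintegralB measurableT i1 i2) (RintegralZl _ measurableT (rint_cosz z)).
by rewrite (RintegralZl _ measurableT (rint_asinz z)) => /eqP; rewrite subr_eq0 => /eqP.
Qed.

Let J z := \int[mu]_a (gauss1 a * cos (z * a)).

Let dJ (z : R) : is_derive z (1 : R) J (- (z / eps) * J z).
Proof.
have -> : - (z / eps) * J z = - \int[mu]_a (gauss1 a * (a * sin (z * a))).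
  by rewrite mulNr mulrAC /J -parts mulrAC divff ?mul1r// gt_eqF.
have [C CP] := gauss1_cauchy.
have C0 : 0 <= C.
  have [h _] := CP 0; have := le_trans (ltW (gauss1_gt0 0)) h.
  by rewrite expr0n/= addr0 invr1 mulr1.
pose F (z a : R) := gauss1 a * cos (z * a).
have dF (s a : R) : is_derive s (1 : R) (F ^~ a) (- (gauss1 a * (a * sin (s * a)))).
  have := is_deriveZ (gauss1 a) (is_derive_cosz a s).
  by move=> h; apply: is_derive_eq h _; rewrite /GRing.scale/=; ring.
have zI : `]z - 1, z + 1[%classic z by rewrite /= in_itv/=; apply/andP; split; lra.
have := @cvg_differentiation_under_integral R _ _ mu F setT measurableT z (z - 1) (z + 1) zI
  (fun s _ => rint_cosz s) (fun s a _ _ => _) (fun a => C * (1 + a ^+ 2)^-1) _ (rintZ measurableT C (@rint_oneDsqrV R)) _.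
move=> H; apply: is_derive_cvg; rewrite -(RintegralN measurableT (rint_asinz z)).
have -> : \int[mu]_a (- (gauss1 a * (a * sin (z * a)))) = \int[mu]_a partial1of2 F z a.
  by apply: eq_Rintegral => a _; rewrite partial1of2E; have [_ ->] := dF z a.
have {}H : h^-1 *: (J (h + z) - J z) @[h --> 0^'] --> \int[mu]_a partial1of2 F z a.
  apply: H => [s a|a|s a _ _].
  - by have [] := dF s a.
  - by rewrite mulr_ge0// invr_ge0 ltW// oneDsqr_gt0.
  - rewrite partial1of2E; have [_ ->] := dF s a; rewrite normrN mulrCA normrM.
    have [_ h] := CP a; apply: le_trans h; rewrite ler_wpM2l// normrM (gtr0_norm (gauss1_gt0 a)).
    by rewrite ler_piMr ?sin_normle1// ltW// gauss1_gt0.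
by apply: eq_fcvg H => h /=; rewrite [h *: 1]mulr1 [z + h]addrC.
Qed.

Lemma gauss1_cos z : J z = gauss_mass * expR (- (z ^+ 2 / (2 * eps))).
Proof.
pose h (z : R) := J z * expR (z ^+ 2 / (2 * eps)).
have dh (s : R) : is_derive s (1 : R) h 0.
  have d : is_derive s (1 : R) (fun z : R => z ^+ 2 / (2 * eps)) (s / eps).
    have h1 := is_deriveZ ((2 * eps)^-1) (is_derive_pow 1 s).
    under eq_fun do rewrite mulrC.
    by apply: is_derive_eq h1 _; rewrite expr1 /GRing.scale/=; field; rewrite gt_eqF.
  have dE := @is_derive1_comp R expR _ s _ _ (is_derive_expR _) d.
  have := is_deriveM (dJ s) dE.
  by move=> h1; apply: is_derive_eq h1 _; rewrite /GRing.scale/=; ring.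
have := @is_derive_0_is_cst R h z 0 dh.
rewrite /h expr0n/= mul0r expR0 mulr1 => hz.
have J0 : J 0 = gauss_mass.
  by apply: eq_Rintegral => a _; rewrite mul0r cos0 mulr1.
by rewrite -J0 -hz expRN mulfK// gt_eqF// expR_gt0.
Qed.

Lemma gauss1_sin z : \int[mu]_a (gauss1 a * sin (z * a)) = 0.
Proof.
have := Rintegral_reflect 0 (rint_sinz z).
have -> : \int[mu]_a (gauss1 (0 - a) * sin (z * (0 - a))) = - \int[mu]_a (gauss1 a * sin (z * a)).
  rewrite -(RintegralN measurableT (rint_sinz z)); apply: eq_Rintegral => a _.
  by rewrite sub0r mulrN sinN mulrN /gauss1 sqrrN.
by move: (\int[mu]_a _) => x; lra.
Qed.

Lemma gauss1_fourier z th :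
  rint mu setT (fun a => gauss1 a * cos (z * a + th)) /\
  \int[mu]_a (gauss1 a * cos (z * a + th)) = gauss_mass * expR (- (z ^+ 2 / (2 * eps))) * cos th.
Proof.
have i1 := rintZr measurableT (cos th) (rint_cosz z).
have i2 := rintZr measurableT (sin th) (rint_sinz z).
have E a : gauss1 a * cos (z * a + th) = gauss1 a * cos (z * a) * cos th - gauss1 a * sin (z * a) * sin th.
  by rewrite cosD; ring.
split; first by apply: (rint_ext measurableT _ (rintB measurableT i1 i2)) => a _; rewrite E.
under eq_Rintegral do rewrite E.
rewrite (RintegralB measurableT i1 i2) (RintegralZr _ measurableT (rint_cosz z)).
by rewrite (RintegralZr _ measurableT (rint_sinz z)) gauss1_sin mul0r subr0 -/(J z) gauss1_cos.
Qed.

End gauss1.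

(** * Nonnegative Fourier transforms and positive definiteness *)

Section gaussV.
Context {R : realType}.
Notation mu := (@lebesgue_measure R).
Notation leb := (@lebesgue_rV R).
Variable eps : R.
Hypothesis eps0 : 0 < eps.

Definition gaussV n (x : 'rV[R]_n) : R := expR (- (eps / 2 * dotr x x)).

Definition gtrig n (z : 'rV[R]_n) (th : R) (x : 'rV[R]_n) : R := gaussV x * cos (dotr z x + th).

Definition ghat n (z : 'rV[R]_n) : R := gauss_mass eps ^+ n * expR (- (dotr z z / (2 * eps))).

Lemma gaussV_gt0 n (x : 'rV[R]_n) : 0 < gaussV x. Proof. exact: expR_gt0. Qed.

Lemma dotr_cons n (a b : R) (x y : 'rV[R]_n) :
  dotr (rV_cons (a, x)) (rV_cons (b, y)) = a * b + dotr x y.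
Proof.
rewrite /dotr big_ord_recl !rV_consE0; congr (_ + _).
by apply: eq_bigr => i _; rewrite !rV_consES.
Qed.

Lemma gaussV_cons n (a : R) (x : 'rV[R]_n) : gaussV (rV_cons (a, x)) = gauss1 eps a * gaussV x.
Proof. by rewrite /gaussV dotr_cons /gauss1 -expRD -expr2; congr expR; ring. Qed.

Lemma gaussV_cauchyw n : exists C : R, forall x : 'rV[R]_n, gaussV x <= C * cauchyw x.
Proof.
have [c cP] := gauss1_cauchy eps0.
elim: n => [|n [C CP]].
  by exists 1 => x; rewrite /gaussV /dotr big_ord0 mulr0 oppr0 expR0 /cauchyw big_ord0 mulr1.
exists (c * C) => x; have [a [y ->]] := rV_consP x.
rewrite gaussV_cons cauchyw_cons mulrACA; have [h _] := cP a.
apply: ler_pM => //; apply: ltW; [exact: gauss1_gt0|exact: gaussV_gt0].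
Qed.

Lemma continuous_dotr n (z : 'rV[R]_n) : continuous (dotr z).
Proof.
apply: continuous_sum => i.
by apply: contM; [exact: contcst|exact: continuous_coord].
Qed.

Lemma continuous_gaussV n : continuous (@gaussV n).
Proof.
apply: (contcomp (@continuous_expR R)); apply: contN; apply: contM; first exact: contcst.
by apply: continuous_sum => i; apply: contM; exact: continuous_coord.
Qed.

Lemma continuous_trig n (z : 'rV[R]_n) th : continuous (fun x => cos (dotr z x + th)).
Proof.
apply: (contcomp (@continuous_cos R)); apply: contD; last exact: contcst.
exact: continuous_dotr.
Qed.

Lemma continuous_gtrig n (z : 'rV[R]_n) th : continuous (gtrig z th).
Proof. by apply: contM; [exact: continuous_gaussV|exact: continuous_trig]. Qed.

Lemma gtrig_le n (z : 'rV[R]_n) th x : `|gtrig z th x| <= gaussV x.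
Proof.
by rewrite normrM (gtr0_norm (gaussV_gt0 x)) ler_piMr ?cos_normle1// ltW// gaussV_gt0.
Qed.

Lemma gtrig_dominated n (z : 'rV[R]_n) th : exists C : R, forall x, `|gtrig z th x| <= C * cauchyw x.
Proof.
have [C CP] := gaussV_cauchyw n; exists C => x.
exact: le_trans (gtrig_le _ _ _) (CP x).
Qed.

Lemma rint_gtrig n (z : 'rV[R]_n) th : rint (leb n) setT (gtrig z th).
Proof. have [C CP] := gtrig_dominated z th; exact: (rint_rV (@continuous_gtrig n z th) CP). Qed.

(** Fourier transform of the Gaussian, one coordinate at a time. *)
Lemma gtrig_fourier n (z : 'rV[R]_n) th : \int[leb n]_x gtrig z th x = ghat z * cos th.
Proof.
elim: n z th => [|n IH] z th.
  have [_ ->] := integral_rV0 (measurable_rV (@continuous_gtrig 0 z th)).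
  by rewrite /gtrig /gaussV /ghat /dotr !big_ord0 mulr0 mul0r oppr0 expR0 !mul1r add0r.
have [C CP] := gtrig_dominated z th.
rewrite (Rintegral_cons (@continuous_gtrig n.+1 z th) CP).
have [b [w zE]] := rV_consP z.
have E a : \int[leb n]_x gtrig z th (rV_cons (a, x)) = ghat w * (gauss1 eps a * cos (b * a + th)).
  rewrite [RHS](_ : _ = gauss1 eps a * (ghat w * cos (b * a + th))); last by ring.
  rewrite -IH -(RintegralZl _ measurableT (rint_gtrig w (b * a + th))).
  apply: eq_Rintegral => x _; rewrite /gtrig gaussV_cons zE dotr_cons -mulrA.
  by congr (_ * (_ * cos _)); ring.
under eq_Rintegral do rewrite E.
have [i1 F1] := gauss1_fourier eps0 b th.
rewrite (RintegralZl _ measurableT i1) F1 /ghat zE dotr_cons -expr2 (exprS (gauss_mass eps)).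
rewrite (mulrDl (b ^+ 2)) opprD expRD; ring.
Qed.

Definition gauss_class n : set ('rV[R]_n -> R) := [set f | exists z th, f = gtrig z th].

Lemma gauss_cont n (f : 'rV[R]_n -> R) : gauss_class f -> continuous f.
Proof. by move=> [z [th ->]]; exact: continuous_gtrig. Qed.

Lemma dotrDr n (z x y : 'rV[R]_n) : dotr z (x + y) = dotr z x + dotr z y.
Proof. by rewrite /dotr -big_split; apply: eq_bigr => i _; rewrite mxE mulrDr. Qed.

Lemma dotrC n (x y : 'rV[R]_n) : dotr x y = dotr y x.
Proof. by apply: eq_bigr => i _; rewrite mulrC. Qed.

Lemma dotrDl n (z x y : 'rV[R]_n) : dotr (x + y) z = dotr x z + dotr y z.
Proof. by rewrite dotrC dotrDr !(dotrC z). Qed.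

Lemma dotrZr n k (z x : 'rV[R]_n) : dotr z (k *: x) = k * dotr z x.
Proof. by rewrite /dotr mulr_sumr; apply: eq_bigr => i _; rewrite mxE mulrCA. Qed.

Lemma dotrNr n (z x : 'rV[R]_n) : dotr z (- x) = - dotr z x.
Proof. by rewrite -scaleN1r dotrZr mulN1r. Qed.

Lemma dotrNl n (z x : 'rV[R]_n) : dotr (- z) x = - dotr z x.
Proof. by rewrite dotrC dotrNr dotrC. Qed.

Lemma dotr_basis n (z : 'rV[R]_n) i : dotr z (basis_rV i) = z 0 i.
Proof.
rewrite /dotr (bigD1 i)//= basis_rVE eqxx mulr1 big1 ?addr0// => j ji.
by rewrite basis_rVE (negbTE ji) mulr0.
Qed.

Lemma dotr_sqdist n (x : 'rV[R]_n) : dotr x x = sqdist 0 x.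
Proof. by apply: eq_bigr => i _; rewrite mxE subr0 expr2. Qed.

Lemma gauss_derive n (f : 'rV[R]_n -> R) i : gauss_class f ->
  exists2 g, polyspan (@gauss_class n) g & forall x, is_derive x (basis_rV i) f (g x).
Proof.
move=> [z [th ->]].
exists (fun x : 'rV[R]_n => - eps * (x 0 i * gtrig z th x) + z 0 i * gtrig z (th + pi / 2) x).
  by apply: polyspanD; apply: polyspanZ; [apply: polyspanX|]; apply: polyspan_gen; do 2 eexists.
move=> x; apply: is_derive_line0.
have E t : gtrig z th (x + t *: basis_rV i) =
    expR (- (eps / 2 * (dotr x x + (2 * t * x 0 i + t ^+ 2)))) * cos (dotr z x + t * z 0 i + th).
  have D : dotr (x + t *: basis_rV i) (x + t *: basis_rV i) = dotr x x + (2 * t * x 0 i + t ^+ 2).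
    by rewrite !dotr_sqdist sqdist_line mxE subr0.
  by rewrite /gtrig /gaussV D dotrDr dotrZr dotr_basis.
under eq_fun do rewrite E.
have d1 : is_derive (0 : R) (1 : R)
    (fun t : R => expR (- (eps / 2 * (dotr x x + (2 * t * x 0 i + t ^+ 2)))))
    (expR (- (eps / 2 * (dotr x x + (2 * 0 * x 0 i + 0 ^+ 2)))) * (- eps * x 0 i)).
  have d : is_derive (0 : R) (1 : R)
      (fun t : R => - (eps / 2 * (dotr x x + (2 * t * x 0 i + t ^+ 2)))) (- eps * x 0 i).
    by apply: is_derive_eq; rewrite /GRing.scale/=; field.
  exact: (@is_derive1_comp R expR _ 0 _ _ (is_derive_expR _) d).
have d2 : is_derive (0 : R) (1 : R) (fun t : R => cos (dotr z x + t * z 0 i + th))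
    (- sin (dotr z x + 0 * z 0 i + th) * z 0 i).
  have d : is_derive (0 : R) (1 : R) (fun t : R => dotr z x + t * z 0 i + th) (z 0 i).
    by apply: is_derive_eq; rewrite /GRing.scale/=; ring.
  exact: (@is_derive1_comp R cos _ 0 _ _ (is_derive_cos _) d).
have := is_deriveM d1 d2; move=> h; apply: is_derive_eq h _.
rewrite /GRing.scale/= mulr0 !mul0r expr0n/= !addr0 /gtrig addrA cosDpihalf -/(gaussV x).
by ring.
Qed.

Lemma dotrr_pow_gaussV n (m : nat) : exists C : R, forall x : 'rV[R]_n, enorm x ^+ m * gaussV x <= C.
Proof.
exists (1 + (2 / eps) ^+ m * m`!%:R) => x.
pose y := eps / 2 * dotr x x; have y0 : 0 <= y by rewrite mulr_ge0 ?dotrr_ge0// divr_ge0// ltW.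
have h0 : gaussV x <= 1 by have := @expRN_pow R 0 y y0; rewrite mulr1.
have h1 : enorm x ^+ m * enorm x ^+ m * gaussV x <= (2 / eps) ^+ m * m`!%:R.
  rewrite -expr2 -exprM mulnC exprM enorm_sqr.
  rewrite (_ : dotr x x = 2 / eps * y); last by rewrite /y; field; rewrite gt_eqF.
  have e20 : 0 <= (2 / eps) ^+ m by rewrite exprn_ge0// divr_ge0// ltW.
  by rewrite exprMn -mulrA ler_wpM2l// mulrC; exact: expRN_pow.
have g0 := gaussV_gt0 x.
apply: (@le_trans _ _ ((1 + enorm x ^+ m * enorm x ^+ m) * gaussV x)).
  rewrite ler_pM2r//; have := sqr_ge0 (enorm x ^+ m - 1); have := exprn_ge0 m (enorm_ge0 x).
  move: (enorm x ^+ m) => u; nra.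
by rewrite mulrDl mul1r lerD.
Qed.

Lemma polyspan_gauss_decay n (f : 'rV[R]_n -> R) (m : nat) : polyspan (@gauss_class n) f ->
  exists C : R, forall x, enorm x ^+ m * `|f x| <= C.
Proof.
move=> Bf; elim: Bf m => [{}f [z [th ->]]|{}f g _ IHf _ IHg|k {}f _ IHf|j {}f _ IHf] m.
- have [C CP] := dotrr_pow_gaussV n m; exists C => x.
  by apply: le_trans (CP x); rewrite ler_wpM2l ?exprn_ge0 ?enorm_ge0// gtrig_le.
- have [C CP] := IHf m; have [D DP] := IHg m; exists (C + D) => x.
  apply: le_trans (lerD (CP x) (DP x)); rewrite -mulrDr.
  by rewrite ler_wpM2l ?exprn_ge0 ?enorm_ge0// ler_normD.
- have [C CP] := IHf m; exists (`|k| * C) => x.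
  by rewrite normrM mulrCA ler_wpM2l.
- have [C CP] := IHf m.+1; exists C => x; apply: le_trans (CP x).
  rewrite normrM exprSr -mulrA ler_wpM2l ?exprn_ge0 ?enorm_ge0//.
  by rewrite ler_wpM2r// coord_le_enorm.
Qed.

(** These are the test functions against which the positivity of Sigma^ and its
support are probed. *)
Lemma polyspan_gauss_schwartz n (f : 'rV[R]_n -> R) : polyspan (@gauss_class n) f -> schwartz f.
Proof.
move=> Bf; split; first exact: polyspan_smooth (@gauss_cont n) (@gauss_derive n) _ Bf.
by move=> s m; apply: polyspan_gauss_decay; exact: polyspan_pderiv (@gauss_derive n) _ _ Bf.
Qed.

Lemma polyspan_gtrig n (z : 'rV[R]_n) th : polyspan (@gauss_class n) (gtrig z th).
Proof. by apply: polyspan_gen; exists z, th. Qed.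

Lemma polyspan_sum n (B : set ('rV[R]_n -> R)) (I : Type) (s : seq I) (F : I -> 'rV[R]_n -> R) f0 :
  polyspan B f0 -> (forall i, polyspan B (F i)) -> polyspan B (fun x => \sum_(i <- s) F i x).
Proof.
move=> B0 BF; elim: s => [|i s IH].
  under eq_fun do rewrite big_nil.
  rewrite (_ : (fun _ => 0) = (fun x => 0 * f0 x)); first exact: polyspanZ.
  by apply/funext => x; rewrite mul0r.
by under eq_fun do rewrite big_cons; apply: polyspanD.
Qed.

Lemma ghatN n (z : 'rV[R]_n) : ghat (- z) = ghat z.
Proof. by rewrite /ghat dotrNl dotrNr opprK. Qed.

Lemma ghat_gt0 n (z : 'rV[R]_n) : 0 < ghat z.
Proof. by rewrite mulr_gt0 ?expR_gt0// exprn_gt0// gauss_mass_gt0. Qed.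

Lemma gtrig_cos n (z xi : 'rV[R]_n) th :
  rint (leb n) setT (fun x => gtrig z th x * cos (dotr xi x)) /\
  \int[leb n]_x (gtrig z th x * cos (dotr xi x)) = (ghat (z + xi) + ghat (z - xi)) / 2 * cos th.
Proof.
have E x : gtrig z th x * cos (dotr xi x) = 2^-1 * gtrig (z + xi) th x + 2^-1 * gtrig (z - xi) th x.
  rewrite /gtrig !dotrDl dotrNl [dotr z x + _ + th]addrAC [dotr z x - _ + th]addrAC.
  by move: (dotr z x + th) => u; rewrite cosB cosD; field.
have i1 := rintZ measurableT 2^-1 (rint_gtrig (z + xi) th).
have i2 := rintZ measurableT 2^-1 (rint_gtrig (z - xi) th).
split; first by apply: (rint_ext measurableT _ (rintD measurableT i1 i2)) => x _; rewrite E.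
under eq_Rintegral do rewrite E.
rewrite (RintegralD measurableT i1 i2) (RintegralZl _ measurableT (rint_gtrig _ th)).
by rewrite (RintegralZl _ measurableT (rint_gtrig _ th)) !gtrig_fourier; ring.
Qed.

Lemma gtrig_sin n (z xi : 'rV[R]_n) th :
  rint (leb n) setT (fun x => gtrig z th x * sin (dotr xi x)) /\
  \int[leb n]_x (gtrig z th x * sin (dotr xi x)) = (ghat (z + xi) - ghat (z - xi)) / 2 * sin th.
Proof.
have E x : gtrig z th x * sin (dotr xi x) =
    2^-1 * gtrig (z + xi) (th - pi / 2) x - 2^-1 * gtrig (z - xi) (th - pi / 2) x.
  rewrite /gtrig !dotrDl dotrNl [dotr z x + _ + _]addrAC [dotr z x - _ + _]addrAC !addrA.
  rewrite [_ + th - _ + _]addrAC [_ + th - _ - _]addrAC -!addrA.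
  rewrite (addrA (dotr z x)) (addrA (dotr z x) th (- dotr xi x - pi / 2)) !addrA.
  by rewrite !cosBpihalf sinB sinD; field.
have i1 := rintZ measurableT 2^-1 (rint_gtrig (z + xi) (th - pi / 2)).
have i2 := rintZ measurableT 2^-1 (rint_gtrig (z - xi) (th - pi / 2)).
split; first by apply: (rint_ext measurableT _ (rintB measurableT i1 i2)) => x _; rewrite E.
under eq_Rintegral do rewrite E.
rewrite (RintegralB measurableT i1 i2) (RintegralZl _ measurableT (rint_gtrig _ _)).
by rewrite (RintegralZl _ measurableT (rint_gtrig _ _)) !gtrig_fourier cosBpihalf; ring.
Qed.

End gaussV.

Section ghat_gauss.
Context {R : realType} (n : nat) (eps : R).
Hypothesis eps0 : 0 < eps.
Notation rV := 'rV[R]_n.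

Lemma ghatE (z : rV) : ghat eps z = gauss_mass eps ^+ n * gaussV eps^-1 z.
Proof. by rewrite /ghat /gaussV; congr (_ * expR (- _)); field; rewrite gt_eqF. Qed.

Lemma continuous_ghat : continuous (fun z : rV => ghat eps z).
Proof.
under eq_fun do rewrite ghatE; apply: contM; first exact: contcst.
exact: continuous_gaussV.
Qed.

Lemma ghat_dominated : exists C : R, forall z : rV, `|ghat eps z| <= C * cauchyw z.
Proof.
have e0 : 0 < eps^-1 by rewrite invr_gt0.
have [C CP] := gaussV_cauchyw e0 n; exists (gauss_mass eps ^+ n * C) => z.
rewrite gtr0_norm ?ghat_gt0// ghatE -mulrA ler_wpM2l// exprn_ge0// ltW//.
exact: gauss_mass_gt0.
Qed.

End ghat_gauss.

Section positive_definite.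
Context {R : realType} (n : nat).
Notation leb := (@lebesgue_rV R).
Notation rV := 'rV[R]_n.
Variables (Sigma : rV -> R) (M : R).
Hypothesis cS : continuous Sigma.
Hypothesis SM : forall x, `|Sigma x| <= M.
Hypothesis S_ge0 : dist_ge0 (fourier_dist Sigma).

Definition fcos (phi : rV -> R) (xi : rV) : R := \int[leb n]_x (phi x * cos (dotr xi x)).
Definition fsin (phi : rV -> R) (xi : rV) : R := \int[leb n]_x (phi x * sin (dotr xi x)).

Lemma Re_fourier_rV phi xi : complex.Re (fourier_rV phi xi) = fcos phi xi.
Proof. by apply: eq_Rintegral => x _ /=; rewrite mul0r subr0 cosN. Qed.

Lemma Im_fourier_rV phi xi : complex.Im (fourier_rV phi xi) = \int[leb n]_x (phi x * - sin (dotr xi x)).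
Proof. by apply: eq_Rintegral => x _ /=; rewrite mul0r addr0 sinN. Qed.

Lemma Re_fourier_dist phi : complex.Re (fourier_dist Sigma phi) = \int[leb n]_xi (Sigma xi * fcos phi xi).
Proof.
apply: eq_Rintegral => xi _; rewrite -Re_fourier_rV.
by case: (fourier_rV phi xi) => a b /=; rewrite mul0r subr0.
Qed.

Lemma Im_fourier_dist phi : (forall xi, rint (leb n) setT (fun x => phi x * sin (dotr xi x))) ->
  complex.Im (fourier_dist Sigma phi) = \int[leb n]_xi (Sigma xi * - fsin phi xi).
Proof.
move=> iphi; apply: eq_Rintegral => xi _.
have -> : - fsin phi xi = complex.Im (fourier_rV phi xi).
  rewrite Im_fourier_rV /fsin -(RintegralN measurableT (iphi xi)).
  by apply: eq_Rintegral => x _; rewrite mulrN.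
by case: (fourier_rV phi xi) => a b /=; rewrite mul0r addr0.
Qed.

Section eps.
Variable eps : R.
Hypothesis eps0 : 0 < eps.

(** A regularization of Sigma: up to a factor it is the convolution with a
Gaussian of variance eps, and it tends to a multiple of Sigma as eps does to 0. *)
Definition smoothed (z : rV) : R := \int[leb n]_xi (Sigma (xi + z) * ghat eps xi).

Let M0 : 0 <= M. Proof. exact: le_trans (SM 0). Qed.

Let rint_S (z : rV) : rint (leb n) setT (fun xi => Sigma (xi + z) * ghat eps xi) /\
  exists C : R, forall xi, `|Sigma (xi + z) * ghat eps xi| <= C * cauchyw xi.
Proof.
have [C CP] := ghat_dominated n eps0.
have c : continuous (fun xi : rV => Sigma (xi + z) * ghat eps xi).
  by apply: contM; [apply: (contcomp cS); exact: continuous_addr|exact: continuous_ghat].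
have b xi : `|Sigma (xi + z) * ghat eps xi| <= M * C * cauchyw xi.
  by rewrite normrM -mulrA ler_pM.
by split; [exact: rint_rV b|exists (M * C)].
Qed.

Let cont_S (z : rV) : continuous (fun xi : rV => Sigma (xi + z) * ghat eps xi).
Proof. by apply: contM; [apply: (contcomp cS); exact: continuous_addr|exact: continuous_ghat]. Qed.

Let smoothedD z : rint (leb n) setT (fun xi => Sigma xi * ghat eps (z + xi)) /\
  \int[leb n]_xi (Sigma xi * ghat eps (z + xi)) = smoothed (- z).
Proof.
have [_ [C CP]] := rint_S (- z).
have [h1 h2] := rV_translate z (cont_S (z := - z)) CP.
have E xi : Sigma xi * ghat eps (z + xi) = Sigma (xi + z - z) * ghat eps (xi + z).
  by rewrite addrK [z + xi]addrC.
split; first by apply: (rint_ext measurableT _ h1) => xi _; rewrite E.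
by rewrite /smoothed -h2; apply: eq_Rintegral => xi _; rewrite E.
Qed.

Let smoothedB z : rint (leb n) setT (fun xi => Sigma xi * ghat eps (z - xi)) /\
  \int[leb n]_xi (Sigma xi * ghat eps (z - xi)) = smoothed z.
Proof.
have [h1 h2] := smoothedD (- z); rewrite opprK in h2.
have E xi : Sigma xi * ghat eps (z - xi) = Sigma xi * ghat eps (- z + xi).
  by rewrite -ghatN opprB [xi - z]addrC.
split; first by apply: (rint_ext measurableT _ h1) => xi _; rewrite E.
by rewrite -h2; apply: eq_Rintegral => xi _; rewrite E.
Qed.

Section sums.
Variables (J : finType) (al th : J -> R) (z : J -> rV).

Definition gsum (x : rV) : R := \sum_j al j * gtrig eps (z j) (th j) x.

Lemma gsum_polyspan : polyspan (@gauss_class R eps n) gsum.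
Proof.
apply: (polyspan_sum _ (f0 := gtrig eps 0 0)); first exact: polyspan_gtrig.
by move=> j; apply: polyspanZ; exact: polyspan_gtrig.
Qed.

Lemma gsum_cos xi : rint (leb n) setT (fun x => gsum x * cos (dotr xi x)) /\
  fcos gsum xi = \sum_j al j * cos (th j) / 2 * (ghat eps (z j + xi) + ghat eps (z j - xi)).
Proof.
have E x : gsum x * cos (dotr xi x) = \sum_j al j * (gtrig eps (z j) (th j) x * cos (dotr xi x)).
  by rewrite mulr_suml; apply: eq_bigr => j _; rewrite mulrA.
have ij j : rint (leb n) setT (fun x => al j * (gtrig eps (z j) (th j) x * cos (dotr xi x))).
  by apply: (rintZ measurableT); exact: (gtrig_cos eps0 (z j) xi (th j)).1.
split; first by apply: (rint_ext measurableT _ (rint_sum measurableT ij)) => x _; rewrite E.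
rewrite /fcos; under eq_Rintegral do rewrite E.
rewrite (Rintegral_sum measurableT ij); apply: eq_bigr => j _.
have [h1 h2] := gtrig_cos eps0 (z j) xi (th j).
by rewrite (RintegralZl _ measurableT h1) h2; ring.
Qed.

Lemma gsum_sin xi : rint (leb n) setT (fun x => gsum x * sin (dotr xi x)) /\
  fsin gsum xi = \sum_j al j * sin (th j) / 2 * (ghat eps (z j + xi) - ghat eps (z j - xi)).
Proof.
have E x : gsum x * sin (dotr xi x) = \sum_j al j * (gtrig eps (z j) (th j) x * sin (dotr xi x)).
  by rewrite mulr_suml; apply: eq_bigr => j _; rewrite mulrA.
have ij j : rint (leb n) setT (fun x => al j * (gtrig eps (z j) (th j) x * sin (dotr xi x))).
  by apply: (rintZ measurableT); exact: (gtrig_sin eps0 (z j) xi (th j)).1.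
split; first by apply: (rint_ext measurableT _ (rint_sum measurableT ij)) => x _; rewrite E.
rewrite /fsin; under eq_Rintegral do rewrite E.
rewrite (Rintegral_sum measurableT ij); apply: eq_bigr => j _.
have [h1 h2] := gtrig_sin eps0 (z j) xi (th j).
by rewrite (RintegralZl _ measurableT h1) h2; ring.
Qed.

Lemma Re_gsum : rint (leb n) setT (fun xi => Sigma xi * fcos gsum xi) /\
  complex.Re (fourier_dist Sigma gsum) =
  \sum_j al j * cos (th j) / 2 * (smoothed (- z j) + smoothed (z j)).
Proof.
have E xi : Sigma xi * fcos gsum xi = \sum_j al j * cos (th j) / 2 *
    (Sigma xi * ghat eps (z j + xi) + Sigma xi * ghat eps (z j - xi)).
  by have [_ ->] := gsum_cos xi; rewrite mulr_sumr; apply: eq_bigr => j _; ring.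
have ij j := rintD measurableT (smoothedD (z j)).1 (smoothedB (z j)).1.
have iJ j := rintZ measurableT (al j * cos (th j) / 2) (ij j).
split; first by apply: (rint_ext measurableT _ (rint_sum measurableT iJ)) => x _; rewrite E.
rewrite Re_fourier_dist; under eq_Rintegral do rewrite E.
rewrite (Rintegral_sum measurableT iJ); apply: eq_bigr => j _.
rewrite (RintegralZl _ measurableT (ij j)).
rewrite (RintegralD measurableT (smoothedD (z j)).1 (smoothedB (z j)).1).
by rewrite (smoothedD (z j)).2 (smoothedB (z j)).2.
Qed.

Lemma Im_gsum : rint (leb n) setT (fun xi => Sigma xi * - fsin gsum xi) /\
  complex.Im (fourier_dist Sigma gsum) =
  \sum_j al j * sin (th j) / 2 * (smoothed (z j) - smoothed (- z j)).
Proof.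
have E xi : Sigma xi * - fsin gsum xi = \sum_j al j * sin (th j) / 2 *
    (Sigma xi * ghat eps (z j - xi) - Sigma xi * ghat eps (z j + xi)).
  have [_ ->] := gsum_sin xi; rewrite -sumrN mulr_sumr; apply: eq_bigr => j _; ring.
have ij j := rintB measurableT (smoothedB (z j)).1 (smoothedD (z j)).1.
have iJ j := rintZ measurableT (al j * sin (th j) / 2) (ij j).
split; first by apply: (rint_ext measurableT _ (rint_sum measurableT iJ)) => x _; rewrite E.
rewrite Im_fourier_dist; last by move=> xi; exact: (gsum_sin xi).1.
under eq_Rintegral do rewrite E.
rewrite (Rintegral_sum measurableT iJ); apply: eq_bigr => j _.
rewrite (RintegralZl _ measurableT (ij j)).
rewrite (RintegralB measurableT (smoothedB (z j)).1 (smoothedD (z j)).1).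
by rewrite (smoothedD (z j)).2 (smoothedB (z j)).2.
Qed.

(** The transform of a nonnegative Gaussian sum, evaluated through its explicit
transform. *)
Lemma gsum_ge0 : (forall x, 0 <= gsum x) ->
  0 <= complex.Re (fourier_dist Sigma gsum) /\ complex.Im (fourier_dist Sigma gsum) = 0.
Proof.
move=> g0; have := S_ge0 (polyspan_gauss_schwartz eps0 gsum_polyspan) g0.
by rewrite lecE/= => /andP[/eqP -> ?].
Qed.

End sums.

(** Positivity of the transform against G (1 + sin (z . x)) >= 0. *)
Lemma smoothedN z : smoothed (- z) = smoothed z.
Proof.
pose al (b : bool) : R := 1; pose th (b : bool) : R := if b then 0 else - (pi / 2).
pose zz (b : bool) : rV := if b then 0 else z.
have [] := @gsum_ge0 bool al th zz.
  move=> x; rewrite /gsum big_bool /gtrig /al /th /zz/= /dotr big1 => [|i _]; last by rewrite mxE mul0r.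
  rewrite addr0 cos0 !mul1r -mulrDr mulr_ge0// ?(ltW (gaussV_gt0 _ _))//.
move=> _; have [_ ->] := @Im_gsum bool al th zz.
rewrite big_bool /al /th /zz/= sin0 sinN sin_pihalf; lra.
Qed.

Section square.
Variables (I : finType) (a : I -> R) (x : I -> rV).

Let al (p : I * I) := a p.1 * a p.2.
Let z (p : I * I) := x p.1 - x p.2.

Definition trig_square (y : rV) : R :=
  (\sum_i a i * cos (dotr (x i) y)) ^+ 2 + (\sum_i a i * sin (dotr (x i) y)) ^+ 2.

Lemma trig_squareE y : trig_square y = \sum_(p : I * I) al p * cos (dotr (z p) y).
Proof.
rewrite -(pair_bigA _ (fun i j => al (i, j) * cos (dotr (z (i, j)) y)))/=.
rewrite /trig_square !expr2 !big_distrlr -big_split/=; apply: eq_bigr => i _.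
rewrite -big_split/=; apply: eq_bigr => j _.
by rewrite /al /z/= dotrDl dotrNl cosB; ring.
Qed.

Lemma gsum_square y : gsum al (fun=> 0) z y = gaussV eps y * trig_square y.
Proof.
rewrite trig_squareE mulr_sumr; apply: eq_bigr => p _.
by rewrite /gtrig addr0; ring.
Qed.

Lemma gsum_square_ge0 y : 0 <= gsum al (fun=> 0) z y.
Proof. by rewrite gsum_square mulr_ge0 ?addr_ge0 ?sqr_ge0// ltW// gaussV_gt0. Qed.

Lemma Re_gsum_square : complex.Re (fourier_dist Sigma (gsum al (fun=> 0) z)) =
  \sum_(p : I * I) a p.1 * a p.2 * smoothed (x p.1 - x p.2).
Proof.
have [_ ->] := Re_gsum al (fun=> 0) z; apply: eq_bigr => p _.
by rewrite smoothedN cos0 /al /z; field.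
Qed.

Lemma smoothed_pd : 0 <= \sum_(p : I * I) a p.1 * a p.2 * smoothed (x p.1 - x p.2).
Proof. by rewrite -Re_gsum_square; have [] := gsum_ge0 gsum_square_ge0. Qed.

End square.
End eps.

Section vanishing_width.
Notation gmass := (\int[leb n]_y gaussV 1 (y : rV)).

Definition rescaled (s : R) (z : rV) : R := \int[leb n]_y (Sigma (s *: y + z) * gaussV 1 y).

Lemma rint_gaussV : rint (leb n) setT (fun y : rV => gaussV 1 y).
Proof.
have := rint_gtrig (@ltr01 R) (0 : rV) 0; apply: rint_ext => // y _.
by rewrite /gtrig /dotr big1 ?addr0 ?cos0 ?mulr1// => i _; rewrite mxE mul0r.
Qed.

Lemma gmass_gt0 : 0 < gmass.
Proof.
have := gtrig_fourier (@ltr01 R) (0 : rV) 0; rewrite cos0 mulr1.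
have -> : \int[leb n]_x gtrig 1 0 0 x = gmass.
  by apply: eq_Rintegral => y _; rewrite /gtrig /dotr big1 ?addr0 ?cos0 ?mulr1// => i _; rewrite mxE mul0r.
by move=> ->; exact: ghat_gt0.
Qed.

Let cont_R s z : continuous (fun y : rV => Sigma (s *: y + z) * gaussV 1 y).
Proof.
by apply: contM; [apply: (contcomp cS); exact: continuous_affine|exact: continuous_gaussV].
Qed.

Let bound_R s z y : `|Sigma (s *: y + z) * gaussV 1 y| <= M * gaussV 1 y.
Proof. by rewrite normrM (gtr0_norm (gaussV_gt0 _ _)) ler_wpM2r// ltW// gaussV_gt0. Qed.

Lemma smoothed_rescaled s z : 0 < s ->
  smoothed (s ^+ 2) z = (s * gauss_mass (s ^+ 2)) ^+ n * rescaled s z.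
Proof.
move=> s0; have e0 : 0 < s ^+ 2 by rewrite exprn_gt0.
have M0 : 0 <= M := le_trans (normr_ge0 _) (SM 0).
have [C CP] := ghat_dominated n e0.
have c : continuous (fun xi : rV => Sigma (xi + z) * ghat (s ^+ 2) xi).
  by apply: contM; [apply: (contcomp cS); exact: continuous_addr|exact: continuous_ghat].
have b (xi : rV) : `|Sigma (xi + z) * ghat (s ^+ 2) xi| <= M * C * cauchyw xi.
  by rewrite normrM -mulrA ler_pM.
have [_] := rV_affine 0 s0 c b; rewrite -/(smoothed _ z) => <-.
rewrite exprMn -mulrA; congr (_ * _).
have iR : rint (leb n) setT (fun y => Sigma (s *: y + z) * gaussV 1 y).
  apply: (rint_le measurableT (measurable_rV (@cont_R s z)) (rintZ measurableT M rint_gaussV)).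
  by move=> y _; exact: bound_R.
rewrite -(RintegralZl _ measurableT iR); apply: eq_Rintegral => y _.
rewrite addr0 [RHS]mulrCA; congr (_ * _).
rewrite /ghat /gaussV; congr (_ * expR (- _)).
by rewrite dotrZr dotrC dotrZr; field; rewrite gt_eqF.
Qed.

Lemma rescaled0 z : rescaled 0 z = Sigma z * gmass.
Proof.
rewrite -(RintegralZl _ measurableT rint_gaussV); apply: eq_Rintegral => y _.
by rewrite scale0r add0r.
Qed.

Lemma rescaled_continuous z : {for 0, continuous (fun s : R => rescaled s z)}.
Proof.
have := @continuity_under_integral R _ _ (leb n) (fun s y => Sigma (s *: y + z) * gaussV 1 y) setT
  measurableT (-1) 1 _ _ (fun y => M * gaussV 1 y) (rintZ measurableT M rint_gaussV) _.
move=> F; have : {in `]-1, 1[%classic, continuous (fun s : R => rescaled s z)}.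
  apply: F.
  - move=> s _; apply: (rint_le measurableT (measurable_rV (@cont_R s z)) (rintZ measurableT M rint_gaussV)).
    by move=> y _; exact: bound_R.
  - apply: aeW => y _ s _.
    have c : continuous (fun s : R => Sigma (s *: y + z) * gaussV 1 y).
      apply: contM; last exact: contcst.
      apply: (contcomp cS (k := fun s : R => s *: y + z)).
      apply: continuous_rV => i; under eq_fun do rewrite !mxE.
      apply: contD; last exact: contcst.
      by apply: contM; [move=> ?; exact: cvg_id|exact: contcst].
    exact: c.
  - by move=> s _; apply: aeW => y _; exact: bound_R.
by apply; rewrite inE/= in_itv/= ltr01 oppr_lt0 ltr01.
Qed.

Lemma Sigma_even z : Sigma (- z) = Sigma z.
Proof.
have g0 := gmass_gt0.
suff : (Sigma (- z) - Sigma z) * gmass = 0.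
  by move/eqP; rewrite mulf_eq0 (gt_eqF g0) orbF subr_eq0 => /eqP.
rewrite mulrBl -!rescaled0.
have c : {for 0, continuous (fun s : R => rescaled s (- z) - rescaled s z)}.
  by apply: cvgB; exact: rescaled_continuous.
have E (s : R) : 0 < s -> rescaled s (- z) - rescaled s z = 0.
  move=> s0; have e0 : 0 < s ^+ 2 by rewrite exprn_gt0.
  have := smoothedN e0 z; rewrite !smoothed_rescaled// => /mulfI ->; first by rewrite subrr.
  by rewrite expf_neq0// mulf_neq0 ?gt_eqF// gauss_mass_gt0.
have l : (rescaled s (- z) - rescaled s z) @[s --> 0^'+] --> rescaled 0 (- z) - rescaled 0 z.
  by apply: cvg_at_right_filter; exact: c.
have l0 : (rescaled s (- z) - rescaled s z) @[s --> 0^'+] --> (0 : R).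
  apply: cvg_near_cst; near=> s; apply: E; near: s; exact: nbhs_right_gt.
by apply: (cvg_unique _ l l0).
Unshelve. all: by end_near.
Qed.

(** Bochner: the squared modulus of sum_i a_i e^(i x_i . xi), weighted by a
Gaussian, is a nonnegative test function whose pairing with Sigma^ is the
quadratic form of the regularization of Sigma; let the Gaussian spread. *)
Lemma Sigma_pd (I : finType) (a : I -> R) (x : I -> rV) :
  0 <= \sum_(p : I * I) a p.1 * a p.2 * Sigma (x p.1 - x p.2).
Proof.
have g0 := gmass_gt0; rewrite -(pmulr_lge0 _ g0).
pose F s := \sum_(p : I * I) a p.1 * a p.2 * rescaled s (x p.1 - x p.2).
have -> : (\sum_(p : I * I) a p.1 * a p.2 * Sigma (x p.1 - x p.2)) * gmass = F 0.
  by rewrite mulr_suml; apply: eq_bigr => p _; rewrite rescaled0; ring.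
have c : F s @[s --> 0^'+] --> F 0.
  apply: cvg_at_right_filter; apply: cvg_sumr => p; apply: cvgM; first exact: cvg_cst.
  exact: rescaled_continuous.
apply: (cvgr_to_ge c); near=> s.
have s0 : 0 < s by near: s; exact: nbhs_right_gt.
have e0 : 0 < s ^+ 2 by rewrite exprn_gt0.
have k0 : 0 < (s * gauss_mass (s ^+ 2)) ^+ n by rewrite exprn_gt0// mulr_gt0// gauss_mass_gt0.
rewrite -(pmulr_rge0 _ k0); have := smoothed_pd e0 a x; congr (_ <= _).
by rewrite mulr_sumr; apply: eq_bigr => p _; rewrite smoothed_rescaled//; ring.
Unshelve. all: by end_near.
Qed.

End vanishing_width.
End positive_definite.

(** * Independence of translates *)

Section schwartz_lin.
Context {R : realType} (n : nat).
Notation leb := (@lebesgue_rV R).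
Notation rV := 'rV[R]_n.

Lemma Rintegral_nonint d (T : measurableType d) (m : {measure set T -> \bar R}) (g : T -> R) :
  measurable_fun setT g -> ~ rint m setT g -> \int[m]_x g x = 0.
Proof.
move=> mg ng; apply: contrapT => g0; apply: ng.
have fg : (\int[m]_x (g x)%:E)%E \is a fin_num.
  by apply: contrapT => /negP nf; apply: g0; rewrite /Rintegral; move: nf; case: (\int[m]_x _)%E.
apply/integrableP; split; first exact/measurable_EFinP.
rewrite /= (eq_integral (fun x => (funepos (EFin \o g) x + funeneg (EFin \o g) x)%E)); last first.
  move=> x _; have -> : `|g x|%:E = (abse \o (EFin \o g)) x by [].
  by rewrite fune_abse.
move: fg; rewrite integralE fin_numB => /andP[fp fn].
have mE : measurable_fun setT (EFin \o g) by exact/measurable_EFinP.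
rewrite ge0_integralD//; last 2 first.
- exact: measurable_funepos.
- exact: measurable_funeneg.
by rewrite lte_add_pinfty// ltey_eq ?fp ?fn.
Qed.

Lemma smooth_derivable (f : rV -> R) s x i : smooth f -> derivable (pderiv s f) x (basis_rV i).
Proof. by move=> sf; have [_] := sf (size s).+1; apply. Qed.

Lemma smooth_continuous (f : rV -> R) s : smooth f -> continuous (pderiv s f).
Proof. by move=> sf; have [+ _] := sf (size s); apply. Qed.

Lemma pderiv_lin (f g : rV -> R) (k l : R) s : smooth f -> smooth g ->
  pderiv s (fun x => k * f x + l * g x) = (fun x => k * pderiv s f x + l * pderiv s g x).
Proof.
move=> sf sg; elim: s => [//|i s IH] /=; rewrite IH; apply/funext => x.
have df := derivableP (@smooth_derivable f s x i sf).
have dg := derivableP (@smooth_derivable g s x i sg).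
by have [_ ->] := is_deriveD (is_deriveZ k df) (is_deriveZ l dg).
Qed.

Lemma schwartz_lin (f g : rV -> R) (k l : R) : schwartz f -> schwartz g ->
  schwartz (fun x => k * f x + l * g x).
Proof.
move=> [sf bf] [sg bg]; split=> [m|s m].
  split=> [s _|s _ x i]; rewrite pderiv_lin//.
    by apply: contD; apply: contM; (try exact: contcst); exact: smooth_continuous.
  have df := derivableP (@smooth_derivable f s x i sf).
  have dg := derivableP (@smooth_derivable g s x i sg).
  by have [] := is_deriveD (is_deriveZ k df) (is_deriveZ l dg).
have [C CP] := bf s m; have [D DP] := bg s m.
exists (`|k| * C + `|l| * D) => x; rewrite pderiv_lin//.
apply: (@le_trans _ _ (`|k| * (enorm x ^+ m * `|pderiv s f x|) + `|l| * (enorm x ^+ m * `|pderiv s g x|))).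
  rewrite [X in _ <= X + _]mulrCA [X in _ <= _ + X]mulrCA -mulrDr ler_wpM2l ?exprn_ge0 ?enorm_ge0//.
  by rewrite -!normrM ler_normD.
by apply: lerD; rewrite ler_wpM2l.
Qed.

Lemma pderiv_out (f : rV -> R) (O : set rV) s : open O -> (forall x, O x -> f x = 0) ->
  forall x, O x -> pderiv s f x = 0.
Proof.
move=> oO f0; elim: s => [//|i s IH] x Ox /=.
have : is_derive x (basis_rV i) (pderiv s f) 0.
  apply: (@near_eq_is_derive _ _ _ (cst 0)).
  have : nbhs x O by apply: open_nbhs_nbhs.
  by apply: filterS => y Oy; rewrite IH.
by case.
Qed.

Lemma test_box (U : set rV) (f : rV -> R) : test_function U f ->
  exists r : R, forall s x, ~ box 0 r x -> pderiv s f x = 0.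
Proof.
move=> [sf cf _].
have /compact_bounded[M [_ MP]] := cf.
exists (M + 1) => s x xb; apply: (@pderiv_out f (~` closure [set x | f x != 0])).
- by apply: closed_openC; exact: closed_closure.
- move=> y yc; apply: contrapT => /eqP fy; apply: yc; exact: subset_closure.
- move=> xc; apply: xb => j; rewrite mxE subr0.
  apply: (le_trans (coord_le_norm _ _)); apply: MP => //; lra.
Qed.

Lemma continuous_enorm : continuous (@enorm R n).
Proof.
apply: (contcomp (@sqrt_continuous R)); apply: continuous_sum => i.
by apply: contM; exact: continuous_coord.
Qed.

Lemma test_schwartz (U : set rV) (f : rV -> R) : test_function U f -> schwartz f.
Proof.
move=> tf; have [r rP] := test_box tf; have [sf _ _] := tf; split => // s m.
have c : continuous (fun x => enorm x ^+ m * `|pderiv s f x|).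
  apply: contM; last by apply: (contcomp (@norm_continuous R R)); exact: smooth_continuous.
  apply: (contcomp (h := fun u : R => u ^+ m)); last exact: continuous_enorm.
  by move=> u; exact: exprn_continuous.
have [x xb|M _ MP] := @box_bounded R n _ 0 r c; first by rewrite rP// normr0 mulr0.
by exists M => x; exact: le_trans (ler_norm _) (MP x).
Qed.

Section test.
Variables (U : set rV) (psi : rV -> R).
Hypothesis tpsi : test_function U psi.

Let cpsi : continuous psi. Proof. by have [/(@smooth_continuous _ [::])] := tpsi. Qed.

Lemma rint_test (g : rV -> R) : continuous g -> rint (leb n) setT (fun x => psi x * g x).
Proof.
move=> cg; have [r rP] := test_box tpsi.
apply: (@rint_box R n _ 0 r); first exact: contM.
by move=> x xb; rewrite (rP [::] x xb : psi x = 0) mul0r.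
Qed.

Lemma test_bounded : exists2 M : R, 0 < M & forall x, `|psi x| <= M.
Proof.
have [r rP] := test_box tpsi.
by apply: (box_bounded cpsi) => x; exact: (rP [::]).
Qed.

Lemma trig_transform_continuous (h : R -> R) : continuous h ->
  (forall a b, `|h a - h b| <= `|a - b|) ->
  continuous (fun xi : rV => \int[leb n]_x (psi x * h (dotr xi x))).
Proof.
move=> ch hl.
have ci (xi : rV) : continuous (fun x : rV => h (dotr xi x)).
  by apply: (contcomp ch); exact: continuous_dotr.
have [r rP] := test_box tpsi.
have inn : rint (leb n) setT (fun x => `|psi x| * `|x|).
  apply: (@rint_box R n _ 0 r).
    by apply: contM; [apply: (contcomp (@norm_continuous R R)); exact: cpsi|exact: norm_continuous].
  by move=> x xb; rewrite (rP [::] x xb : psi x = 0) normr0 mul0r.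
pose K := \int[leb n]_x (`|psi x| * `|x|).
have K0 : 0 <= K by apply: Rintegral_ge0 => x _; exact: mulr_ge0.
have lip (xi eta : rV) : `|(\int[leb n]_x (psi x * h (dotr xi x))) - \int[leb n]_x (psi x * h (dotr eta x))|
    <= n%:R * `|xi - eta| * K.
  rewrite -(RintegralB measurableT (rint_test (ci xi)) (rint_test (ci eta))).
  rewrite -(RintegralZl _ measurableT inn).
  apply: (Rintegral_norm_le measurableT (rintB measurableT (rint_test (ci xi)) (rint_test (ci eta)))
    (rintZ measurableT _ inn)) => x _.
  rewrite -mulrBr normrM mulrCA ler_wpM2l//; apply: (le_trans (hl _ _)).
  by rewrite -mulrA (_ : _ - _ = dotr (xi - eta) x) ?dotr_le// dotrDl dotrNl.
move=> xi; apply: near_cont => e e0.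
have p : 0 < n%:R * K + 1 by rewrite ltr_wpDl// mulr_ge0.
near=> eta; apply: (le_trans (lip _ _)).
rewrite mulrAC; apply: (@le_trans _ _ ((n%:R * K + 1) * `|xi - eta|)).
  by rewrite ler_wpM2r// lerDl.
rewrite mulrC -ler_pdivlMr//; near: eta; apply/nbhs_ballP.
exists (e / (n%:R * K + 1)) => /=; first by rewrite divr_gt0.
by move=> eta; rewrite mx_norm_ball /ball_/= => /ltW.
Unshelve. all: by end_near.
Qed.

Lemma continuous_fcos : continuous (fcos psi).
Proof. by apply: trig_transform_continuous; [exact: continuous_cos|exact: cos_lipschitz]. Qed.

Lemma continuous_fsin : continuous (fsin psi).
Proof.
apply: trig_transform_continuous; first exact: continuous_sin.
move=> a b; rewrite -!cosBpihalf; apply: (le_trans (cos_lipschitz _ _)).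
by rewrite opprB addrA subrK.
Qed.

End test.
End schwartz_lin.

Section characteristic.
Context {R : realType} (n : nat).
Notation leb := (@lebesgue_rV R).
Notation rV := 'rV[R]_n.
Variables (Sigma : rV -> R) (M : R).
Hypothesis cS : continuous Sigma.
Hypothesis SM : forall x, `|Sigma x| <= M.
Hypothesis S_ge0 : dist_ge0 (fourier_dist Sigma).
Hypothesis S_supp : dist_supp (fourier_dist Sigma) = setT.

Variables (I : finType) (a : I -> R) (x : I -> rV).
Hypothesis aS0 : forall y, \sum_i a i * Sigma (y - x i) = 0.

Let al (p : I * I) := a p.1 * a p.2.
Let z (p : I * I) := x p.1 - x p.2.
Let phi := gsum 1 al (fun=> 0) z.

Let Re_phi : complex.Re (fourier_dist Sigma phi) = 0.
Proof.
rewrite (Re_gsum_square cS SM S_ge0 (@ltr01 R) a x).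
have i1 (y : rV) : rint (leb n) setT (fun xi => Sigma (xi + y) * ghat 1 xi).
  have [C CP] := ghat_dominated n (@ltr01 R).
  apply: (@rint_rV R n _ (M * C)).
    by apply: contM; [apply: (contcomp cS); exact: continuous_addr|exact: continuous_ghat].
  move=> xi; rewrite normrM -mulrA ler_pM//.
have i2 (p : I * I) : rint (leb n) setT (fun xi => al p * (Sigma (xi + z p) * ghat 1 xi)).
  exact: (rintZ measurableT).
transitivity (\int[leb n]_xi \sum_(p : I * I) al p * (Sigma (xi + z p) * ghat 1 xi)).
  rewrite (Rintegral_sum measurableT i2); apply: eq_bigr => p _.
  by rewrite (RintegralZl _ measurableT (i1 _)).
transitivity (\int[leb n]_(xi in [set: rV]) (0 : R)); last by rewrite /Rintegral integral0.
apply: eq_Rintegral => xi _.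
rewrite -(pair_bigA _ (fun i j => al (i, j) * (Sigma (xi + z (i, j)) * ghat 1 xi)))/=.
rewrite big1// => i _.
transitivity (a i * ghat 1 xi * \sum_j a j * Sigma (xi + x i - x j)); last by rewrite aS0 mulr0.
by rewrite mulr_sumr; apply: eq_bigr => j _; rewrite /al /z/= addrA; ring.
Qed.

Let Im_phi : complex.Im (fourier_dist Sigma phi) = 0.
Proof.
by have [] := gsum_ge0 S_ge0 (@ltr01 R) (gsum_square_ge0 1 a x).
Qed.

Let schwartz_phi : schwartz phi.
Proof. by apply: (polyspan_gauss_schwartz (@ltr01 R)); exact: gsum_polyspan. Qed.

Let rint_cos xi : rint (leb n) setT (fun y => phi y * cos (dotr xi y)).
Proof. exact: (gsum_cos (@ltr01 R) al (fun=> 0) z xi).1. Qed.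

Let rint_sin xi : rint (leb n) setT (fun y => phi y * sin (dotr xi y)).
Proof. exact: (gsum_sin (@ltr01 R) al (fun=> 0) z xi).1. Qed.

(** A test function dominated by phi is annihilated, since both C phi + psi and
C phi - psi are nonnegative and phi itself is annihilated. *)
Lemma dominated_annihilated (U : set rV) (psi : rV -> R) (C : R) : test_function U psi ->
  (forall y, `|psi y| <= C * phi y) -> fourier_dist Sigma psi = 0.
Proof.
move=> tpsi psiC.
have T_ge0 (l : R) : `|l| = 1 -> 0 <= fourier_dist Sigma (fun y => C * phi y + l * psi y).
  move=> l1; apply: S_ge0; first exact: schwartz_lin schwartz_phi (test_schwartz tpsi).
  move=> y; have := psiC y; have : `|l * psi y| = `|psi y| by rewrite normrM l1 mul1r.
  by move=> <-; rewrite ler_norml => /andP[? _]; lra.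
have T_parts l : `|l| = 1 -> 0 <= complex.Re (fourier_dist Sigma (fun y => C * phi y + l * psi y)) /\
    complex.Im (fourier_dist Sigma (fun y => C * phi y + l * psi y)) = 0.
  by move=> /T_ge0; rewrite lecE => /andP[/eqP h1 h2].
have iC xi : rint (leb n) setT (fun y => psi y * cos (dotr xi y)).
  by apply: (rint_test tpsi); apply: (contcomp (@continuous_cos R)); exact: continuous_dotr.
have iS xi : rint (leb n) setT (fun y => psi y * sin (dotr xi y)).
  by apply: (rint_test tpsi); apply: (contcomp (@continuous_sin R)); exact: continuous_dotr.
have fcosE l xi : fcos (fun y => C * phi y + l * psi y) xi = C * fcos phi xi + l * fcos psi xi.
  have i1 := rintZ measurableT C (rint_cos xi); have i2 := rintZ measurableT l (iC xi).
  rewrite /fcos -(RintegralZl _ measurableT (rint_cos xi)) -(RintegralZl _ measurableT (iC xi)).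
  rewrite -(RintegralD measurableT i1 i2); apply: eq_Rintegral => y _; ring.
have fsinE l xi : rint (leb n) setT (fun y => (C * phi y + l * psi y) * sin (dotr xi y)) /\
    fsin (fun y => C * phi y + l * psi y) xi = C * fsin phi xi + l * fsin psi xi.
  have i1 := rintZ measurableT C (rint_sin xi); have i2 := rintZ measurableT l (iS xi).
  split; first by apply: (rint_ext measurableT _ (rintD measurableT i1 i2)) => y _; ring.
  rewrite /fsin -(RintegralZl _ measurableT (rint_sin xi)) -(RintegralZl _ measurableT (iS xi)).
  rewrite -(RintegralD measurableT i1 i2); apply: eq_Rintegral => y _; ring.
have [iR _] := Re_gsum cS SM (@ltr01 R) al (fun=> 0) z.
have [iI _] := Im_gsum cS SM (@ltr01 R) al (fun=> 0) z.
rewrite -/phi in iR iI.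
have Re0 : complex.Re (fourier_dist Sigma psi) = 0.
  have [ip|np] := pselect (rint (leb n) setT (fun xi => Sigma xi * fcos psi xi)); last first.
    have c : continuous (fun xi => Sigma xi * fcos psi xi).
      by apply: contM => //; exact: continuous_fcos tpsi.
    by rewrite Re_fourier_dist; apply: Rintegral_nonint np; exact: (measurable_rV c).
  have E l : complex.Re (fourier_dist Sigma (fun y => C * phi y + l * psi y)) =
      l * complex.Re (fourier_dist Sigma psi).
    have i1 := rintZ measurableT C iR; have i2 := rintZ measurableT l ip.
    have Ephi : \int[leb n]_xi (Sigma xi * fcos phi xi) = 0 by rewrite -Re_fourier_dist.
    rewrite [LHS]Re_fourier_dist [X in l * X]Re_fourier_dist.
    transitivity (\int[leb n]_xi (C * (Sigma xi * fcos phi xi) + l * (Sigma xi * fcos psi xi))).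
      by apply: eq_Rintegral => xi _; rewrite fcosE; ring.
    rewrite (RintegralD measurableT i1 i2) (RintegralZl _ measurableT iR) Ephi mulr0 add0r.
    by rewrite (RintegralZl _ measurableT ip).
  have [h1 _] := T_parts 1 (normr1 _); have [h2 _] := T_parts (-1) (normrN1 _).
  rewrite E mul1r in h1; rewrite E mulN1r oppr_ge0 in h2.
  by apply/eqP; rewrite eq_le h1 h2.
have Im0 : complex.Im (fourier_dist Sigma psi) = 0.
  have [ip|np] := pselect (rint (leb n) setT (fun xi => Sigma xi * - fsin psi xi)); last first.
    have c : continuous (fun xi => Sigma xi * - fsin psi xi).
      by apply: contM => //; apply: contN; exact: continuous_fsin tpsi.
    by rewrite Im_fourier_dist//; apply: Rintegral_nonint np; exact: (measurable_rV c).
  have [_ h] := T_parts 1 (normr1 _).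
  have i1 := rintZ measurableT C iI.
  have E1 := @Im_fourier_dist R n Sigma (fun y => C * phi y + 1 * psi y) (fun xi => (fsinE 1 xi).1).
  have E2 := @Im_fourier_dist R n Sigma phi rint_sin.
  have E3 := @Im_fourier_dist R n Sigma psi iS.
  rewrite Im_phi in E2; rewrite h in E1; rewrite E3.
  transitivity (\int[leb n]_xi (Sigma xi * - fsin (fun y => C * phi y + 1 * psi y) xi)); last by [].
  transitivity (\int[leb n]_xi (C * (Sigma xi * - fsin phi xi) + Sigma xi * - fsin psi xi)); last first.
    by apply: eq_Rintegral => xi _; have [_ ->] := fsinE 1 xi; ring.
  by rewrite (RintegralD measurableT i1 ip) (RintegralZl _ measurableT iI) -E2 mulr0 add0r.
by move: Re0 Im0; case: (fourier_dist Sigma psi) => u v /= -> ->.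
Qed.

Let trig0 xi : trig_square a x xi = 0.
Proof.
apply: contrapT => /eqP t0.
have p0 : 0 < phi xi.
  rewrite /phi (gsum_square 1 a x) mulr_gt0 ?gaussV_gt0//.
  by rewrite lt_neqAle eq_sym t0/= addr_ge0// sqr_ge0.
have cphi : continuous phi.
  exact: polyspan_continuous (@gauss_cont R 1 n) _ (gsum_polyspan _ _ _ _).
pose U := phi @^-1` [set u | phi xi / 2 < u].
have oU : open U by apply: open_comp => [y _|]; [exact: cphi|exact: open_gt].
have Uxi : U xi by rewrite /U/=; lra.
have : dist_supp (fourier_dist Sigma) xi by rewrite S_supp.
move=> /(_ U oU Uxi)[psi tpsi /negP]; apply; apply/eqP.
have [K K0 KP] := test_bounded tpsi; have [_ _ sU] := tpsi.
(* On the support of psi, phi is larger than phi xi / 2. *)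
apply: (dominated_annihilated (C := 2 * K / phi xi) tpsi) => y.
have [->|py] := eqVneq (psi y) 0.
  rewrite normr0 mulr_ge0//; last exact: (gsum_square_ge0 1 a x).
  by rewrite divr_ge0 ?mulr_ge0 ?ltW.
apply: (le_trans (KP y)).
have Uy : phi xi / 2 < phi y by apply: sU; exact: subset_closure.
rewrite mulrAC ler_pdivlMr//.
have : K * phi xi <= 2 * K * phi y by rewrite (mulrC 2) -mulrA ler_pM2l//; lra.
by [].
Qed.

(** With phi the Gaussian times |sum_i a_i e^(i x_i . xi)|^2, Sigma^ pairs to 0
with phi. If phi were positive at xi, every test function supported near xi
would be dominated by a multiple of phi, hence annihilated by Sigma^, although
xi lies in its support. So the trigonometric sum vanishes identically, and
its transform against wider and wider Gaussians isolates the weight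
carried by x0. *)
Lemma translates_independent (x0 : rV) : \sum_(i | x i == x0) a i = 0.
Proof.
have cs xi : \sum_i a i * cos (dotr (x i) xi) = 0 /\ \sum_i a i * sin (dotr (x i) xi) = 0.
  have := trig0 xi; rewrite /trig_square => /eqP; rewrite paddr_eq0 ?sqr_ge0//.
  by rewrite !sqrf_eq0 => /andP[/eqP -> /eqP ->].
(* The Gaussian weight has parameter 1 / (2 (k + 1)), and is translated to x0. *)
have G (k : nat) : \sum_i a i * expR (- dotr (x i - x0) (x i - x0)) ^+ k.+1 = 0.
  pose eps : R := (2 * k.+1%:R)^-1.
  have e0 : 0 < eps by rewrite invr_gt0 mulr_gt0.
  have ij i := rintZ measurableT (a i) (rint_gtrig e0 (x i - x0) 0).
  have : \int[leb n]_xi \sum_i a i * gtrig eps (x i - x0) 0 xi = 0.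
    transitivity (\int[leb n]_(xi in [set: rV]) (0 : R)); last by rewrite /Rintegral integral0.
    apply: eq_Rintegral => xi _; have [c0 s0] := cs xi.
    transitivity (gaussV eps xi * (cos (dotr x0 xi) * (\sum_i a i * cos (dotr (x i) xi)) +
      sin (dotr x0 xi) * (\sum_i a i * sin (dotr (x i) xi)))); last by rewrite c0 s0 !mulr0 addr0 mulr0.
    rewrite !mulr_sumr -big_split mulr_sumr; apply: eq_bigr => i _ /=.
    by rewrite /gtrig addr0 dotrDl dotrNl cosB; ring.
  rewrite (Rintegral_sum measurableT ij).
  have m0 : 0 < gauss_mass eps ^+ n by rewrite exprn_gt0// gauss_mass_gt0.
  move=> h; apply: (mulfI (lt0r_neq0 m0)); rewrite mulr0 -[RHS]h mulr_sumr; apply: eq_bigr => i _.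
  rewrite (RintegralZl _ measurableT (rint_gtrig e0 _ _)) gtrig_fourier// cos0 mulr1 /ghat -expRM_natl.
  rewrite [LHS]mulrCA; congr (_ * (_ * expR _)).
  have K0 : k.+1%:R != 0 :> R by rewrite pnatr_eq0.
  by rewrite /eps mulrN; congr (- _); move: (k.+1%:R) K0 => K K0; field.
have L : \sum_i a i * expR (- dotr (x i - x0) (x i - x0)) ^+ k.+1 @[k --> \oo] -->
    \sum_i a i * (x i == x0)%:R.
  apply: cvg_sumr => i; apply: cvgM; first exact: cvg_cst.
  have [->|xi] := eqVneq (x i) x0.
    rewrite subrr (_ : dotr 0 0 = 0 :> R) ?oppr0 ?expR0; last first.
      by rewrite /dotr big1// => j _; rewrite mxE mul0r.
    by under eq_fun do rewrite expr1n; exact: cvg_cst.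
  have d0 : 0 < dotr (x i - x0) (x i - x0).
    rewrite lt_neqAle dotrr_ge0 andbT; apply: contraNneq xi => d0.
    rewrite -subr_eq0; apply/eqP/rowP => j; rewrite [RHS]mxE; apply/eqP; rewrite -normr_le0.
    by rewrite (le_trans (coord_le_enorm _ _))// /enorm -d0 sqrtr0.
  under eq_fun do rewrite exprS.
  have -> : false%:R = expR (- dotr (x i - x0) (x i - x0)) * 0 :> R by rewrite mulr0.
  apply: cvgM; first exact: cvg_cst.
  apply: cvg_expr; rewrite ger0_norm ?expR_ge0// -expR0 ltr_expR oppr_lt0//.
have : \sum_i a i * expR (- dotr (x i - x0) (x i - x0)) ^+ k.+1 @[k --> \oo] --> (0 : R).
  by under eq_fun do rewrite G; exact: cvg_cst.
move=> /(cvg_unique _ L) E; rewrite -[RHS]E//.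
by rewrite [LHS]big_mkcond/=; apply: eq_bigr => i _; case: eqP; rewrite ?mulr1 ?mulr0.
Qed.

End characteristic.

(** * Positive definite kernels and the memory integral *)

Section linear.
Context {R : realType}.
Notation mu := (@lebesgue_measure R).

Lemma RintB f g a b : rint mu `[a, b] f -> rint mu `[a, b] g ->
  \int[mu]_(x in `[a, b]) (f x - g x) = \int[mu]_(x in `[a, b]) f x - \int[mu]_(x in `[a, b]) g x.
Proof. by move=> i1 i2; rewrite RintegralB. Qed.

Lemma RintZ k f a b : rint mu `[a, b] f ->
  \int[mu]_(x in `[a, b]) (k * f x) = k * \int[mu]_(x in `[a, b]) f x.
Proof. by move=> i1; rewrite RintegralZl. Qed.

End linear.

Section kernels.
Context {R : realType}.
Notation mu := (@lebesgue_measure R).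
Implicit Types K L F : R -> R -> R.

Definition pdkernel K := forall (I : finType) (a t : I -> R),
  0 <= \sum_(p : I * I) a p.1 * a p.2 * K (t p.1) (t p.2).

Lemma pdkernel_mul (u : R -> R) K : pdkernel K -> pdkernel (fun t s => u t * u s * K t s).
Proof.
move=> pK I a t; have := pK I (fun i => a i * u (t i)) t; congr (_ <= _).
by apply: eq_bigr => p _; ring.
Qed.

Lemma pdkernelD K L : pdkernel K -> pdkernel L -> pdkernel (fun t s => K t s + L t s).
Proof.
move=> pK pL I a t; have := addr_ge0 (pK I a t) (pL I a t); congr (_ <= _).
by rewrite -big_split; apply: eq_bigr => p _ /=; rewrite mulrDr.
Qed.

Section mixed_derivative.
Variables K K1 L : R -> R -> R.
Hypothesis dK : forall t s, is_derive t (1 : R) (K ^~ s) (K1 t s).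
Hypothesis dK1 : forall t s, is_derive s (1 : R) (K1 t) (L t s).
Hypothesis cL : jcont L.

Let D (h : R) (x y : R) := (K (x + h) (y + h) - K (x + h) y) - (K x (y + h) - K x y).

Lemma mixed_difference_cvg x y : D h x y / h ^+ 2 @[h --> 0^'+] --> L x y.
Proof.
apply/cvgrPdist_le => e e0.
have := @cont_near R (R * R)%type (fun z => L z.1 z.2) (x, y) e cL e0.
move=> /nbhs_ballP[r /= r0 rP]; near=> h.
have h0 : 0 < h by near: h; exact: nbhs_right_gt.
have hr : h < r by near: h; exact: nbhs_right_lt.
have dg (z : R) : is_derive z (1 : R) (fun z => K z (y + h) - K z y) (K1 z (y + h) - K1 z y).
  exact: is_deriveB.
have cg : continuous (fun z => K z (y + h) - K z y).
  by move=> z; exact: is_derive_continuous (dg z).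
have xh : x <= x + h by rewrite lerDl ltW.
have [xi xiI E1] := @MVT_segment R _ _ x (x + h) xh (fun z _ => dg z) (continuous_subspaceT cg).
have ck : continuous (K1 xi) by move=> z; exact: is_derive_continuous (dK1 xi z).
have yh : y <= y + h by rewrite lerDl ltW.
have [eta etaI E2] := @MVT_segment R _ _ y (y + h) yh (fun z _ => dK1 xi z) (continuous_subspaceT ck).
have -> : D h x y / h ^+ 2 = L xi eta.
  rewrite /D E1 E2 [y + h]addrC [x + h]addrC !addrK.
  by field; rewrite gt_eqF.
move: xiI etaI; rewrite !in_itv/= => /andP[? ?] /andP[? ?].
apply: (rP (xi, eta)); split; rewrite /ball/= ltr_norml; apply/andP; split; lra.
Unshelve. all: by end_near.
Qed.

(** The mixed second differences are symmetric. *)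
Lemma mixed_derivative_sym : (forall t s, K t s = K s t) -> forall t s, L t s = L s t.
Proof.
move=> sK t s; have c1 := @mixed_difference_cvg t s; have c2 := @mixed_difference_cvg s t.
apply: (cvg_unique _ c1); first exact: Rhausdorff.
apply: eq_fcvg c2 => h; rewrite /D; congr (_ / _).
by rewrite (sK (t + h) (s + h)) (sK (t + h) s) (sK t (s + h)) (sK t s); ring.
Qed.

(** Mixed second differences of a positive definite kernel form a positive
definite kernel, and by the mean value theorem they converge to the mixed
derivative. *)
Lemma pdkernel_mixed : pdkernel K -> pdkernel L.
Proof.
move=> pK I a t.
have Dpos h : 0 <= \sum_(p : I * I) a p.1 * a p.2 * D h (t p.1) (t p.2).
  have := pK (I * bool)%type (fun z => (if z.2 then 1 else -1) * a z.1)
    (fun z => if z.2 then t z.1 + h else t z.1).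
  congr (_ <= _).
  rewrite -(pair_bigA _ (fun z w => (if z.2 then 1 else -1) * a z.1 * ((if w.2 then 1 else -1) * a w.1) *
    K (if z.2 then t z.1 + h else t z.1) (if w.2 then t w.1 + h else t w.1)))/=.
  rewrite -(pair_bigA _ (fun i j => a i * a j * D h (t i) (t j)))/=.
  rewrite -(pair_bigA _ (fun i b => \sum_(w : I * bool) (if b then 1 else -1) * a i * ((if w.2 then 1 else -1) * a w.1) *
    K (if b then t i + h else t i) (if w.2 then t w.1 + h else t w.1)))/=.
  apply: eq_bigr => i _; rewrite big_bool/= -big_split/=.
  rewrite -(pair_bigA _ (fun j b => 1 * a i * ((if b then 1 else -1) * a j) *
      K (t i + h) (if b then t j + h else t j) + -1 * a i * ((if b then 1 else -1) * a j) *
      K (t i) (if b then t j + h else t j)))/=.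
  by apply: eq_bigr => j _; rewrite big_bool/= /D; ring.
have c : \sum_(p : I * I) a p.1 * a p.2 * (D h (t p.1) (t p.2) / h ^+ 2) @[h --> 0^'+] -->
    \sum_(p : I * I) a p.1 * a p.2 * L (t p.1) (t p.2).
  by apply: cvg_sumr => p; apply: cvgM; [exact: cvg_cst|exact: mixed_difference_cvg].
apply: (cvgr_to_ge c); near=> h.
rewrite (eq_bigr (fun p : I * I => a p.1 * a p.2 * D h (t p.1) (t p.2) * (h ^+ 2)^-1)); last first.
  by move=> p _; rewrite mulrA.
by rewrite -mulr_suml mulr_ge0// invr_ge0 sqr_ge0.
Unshelve. all: by end_near.
Qed.

End mixed_derivative.

Lemma riemann_sum (g : R -> R) (T e : R) n : 0 <= T -> continuous g ->
  (forall s t, 0 <= s <= T -> 0 <= t <= T -> `|s - t| <= T / n.+1%:R -> `|g s - g t| <= e) ->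
  `|\int[mu]_(t in `[0, T]) g t - \sum_(i < n.+1) g (i%:R * (T / n.+1%:R)) * (T / n.+1%:R)| <= e * T.
Proof.
move=> T0 cg ge; pose h := T / n.+1%:R; rewrite -/h.
have h0 : 0 <= h by rewrite divr_ge0.
have Th : T = 0 + n.+1%:R * h by rewrite add0r /h mulrC divfK.
rewrite {1}Th (Rintegral_itv_lin_sum n.+1 0 h0 cg) -sumrB.
have -> : e * T = \sum_(i < n.+1) e * h.
  by rewrite -mulr_sumr sumr_const card_ord -mulr_natl {1}Th add0r.
 apply: (le_trans (ler_norm_sum _ _ _)); apply: ler_sum => i _.
rewrite !add0r; set a := i%:R * h.
have -> : i.+1%:R * h = a + h by rewrite -natr1 mulrDl mul1r.
have ah : a <= a + h by rewrite lerDl.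
have E : g a * h = \int[mu]_(t in `[a, a + h]) g a by rewrite Rintegral_itv_cst// addrAC subrr add0r.
rewrite E -(RintB (rint_itv _ _ cg) (rint_cst _ _ _)).
rewrite [X in _ <= _ * X](_ : h = a + h - a); last by rewrite addrAC subrr add0r.
apply: Rintegral_itv_bound => //.
  by apply: rintB => //; [exact: rint_itv|exact: rint_cst].
have a0 : 0 <= a by rewrite mulr_ge0.
have aT : a + h <= T.
  rewrite Th add0r /a -[X in _ + X]mul1r -mulrDl ler_wpM2r// natr1 ler_nat; exact: ltn_ord.
move=> t /andP[at1 at2]; apply: ge.
- by apply/andP; split; lra.
- by apply/andP; split; lra.
- by rewrite ger0_norm; [rewrite -/h; lra|lra].
Qed.

(** The double Riemann sums are values of the quadratic form. *)
Lemma pdkernel_dint F (T : R) : 0 <= T -> jcont F -> pdkernel F -> 0 <= dint T F.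
Proof.
move=> T0 cF pF; apply/ler_addgt0Pr => e0 e00.
pose e := e0 / (2 * T ^+ 2 + 1).
have den0 : 0 < 2 * T ^+ 2 + 1 by rewrite ltr_wpDl// mulr_ge0// sqr_ge0.
have epos : 0 < e by rewrite divr_gt0.
have eT : e * T * T + e * T * T <= e0.
  have -> : e * T * T + e * T * T = e0 * (2 * T ^+ 2 / (2 * T ^+ 2 + 1)) by rewrite /e; field; rewrite gt_eqF.
  by rewrite ler_piMr ?(ltW e00)// ler_pdivrMr// mul1r lerDl.
have cK : compact (`[0, T] `*` `[0, T] : set (R * R)).
  by apply: compact_setX; exact: segment_compact.
have [dl dl0 dP] := @compact_unif_cont R (R * R)%type _ _ e cK cF epos.
have [n nP] : exists n : nat, T / n.+1%:R < dl.
  exists (Num.truncn (T / dl)).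
  by rewrite ltr_pdivrMr// mulrC -ltr_pdivrMr// truncnS_gt.
pose h := T / n.+1%:R.
have h0 : 0 <= h by rewrite divr_ge0.
have Th : T = n.+1%:R * h by rewrite /h mulrC divfK.
pose x (i : 'I_n.+1) := i%:R * h.
have xI i : 0 <= x i <= T.
  rewrite mulr_ge0//= /x Th ler_wpM2r// ler_nat; exact: ltnW (ltn_ord i).
have close a b y : 0 <= a <= T -> 0 <= y <= T -> `|a - b| <= h -> `|F a y - F b y| <= e.
  move=> aI yI ab; apply: ltW; apply: (dP (a, y) (b, y)).
    by split => /=; rewrite in_itv.
  by split => /=; [exact: le_lt_trans ab nP|exact: ballxx].
have close2 a b y : 0 <= a <= T -> 0 <= y <= T -> `|a - b| <= h -> `|F y a - F y b| <= e.
  move=> aI yI ab; apply: ltW; apply: (dP (y, a) (y, b)).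
    by split => /=; rewrite in_itv.
  by split => /=; [exact: ballxx|exact: le_lt_trans ab nP].
pose g t := \int[mu]_(s in `[0, T]) F t s.
have cg : continuous g by exact: jcont_inner.
have r1 : `|dint T F - \sum_(i < n.+1) g (x i) * h| <= e * T * T.
  apply: (@riemann_sum g T (e * T) n T0 cg) => s t sI tI st.
  rewrite /g -(RintB (rint_itv _ _ (cont2_1 cF)) (rint_itv _ _ (cont2_1 cF))).
  rewrite -[X in _ <= _ * X]subr0; apply: Rintegral_itv_bound => //.
    by apply: rintB => //; apply: rint_itv; exact: cont2_1.
  by move=> y yI; exact: close.
have r2 : `|\sum_(i < n.+1) g (x i) * h - \sum_(i < n.+1) (\sum_(j < n.+1) F (x i) (x j) * h) * h| <= e * T * T.
  rewrite -sumrB; apply: (le_trans (ler_norm_sum _ _ _)).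
  have -> : e * T * T = \sum_(i < n.+1) e * T * h.
    by rewrite -mulr_sumr sumr_const card_ord -mulr_natl -Th.
  apply: ler_sum => i _; rewrite -mulrBl normrM (ger0_norm h0) ler_wpM2r//.
  apply: (@riemann_sum (F (x i)) T e n T0 (cont2_1 cF)) => s t sI tI st.
  exact: close2.
have r3 : 0 <= \sum_(i < n.+1) (\sum_(j < n.+1) F (x i) (x j) * h) * h.
  have := pF 'I_n.+1 (fun _ => h) x.
  rewrite -(pair_bigA _ (fun i j => h * h * F (x i) (x j)))/=.
  congr (_ <= _); apply: eq_bigr => i _; rewrite mulr_suml; apply: eq_bigr => j _; ring.
move: r1 r2 r3 eT; set A := dint T F; set B := \sum_(i < _) _ * h; set C := \sum_(i < _) _ * h.
by rewrite !ler_norml => /andP[? ?] /andP[? ?] ? ?; lra.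
Qed.

(** cos (w (t - s)) is a sum of two kernels of the form u(t) u(s), and a product
with such a kernel stays positive definite. *)
Lemma pdkernel_cospos F (T : R) : 0 <= T -> jcont F -> pdkernel F -> cospos T F.
Proof.
move=> T0 cF pF w; have cc : jcont (fun t s => cos (w * (t - s)) * F t s).
  by apply: jcontM => //; apply: (@jcont_diff R (fun t => cos (w * t))); exact: continuous_cosZ.
apply: pdkernel_dint => //.
have := pdkernelD (pdkernel_mul (fun t => cos (w * t)) pF) (pdkernel_mul (fun t => sin (w * t)) pF).
congr pdkernel; apply/funext => t; apply/funext => s.
by rewrite mulrBr cosB; ring.
Qed.

(** Both sides integrate over the triangle x <= y of the square [0, T]^2. *)
Lemma rint_triangle_fubini (F : R -> R -> R) (u w : R -> R) (T : R) :
  measurable_fun setT (fun z : measurableTypeR R * measurableTypeR R => F z.1 z.2) ->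
  rint mu `[0, T] u -> rint mu `[0, T] w ->
  (forall x y, 0 <= x <= T -> 0 <= y <= T -> `|F x y| <= u x * w y) ->
  \int[mu]_(x in `[0, T]) \int[mu]_(y in `[x, T]) F x y =
  \int[mu]_(y in `[0, T]) \int[mu]_(x in `[0, y]) F x y.
Proof.
move=> mF iu iw Fuw; pose G x y := if x <= y then F x y else 0.
have mG : measurable_fun setT (fun z : measurableTypeR R * measurableTypeR R => G z.1 z.2).
  apply: measurable_fun_ifT => //.
  by apply: measurable_fun_ler; [exact: measurable_fst|exact: measurable_snd].
have Gle x y : 0 <= x <= T -> 0 <= y <= T -> `|G x y| <= u x * w y.
  move=> xI yI; rewrite /G; case: ifP => _; first exact: Fuw.
  by rewrite normr0 (le_trans _ (Fuw _ _ xI yI)).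
have [_ E] := @Rfubini R _ _ _ _ mu mu `[0, T] `[0, T] G u w (measurable_itv _) (measurable_itv _) mG iu iw
  (fun x y xI yI => Gle x y ltac:(by move: xI; rewrite /= in_itv) ltac:(by move: yI; rewrite /= in_itv)).
transitivity (\int[mu]_(x in `[0, T]) \int[mu]_(y in `[0, T]) G x y).
  apply: Rintegral_ext => x /=; rewrite in_itv/= => /andP[x0 xT].
  rewrite Rintegral_mkcond [RHS]Rintegral_mkcond; apply: Rintegral_ext => y _.
  rewrite /G !patchE !mem_setE !in_itv/=.
  have [xy|xy] := leP x y; last by rewrite andFb if_same.
  by rewrite (le_trans x0 xy).
rewrite E; apply: Rintegral_ext => y /=; rewrite in_itv/= => /andP[y0 yT].
rewrite Rintegral_mkcond [RHS]Rintegral_mkcond; apply: Rintegral_ext => x _.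
rewrite /G !patchE !mem_setE !in_itv/=.
have [xy|xy] := leP x y; last by rewrite andbF if_same.
by rewrite (le_trans xy yT).
Qed.

Lemma triangle_half F (T : R) : 0 <= T -> jcont F -> (forall t s, F t s = F s t) ->
  \int[mu]_(t in `[0, T]) \int[mu]_(s in `[0, t]) F t s = dint T F / 2.
Proof.
move=> T0 cF sF.
have [M M0 MP] := bounded_rect 0 T 0 T cF.
have tri : \int[mu]_(t in `[0, T]) \int[mu]_(s in `[t, T]) F t s =
    \int[mu]_(t in `[0, T]) \int[mu]_(s in `[0, t]) F t s.
  rewrite (@rint_triangle_fubini F (cst M) (cst 1) T (measurable_cont2 cF) (rint_cst _ _ _) (rint_cst _ _ _)); last first.
    by move=> x y xI yI; rewrite /= mulr1; exact: MP.
  by apply: Rintegral_ext => y _; apply: Rintegral_ext => x _; rewrite sF.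
have c1 := param_continuous_tri cF.
have cg : continuous (fun t => \int[mu]_(s in `[0, T]) F t s) by exact: jcont_inner.
have E t : 0 <= t <= T -> \int[mu]_(s in `[t, T]) F t s =
    \int[mu]_(s in `[0, T]) F t s - \int[mu]_(s in `[0, t]) F t s.
  move=> /andP[t0 tT].
  by rewrite (Rintegral_itv_split t0 tT (rint_itv _ _ (cont2_1 cF))) addrAC subrr add0r.
have {}E : \int[mu]_(t in `[0, T]) \int[mu]_(s in `[t, T]) F t s =
    \int[mu]_(t in `[0, T]) (\int[mu]_(s in `[0, T]) F t s - \int[mu]_(s in `[0, t]) F t s).
  by apply: Rintegral_ext => t /=; rewrite in_itv/=; exact: E.
move: tri; rewrite E.
rewrite (RintB (rint_itv _ _ cg) (rint_itv _ _ c1)) -/(dint T F).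
by move=> /eqP; rewrite subr_eq => /eqP ->; field.
Qed.

End kernels.

Section memory_kernel.
Context {R : realType}.
Notation mu := (@lebesgue_measure R).
Variables p P : R -> R.
Hypothesis lp : locally_integrable setT p.
Hypothesis pP : forall a b, a <= b -> P b - P a = \int[mu]_(t in `[a, b]) p t.

Let mp : measurable_fun setT (p : measurableTypeR R -> measurableTypeR R).
Proof. by case: lp. Qed.

Lemma kernel_rint a b : rint mu `[a, b] p.
Proof.
case: lp => _ _ H; apply/integrableP; split; first by apply/measurable_EFinP; exact: measurable_funTS.
by apply: H => //; exact: segment_compact.
Qed.

Lemma primitive_continuous : continuous P.
Proof.
move=> x; have ab : x - 1 <= x + 1 by lra.
have := @parameterized_integral_continuous R (x - 1) (x + 1) p ab (kernel_rint _ _).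
have lt : x - 1 < x + 1 by lra.
move=> /(continuous_within_itvP _ lt)[c _ _].
have {}c : {for x, continuous (fun y => P (x - 1) + parameterized_integral mu (x - 1) y p)}.
  by apply: cvgD; [exact: cvg_cst|apply: c; rewrite in_itv/=; apply/andP; split; lra].
have : (fun y => P (x - 1) + parameterized_integral mu (x - 1) y p) y @[y --> x] -->
    P (x - 1) + parameterized_integral mu (x - 1) x p by exact: c.
have E y : x - 1 <= y -> P (x - 1) + parameterized_integral mu (x - 1) y p = P y.
  by move=> xy; rewrite /parameterized_integral -(pP xy) addrC subrK.
have x1 : x - 1 <= x by lra.
rewrite (E _ x1); apply: cvg_trans; apply: near_eq_cvg; near=> y.
rewrite E//; suff: x - 1 < y by exact: ltW.
near: y; exists 1 => //= y; rewrite /ball_/= ltr_norml => /andP[_ ?]; lra.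
Unshelve. all: by end_near.
Qed.

(** P(x) - P(- x) is the integral of p over [- x, x], where the point 0 has
measure zero. *)
Lemma primitive_even : (forall t, 0 < t -> p (- t) = - p t) -> forall t, P (- t) = P t.
Proof.
move=> podd.
have H x : 0 <= x -> P (- x) = P x.
  move=> x0; have [i1 e1] := Rintegral_reflect_itv 0 (kernel_rint (- x) 0).
  have i2 := kernel_rint 0 x.
  have nx : - x <= 0 by rewrite oppr_le0.
  have E1 := pP x0; have E2 := pP nx.
  move: i1 e1; rewrite subr0 sub0r opprK => i1 e1.
  have i1' : rint mu `]0, x] (fun s => p (0 - s)).
    by apply: rintS i1 => //; apply: subset_itvr; rewrite bnd_simp.
  have i2' : rint mu `]0, x] p by apply: rintS i2 => //; apply: subset_itvr; rewrite bnd_simp.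
  have i3' : rint mu `]0, x] (fun s => - p s) by exact: rintN.
  have : P 0 - P (- x) = - (P x - P 0).
    rewrite E1 E2 -e1 -(Rintegral_itv_obnd_cbnd i1') -(Rintegral_itv_obnd_cbnd i2') -RintegralN//.
    by apply: Rintegral_ext => s /=; rewrite in_itv/= => /andP[s0 _]; rewrite sub0r podd.
  lra.
move=> t; have [t0|t0] := leP 0 t; first exact: H.
have nt : 0 <= - t by rewrite oppr_ge0 ltW.
by rewrite -{2}(opprK t) (H _ nt).
Qed.

(** Integrating by parts moves the derivative from P to f although p is only
locally integrable: write f as the integral of its derivative and exchange
the integrals over the triangle r <= s. *)
Lemma memory_parts (f f' : R -> R) (t : R) : 0 <= t -> continuous f' ->
  (forall s, is_derive s (1 : R) f (f' s)) ->
  \int[mu]_(s in `[0, t]) (p (t - s) * f s) =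
  - P 0 * f t + P t * f 0 + \int[mu]_(s in `[0, t]) (P (t - s) * f' s).
Proof.
move=> t0 cf' df.
have cf : continuous f by move=> s; exact: is_derive_continuous (df s).
have fE s : 0 <= s -> f s = f 0 + \int[mu]_(r in `[0, s]) f' r.
  by move=> s0; rewrite (@FTC2_itv R f f' 0 s s0 cf' (fun x _ => df x) cf) addrC subrK.
have refl r : 0 <= r <= t -> rint mu `[r, t] (fun s => p (t - s)) /\
    \int[mu]_(s in `[r, t]) p (t - s) = P (t - r) - P 0.
  move=> /andP[r0 rt]; have := Rintegral_reflect_itv t (kernel_rint 0 (t - r)).
  rewrite subr0 opprB addrCA subrr addr0 => -[i ->]; split => //.
  by rewrite pP// subr_ge0.
have [ip Ep] := refl 0 (ltac:(by rewrite lexx) : 0 <= 0 <= t).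
have ip1 := rint_norm ip.
have if1 : rint mu `[0, t] (fun s => `|f' s|) by apply: rint_norm; exact: rint_itv.
have mF : measurable_fun setT (fun z : measurableTypeR R * measurableTypeR R => f' z.1 * p (t - z.2)).
  apply: measurable_funM.
    by apply: measurableT_comp; [exact: continuous_measurable_fun|exact: measurable_fst].
  apply: (measurableT_comp mp); apply: measurable_funB => //.
have B x y : 0 <= x <= t -> 0 <= y <= t -> `|f' x * p (t - y)| <= `|f' x| * `|p (t - y)|.
  by move=> _ _; rewrite normrM.
have tri := rint_triangle_fubini mF if1 ip1 B.
have cP := primitive_continuous.
have cPt : continuous (fun s => P (t - s)).
  by apply: (cont_comp cP); apply: contB; [exact: contcst|move=> ?; exact: cvg_id].
have iPf : rint mu `[0, t] (fun s => P (t - s) * f' s) by apply: rint_itv; exact: contM.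
have iF : rint mu `[0, t] f' by exact: rint_itv.
have L : \int[mu]_(x in `[0, t]) \int[mu]_(y in `[x, t]) (f' x * p (t - y)) =
    \int[mu]_(s in `[0, t]) (P (t - s) * f' s) - P 0 * (f t - f 0).
  rewrite -(@FTC2_itv R f f' 0 t t0 cf' (fun x _ => df x) cf).
  rewrite -(RintZ _ iF).
  have iPF : rint mu `[0, t] (fun x => P 0 * f' x) by exact: rintZ.
  rewrite -(RintB iPf iPF).
  apply: Rintegral_ext => x /=; rewrite in_itv/= => xI; have [i e] := refl x xI.
  by rewrite RintegralZl// e; ring.
have Rr : \int[mu]_(y in `[0, t]) \int[mu]_(x in `[0, y]) (f' x * p (t - y)) =
    \int[mu]_(s in `[0, t]) (p (t - s) * f s) - f 0 * (P t - P 0).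
  have {}Ep : P t - P 0 = \int[mu]_(s in `[0, t]) p (t - s) by rewrite Ep subr0.
  rewrite Ep -(RintZ _ ip).
  have ipf : rint mu `[0, t] (fun s => p (t - s) * f s).
    have [M M0 MP] := compact_cont_bounded (@segment_compact R 0 t) cf.
    apply: (@rint_le _ _ _ mu _ (measurable_itv _) _ (fun s => `|p (t - s)| * M)).
    - apply: measurable_funM; last by apply: measurable_funTS; exact: continuous_measurable_fun.
      exact: rint_meas ip.
    - exact: rintZr.
    - by move=> s sI; rewrite normrM ler_wpM2l// MP.
  have ifp : rint mu `[0, t] (fun s => f 0 * p (t - s)) by exact: rintZ.
  rewrite -(RintB ipf ifp).
  apply: Rintegral_ext => y /=; rewrite in_itv/= => /andP[y0 yt].
  rewrite RintegralZr//; last exact: rint_itv.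
  by rewrite (fE y y0); ring.
move: tri; rewrite L Rr => /eqP; rewrite eq_sym subr_eq => /eqP ->; ring.
Qed.

End memory_kernel.

Section transforms.
Context {R : realType}.
Notation mu := (@lebesgue_measure R).
Variable P : R -> R.
Hypothesis iP : rint mu setT P.

Lemma fourierE w : fourier P w = Complex (costrans P w) (- sintrans P w).
Proof.
have iPs : rint mu setT (fun s => P s * sin (w * s)).
  apply: (@rint_le _ _ _ mu _ measurableT _ (fun s => `|P s|)); last 2 first.
  - exact: rint_norm.
  - by move=> s _; rewrite normrM ler_piMr// sin_normle1.
  apply: measurable_funM; first exact: rint_meas iP.
  by apply: continuous_measurable_fun; exact: continuous_sinZ.
rewrite /fourier /Cintegral /costrans /sintrans -(RintegralN measurableT iPs); congr Complex.
  by apply: Rintegral_ext => t _ /=; rewrite mul0r subr0 cosN.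
by apply: Rintegral_ext => t _ /=; rewrite mul0r addr0 sinN mulrN.
Qed.

Lemma fourier_le0_costrans w : fourier P w <= 0 -> costrans P w <= 0 /\ sintrans P w = 0.
Proof. by rewrite fourierE lecE/= => /andP[/eqP E H]; split => //; lra. Qed.

Lemma fourier_costrans_neq0 w : fourier P w <= 0 -> fourier P w != 0 -> costrans P w != 0.
Proof.
move=> /fourier_le0_costrans[_ s0]; rewrite fourierE s0 oppr0.
by apply: contra => /eqP ->.
Qed.

End transforms.

(** * Curves and their pair interaction *)

Section scalar_derivatives.
Context {R : realType}.
Implicit Types (f g : R -> R) (t a b k l : R).

Lemma derDf f g t a b : is_derive t (1 : R) f a -> is_derive t (1 : R) g b ->
  is_derive t (1 : R) (fun t => f t + g t) (a + b).
Proof. by move=> d1 d2; exact: (is_deriveD d1 d2). Qed.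

Lemma derZf f k t a : is_derive t (1 : R) f a -> is_derive t (1 : R) (fun t => k * f t) (k * a).
Proof. by move=> d1; exact: (is_deriveZ k d1). Qed.

Lemma derBf f g t a b : is_derive t (1 : R) f a -> is_derive t (1 : R) g b ->
  is_derive t (1 : R) (fun t => f t - g t) (a - b).
Proof. by move=> d1 d2; exact: (is_deriveB d1 d2). Qed.

Lemma derMf f g t a b : is_derive t (1 : R) f a -> is_derive t (1 : R) g b ->
  is_derive t (1 : R) (fun t => f t * g t) (f t * b + g t * a).
Proof. by move=> d1 d2; exact: (is_deriveM d1 d2). Qed.

Lemma der_cst k t : is_derive t (1 : R) (fun _ => k) 0.
Proof. exact: is_derive_cst. Qed.

Lemma der_sum (I : finType) (f : I -> R -> R) (a : I -> R) t :
  (forall i, is_derive t (1 : R) (f i) (a i)) ->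
  is_derive t (1 : R) (fun t => \sum_i f i t) (\sum_i a i).
Proof.
move=> d1; elim: (index_enum I) => [|i s IH].
  rewrite big_nil (_ : (fun t => _) = fun _ => 0); first exact: der_cst.
  by apply/funext => u; rewrite big_nil.
rewrite big_cons (_ : (fun t => _) = fun t => f i t + \sum_(i <- s) f i t); first exact: derDf.
by apply/funext => u; rewrite big_cons.
Qed.

Definition slope_ge0 f t l :=
  (s - t)^-1 * (f s - f t) @[s --> within [set s | 0 <= s] t^'] --> l.

Definition glue f g t := if 0 <= t then f t else g t.

Lemma glue_derive f f' g g' : (forall t, 0 <= t -> slope_ge0 f t (f' t)) ->
  (forall t, is_derive t (1 : R) g (g' t)) -> f 0 = g 0 -> f' 0 = g' 0 ->
  forall t, is_derive t (1 : R) (glue f g) (glue f' g' t).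
Proof.
move=> df dg e0 e1 t; have [t0|t0] := leP 0 t; last first.
  rewrite /glue leNgt t0/=; apply: near_eq_is_derive (dg t).
  near=> s; rewrite ifF//; apply/negbTE; rewrite -ltNge.
  by near: s; exact: lt_nbhsl.
apply: is_derive_cvg; apply/cvgrPdist_le => e epos.
have gt : glue f g t = f t by rewrite /glue t0.
have right : \forall h \near 0^', 0 <= t + h -> `|glue f' g' t - h^-1 * (glue f g (t + h) - f t)| <= e.
  move: (df t t0) => /cvgrPdist_le/(_ e epos).
  rewrite /within/= => -[r /= r0 rP].
  exists r => //= h; rewrite /ball_/= sub0r normrN => hr h0 th.
  have := rP (t + h); rewrite /ball_/= opprD addNKr normrN => /(_ hr).
  by rewrite /glue t0 th addrAC subrr add0r; apply => //; rewrite addrC -subr_eq0 addrK.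
have left : \forall h \near 0^', t + h < 0 -> `|glue f' g' t - h^-1 * (glue f g (t + h) - f t)| <= e.
  move: t0 gt right; rewrite le_eqVlt => /predU1P[<- _ _|t0 _ _]; last first.
    exists t => //= h; rewrite /ball_/= sub0r normrN => /ltr_normlP[ht _] _ th.
    by exfalso; move: th; rewrite ltNge => /negP; apply; rewrite -lerBlDl sub0r; lra.
  have := is_derive_quotient (dg 0) => /cvgrPdist_le/(_ e epos).
  apply: filterS => h; rewrite /glue lexx e1 e0 !add0r => H hn.
  have -> : (0 <= h) = false by apply/negbTE; rewrite -ltNge.
  by move: H; rewrite scaler1.
near=> h; rewrite gt scaler1; have [th|th] := leP 0 (t + h).
  by apply: (near right h) => //.
by apply: (near left h) => //.
Unshelve. all: by end_near.
Qed.

End scalar_derivatives.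

Section curve_extension.
Context {R : realType} (n : nat).
Variables q v F : R -> 'rV[R]_n.
Hypothesis dq : forall t, 0 <= t -> derive_ge0 q t (v t).
Hypothesis dv : forall t, 0 <= t -> derive_ge0 v t (F t).

Let slope_coord (f f' : R -> 'rV[R]_n) t i : derive_ge0 f t (f' t) ->
  slope_ge0 (fun t => f t 0 i) t (f' t 0 i).
Proof. move=> h; have h' := cvg_coord (i := i) h; rewrite /slope_ge0.
by apply: eq_fcvg (h' _) => s; rewrite !mxE. Qed.

(** The Tauberian theorem is about functions on the whole line. Continuing the
curve to negative times with the same position, velocity and acceleration
at 0 keeps it twice differentiable there; sine and cosine keep it bounded. *)
Lemma curve_extension : exists qx vx Fx : R -> 'rV[R]_n,
  [/\ forall t, 0 <= t -> [/\ qx t = q t, vx t = v t & Fx t = F t],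
      forall t i, is_derive t (1 : R) (fun t => qx t 0 i) (vx t 0 i),
      forall t i, is_derive t (1 : R) (fun t => vx t 0 i) (Fx t 0 i) &
      forall t i, t < 0 -> `|qx t 0 i| <= `|q 0 0 i| + `|v 0 0 i| + 2 * `|F 0 0 i| /\
                           `|vx t 0 i| <= `|v 0 0 i| + `|F 0 0 i|].
Proof.
pose gq i t := q 0 0 i + v 0 0 i * sin t + F 0 0 i * (1 - cos t).
pose gv i t := v 0 0 i * cos t + F 0 0 i * sin t.
pose gF i t := F 0 0 i * cos t - v 0 0 i * sin t.
have dgq i t : is_derive t (1 : R) (gq i) (gv i t).
  apply: is_derive_eq (derDf (derDf (der_cst (q 0 0 i) t) (derZf (v 0 0 i) (is_derive_sin t)))
    (derZf (F 0 0 i) (derBf (der_cst 1 t) (is_derive_cos t)))) _.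
  by rewrite /gv; ring.
have dgv i t : is_derive t (1 : R) (gv i) (gF i t).
  apply: is_derive_eq (derDf (derZf (v 0 0 i) (is_derive_cos t)) (derZf (F 0 0 i) (is_derive_sin t))) _.
  by rewrite /gF; ring.
pose ext (f : R -> 'rV[R]_n) (g : 'I_n -> R -> R) t := \row_i glue (fun t => f t 0 i) (g i) t.
exists (ext q gq), (ext v gv), (ext F gF); split.
- by move=> t t0; split; apply/rowP => i; rewrite mxE /glue t0.
- move=> t i; rewrite (_ : (fun t => _) = glue (fun t => q t 0 i) (gq i)); last first.
    by apply/funext => s; rewrite mxE.
  rewrite mxE; apply: glue_derive => //.
  + by move=> s s0; exact: slope_coord (dq s0).
  + by rewrite /gq sin0 cos0; ring.
  + by rewrite /gv sin0 cos0; ring.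
- move=> t i; rewrite (_ : (fun t => _) = glue (fun t => v t 0 i) (gv i)); last first.
    by apply/funext => s; rewrite mxE.
  rewrite mxE; apply: glue_derive => //.
  + by move=> s s0; exact: slope_coord (dv s0).
  + by rewrite /gv sin0 cos0; ring.
  + by rewrite /gF sin0 cos0; ring.
- move=> t i t0; rewrite !mxE /glue.
  have -> : (0 <= t) = false by apply/negbTE; rewrite -ltNge.
  rewrite /gq /gv.
  have c1 := cos_normle1 t; have s1 := sin_normle1 t.
  have m (x y k : R) : `|y| <= k -> `|x * y| <= k * `|x|.
    by move=> h; rewrite normrM mulrC ler_wpM2r.
  have c2 : `|1 - cos t| <= 2 by apply: le_trans (ler_normB _ _) _; rewrite normr1; lra.
  split.
    apply: le_trans (ler_normD _ _) _; apply: lerD; last exact: m.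
    apply: le_trans (ler_normD _ _) _; apply: lerD => //.
    by rewrite -[leRHS]mul1r; exact: m.
  apply: le_trans (ler_normD _ _) _; apply: lerD.
    by rewrite -[leRHS]mul1r; exact: m.
  by rewrite -[leRHS]mul1r; exact: m.
Qed.

End curve_extension.

Section interaction.
Context {R : realType} (n : nat).
Notation rV := 'rV[R]_n.
Notation e_ i := (@basis_rV R n i).
Variable Sigma : rV -> R.

Lemma vanishing_bounded (f : rV -> R) : continuous f -> f @ at_infty n --> (0 : R) ->
  exists2 M : R, 0 < M & forall x, `|f x| <= M.
Proof.
move=> cf /(_ (ball 0 1) (nbhsx_ballx _ _ ltr01))[r rP].
have cb : compact (box (0 : rV) r) by exact: compact_box.
have [M M0 MP] := compact_cont_bounded cb cf.
exists (M + 1) => [|x]; first by rewrite addr_gt0.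
have [xr|rx] := leP (enorm x) r.
  apply: le_trans (MP x _) _; last by rewrite lerDl.
  by move=> i; rewrite mxE subr0 (le_trans (coord_le_enorm x i)).
have := rP x rx; rewrite /ball/= sub0r normrN => h; apply: (le_trans (ltW h)).
by rewrite lerDr ltW.
Qed.

Lemma C0m2_bounds : C0m 2 Sigma -> exists2 M : R, 0 < M &
  [/\ forall x, `|Sigma x| <= M, forall i x, `|'D_(e_ i) Sigma x| <= M &
      forall i j x, `|'D_(e_ j) (fun x => 'D_(e_ i) Sigma x) x| <= M].
Proof.
move=> [[cS _] vS].
have b s : (size s <= 2)%N -> exists2 M : R, 0 < M & forall x, `|pderiv s Sigma x| <= M.
  by move=> s2; apply: vanishing_bounded; [exact: cS|exact: vS].
have [M0 M0p M0P] := b [::] isT.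
have /fin_all_exists2[M1 M1p M1P] : forall i, exists2 M : R, 0 < M & forall x, `|pderiv [:: i] Sigma x| <= M.
  by move=> i; exact: b.
have /fin_all_exists2[M2 M2p M2P] : forall z : 'I_n * 'I_n, exists2 M : R, 0 < M & forall x, `|pderiv [:: z.2; z.1] Sigma x| <= M.
  by move=> i; exact: b.
have s1 i : M1 i <= \sum_i M1 i.
  by rewrite (bigD1 i)//= lerDl sumr_ge0// => j _; exact: ltW.
have s2 i : M2 i <= \sum_i M2 i.
  by rewrite (bigD1 i)//= lerDl sumr_ge0// => j _; exact: ltW.
have p1 : 0 <= \sum_i M1 i by apply: sumr_ge0 => j _; exact: ltW.
have p2 : 0 <= \sum_i M2 i by apply: sumr_ge0 => j _; exact: ltW.
exists (M0 + \sum_i M1 i + \sum_i M2 i); first by rewrite -addrA ltr_pwDl// addr_ge0.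
split => [x|i x|i j x].
- by apply: le_trans (M0P x) _; lra.
- by apply: le_trans (M1P i x) _; have := s1 i; lra.
- by apply: le_trans (M2P (i, j) x) _; have := s2 (i, j); lra.
Qed.

Lemma even_derive i x : (forall x, Sigma (- x) = Sigma x) ->
  (forall x i, derivable Sigma x (e_ i)) -> (forall i, continuous (fun x => 'D_(e_ i) Sigma x)) ->
  'D_(e_ i) Sigma (- x) = - 'D_(e_ i) Sigma x.
Proof.
move=> eS dS cS.
have dc (s : R) j : is_derive 0 (1 : R) (fun t => (s *: x + t *: (s *: e_ i)) 0 j) ((s *: e_ i) 0 j).
  rewrite (_ : (fun t => _) = fun t => (s *: x) 0 j + (s *: e_ i) 0 j * t); last first.
    by apply/funext => t; rewrite !mxE; ring.
  apply: is_derive_eq (derDf (der_cst _ _) (derZf ((s *: e_ i) 0 j) (is_derive_id 0 (1 : R)))) _.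
  by rewrite add0r mulr1.
have d s := C1_chain (c := fun t => s *: x + t *: (s *: e_ i)) dS cS (dc s).
have E (s : R) : \sum_j 'D_(e_ j) Sigma (s *: x + 0 *: (s *: e_ i)) * (s *: e_ i) 0 j = s * 'D_(e_ i) Sigma (s *: x).
  rewrite (bigD1 i)//= big1 ?addr0; last first.
    by move=> j ji; rewrite mxE basis_rVE (negbTE ji) !mulr0.
  by rewrite mxE basis_rVE eqxx mulr1 scale0r addr0 mulrC.
have := d 1; have := d (-1); rewrite !E !mulN1r !mul1r scale1r scaleN1r => d2 d1.
have ee : (fun t => Sigma (- x + t *: (-1 *: e_ i))) = (fun t => Sigma (x + t *: (1 *: e_ i))).
  by apply/funext => t; rewrite scale1r scaleN1r scalerN -opprD eS.
move: d2; rewrite scaleN1r in ee *; rewrite ee => d2.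
by have := derive_val (is_derive := d1); rewrite (derive_val (is_derive := d2)) => <-; rewrite opprK.
Qed.

End interaction.

(** * The pair interaction along smooth curves *)

Section system.
Context {R : realType} (n N : nat).
Notation mu := (@lebesgue_measure R).
Notation rV := 'rV[R]_n.
Notation e_ i := (@basis_rV R n i).
Notation X := ('I_N * 'I_n)%type.

Variable Sigma : rV -> R.
Variable M : R.
Hypothesis M0 : 0 < M.
Hypothesis cS : continuous Sigma.
Hypothesis dS : forall x i, derivable Sigma x (e_ i).
Hypothesis cS1 : forall i, continuous (fun x => 'D_(e_ i) Sigma x).
Hypothesis dS1 : forall i x j, derivable (fun x => 'D_(e_ i) Sigma x) x (e_ j).
Hypothesis cS2 : forall i j, continuous (fun x => 'D_(e_ j) (fun x => 'D_(e_ i) Sigma x) x).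
Hypothesis bS : forall x, `|Sigma x| <= M.
Hypothesis bS1 : forall i x, `|'D_(e_ i) Sigma x| <= M.
Hypothesis bS2 : forall i j x, `|'D_(e_ j) (fun x => 'D_(e_ i) Sigma x) x| <= M.
Hypothesis S_ge0 : dist_ge0 (fourier_dist Sigma).

Variables (q v : 'I_N -> R -> rV).
Hypothesis dq : forall k t i, is_derive t (1 : R) (fun t => q k t 0 i) (v k t 0 i).
Hypothesis cv : forall k i, continuous (fun t => v k t 0 i).

Let c : R := N%:R^-1.
Let c0 : 0 <= c.
Proof. by rewrite invr_ge0. Qed.

Definition vel (x : X) t := v x.1 t 0 x.2.

(** The matrix of interactions between the configurations at times t and s. *)
Definition pair_kernel t s := c * \sum_k c * \sum_j Sigma (q k t - q j s).

Definition pair_force (x : X) t s := c * \sum_j 'D_(e_ x.2) Sigma (q x.1 t - q j s).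

(** The derivative of [pair_kernel] in t, which is the power of the pair forces. *)
Definition pair_power t s := c * \sum_x pair_force x t s * vel x t.

Definition pair_force_rate (x : X) t s := - (c * \sum_j \sum_l
  'D_(e_ l) (fun z => 'D_(e_ x.2) Sigma z) (q x.1 t - q j s) * v j s 0 l).

(** The mixed derivative of [pair_kernel]. *)
Definition pair_power_rate t s := c * \sum_x pair_force_rate x t s * vel x t.

Lemma vel_continuous x : continuous (vel x).
Proof. exact: cv. Qed.

Let cq k : continuous (q k).
Proof. by apply: continuous_rV => i t; exact: is_derive_continuous (dq k t i). Qed.

Let cqq k j : continuous (fun z : R * R => q k z.1 - q j z.2).
Proof.
apply: continuous_rV => i.
have -> : (fun z : R * R => (q k z.1 - q j z.2) 0 i) = fun z => q k z.1 0 i - q j z.2 0 i.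
  by apply/funext => z; rewrite !mxE.
have ci m : continuous (fun t => q m t 0 i) by move=> t; exact: is_derive_continuous (dq m t i).
by apply: contB; [exact: jcont_fst (ci k)|exact: jcont_snd (ci j)].
Qed.

Let jsum (I : finType) (f : I -> R -> R -> R) : (forall i, jcont (f i)) ->
  jcont (fun t s => \sum_i f i t s).
Proof. by move=> cf; apply: (continuous_sum (F := fun i (z : R * R) => f i z.1 z.2)) => i; exact: cf. Qed.

Let jN (f : R -> R -> R) : jcont f -> jcont (fun t s => - f t s).
Proof. by move=> cf; exact: contN. Qed.

Let jcomp (f : rV -> R) k j : continuous f -> jcont (fun t s => f (q k t - q j s)).
Proof. by move=> cf; exact: (contcomp cf (@cqq k j)). Qed.

Let jZ (k : R) (I : finType) (f : I -> R -> R -> R) : (forall i, jcont (f i)) ->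
  jcont (fun t s => k * \sum_i f i t s).
Proof. by move=> cf; apply: jcontZ; exact: jsum. Qed.

Lemma pair_force_jcont x : jcont (pair_force x).
Proof. by apply: jZ => j; exact: jcomp (@cS1 x.2). Qed.

Lemma pair_force_rate_jcont x : jcont (pair_force_rate x).
Proof.
apply: jN; apply: jZ => j; apply: jsum => l.
apply: jcontM; last by apply: jcont_snd; exact: cv.
exact: jcomp (@cS2 x.2 l).
Qed.

Lemma pair_power_rate_jcont : jcont pair_power_rate.
Proof.
apply: jZ => x; apply: jcontM; first exact: pair_force_rate_jcont.
by apply: jcont_fst; exact: vel_continuous.
Qed.

Let dfst (f : rV -> R) k y t : (forall x i, derivable f x (e_ i)) ->
  (forall i, continuous (fun x => 'D_(e_ i) f x)) ->
  is_derive t (1 : R) (fun t => f (q k t - y)) (\sum_i 'D_(e_ i) f (q k t - y) * v k t 0 i).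
Proof.
move=> df cf; apply: (@C1_chain R n f (fun t => q k t - y)) => // i.
rewrite (_ : (fun t => _) = fun t => q k t 0 i - y 0 i); last by apply/funext => s; rewrite !mxE.
by apply: is_derive_eq (derBf (dq k t i) (der_cst _ t)) _; rewrite subr0.
Qed.

Let dsnd (f : rV -> R) j y s : (forall x i, derivable f x (e_ i)) ->
  (forall i, continuous (fun x => 'D_(e_ i) f x)) ->
  is_derive s (1 : R) (fun s => f (y - q j s)) (- \sum_i 'D_(e_ i) f (y - q j s) * v j s 0 i).
Proof.
move=> df cf.
have H : forall i, is_derive s (1 : R) (fun s => (y - q j s) 0 i) ((- v j s) 0 i).
  move=> i; rewrite (_ : (fun t => _) = fun t => y 0 i - q j t 0 i); last by apply/funext => u; rewrite !mxE.
  by apply: is_derive_eq (derBf (der_cst _ s) (dq j s i)) _; rewrite mxE sub0r.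
apply: is_derive_eq (C1_chain df cf H) _.
by rewrite -sumrN; apply: eq_bigr => i _; rewrite mxE mulrN.
Qed.

Lemma pair_kernel_derive t s : is_derive t (1 : R) (pair_kernel ^~ s) (pair_power t s).
Proof.
have H k : is_derive t (1 : R) (fun t => c * \sum_j Sigma (q k t - q j s))
    (\sum_i pair_force (k, i) t s * v k t 0 i).
  apply: is_derive_eq (derZf c (der_sum (fun j => dfst k (q j s) t dS cS1))) _.
  rewrite exchange_big/= mulr_sumr; apply: eq_bigr => i _.
  by rewrite /pair_force/= -mulrA -mulr_suml.
apply: is_derive_eq (derZf c (der_sum H)) _; rewrite /pair_power.
by rewrite (pair_bigA _ (fun k i => pair_force (k, i) t s * v k t 0 i)); congr (_ * _); apply: eq_bigr => -[].
Qed.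

Lemma pair_force_derive x t s : is_derive s (1 : R) (pair_force x t) (pair_force_rate x t s).
Proof.
have H j := dsnd j (q x.1 t) s (@dS1 x.2) (@cS2 x.2).
apply: is_derive_eq (derZf c (der_sum H)) _.
by rewrite /pair_force_rate -mulrN sumrN.
Qed.

Lemma pair_power_derive t s : is_derive s (1 : R) (pair_power t) (pair_power_rate t s).
Proof.
apply: (derZf c (der_sum _)) => x.
apply: is_derive_eq (derMf (pair_force_derive x t s) (der_cst _ s)) _.
by rewrite mulr0 add0r mulrC.
Qed.

Let eS := Sigma_even cS bS S_ge0.

Lemma pair_kernel_sym t s : pair_kernel t s = pair_kernel s t.
Proof.
rewrite /pair_kernel -!mulr_sumr exchange_big/=; congr (_ * (_ * _)).
by apply: eq_bigr => j _; apply: eq_bigr => k _; rewrite -eS opprB.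
Qed.

(** A mixed derivative of a symmetric kernel. *)
Lemma pair_power_rate_sym t s : pair_power_rate t s = pair_power_rate s t.
Proof.
exact: (mixed_derivative_sym pair_kernel_derive pair_power_derive pair_power_rate_jcont pair_kernel_sym).
Qed.

Let kernel_sum (I : finType) (a t : I -> R) :
  \sum_(p : (I * 'I_N) * (I * 'I_N)) c * a p.1.1 * (c * a p.2.1) * Sigma (q p.1.2 (t p.1.1) - q p.2.2 (t p.2.1)) =
  \sum_(p : I * I) a p.1 * a p.2 * pair_kernel (t p.1) (t p.2).
Proof.
rewrite -(pair_bigA _ (fun z w : I * 'I_N => c * a z.1 * (c * a w.1) * Sigma (q z.2 (t z.1) - q w.2 (t w.1))))/=.
rewrite -(pair_bigA _ (fun i j => a i * a j * pair_kernel (t i) (t j)))/=.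
rewrite -(pair_bigA _ (fun i k => \sum_(w : I * 'I_N) c * a i * (c * a w.1) * Sigma (q k (t i) - q w.2 (t w.1))))/=.
apply: eq_bigr => i _.
under eq_bigr => k _ do rewrite -(pair_bigA _ (fun j l => c * a i * (c * a j) * Sigma (q k (t i) - q l (t j))))/=.
rewrite exchange_big/=; apply: eq_bigr => j _.
under eq_bigr => k _ do rewrite -mulr_sumr.
by rewrite -mulr_sumr /pair_kernel -[in RHS]mulr_sumr; ring.
Qed.

Lemma pair_kernel_pd : pdkernel pair_kernel.
Proof.
move=> I a t; rewrite -kernel_sum.
exact: (Sigma_pd cS bS S_ge0 (fun z : I * 'I_N => c * a z.1) (fun z => q z.2 (t z.1))).
Qed.

(** Both arguments contribute equally, since grad Sigma is odd. *)
Lemma pair_kernel_diag t : is_derive t (1 : R) (fun t => pair_kernel t t) (2 * pair_power t t).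
Proof.
have oddS i x := @even_derive R n Sigma i x eS dS cS1.
have H k j : is_derive t (1 : R) (fun t => Sigma (q k t - q j t))
    (\sum_i 'D_(e_ i) Sigma (q k t - q j t) * (v k t - v j t) 0 i).
  apply: (@C1_chain R n Sigma (fun t => q k t - q j t)) => // i.
  rewrite (_ : (fun t => _) = fun t => q k t 0 i - q j t 0 i); last by apply/funext => s; rewrite !mxE.
  by apply: is_derive_eq (derBf (dq k t i) (dq j t i)) _; rewrite !mxE.
apply: is_derive_eq (derZf c (der_sum (fun k => derZf c (der_sum (H k))))) _.
pose T k j := \sum_i 'D_(e_ i) Sigma (q k t - q j t) * v k t 0 i.
have E k j : \sum_i 'D_(e_ i) Sigma (q k t - q j t) * (v k t - v j t) 0 i = T k j + T j k.
  rewrite /T -big_split/=; apply: eq_bigr => i _.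
  by rewrite !mxE mulrBr -(opprB (q j t)) oddS; ring.
have -> : pair_power t t = c * (c * \sum_k \sum_j T k j).
  rewrite /pair_power; congr (c * _).
  rewrite -(pair_bigA _ (fun k i => pair_force (k, i) t t * v k t 0 i))/= mulr_sumr.
  apply: eq_bigr => k _; rewrite exchange_big/= mulr_sumr; apply: eq_bigr => i _.
  by rewrite /pair_force/= -mulrA -mulr_suml.
rewrite -mulr_sumr (eq_bigr (fun k => \sum_j T k j + \sum_j T j k)); last first.
  by move=> k _; rewrite -big_split/=; apply: eq_bigr => j _; exact: E.
by rewrite big_split/= [X in _ + X]exchange_big/=; ring.
Qed.

Lemma average_bound (a : 'I_N -> R) B : 0 <= B -> (forall j, `|a j| <= B) -> `|c * \sum_j a j| <= B.
Proof.
move=> B0 aB; rewrite normrM (ger0_norm c0).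
have h : `|\sum_j a j| <= N%:R * B.
  apply: le_trans (ler_norm_sum _ _ _) _.
  by rewrite mulr_natl -[X in _ *+ X](card_ord N) -sumr_const; apply: ler_sum.
apply: le_trans (ler_wpM2l c0 h) _; rewrite mulrA /c.
have [->|N0] := eqVneq N 0%N; first by rewrite invr0 !mul0r.
by rewrite mulVf ?mul1r// pnatr_eq0.
Qed.

Lemma pair_kernel_bound t s : `|pair_kernel t s| <= M.
Proof. by apply: average_bound (ltW M0) _ => k; apply: average_bound (ltW M0) _ => j. Qed.

Lemma pair_force_bound x t s : `|pair_force x t s| <= M.
Proof. by apply: average_bound (ltW M0) _ => k. Qed.

Let sum_bound (a b : 'I_n -> R) B : (forall l, `|a l| <= M) -> (forall l, `|b l| <= B) ->
  `|\sum_l a l * b l| <= n%:R * (M * B).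
Proof.
move=> aM bB; apply: le_trans (ler_norm_sum _ _ _) _.
rewrite mulr_natl -[X in _ *+ X](card_ord n) -sumr_const; apply: ler_sum => l _.
by rewrite normrM ler_pM.
Qed.

Lemma pair_force_rate_bound x t s B : 0 <= B -> (forall j l, `|v j s 0 l| <= B) ->
  `|pair_force_rate x t s| <= n%:R * (M * B).
Proof.
move=> B0 vB; rewrite /pair_force_rate normrN; apply: average_bound.
  by rewrite mulr_ge0// mulr_ge0// ltW.
by move=> j; exact: sum_bound.
Qed.

Section test_potential.
Variable y : rV.

Definition potential t := c * \sum_k Sigma (y - q k t).

Definition potential_rate t := c * \sum_k - \sum_i 'D_(e_ i) Sigma (y - q k t) * v k t 0 i.

Lemma potential_derive t : is_derive t (1 : R) potential (potential_rate t).
Proof. by apply: (derZf c (der_sum _)) => k; exact: dsnd. Qed.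

Lemma potential_bound t : `|potential t| <= M.
Proof. by apply: average_bound (ltW M0) _ => k. Qed.

Lemma potential_rate_bound t B : 0 <= B -> (forall j l, `|v j t 0 l| <= B) ->
  `|potential_rate t| <= n%:R * (M * B).
Proof.
move=> B0 vB; apply: average_bound; first by rewrite mulr_ge0// mulr_ge0// ltW.
by move=> k; rewrite normrN; exact: sum_bound.
Qed.

Lemma potential_rate_continuous : continuous potential_rate.
Proof.
apply: contM; first exact: contcst.
apply: (@continuous_sum R _ _ (fun k t => - \sum_i 'D_(e_ i) Sigma (y - q k t) * v k t 0 i)) => k.
apply: contN; apply: (@continuous_sum R _ _ (fun i t => 'D_(e_ i) Sigma (y - q k t) * v k t 0 i)) => i.
apply: contM; last exact: cv.
apply: (contcomp (@cS1 i)); apply: continuous_rV => j.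
rewrite (_ : (fun t => _) = fun t => y 0 j - q k t 0 j); last by apply/funext => t; rewrite !mxE.
by apply: contB; [exact: contcst|move=> t; exact: is_derive_continuous (dq k t j)].
Qed.

Lemma Sigma0_ge0 : 0 <= Sigma 0.
Proof.
have := Sigma_pd cS bS S_ge0 (fun _ : 'I_1 => 1) (fun _ => 0).
by rewrite -(pair_bigA _ (fun i j : 'I_1 => 1 * 1 * Sigma (0 - 0)))/= !big_ord1 !mul1r subr0.
Qed.

Lemma discriminant_le (s b A : R) : 0 <= s -> (forall l, 0 <= l * l * s + 2 * l * b + A) -> b * b <= s * A.
Proof.
rewrite le_eqVlt => /predU1P[<-|s0] H.
  rewrite mul0r; have [->|b0] := eqVneq b 0; first by rewrite mul0r.
  have := H (- (A + 1) / (2 * b)); rewrite mulr0 add0r.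
  have -> : 2 * (- (A + 1) / (2 * b)) * b + A = -1 by field.
  lra.
have := H (- b / s).
have -> : - b / s * (- b / s) * s + 2 * (- b / s) * b + A = (s * A - b * b) / s by field; rewrite gt_eqF.
by rewrite pmulr_lge0 ?invr_gt0// subr_ge0.
Qed.

(** Enlarge the family of points by y with an arbitrary weight l; the quadratic
form is then a nonnegative polynomial in l, and its discriminant is the
claim. *)
Lemma schur_pd : pdkernel (fun t s => Sigma 0 * pair_kernel t s - potential t * potential s).
Proof.
move=> I a t; pose b := \sum_i a i * potential (t i).
pose A := \sum_(p : I * I) a p.1 * a p.2 * pair_kernel (t p.1) (t p.2).
have -> : \sum_(p : I * I) a p.1 * a p.2 * (Sigma 0 * pair_kernel (t p.1) (t p.2) -
    potential (t p.1) * potential (t p.2)) = Sigma 0 * A - b * b.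
  have -> : b * b = \sum_(p : I * I) a p.1 * potential (t p.1) * (a p.2 * potential (t p.2)).
    rewrite /b mulr_suml -(pair_bigA _ (fun i j => a i * potential (t i) * (a j * potential (t j))))/=.
    by apply: eq_bigr => i _; rewrite mulr_sumr.
  rewrite /A mulr_sumr.
  by rewrite -sumrB; apply: eq_bigr => p _; ring.
rewrite subr_ge0; apply: discriminant_le Sigma0_ge0 _ => l.
(* The left summand is the extra point y, with weight l. *)
pose aa (u : 'I_1 + I * 'I_N) := if u is inr z then c * a z.1 else l.
pose xx (u : 'I_1 + I * 'I_N) := if u is inr z then q z.2 (t z.1) else y.
have := Sigma_pd cS bS S_ge0 aa xx; congr (_ <= _).
rewrite -(pair_bigA _ (fun u w => aa u * aa w * Sigma (xx u - xx w)))/=.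
rewrite big_sumType/= big_ord1 big_sumType/= big_ord1 subrr.
under [X in _ + X]eq_bigr => z _ do rewrite big_sumType/= big_ord1.
rewrite big_split/= (pair_bigA _ (fun z w : I * 'I_N => c * a z.1 * (c * a w.1) * Sigma (q z.2 (t z.1) - q w.2 (t w.1))))/=.
rewrite kernel_sum -/A.
have E1 : \sum_(z : I * 'I_N) l * (c * a z.1) * Sigma (y - q z.2 (t z.1)) = l * b.
  rewrite -(pair_bigA _ (fun i k => l * (c * a i) * Sigma (y - q k (t i))))/= /b mulr_sumr.
  by apply: eq_bigr => i _; rewrite -mulr_sumr /potential; ring.
have -> : \sum_(z : I * 'I_N) c * a z.1 * l * Sigma (q z.2 (t z.1) - y) = l * b.
  by rewrite -E1; apply: eq_bigr => z _; rewrite -eS opprB; ring.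
by rewrite E1; ring.
Qed.

(** The mixed derivative of the kernel of [schur_pd] is positive definite, and
- P acts positively on it. *)
Lemma potential_dissipation P T : 0 <= T -> continuous P -> pdk (fun t => - P t) ->
  dint T (fun t s => - P (t - s) * (potential_rate t * potential_rate s)) <=
  Sigma 0 * dint T (fun t s => - P (t - s) * pair_power_rate t s).
Proof.
move=> T0 cP pP.
pose K2 t s := Sigma 0 * pair_power_rate t s - potential_rate t * potential_rate s.
have jrr : jcont (fun t s => potential_rate t * potential_rate s).
  by apply: jcontM; [apply: jcont_fst|apply: jcont_snd]; exact: potential_rate_continuous.
have jK2 : jcont K2 by apply: jcontB => //; apply: jcontZ; exact: pair_power_rate_jcont.
have jP : jcont (fun t s => - P (t - s)) by apply: (@jcont_diff R (fun t => - P t)); exact: contN.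
have pK2 : pdkernel K2.
  pose K0 t s := Sigma 0 * pair_kernel t s - potential t * potential s.
  pose K1 t s := Sigma 0 * pair_power t s - potential_rate t * potential s.
  have d1 t s : is_derive t (1 : R) (K0 ^~ s) (K1 t s).
    have e1 := derZf (Sigma 0) (pair_kernel_derive t s).
    have e2 := derMf (potential_derive t) (der_cst (potential s) t).
    by apply: is_derive_eq (derBf e1 e2) _; rewrite /K1 mulr0 add0r [potential s * _]mulrC.
  have d2 t s : is_derive s (1 : R) (K1 t) (K2 t s).
    exact: (derBf (derZf (Sigma 0) (pair_power_derive t s)) (derZf (potential_rate t) (potential_derive s))).
  exact: (@pdkernel_mixed R K0 K1 K2 d1 d2 jK2 schur_pd).
have := pP T K2 T0 jK2 (pdkernel_cospos T0 jK2 pK2).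
have -> : (fun t s => - P (t - s) * K2 t s) = fun t s => Sigma 0 * (- P (t - s) * pair_power_rate t s) -
    - P (t - s) * (potential_rate t * potential_rate s).
  by apply/funext => t; apply/funext => s; rewrite /K2; ring.
have j1 : jcont (fun t s => - P (t - s) * pair_power_rate t s).
  by apply: jcontM => //; exact: pair_power_rate_jcont.
have j2 : jcont (fun t s => - P (t - s) * (potential_rate t * potential_rate s)) by exact: jcontM.
by rewrite dintB// ?dintZ//; [rewrite subr_ge0|exact: jcontZ].
Qed.

End test_potential.

End system.

(** * The energy estimate *)

Section energy.
Context {R : realType}.
Notation mu := (@lebesgue_measure R).
Variable X : finType.
Variables (c M : R) (P : R -> R).
Variables (u a gv w : X -> R -> R) (g H : X -> R -> R -> R) (U Kd nn : R -> R).
Hypothesis c0 : 0 < c.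
Hypothesis M0 : 0 <= M.
Hypothesis cP : continuous P.
Hypothesis iP : rint mu setT P.
Hypothesis eP : forall t, P (- t) = P t.
Hypothesis pP : pdk (fun t => - P t).
Hypothesis cu : forall x, continuous (u x).
Hypothesis du : forall x (t : R), 0 < t -> is_derive t (1 : R) (u x) (a x t).
Hypothesis aE : forall x (t : R), 0 <= t -> a x t = - gv x t - w x t - P 0 * g x t t + P t * g x t 0 +
  \int[mu]_(s in `[0, t]) (P (t - s) * H x t s).
Hypothesis U0 : forall t, 0 <= U t.
Hypothesis dU : forall t, is_derive t (1 : R) U (c * \sum_x gv x t * u x t).
Let K1 t s := c * \sum_x g x t s * u x t.
Let L t s := c * \sum_x H x t s * u x t.
Hypothesis dKd : forall t, is_derive t (1 : R) Kd (2 * K1 t t).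
Hypothesis KdM : forall t, `|Kd t| <= M.
Hypothesis gM : forall x t s, `|g x t s| <= M.
Hypothesis jg : forall x, jcont (g x).
Hypothesis jH : forall x, jcont (H x).
Hypothesis Lsym : forall t s, L t s = L s t.
Hypothesis Lpd : pdkernel L.
Hypothesis cw : forall x, continuous (w x).
Hypothesis wn : forall x (t : R), 0 <= t -> `|w x t| <= nn t.
Hypothesis nn0 : forall t : R, 0 <= t -> 0 <= nn t.
Hypothesis inn : rint mu `[0, +oo[ nn.

Let cg0 x : continuous (g x ^~ 0).
Proof. by apply: cont2_2; exact: jg. Qed.

Let jL : jcont L.
Proof.
apply: jcontZ; apply: (continuous_sum (F := fun x (z : R * R) => H x z.1 z.2 * u x z.1)) => x.
by apply: contM; [exact: jH|exact: jcont_fst].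
Qed.

Let jPL : jcont (fun t s => P (t - s) * L t s).
Proof. by apply: jcontM => //; exact: jcont_diff. Qed.

Definition kinetic t := \sum_x u x t * u x t.

Let work t := c * \sum_x u x t * (- w x t + P t * g x t 0).

Let cwork : continuous work.
Proof.
apply: contM; first exact: contcst.
apply: (continuous_sum (F := fun x t => u x t * (- w x t + P t * g x t 0))) => x.
apply: contM; first exact: cu.
apply: contD; first by apply: contN.
by apply: contM.
Qed.

Let Z t := \int[mu]_(s in `[0, t]) (P (t - s) * L t s).

Let cZ : continuous Z.
Proof. exact: (param_continuous_tri jPL). Qed.

Let G t := c / 2 * kinetic t + U t + P 0 / 2 * Kd t.

Let dissipation T := dint T (fun t s => - P (t - s) * L t s).

Let cG : continuous G.
Proof.
have cK : continuous kinetic.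
  by apply: (continuous_sum (F := fun x t => u x t * u x t)) => x; exact: contM.
apply: contD; first apply: contD.
- by apply: contM => //; exact: contcst.
- by move=> t; exact: is_derive_continuous (dU t).
- by apply: contM; [exact: contcst|move=> t; exact: is_derive_continuous (dKd t)].
Qed.

Let dG (t : R) : 0 < t -> is_derive t (1 : R) G (work t + Z t).
Proof.
move=> t0.
have d1 : is_derive t (1 : R) kinetic (\sum_x (u x t * a x t + u x t * a x t)).
  by apply: der_sum => x; exact: (derMf (du x t0) (du x t0)).
apply: is_derive_eq (derDf (derDf (derZf (c / 2) d1) (dU t)) (derZf (P 0 / 2) (dKd t))) _.
have iH x : rint mu `[0, t] (fun s => P (t - s) * H x t s).
  apply: rint_itv; apply: contM; last by apply: cont2_1; exact: jH.
  by apply: (contcomp cP); apply: contB; [exact: contcst|move=> ?; exact: cvg_id].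
have ZE : Z t = c * \sum_x u x t * \int[mu]_(s in `[0, t]) (P (t - s) * H x t s).
  rewrite mulr_sumr.
  have i2 x : rint mu `[0, t] (fun s => c * u x t * (P (t - s) * H x t s)) by exact: rintZ.
  transitivity (\int[mu]_(s in `[0, t]) \sum_x c * u x t * (P (t - s) * H x t s)).
    apply: Rintegral_ext => s _; rewrite /L mulr_sumr mulr_sumr.
    by apply: eq_bigr => x _; ring.
  transitivity (\sum_x \int[mu]_(s in `[0, t]) (c * u x t * (P (t - s) * H x t s))).
    by apply: Rintegral_sum.
  by apply: eq_bigr => x _; rewrite (RintZ _ (iH x)) mulrA.
have -> : \sum_x (u x t * a x t + u x t * a x t) = 2 * \sum_x u x t * a x t.
  by rewrite mulr_sumr; apply: eq_bigr => x _; ring.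
have -> : c / 2 * (2 * \sum_x u x t * a x t) = c * \sum_x u x t * a x t by field.
have -> : P 0 / 2 * (2 * K1 t t) = P 0 * K1 t t by field.
rewrite ZE /work /K1 mulrCA -!mulrDr; congr (c * _).
rewrite mulr_sumr -!big_split/=; apply: eq_bigr => x _.
by rewrite (aE x (ltW t0)); ring.
Qed.

Let balance T : 0 <= T ->
  G T + dissipation T / 2 = G 0 + \int[mu]_(t in `[0, T]) work t.
Proof.
move=> T0.
have cWZ : continuous (fun t => work t + Z t) by exact: contD.
have dd x : 0 < x < T -> is_derive x (1 : R) G (work x + Z x).
  by move=> /andP[x0 _]; exact: dG.
have e := FTC2_itv T0 cWZ dd cG.
have e1 : \int[mu]_(t in `[0, T]) (work t + Z t) =
    \int[mu]_(t in `[0, T]) work t + \int[mu]_(t in `[0, T]) Z t.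
  by rewrite RintegralD//; exact: rint_itv.
have e2 : \int[mu]_(t in `[0, T]) Z t = - dissipation T / 2.
  rewrite /Z (triangle_half T0 jPL); last by move=> t s; rewrite -eP opprB Lsym.
  congr (_ / 2); rewrite /dissipation.
  have -> : (fun t s => - P (t - s) * L t s) = fun t s => -1 * (P (t - s) * L t s).
    by apply/funext => t; apply/funext => s; ring.
  by rewrite dintZ//; ring.
by rewrite e1 e2 in e; lra.
Qed.

Let dissipation_ge0 T : 0 <= T -> 0 <= dissipation T.
Proof. by move=> T0; apply: pP => //; exact: pdkernel_cospos. Qed.

Let Atot := \int[mu]_(t in `[0, +oo[) nn t + M * \int[mu]_t `|P t|.

(** The inequality |u| <= eta S + 1 / eta, for u^2 <= S, replaces a square root;
eta is chosen later so as to absorb the first term. *)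
Let work_bound T S eta : 0 <= T -> 0 <= S -> 0 < eta ->
  (forall t, 0 <= t <= T -> kinetic t <= S) ->
  `|\int[mu]_(t in `[0, T]) work t| <= c * (#|X|%:R * (eta * S + eta^-1)) * Atot.
Proof.
move=> T0 S0 eta0 kS.
pose B := c * (#|X|%:R * (eta * S + eta^-1)).
have B0 : 0 <= B.
  apply: mulr_ge0 (ltW c0) _; apply: mulr_ge0 => //; apply: addr_ge0; first exact: mulr_ge0 (ltW eta0) _.
  by rewrite invr_ge0 ltW.
have uB x t : 0 <= t <= T -> `|u x t| <= eta * S + eta^-1.
  move=> tI; have h : u x t ^+ 2 <= S.
    apply: le_trans (kS _ tI); rewrite /kinetic (bigD1 x)//= expr2 lerDl.
    by apply: sumr_ge0 => y _; rewrite -expr2 sqr_ge0.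
  have e0 : eta * eta^-1 = 1 by rewrite mulfV// gt_eqF.
  have i0 : 0 < eta^-1 by rewrite invr_gt0.
  rewrite -real_normK ?num_real// in h.
  move: (normr_ge0 (u x t)) h e0 i0 eta0; move: `|u x t| eta^-1 => z i z0 h e0 i0 et0.
  have : eta * z ^+ 2 <= eta * S by rewrite ler_wpM2l// ltW.
  have : 0 <= (eta * z - 1) ^+ 2 * i by rewrite mulr_ge0// ?sqr_ge0// ltW.
  have -> : (eta * z - 1) ^+ 2 * i = (eta * i) * (eta * z ^+ 2) - 2 * (eta * i) * z + i by ring.
  rewrite e0; nra.
have wB t : 0 <= t <= T -> `|work t| <= B * (nn t + M * `|P t|).
  move=> /andP[t0 tT]; rewrite /work normrM (ger0_norm (ltW c0)) /B -mulrA ler_wpM2l ?(ltW c0)//.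
  apply: le_trans (ler_norm_sum _ _ _) _.
  rewrite -mulrA mulr_natl -sumr_const; apply: ler_sum => x _.
  rewrite normrM; apply: ler_pM => //; first by apply: uB; rewrite t0.
  apply: le_trans (ler_normD _ _) _; rewrite normrN normrM mulrC; apply: lerD; first exact: wn.
  by rewrite ler_wpM2r.
have iPn : rint mu setT (fun t => `|P t|) by exact: rint_norm.
have sub : `[0, T]%classic `<=` (`[0, +oo[%classic : set R) by apply: subset_itvl.
have i1 : rint mu `[0, T] nn by apply: rintS inn.
have i2 : rint mu `[0, T] (fun t => M * `|P t|) by apply: rintZ => //; apply: rintS iPn.
have i3 : rint mu `[0, T] (fun t => nn t + M * `|P t|) by apply: rintD.
have i4 : rint mu `[0, T] (fun t => B * (nn t + M * `|P t|)) by apply: rintZ.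
apply: (@le_trans _ _ (\int[mu]_(t in `[0, T]) (B * (nn t + M * `|P t|)))).
  by apply: Rintegral_norm_le => //; exact: rint_itv.
rewrite (RintZ _ i3) -/B ler_wpM2l//.
have i5 : rint mu `[0, T] (fun t => `|P t|) by apply: rintS iPn.
rewrite RintegralD// (RintZ _ i5) /Atot; apply: lerD.
  pose nn' := nn \_ `[0, +oo[.
  have -> : \int[mu]_(t in `[0, +oo[) nn t = \int[mu]_t nn' t by rewrite Rintegral_mkcond.
  have -> : \int[mu]_(t in `[0, T]) nn t = \int[mu]_(t in `[0, T]) nn' t.
    apply: Rintegral_ext => t tI; rewrite /nn' patchE ifT// inE; exact: sub.
  have inn' : rint mu setT nn'.
    by have [h _] := @rint_restrict R _ _ mu `[0, +oo[ (measurable_itv _) nn; exact: h inn.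
  apply: Rintegral_subset_ge0 => //.
  move=> t; rewrite /nn' patchE; case: ifPn => //; rewrite inE/= in_itv/= andbT; exact: nn0.
by rewrite ler_wpM2l//; apply: Rintegral_subset_ge0.
Qed.

(** The choice eta = 1 / (4 (A + 1)) turns the term in S into c S / 4 at most. *)
Lemma absorb_bound (S0 C1 A : R) : 0 <= A -> 0 <= S0 ->
  c / 2 * S0 <= C1 + c * ((4 * (A + 1))^-1 * S0 + 4 * (A + 1)) * A ->
  S0 <= 4 / c * C1 + 16 * (A + 1) * A.
Proof.
move=> A0 S00 h.
have a4 : (4 * (A + 1))^-1 * A <= 4^-1.
  rewrite invfM -mulrA ler_piMr// mulrC ler_pdivrMr ?mul1r//; lra.
have h2 : c * ((4 * (A + 1))^-1 * S0 + 4 * (A + 1)) * A <= c * S0 / 4 + c * (4 * (A + 1) * A).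
  have -> : c * ((4 * (A + 1))^-1 * S0 + 4 * (A + 1)) * A =
    c * S0 * ((4 * (A + 1))^-1 * A) + c * (4 * (A + 1) * A) by ring.
  by rewrite lerD2r ler_wpM2l// mulr_ge0// ltW.
have h3 : c * S0 <= 4 * C1 + c * (16 * (A + 1) * A) by lra.
have -> : 4 / c * C1 + 16 * (A + 1) * A = (4 * C1 + c * (16 * (A + 1) * A)) / c by field; rewrite gt_eqF.
by rewrite ler_pdivlMr// mulrC.
Qed.

(** On [0, T] let S be the maximum of the kinetic term. The work is at most a
constant times the integral of the external forces times sqrt S, while the
energy at the time of the maximum is at least a multiple of S, the
dissipation being nonnegative. So S is bounded independently of T, and the
balance then bounds the other terms. *)
Lemma energy_bounds : exists2 B, 0 <= B & forall t : R, 0 <= t ->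
  [/\ forall x, u x t ^+ 2 <= B, U t <= B & dissipation t <= B].
Proof.
pose m : R := #|X|%:R.
have m0 : 0 <= m by [].
pose p := `|P 0| * M.
have p0 : 0 <= p by rewrite mulr_ge0.
pose C0 := `|G 0| + p.
have C00 : 0 <= C0 by rewrite addr_ge0.
have ck : continuous kinetic.
  by apply: (continuous_sum (F := fun x t => u x t * u x t)) => x; exact: contM.
have k0 t : 0 <= kinetic t by apply: sumr_ge0 => x _; rewrite -expr2 sqr_ge0.
have A0 : 0 <= Atot.
  apply: addr_ge0; last by rewrite mulr_ge0//; apply: Rintegral_ge0.
  by apply: Rintegral_ge0 => t /=; rewrite in_itv/= andbT; exact: nn0.
have Gle t : c / 2 * kinetic t + U t - p / 2 <= G t.
  rewrite /G lerD2l.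
  have : `|P 0 / 2 * Kd t| <= p / 2.
    by rewrite !normrM normfV (ger0_norm (ler0n _ 2)) mulrAC /p ler_wpM2r// ler_wpM2l.
  by rewrite ler_norml => /andP[].
have G0le : G 0 <= `|G 0| by exact: ler_norm.
have ck0 t : 0 <= c / 2 * kinetic t by rewrite mulr_ge0// divr_ge0// ltW.
pose A := m * Atot.
have AA : 0 <= A by rewrite mulr_ge0.
pose S1 := 4 / c * C0 + 16 * (A + 1) * A.
(* The balance is evaluated at the time T where the kinetic term is largest. *)
have kin t : 0 <= t -> kinetic t <= S1.
  move=> t0; have [T TI Tmax] := @EVT_max R kinetic 0 t t0 (continuous_subspaceT ck).
  move: TI; rewrite in_itv/= => /andP[T0 Tt].
  apply: le_trans (Tmax t _) _; first by rewrite in_itv/= t0 lexx.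
  apply: absorb_bound => //.
  have kT s : 0 <= s <= T -> kinetic s <= kinetic T.
    by move=> /andP[s0 sT]; apply: Tmax; rewrite in_itv/= s0 (le_trans sT).
  have e0 : 0 < (4 * (A + 1))^-1 by rewrite invr_gt0 mulr_gt0// ltr_wpDl.
  have := work_bound T0 (k0 T) e0 kT; rewrite invrK => wb.
  have wb' : \int[mu]_(t in `[0, T]) work t <= c * ((4 * (A + 1))^-1 * kinetic T + 4 * (A + 1)) * A.
    apply: le_trans (ler_norm _) (le_trans wb _).
    by rewrite le_eqVlt; apply/orP; left; apply/eqP; rewrite /A -/m; ring.
  have := balance T0; have := dissipation_ge0 T0; have := Gle T; have := U0 T.
  by rewrite /C0; move: wb' G0le p0; lra.
have S10 : 0 <= S1 by rewrite (le_trans (k0 0))// kin.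
pose I1 := c * (m * (1 * S1 + 1^-1)) * Atot.
have I10 : 0 <= I1.
  apply: mulr_ge0 => //; apply: mulr_ge0 (ltW c0) _; apply: mulr_ge0 => //.
  by rewrite invr1 mul1r addr_ge0.
exists (S1 + 2 * (C0 + I1)); first by lra.
move=> t t0.
have wb : \int[mu]_(s in `[0, t]) work s <= I1.
  apply: le_trans (ler_norm _) (work_bound t0 S10 ltr01 _).
  by move=> s /andP[s0 _]; exact: kin.
have := balance t0; have := dissipation_ge0 t0; have := Gle t; have := U0 t; have := ck0 t.
have := kin t t0.
move: wb G0le p0 I10 C00 S10; rewrite /C0 => h1 h2 h3 h4 h5 h6 h7 h8 h9 h10 h11 h12; split.
- move=> x; apply: (@le_trans _ _ (kinetic t)).
    rewrite /kinetic (bigD1 x)//= expr2 lerDl.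
    by apply: sumr_ge0 => y _; rewrite -expr2 sqr_ge0.
  by move: h1 h2 h3 h4 h5 h6 h7; lra.
- by move: h1 h2 h3 h4 h5 h6 h7 h8 h9 h10 h11 h12; lra.
- by move: h1 h2 h3 h4 h5 h6 h7 h8 h9 h10 h11 h12; lra.
Qed.

End energy.

(** * Limits along ultrafilters and vanishing velocities *)

Section ultrafilters.
Context {R : realType}.

(** Ultrafilters play the part of sequences of times tending to infinity along
which every bounded quantity converges at once. *)
Lemma ultra_unbounded (B : set R) : (forall T : R, exists2 t, T <= t & B t) ->
  exists U : set_system R, [/\ UltraFilter U, U B & forall T : R, U [set t | T <= t]].
Proof.
move=> HB; pose G := [set A : set R | exists T : R, forall t, T <= t -> B t -> A t].
have PG : ProperFilter G.
  apply: Build_ProperFilter.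
    by move=> [T TA]; have [t tT Bt] := HB T; exact: TA Bt.
  split.
  - by exists 0.
  - move=> A1 A2 [T1 H1] [T2 H2]; exists (Num.max T1 T2) => t; rewrite ge_max => /andP[? ?] Bt.
    by split; [exact: H1|exact: H2].
  - by move=> A1 A2 A12 [T1 H1]; exists T1 => t t1 Bt; apply: A12; exact: H1.
have [U [UU GU]] := ultraFilterLemma PG; exists U; split => //.
  by apply: GU; exists 0.
by move=> T; apply: GU; exists T.
Qed.

Lemma ultra_map (T S : Type) (f : T -> S) (U : set_system T) : UltraFilter U -> UltraFilter (f @ U).
Proof.
move=> UU; have PU := @ultra_proper T U UU.
apply: Build_UltraFilter => G PG UG; apply/funext => A; apply/propext; split; last exact: UG.
move=> GA; have [//|UC] := in_ultra_setVsetC (f @^-1` A) UU.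
have : G (A `&` ~` A) by apply: filterI => //; exact: UG.
by rewrite setICr => /(@filter_ex _ G PG)[].
Qed.

Lemma ultra_cvg_box n (f : R -> 'rV[R]_n) (U : set_system R) (r : R) : UltraFilter U ->
  U [set t | box 0 r (f t)] -> exists l : 'rV[R]_n, f t @[t --> U] --> l.
Proof.
move=> UU Ub; have := @compact_box R n 0 r; rewrite compact_ultra => /(_ (f @ U) (ultra_map f UU) Ub).
by move=> [l [_ fl]]; exists l.
Qed.

End ultrafilters.

(** * Asymptotics of the positions and velocities *)

Section asymptotics.
Context {R : realType} (n N : nat).
Notation mu := (@lebesgue_measure R).
Notation rV := 'rV[R]_n.
Notation e_ i := (@basis_rV R n i).
Notation X := ('I_N * 'I_n)%type.
Variables (Sigma : rV -> R) (M : R).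
Hypothesis N0 : (0 < N)%N.
Hypothesis M0 : 0 < M.
Hypothesis cS : continuous Sigma.
Hypothesis bS : forall x, `|Sigma x| <= M.
Hypothesis S_ge0 : dist_ge0 (fourier_dist Sigma).
Hypothesis S_supp : dist_supp (fourier_dist Sigma) = setT.

(** A measure is determined by its convolution with Sigma, in particular its
support is. *)
Lemma same_support (x x' : 'I_N -> rV) :
  (forall y, \sum_k Sigma (y - x' k) = \sum_k Sigma (y - x k)) ->
  forall k, exists j, x' k = x j.
Proof.
move=> H k; apply: contrapT => nex.
pose a (u : 'I_N + 'I_N) : R := if u is inl _ then 1 else -1.
pose z (u : 'I_N + 'I_N) := match u with inl k => x' k | inr k => x k end.
have a0 y : \sum_u a u * Sigma (y - z u) = 0.
  rewrite big_sumType/=.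
  have -> : \sum_(i < N) 1 * Sigma (y - x' i) = \sum_(i < N) Sigma (y - x' i).
    by apply: eq_bigr => i _; rewrite mul1r.
  rewrite H; have -> : \sum_(i < N) -1 * Sigma (y - x i) = - \sum_(i < N) Sigma (y - x i).
    by rewrite -sumrN; apply: eq_bigr => i _; rewrite mulN1r.
  by rewrite subrr.
have := translates_independent cS bS S_ge0 S_supp a0 (x' k).
rewrite big_sumType/= [X in _ + X]big_pred0; last first.
  by move=> j; apply/negbTE/eqP => e; apply: nex; exists j.
rewrite addr0 (bigD1 k)//= => /eqP; rewrite gt_eqF// ltr_pwDl// sumr_ge0//.
Qed.

Variables (q v : 'I_N -> R -> rV) (a : X -> R -> R).
Hypothesis dq : forall k t i, is_derive t (1 : R) (fun t => q k t 0 i) (v k t 0 i).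
Hypothesis cv : forall k i, continuous (fun t => v k t 0 i).
Hypothesis dv : forall x (t : R), 0 < t -> is_derive t (1 : R) (fun t => v x.1 t 0 x.2) (a x t).
Variables (Q B A : R) (nn : R -> R).
Hypothesis qQ : forall k (t : R), 0 <= t -> box 0 Q (q k t).
Hypothesis vB : forall k i (t : R), 0 <= t -> `|v k t 0 i| <= B.
Hypothesis A0 : 0 < A.
Hypothesis ca : forall x, continuous (a x).
Hypothesis aA : forall x (t : R), 0 <= t -> `|a x t| <= A + nn t.
Hypothesis nn0 : forall t : R, 0 <= t -> 0 <= nn t.
Hypothesis inn : rint mu `[0, +oo[ nn.
Hypothesis incr : forall y tau (e : R), 0 < tau -> 0 < e -> exists T : R, forall t, T <= t ->
  `|\sum_k Sigma (y - q k (t + tau)) - \sum_k Sigma (y - q k t)| <= e.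

Lemma nn_tail (e : R) : 0 < e -> exists2 T : R, 0 < T & forall a b, T <= a -> a <= b ->
  \int[mu]_(t in `[a, b]) nn t <= e.
Proof.
move=> e0; pose nn' := nn \_ `[0, +oo[.
have inn' : rint mu setT nn'.
  by have [h _] := @rint_restrict R _ _ mu `[0, +oo[ (measurable_itv _) nn; exact: h inn.
have [T T0 TP] := tail_small inn' e0; exists T => // x y Tx xy.
have xT t : `[x, y]%classic t -> T <= `|t|.
  move=> /=; rewrite in_itv/= => /andP[xt _]; rewrite ger0_norm; lra.
apply: le_trans (TP _ (measurable_itv _) xT).
rewrite le_eqVlt; apply/orP; left; apply/eqP; apply: Rintegral_ext => t /=; rewrite in_itv/= => /andP[xt _].
have t0 : 0 <= t by lra.
rewrite /nn' patchE ifT ?inE/= ?in_itv/= ?t0// ger0_norm//; exact: nn0.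
Qed.

Lemma velocity_variation (e : R) : 0 < e -> exists2 T : R, 0 < T & forall x t s, T <= t -> t <= s ->
  `|v x.1 s 0 x.2 - v x.1 t 0 x.2| <= A * (s - t) + e.
Proof.
move=> e0; have [T T0 TP] := nn_tail e0; exists T => // x t s Tt ts.
have dd r : t < r < s -> is_derive r (1 : R) (fun t => v x.1 t 0 x.2) (a x r).
  by move=> /andP[tr _]; apply: dv; lra.
rewrite -(FTC2_itv ts (@ca x) dd (@cv x.1 x.2)).
have i1 : rint mu `[t, s] nn.
  by apply: rintS inn => // r /=; rewrite !in_itv/= => /andP[tr _]; rewrite andbT; lra.
have i2 : rint mu `[t, s] (fun r => A + nn r) by apply: rintD => //; exact: rint_cst.
apply: (@le_trans _ _ (\int[mu]_(r in `[t, s]) (A + nn r))).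
  apply: Rintegral_norm_le => //; first exact: rint_itv.
  by move=> r /=; rewrite in_itv/= => /andP[tr _]; apply: aA; lra.
rewrite RintegralD//; last exact: rint_cst.
by apply: lerD; [rewrite Rintegral_itv_cst|exact: TP].
Qed.

(** First-order Taylor expansion; the integrable part of the acceleration only
contributes a vanishing error. *)
Lemma taylor_position (e : R) : 0 < e -> exists2 T : R, 0 < T & forall x t tau, T <= t -> 0 <= tau ->
  `|q x.1 (t + tau) 0 x.2 - q x.1 t 0 x.2 - tau * v x.1 t 0 x.2| <= tau * (A * tau + e).
Proof.
move=> e0; have [T T0 TP] := velocity_variation e0; exists T => // x t tau Tt tau0.
have tt : t <= t + tau by rewrite lerDl.
have cq : continuous (fun t => q x.1 t 0 x.2) by move=> s; exact: is_derive_continuous (dq x.1 s x.2).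
rewrite -(FTC2_itv tt (@cv x.1 x.2) (fun s _ => dq x.1 s x.2) cq).
have -> : tau * v x.1 t 0 x.2 = \int[mu]_(s in `[t, t + tau]) v x.1 t 0 x.2.
  by rewrite Rintegral_itv_cst//; ring.
rewrite -RintB; [|exact: rint_itv|exact: rint_cst].
have -> : tau * (A * tau + e) = (A * tau + e) * (t + tau - t) by ring.
apply: Rintegral_itv_bound => //.
  by apply: rintB => //; [exact: rint_itv|exact: rint_cst].
move=> s /andP[ts st]; apply: le_trans (TP x t s Tt ts) _.
by rewrite lerD2r ler_pM2l//; lra.
Qed.

(** Along an ultrafilter the positions at times t and t + tau converge to
configurations x and x' with the same support, by incr, whereas x' - x is
tau w up to O(tau^2) if the velocities converge to w. As the support of x is
finite, w = 0. *)
Lemma velocity_vanish (x : X) (e : R) : 0 < e -> exists T : R, forall t, T <= t -> `|v x.1 t 0 x.2| <= e.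
Proof.
move=> e0; apply: contrapT => nT.
have [|U [UU UB UT]] := @ultra_unbounded R [set t | e < `|v x.1 t 0 x.2|].
  move=> T; apply: contrapT => H; apply: nT; exists T => t Tt.
  by rewrite leNgt; apply/negP => h; apply: H; exists t.
have PU : ProperFilter U by exact: ultra_proper.
have qc k : exists l : rV, q k t @[t --> U] --> l.
  by apply: (@ultra_cvg_box R n (q k) U Q) => //; apply: filterS (UT 0) => t; exact: qQ.
have [y yP] := choice qc.
have vb : U [set t | box 0 B (v x.1 t)].
  by apply: filterS (UT 0) => t t0 i; rewrite mxE subr0; exact: vB.
have [w wP] := ultra_cvg_box UU vb.
have wi : v x.1 t 0 x.2 @[t --> U] --> w 0 x.2 by exact: cvg_coord wP.
have w0 : 0 < `|w 0 x.2|.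
  apply: lt_le_trans e0 _; apply: (cvgr_to_ge (cvg_norm wi)).
  by apply: filterS UB => t; exact: ltW.
set m := `|w 0 x.2| in w0.
pose gap j := `|y j 0 x.2 - y x.1 0 x.2|.
(* tau is so small that A tau^2 < tau |w|, and that tau |w| + A tau^2 is less
than every nonzero gap between the limit positions. *)
have [tau [tau0 tau1 tau2]] : exists tau : R, [/\ 0 < tau, A * tau < m &
    forall j, 0 < gap j -> tau * m + A * tau ^+ 2 < gap j].
  have ev : \forall tau \near (0 : R)^'+, forall j, 0 < gap j -> tau * m + A * tau ^+ 2 < gap j.
    apply: filter_forall => j.
    have [g0|g0] := ltP 0 (gap j); last by near=> tau => h.
    have c : tau * m + A * tau ^+ 2 @[tau --> (0 : R)^'+] --> (0 : R).
      apply: cvg_within_filter.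
      have : {for (0 : R), continuous (fun tau : R => tau * m + A * tau ^+ 2)}.
        apply: contD; first by apply: contM; [move=> ?; exact: cvg_id|exact: contcst].
        by apply: contM; [exact: contcst|move=> ?; exact: exprn_continuous].
      move=> h; have c0 : tau * m + A * tau ^+ 2 @[tau --> (0 : R)] --> (0 * m + A * 0 ^+ 2) by exact: h.
      by move: c0; rewrite mul0r expr0n/= mulr0 addr0.
    by near=> tau => _; near: tau; exact: (cvgr_lt _ c).
  have am : 0 < m / A by rewrite divr_gt0.
  near (0 : R)^'+ => tau; exists tau; split.
  - by near: tau; exact: nbhs_right_gt.
  - by rewrite mulrC -ltr_pdivlMr//; near: tau; exact: (nbhs_right_lt am).
  - by apply: (near ev tau).
have qc' k : exists l : rV, q k (t + tau) @[t --> U] --> l.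
  apply: (@ultra_cvg_box R n (fun t => q k (t + tau)) U Q) => //.
  by apply: filterS (UT 0) => t t0; apply: qQ; rewrite addr_ge0// ltW.
have [y' y'P] := choice qc'.
have same z : \sum_k Sigma (z - y' k) = \sum_k Sigma (z - y k).
  apply/eqP; rewrite -subr_eq0 -normr_le0; apply/ler_addgt0Pr => e1 e10; rewrite add0r.
  have [T TP] := incr z tau0 e10.
  have cz : continuous (fun u : rV => Sigma (z - u)).
    apply: (contcomp cS); apply: continuous_rV => i.
    rewrite (_ : (fun t => _) = fun u : rV => z 0 i - u 0 i); last by apply/funext => u; rewrite !mxE.
    by apply: contB; [exact: contcst|exact: continuous_coord].
  have c (p : 'I_N -> R -> rV) (l : 'I_N -> rV) : (forall k, p k t @[t --> U] --> l k) ->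
      \sum_k Sigma (z - p k t) @[t --> U] --> \sum_k Sigma (z - l k).
    move=> pl; apply: cvg_sumr => k.
    exact: (@continuous_cvg _ _ _ _ _ (fun t => p k t) (fun u => Sigma (z - u)) (l k) (cz (l k)) (pl k)).
  apply: (cvgr_to_le (cvg_norm (cvgB (c _ _ y'P) (c _ _ yP)))).
  by apply: filterS (UT T) => t Tt; exact: TP.
have [j jE] := same_support same x.1.
have dist : `|y' x.1 0 x.2 - y x.1 0 x.2 - tau * w 0 x.2| <= A * tau ^+ 2.
  apply/ler_addgt0Pr => e1 e10.
  have e2 : 0 < e1 / tau by rewrite divr_gt0.
  have [T _ TP] := taylor_position e2.
  have c1 : q x.1 (t + tau) 0 x.2 @[t --> U] --> y' x.1 0 x.2 by exact: cvg_coord (y'P x.1).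
  have c2 : q x.1 t 0 x.2 @[t --> U] --> y x.1 0 x.2 by exact: cvg_coord (yP x.1).
  have c3 : q x.1 (t + tau) 0 x.2 - q x.1 t 0 x.2 - tau * v x.1 t 0 x.2 @[t --> U] -->
      y' x.1 0 x.2 - y x.1 0 x.2 - tau * w 0 x.2.
    by apply: cvgB; [apply: cvgB|apply: cvgM => //; exact: cvg_cst].
  apply: (cvgr_to_le (cvg_norm c3)); apply: filterS (UT T) => t Tt.
  apply: le_trans (TP x t tau Tt (ltW tau0)) _.
  by rewrite le_eqVlt; apply/orP; left; apply/eqP; field; rewrite gt_eqF.
have mt : `|tau * w 0 x.2| = tau * m by rewrite normrM gtr0_norm.
have at2 : A * tau ^+ 2 < tau * m by rewrite expr2 mulrA mulrC ltr_pM2l.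
have gp : 0 < gap j.
  rewrite /gap -jE; set g := y' _ _ _ - _ in dist *; rewrite normr_gt0; apply/eqP => g0.
  by move: dist; rewrite g0 sub0r normrN mt leNgt at2.
have := tau2 j gp; rewrite ltNge => /negP; apply.
rewrite /gap -jE; move: dist mt; set g := y' _ _ _ - _; set h := tau * w 0 x.2 => d mt.
rewrite (_ : g = h + (g - h)); last by rewrite addrC subrK.
by apply: le_trans (ler_normD _ _) _; rewrite mt lerD2l.
Unshelve. all: by end_near.
Qed.

Lemma velocities_vanish (e : R) : 0 < e -> exists2 T : R, 0 < T &
  forall k i t, T <= t -> `|v k t 0 i| <= e.
Proof.
move=> e0; have /fin_all_exists[T TP] := fun x => velocity_vanish x e0.
exists (1 + \sum_x `|T x|).
  by rewrite ltr_pwDl// sumr_ge0.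
move=> k i t Tt; apply: (TP (k, i)); apply: le_trans Tt; apply: le_trans (ler_norm _) _.
rewrite (bigD1 (k, i))//= addrCA lerDl addr_ge0// sumr_ge0//.
Qed.

Variable P : R -> R.
Hypothesis cP : continuous P.
Hypothesis iP : rint mu setT P.

(** The memory of the velocities fades: split the history at a time after which
the velocities are small, and before which the kernel is. *)
Lemma memory_vanish (H : R -> R -> R) (D : R) (e : R) : 0 <= D -> jcont H ->
  (forall t s b, 0 <= b -> (forall j l, `|v j s 0 l| <= b) -> `|H t s| <= D * b) -> 0 < e ->
  exists2 T : R, 0 < T & forall t, T <= t -> `|\int[mu]_(s in `[0, t]) (P (t - s) * H t s)| <= e.
Proof.
move=> D0 jH HD e0; have iPn : rint mu setT (fun t => `|P t|) by exact: rint_norm.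
pose I := \int[mu]_t `|P t|; have I0 : 0 <= I by apply: Rintegral_ge0.
pose B1 := `|B|; have B10 : 0 <= B1 by exact: normr_ge0.
have d1 : 0 < 2 * (D * I + 1) by rewrite mulr_gt0// ltr_wpDl// mulr_ge0.
have d2 : 0 < 2 * (D * B1 + 1) by rewrite mulr_gt0// ltr_wpDl// mulr_ge0.
pose b := e / (2 * (D * I + 1)); have b0 : 0 < b by rewrite divr_gt0.
have [T0 T00 T0P] := velocities_vanish b0.
have [T1 T10 T1P] := tail_small iP (divr_gt0 e0 d2).
exists (T0 + T1) => [|t Tt]; first exact: addr_gt0.
have t0T : T0 <= t by lra.
have T0' := ltW T00.
have cPt : continuous (fun s => P (t - s)).
  by apply: (contcomp cP); apply: contB; [exact: contcst|move=> ?; exact: cvg_id].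
have cPH : continuous (fun s => P (t - s) * H t s) by apply: contM => //; exact: cont2_1.
rewrite (Rintegral_itv_split T0' t0T (rint_itv _ _ cPH)).
have piece (x y k l : R) : rint mu `[x, y] (fun s => P (t - s) * H t s) ->
    (forall s, x <= s <= y -> `|H t s| <= D * k) -> 0 <= k ->
    \int[mu]_(s in `[t - y, t - x]) `|P s| <= l ->
    `|\int[mu]_(s in `[x, y]) (P (t - s) * H t s)| <= D * k * l.
  move=> ip Hk k0 Pl; have Dk : 0 <= D * k by rewrite mulr_ge0.
  have iPi : rint mu `[t - y, t - x] (fun s => `|P s|) by apply: rintS iPn.
  have [i1 e1] := Rintegral_reflect_itv t iPi.
  rewrite !subKr in i1 e1.
  apply: le_trans (ler_wpM2l Dk Pl); rewrite -e1 -(RintZ _ i1).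
  have i2 : rint mu `[x, y] (fun s => D * k * `|P (t - s)|) by apply: rintZ.
  apply: Rintegral_norm_le => // s /=; rewrite in_itv/= => sI.
  by rewrite normrM mulrC ler_wpM2r// Hk.
have ipi x y : rint mu `[x, y] (fun s => P (t - s) * H t s) by exact: rint_itv.
have p1 : `|\int[mu]_(s in `[0, T0]) (P (t - s) * H t s)| <= D * B1 * (e / (2 * (D * B1 + 1))).
  apply: piece => //.
    move=> s /andP[s0 _]; apply: HD => // j l; apply: le_trans (vB j l s0) _; exact: ler_norm.
  apply: T1P => // r /=; rewrite in_itv/= => /andP[r1 _].
  by rewrite ger0_norm; lra.
have p2 : `|\int[mu]_(s in `[T0, t]) (P (t - s) * H t s)| <= D * b * I.
  apply: piece => //; last by apply: Rintegral_subset_ge0.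
  - by move=> s /andP[s0 _]; apply: HD => [|j l]; [exact: ltW|exact: T0P].
  - exact: ltW.
apply: le_trans (ler_normD _ _) _; apply: le_trans (lerD p1 p2) _.
have h1 : D * B1 * (e / (2 * (D * B1 + 1))) <= e / 2.
  have -> : D * B1 * (e / (2 * (D * B1 + 1))) = e / 2 * (D * B1 / (D * B1 + 1)).
    by field; move: d2; rewrite pmulr_rgt0// => /gt_eqF ->.
  rewrite ler_piMr ?divr_ge0 ?(ltW e0)// ler_pdivrMr; last by move: d2; rewrite pmulr_rgt0.
  by rewrite mul1r lerDl.
have h2 : D * b * I <= e / 2.
  have -> : D * b * I = e / 2 * (D * I / (D * I + 1)).
    by rewrite /b; field; move: d1; rewrite pmulr_rgt0// => /gt_eqF ->.
  rewrite ler_piMr ?divr_ge0 ?(ltW e0)// ler_pdivrMr; last by move: d1; rewrite pmulr_rgt0.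
  by rewrite mul1r lerDl.
by lra.
Qed.

(** Uniform continuity on the box that contains the curve. *)
Lemma slowly_varying (f : rV -> R) (c : R -> rV) (r e : R) : continuous f ->
  (forall t : R, 0 <= t -> box 0 r (c t)) ->
  (forall e : R, 0 < e -> exists T : R, forall t s i, T <= t -> t <= s <= t + 1 -> `|c s 0 i - c t 0 i| <= e) ->
  0 < e -> exists T : R, forall t s, T <= t -> t <= s <= t + 1 -> `|f (c s) - f (c t)| <= e.
Proof.
move=> cf cr cs e0.
have [d d0 dP] := @compact_unif_cont R rV _ f e (@compact_box R n 0 r) cf e0.
have d20 : 0 < d / 2 by rewrite divr_gt0.
have [T TP] := cs _ d20; exists (Num.max 0 T) => t s; rewrite ge_max => /andP[t0 Tt] ts.
rewrite distrC; apply: ltW; apply: dP; first exact: cr.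
rewrite -ball_normE/=; apply: (@le_lt_trans _ _ (d / 2)); last by rewrite ltr_pdivrMr// ltr_pMr// ltr1n.
apply: norm_le_coord; first exact: ltW.
by move=> i; rewrite !mxE distrC; exact: TP.
Qed.

Lemma position_slow k (e : R) : 0 < e ->
  exists T : R, forall t s i, T <= t -> t <= s <= t + 1 -> `|q k s 0 i - q k t 0 i| <= e.
Proof.
move=> e0; have [T T0 TP] := velocities_vanish e0; exists T => t s i Tt /andP[ts st].
have cq : continuous (fun t => q k t 0 i) by move=> u; exact: is_derive_continuous (dq k u i).
rewrite -(FTC2_itv ts (@cv k i) (fun s _ => dq k s i) cq).
apply: (@le_trans _ _ (e * (s - t))).
  apply: Rintegral_itv_bound => //; first exact: rint_itv.
  by move=> r /andP[tr _]; apply: TP; exact: le_trans tr.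
by rewrite ler_piMr ?(ltW e0)//; lra.
Qed.

Lemma distance_slow k j (e : R) : 0 < e ->
  exists T : R, forall t s i, T <= t -> t <= s <= t + 1 ->
    `|(q k s - q j s) 0 i - (q k t - q j t) 0 i| <= e.
Proof.
move=> e0; have e20 : 0 < e / 2 by rewrite divr_gt0.
have [T1 TP1] := position_slow k e20; have [T2 TP2] := position_slow j e20.
exists (Num.max T1 T2) => t s i; rewrite ge_max => /andP[t1 t2] ts.
rewrite !mxE (_ : _ - _ = (q k s 0 i - q k t 0 i) - (q j s 0 i - q j t 0 i)); last by ring.
apply: le_trans (ler_normB _ _) _; rewrite [leRHS]splitr.
by apply: lerD; [exact: TP1|exact: TP2].
Qed.

(** Over a unit interval the integrals of r and of a, the latter an increment of
the velocity, are small, hence so is the integral of f; and f varies slowly,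
so that it is close to its average. *)
Lemma residual_vanish x (f r : R -> R) (e : R) : continuous f -> continuous r ->
  (forall t : R, 0 <= t -> a x t = r t - f t) ->
  (forall e : R, 0 < e -> exists T : R, forall t s, T <= t -> t <= s <= t + 1 -> `|f s - f t| <= e) ->
  (forall e : R, 0 < e -> exists T : R, forall t, T <= t -> `|\int[mu]_(s in `[t, t + 1]) r s| <= e) ->
  0 < e -> exists T : R, forall t, T <= t -> `|f t| <= e.
Proof.
move=> cf cr arf fs rs e0; have e40 : 0 < e / 4 by rewrite divr_gt0.
have [T1 TP1] := fs _ e40; have [T2 TP2] := rs _ e40; have [T3 T30 TP3] := velocities_vanish e40.
exists (Num.max T1 (Num.max T2 T3)) => t; rewrite !ge_max => /and3P[t1 t2 t3].
have tt : t <= t + 1 by lra.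
have dd s : t < s < t + 1 -> is_derive s (1 : R) (fun t => v x.1 t 0 x.2) (a x s).
  by move=> /andP[ts _]; apply: dv; lra.
have E1 := FTC2_itv tt (@ca x) dd (@cv x.1 x.2).
have E2 : \int[mu]_(s in `[t, t + 1]) a x s =
    \int[mu]_(s in `[t, t + 1]) r s - \int[mu]_(s in `[t, t + 1]) f s.
  rewrite -RintB; [|exact: rint_itv|exact: rint_itv].
  by apply: Rintegral_ext => s /=; rewrite in_itv/= => /andP[ts _]; apply: arf; lra.
have E3 : `|\int[mu]_(s in `[t, t + 1]) (f s - f t)| <= e / 4.
  have -> : e / 4 = e / 4 * (t + 1 - t) by rewrite addrAC subrr add0r mulr1.
  apply: Rintegral_itv_bound => //; last by move=> s; exact: TP1.
  by apply: rint_itv; apply: contB => //; exact: contcst.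
rewrite RintB in E3; [|exact: rint_itv|exact: rint_cst].
rewrite Rintegral_itv_cst// in E3.
have := TP2 t t2; have := TP3 x.1 x.2 t t3; have := TP3 x.1 x.2 (t + 1) (le_trans t3 tt).
rewrite E2 in E1; move: E1 E3.
set F := \int[mu]_(s in _) f s; set S := \int[mu]_(s in _) r s.
rewrite !ler_norml => E1 /andP[? ?] /andP[? ?] /andP[? ?] /andP[? ?].
by apply/andP; split; lra.
Qed.

End asymptotics.

(** * The external potential *)

Section external_potential.
Context {R : realType} (n : nat).
Notation mu := (@lebesgue_measure R).
Notation leb := (@lebesgue_rV R n).
Notation rV := 'rV[R]_n.
Notation e_ i := (@basis_rV R n i).
Variable Phi0 : R -> rV -> R.
Hypothesis rP : forall t : R, 0 <= t -> continuous (Phi0 t) /\ sobolev_infty 2 (Phi0 t).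
Hypothesis cP : forall t : R, 0 <= t -> forall e : R, 0 < e -> \forall s \near t,
  0 <= s -> sobolev_infty_le 2 e (Phi0 s \- Phi0 t).
Hypothesis iP : mu.-integrable `[0, +oo[
  (fun t => 'N[leb]_+oo [EFin \o (fun x => enorm (grad (Phi0 t) x))])%E.

Lemma external_C1 t : 0 <= t -> (forall x i, derivable (Phi0 t) x (e_ i)) /\
  (forall i, continuous (fun x => 'D_(e_ i) (Phi0 t) x)).
Proof.
by move=> t0; have [c [C s]] := rP t0; apply: sobolev_loc_C1 => //; exact: sobolev_le_loc s.
Qed.

Definition external_sup t := fine ('N[leb]_+oo [EFin \o (fun x => enorm (grad (Phi0 t) x))])%E.

Lemma Lnorm_oo_le (g : rV -> R) (C : R) : (forall x, `|g x| <= C) ->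
  ('N[leb]_+oo [EFin \o g] <= C%:E)%E.
Proof.
move=> gC; rewrite unlock ifT; last first.
  apply: lt_le_trans (box_measure_gt0 (0 : rV) (@ltr01 R)) _.
  by apply: le_measure; rewrite ?inE//; exact: measurable_box.
by apply/ess_supP; apply: aeW => x /=; rewrite lee_fin.
Qed.

(** Finiteness at every time is a consequence of the Sobolev bound; integrability
in time alone would give it almost everywhere. *)
Lemma external_sup_fin t : 0 <= t ->
  ('N[leb]_+oo [EFin \o (fun x => enorm (grad (Phi0 t) x))] = (external_sup t)%:E)%E.
Proof.
move=> t0; have [c [C s]] := rP t0; have b := sobolev_le_derive c s.
rewrite /external_sup fineK// ge0_fin_numE ?Lnorm_ge0//.
apply: (@le_lt_trans _ _ (n%:R * `|C|)%:E); last exact: ltry.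
apply: Lnorm_oo_le => x; rewrite ger0_norm ?enorm_ge0//.
apply: le_trans (enorm_le_norm _) _; rewrite ler_wpM2l//; apply: norm_le_coord => // i.
by rewrite mxE; apply: le_trans (b x i) (ler_norm _).
Qed.

Lemma external_sup_ge0 t : 0 <= t -> 0 <= external_sup t.
Proof. by move=> t0; rewrite -lee_fin -external_sup_fin// Lnorm_ge0. Qed.

Lemma rint_external_sup : rint mu `[0, +oo[ external_sup.
Proof.
apply: eq_integrable iP => // t; rewrite inE/= in_itv/= andbT => t0.
by rewrite external_sup_fin.
Qed.

(** The bound holds almost everywhere, hence everywhere by continuity. *)
Lemma external_force_le t x i : 0 <= t -> `|'D_(e_ i) (Phi0 t) x| <= external_sup t.
Proof.
move=> t0; have [_ c1] := external_C1 t0.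
apply: (@continuous_ae_le R n (fun x => `|'D_(e_ i) (Phi0 t) x|)).
  by apply: (contcomp (@norm_continuous R R)); exact: c1.
have : ('N[leb]_+oo [EFin \o (fun x => enorm (grad (Phi0 t) x))] <= (external_sup t)%:E)%E.
  by rewrite external_sup_fin.
move=> /Lnorm_oo_ae; apply: filterS => z; rewrite ger0_norm ?enorm_ge0//.
by apply: le_trans; have := coord_le_enorm (grad (Phi0 t) z) i; rewrite mxE.
Qed.

(** Continuity in time holds uniformly in space, since the W^(2,oo) norm controls
the partial derivatives. Freezing the potential at negative times makes the
force continuous on the whole line. *)
Lemma external_force_continuous (q : R -> rV) i : continuous q ->
  continuous (fun t : R => 'D_(e_ i) (Phi0 (Num.max t 0)) (q t)).
Proof.
move=> cq t; apply: near_cont => e e0.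
pose m (s : R) := Num.max s 0.
have m0 s : 0 <= m s by rewrite /m le_max lexx orbT.
have cm : continuous m by move=> s; apply: continuous_max; [exact: cvg_id|exact: cvg_cst].
have e20 : 0 < e / 2 by rewrite divr_gt0.
have near1 : \forall s \near t, 0 <= m s -> sobolev_infty_le 2 (e / 2) (Phi0 (m s) \- Phi0 (m t)).
  exact: (cm t _ (cP (m0 t) e20)).
have [d1 c1] := external_C1 (m0 t).
have near2 := @cont_near R R (fun s => 'D_(e_ i) (Phi0 (m t)) (q s)) t (e / 2)
  (contcomp (@c1 i) cq) e20.
near=> s.
have sb : sobolev_infty_le 2 (e / 2) (Phi0 (m s) \- Phi0 (m t)).
  by have := m0 s; near: s.
have h2 : `|'D_(e_ i) (Phi0 (m t)) (q t) - 'D_(e_ i) (Phi0 (m t)) (q s)| <= e / 2.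
  by near: s; exact: near2.
have [d2 c2] := external_C1 (m0 s).
have cc : continuous (Phi0 (m s) \- Phi0 (m t)).
  by apply: contB; [case: (rP (m0 s))|case: (rP (m0 t))].
have h1 := sobolev_le_derive cc sb (q s) i.
rewrite (_ : 'D_(e_ i) (Phi0 (m s) \- Phi0 (m t)) (q s) =
  'D_(e_ i) (Phi0 (m s)) (q s) - 'D_(e_ i) (Phi0 (m t)) (q s)) in h1; last first.
  by rewrite deriveB.
rewrite -/(m s) -/(m t).
move: h1 h2; set x := 'D_(e_ i) (Phi0 (m s)) (q s); set y := 'D_(e_ i) (Phi0 (m t)) (q s).
set z := 'D_(e_ i) (Phi0 (m t)) (q t); rewrite !ler_norml => /andP[? ?] /andP[? ?].
by apply/andP; split; lra.
Unshelve. all: by end_near.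
Qed.

End external_potential.

(** * Convergence to equilibria *)

Section trajectories.
Context {R : realType} (n N : nat).
Notation mu := (@lebesgue_measure R).
Notation rV := 'rV[R]_n.
Notation e_ i := (@basis_rV R n i).
Notation X := ('I_N * 'I_n)%type.
Variables (V : rV -> R) (Phi0 : R -> rV -> R) (p P : R -> R) (Sigma : rV -> R).
Hypothesis N0 : (0 < N)%N.
Hypothesis p_odd : forall t : R, 0 < t -> p (- t) = - p t.
Hypothesis h2 : hypH2 Phi0 p Sigma V.
Hypothesis h3 : hypH3 Phi0 p P Sigma.
Hypothesis h5 : hypH5 P Sigma.
Variables (q v F : 'I_N -> R -> rV).
Hypothesis dq : forall k t i, is_derive t (1 : R) (fun t => q k t 0 i) (v k t 0 i).
Hypothesis dvF : forall k t i, is_derive t (1 : R) (fun t => v k t 0 i) (F k t 0 i).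
Hypothesis FE : forall k (t : R) i, 0 <= t -> F k t 0 i =
  - ('D_(e_ i) V (q k t) + 'D_(e_ i) (Phi0 t) (q k t)) +
  \int[mu]_(s in `[0, t]) (p (t - s) * pair_force Sigma q (k, i) t s).
Variable Bm : R.
Hypothesis vneg : forall k (t : R) i, t < 0 -> `|v k t 0 i| <= Bm.
Hypothesis conf : V @ at_infty n --> +oo%R \/ exists Q : R, forall k (t : R), 0 <= t -> enorm (q k t) <= Q.
Variable M : R.
Hypothesis M0 : 0 < M.
Hypothesis bS : forall x, `|Sigma x| <= M.
Hypothesis bS1 : forall i x, `|'D_(e_ i) Sigma x| <= M.
Hypothesis bS2 : forall i j x, `|'D_(e_ j) (fun x => 'D_(e_ i) Sigma x) x| <= M.

Let c : R := N%:R^-1.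
Let c0 : 0 < c. Proof. by rewrite invr_gt0 ltr0n. Qed.

Let lp : locally_integrable setT p. Proof. by case: h2. Qed.
Let pP : forall a b, a <= b -> P b - P a = \int[mu]_(t in `[a, b]) p t.
Proof. by case: h3. Qed.
Let cP : continuous P. Proof. exact: (primitive_continuous lp pP). Qed.
Let eP : forall t, P (- t) = P t. Proof. exact: (primitive_even lp pP p_odd). Qed.
Let iP : rint mu setT P.
Proof. by case: h3 => _ _ /Lfun1_integrable. Qed.
Let P_cos w : costrans P w <= 0.
Proof. by case: h3 => _ _ _ /(_ w) /(fourier_le0_costrans iP)[]. Qed.
Let P_sin w : sintrans P w = 0.
Proof. by case: h3 => _ _ _ /(_ w) /(fourier_le0_costrans iP)[]. Qed.
Let P_cos0 w : w != 0 -> costrans P w != 0.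
Proof.
case: h3 => _ _ _ /(_ w) Pw _; case: h5 => /(_ w) Pw0 _ w0.
exact: (fourier_costrans_neq0 iP Pw (Pw0 w0)).
Qed.

(* The weight 0 lies below every spectrum, so - P itself acts positively. *)
Let pdP : pdk (fun t => - P t).
Proof.
have [||||C C0 pC] := @pdk_spectral_dominates R P cP iP P_sin P_cos P_cos0 (fun _ => 0) 1 1 ltr01 (lexx 1) => //.
  exact: contcst.
move=> T L T0 jL cL; have := pC T L T0 jL cL.
have -> : (fun t s : R => (C * - P (t - s) - cosint (fun _ => 0) 1 (t - s)) * L t s) =
    fun t s => C * (- P (t - s) * L t s).
  apply/funext => t; apply/funext => s; rewrite /cosint.
  have -> : \int[mu]_(w in `[0, 1]) (0 * cos (w * (t - s))) = 0.
    transitivity (\int[mu]_(w in `[0, 1]) (0 : R)); last by rewrite Rintegral_itv_cst ?mul0r.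
    by apply: Rintegral_ext => ? _; rewrite mul0r.
  by rewrite subr0 mulrA.
rewrite dintZ//; last by apply: jcontM => //; apply: (@jcont_diff R (fun t => - P t)); exact: contN.
by rewrite pmulr_rge0.
Qed.

Let cS : continuous Sigma. Proof. by case: h2 => _ _ _ [[H _] _] _; exact: (H [::] isT). Qed.
Let dS x i : derivable Sigma x (e_ i).
Proof. by case: h2 => _ _ _ [[_ H] _] _; exact: (H [::] isT). Qed.
Let cS1 i : continuous (fun x => 'D_(e_ i) Sigma x).
Proof. by case: h2 => _ _ _ [[H _] _] _; exact: (H [:: i] isT). Qed.
Let dS1 i x j : derivable (fun x => 'D_(e_ i) Sigma x) x (e_ j).
Proof. by case: h2 => _ _ _ [[_ H] _] _; exact: (H [:: i] isT). Qed.
Let cS2 i j : continuous (fun x => 'D_(e_ j) (fun x => 'D_(e_ i) Sigma x) x).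
Proof. by case: h2 => _ _ _ [[H _] _] _; exact: (H [:: j; i] isT). Qed.
Let S_ge0 : dist_ge0 (fourier_dist Sigma). Proof. by case: h3. Qed.
Let S_supp : dist_supp (fourier_dist Sigma) = setT. Proof. by case: h5. Qed.

Let V0 x : 0 <= V x. Proof. by case: h2 => _ _ _ _ [_ _ H]; exact: H. Qed.
Let VC1 : (forall x i, derivable V x (e_ i)) /\ (forall i, continuous (fun x => 'D_(e_ i) V x)).
Proof. by case: h2 => _ _ _ _ [cV sV _]; exact: sobolev_loc_C1. Qed.
Let dV x i : derivable V x (e_ i). Proof. by case: VC1 => H _; exact: H. Qed.
Let cV1 i : continuous (fun x => 'D_(e_ i) V x). Proof. by case: VC1 => _ H; exact: H. Qed.

Let rPhi (t : R) : 0 <= t -> continuous (Phi0 t) /\ sobolev_infty 2 (Phi0 t).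
Proof. by case: h2 => H _ _ _ _; exact: H. Qed.
Let cPhi (t : R) : 0 <= t -> forall e : R, 0 < e -> \forall s \near t,
  0 <= s -> sobolev_infty_le 2 e (Phi0 s \- Phi0 t).
Proof. by case: h2 => _ H _ _ _; exact: H. Qed.
Let iPhi : mu.-integrable `[0, +oo[
  (fun t => 'N[lebesgue_rV n]_+oo [EFin \o (fun x => enorm (grad (Phi0 t) x))])%E.
Proof. by case: h3. Qed.

Let cv k i : continuous (fun t => v k t 0 i).
Proof. by move=> t; exact: is_derive_continuous (dvF k t i). Qed.
Let cq k : continuous (q k).
Proof. by apply: continuous_rV => i t; exact: is_derive_continuous (dq k t i). Qed.

Let g (x : X) t s := pair_force Sigma q x t s.
Let H (x : X) t s := pair_force_rate Sigma q v x t s.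
Let conv (x : X) t := \int[mu]_(s in `[0, t]) (P (t - s) * H x t s).
Let gv (x : X) t := 'D_(e_ x.2) V (q x.1 t).
Let w (x : X) t := 'D_(e_ x.2) (Phi0 (Num.max t 0)) (q x.1 t).
Let f (x : X) t := gv x t + P 0 * g x t t.
Let r (x : X) t := - w x t + P t * g x t 0 + conv x t.
Let a (x : X) t := r x t - f x t.

Let jg x : jcont (g x). Proof. exact: (pair_force_jcont cS1 dq). Qed.
Let jH x : jcont (H x). Proof. exact: (pair_force_rate_jcont cS2 dq cv). Qed.
Let cgv x : continuous (gv x). Proof. by apply: (contcomp (@cV1 x.2)); exact: cq. Qed.
Let cw x : continuous (w x). Proof. exact: external_force_continuous. Qed.
Let cgd x : continuous (fun t => g x t t).
Proof.
move=> t; apply: (@continuous_comp _ _ _ (fun t : R => (t, t)) (fun z : R * R => g x z.1 z.2)).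
  by apply: cont_pair; exact: cvg_id.
exact: jg.
Qed.
Let cg0 x : continuous (fun t => g x t 0). Proof. by apply: cont2_2; exact: jg. Qed.
Let cconv x : continuous (conv x).
Proof.
have j : jcont (fun t s => P (t - s) * H x t s) by apply: jcontM => //; exact: jcont_diff.
exact: (param_continuous_tri j).
Qed.
Let cf x : continuous (f x).
Proof. by apply: contD => //; apply: contM => //; exact: contcst. Qed.
Let cr x : continuous (r x).
Proof. by apply: contD => //; apply: contD; [exact: contN|exact: contM]. Qed.
Let ca x : continuous (a x). Proof. exact: contB. Qed.

Let accelE x (t : R) : 0 <= t -> F x.1 t 0 x.2 = a x t.
Proof.
move=> t0; rewrite FE// -surjective_pairing.
have cH : continuous (H x t) by apply: cont2_1; exact: jH.
have dH s : is_derive s (1 : R) (g x t) (H x t s) by exact: pair_force_derive.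
rewrite (memory_parts lp pP t0 cH dH).
by rewrite /a /r /f /w /gv /conv max_l//; ring.
Qed.

Let da x (t : R) : 0 < t -> is_derive t (1 : R) (fun t => v x.1 t 0 x.2) (a x t).
Proof. by move=> t0; rewrite -accelE ?ltW//; exact: dvF. Qed.

Let U t := c * \sum_k V (q k t).
Let dU t : is_derive t (1 : R) U (c * \sum_x gv x t * vel v x t).
Proof.
have Hk k : is_derive t (1 : R) (fun t => V (q k t)) (\sum_i 'D_(e_ i) V (q k t) * v k t 0 i).
  exact: (C1_chain dV cV1 (dq k t)).
apply: is_derive_eq (derZf c (der_sum Hk)) _; congr (c * _).
by rewrite (pair_bigA _ (fun k i => 'D_(e_ i) V (q k t) * v k t 0 i)).
Qed.

Let nn := external_sup Phi0.
Let nn0 (t : R) : 0 <= t -> 0 <= nn t. Proof. exact: external_sup_ge0. Qed.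
Let inn : rint mu `[0, +oo[ nn. Proof. exact: rint_external_sup. Qed.
Let wn x (t : R) : 0 <= t -> `|w x t| <= nn t.
Proof. by move=> t0; rewrite /w max_l//; exact: external_force_le. Qed.

Let gM x t s : `|g x t s| <= M. Proof. exact: pair_force_bound. Qed.

Let bounds : exists2 B, 0 <= B & forall t : R, 0 <= t ->
  [/\ forall x : X, vel v x t ^+ 2 <= B, U t <= B &
      dint t (fun t s => - P (t - s) * pair_power_rate Sigma q v t s) <= B].
Proof.
apply: (@energy_bounds R (prod 'I_N 'I_n) c M P (vel v) a gv w g H U (fun t => pair_kernel Sigma q t t) nn) => //.
- exact: ltW.
- by move=> x; exact: cv.
- by move=> x t t0; rewrite /a /r /f /conv; ring.
- by move=> t; rewrite /U mulr_ge0 ?(ltW c0)// sumr_ge0.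
- move=> t; exact: (pair_kernel_diag cS dS cS1 bS S_ge0 dq).
- by move=> t; exact: pair_kernel_bound.
- by move=> t s; exact: (pair_power_rate_sym cS dS cS1 dS1 cS2 bS S_ge0 dq cv).
- exact: (pdkernel_mixed (pair_kernel_derive dS cS1 dq) (pair_power_derive dS1 cS2 dq)
    (pair_power_rate_jcont cS2 dq cv) (pair_kernel_pd cS bS S_ge0 q)).
Qed.

Let position_bounds : exists Q : R, forall k (t : R), 0 <= t -> box 0 Q (q k t).
Proof.
case: conf => [Voo|[Q QP]]; last first.
  by exists Q => k t t0 i; rewrite mxE subr0; apply: le_trans (coord_le_enorm _ i) (QP k t t0).
have [B B0 BP] := bounds.
have [Q QP] : at_infty n [set x | N%:R * B < V x].
  by have := Voo _ (nbhs_pinfty_gt (num_real (N%:R * B))); exact.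
exists Q => k t t0 i; rewrite mxE subr0; apply: le_trans (coord_le_enorm _ i) _.
rewrite leNgt; apply/negP => /QP /=; apply/negP; rewrite -leNgt.
have [_ UB _] := BP t t0.
rewrite -ler_pdivrMl ?ltr0n//; apply: le_trans UB; rewrite /U ler_wpM2l ?(ltW c0)//.
by rewrite (bigD1 k)//= lerDl sumr_ge0.
Qed.

Let velocity_bound : exists2 B : R, 0 < B & forall k i t, `|v k t 0 i| <= B.
Proof.
have [B B0 BP] := bounds; exists (B + 1 + `|Bm|); first by rewrite ltr_wpDr// ltr_wpDl.
move=> k i t; have [t0|t0] := leP 0 t.
  have [/(_ (k, i)) uB _ _] := BP t t0; rewrite /vel/= in uB.
  have : `|v k t 0 i| <= B + 1.
    rewrite -real_normK ?num_real// in uB; move: (normr_ge0 (v k t 0 i)) uB B0.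
    by move: `|_| => z z0 zB B0; nra.
  by move=> h; apply: le_trans h _; rewrite lerDl.
apply: le_trans (vneg k i t0) (le_trans (ler_norm _) _); rewrite lerDr; lra.
Qed.

Let increments y (tau e : R) : 0 < tau -> 0 < e -> exists T : R, forall t, T <= t ->
  `|\sum_k Sigma (y - q k (t + tau)) - \sum_k Sigma (y - q k t)| <= e.
Proof.
move=> tau0 e0; have [B B0 vB] := velocity_bound; have [C _ CP] := bounds.
have D0 : 0 < n%:R * (M * B) + 1 by rewrite ltr_wpDl// mulr_ge0// mulr_ge0// ltW.
have hD t : `|potential_rate Sigma q v y t| <= n%:R * (M * B) + 1.
  apply: (@le_trans _ _ (n%:R * (M * B))); last by rewrite lerDl.
  by apply: potential_rate_bound => //; exact: ltW.
have dis T : 0 <= T -> dint T (fun t s => - P (t - s) *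
    (potential_rate Sigma q v y t * potential_rate Sigma q v y s)) <= Sigma 0 * C.
  move=> T0; have [_ _ dC] := CP T T0.
  apply: le_trans (potential_dissipation cS dS cS1 dS1 cS2 bS S_ge0 dq cv y T0 cP pdP) _.
  by rewrite ler_wpM2l//; exact: Sigma0_ge0.
have e1 : 0 < c * e by rewrite mulr_gt0.
have ch : continuous (potential_rate Sigma q v y) by exact: potential_rate_continuous.
have dh t : is_derive t (1 : R) (potential Sigma q y) (potential_rate Sigma q v y t) by exact: potential_derive.
have bp t : `|potential Sigma q y t| <= M by exact: potential_bound.
have [T TP] := @increment_vanish R (potential Sigma q y) (potential_rate Sigma q v y) (n%:R * (M * B) + 1) M
  ch dh D0 hD M0 bp tau tau0 P (Sigma 0 * C) cP iP P_sin P_cos P_cos0 dis (c * e) e1.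
exists T => t Tt; have := TP t Tt; rewrite /potential -mulrBr normrM gtr0_norm//.
by rewrite ler_pM2l.
Qed.

Let nP (t : R) := nn t + M * `|P t|.
Let nP0 (t : R) : 0 <= t -> 0 <= nP t.
Proof. by move=> t0; rewrite addr_ge0 ?nn0// mulr_ge0// ltW. Qed.
Let inP : rint mu `[0, +oo[ nP.
Proof.
have iPn : rint mu `[0, +oo[ (fun t => `|P t|) by apply: rintS (rint_norm iP).
by apply: rintD => //; exact: rintZ.
Qed.

Let residual_bound x (t : R) : 0 <= t -> `|r x t| <= nP t + `|conv x t|.
Proof.
move=> t0; apply: le_trans (ler_normD _ _) _; rewrite lerD2r.
apply: le_trans (ler_normD _ _) _; rewrite normrN; apply: lerD; first exact: wn.
by rewrite normrM mulrC ler_wpM2r.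
Qed.

Let HB x t s (b : R) : 0 <= b -> (forall j l, `|v j s 0 l| <= b) -> `|H x t s| <= n%:R * M * b.
Proof. by move=> b0 vb; rewrite -mulrA; exact: pair_force_rate_bound. Qed.

Let accel_bound : exists2 A : R, 0 < A & forall x (t : R), 0 <= t -> `|a x t| <= A + nP t.
Proof.
have [B B0 vB] := velocity_bound; have [Q QP] := position_bounds.
have /fin_all_exists2[Ai Ai0 AiP] : forall i : 'I_n, exists2 A : R, 0 < A &
    forall x, box 0 Q x -> `|'D_(e_ i) V x| <= A.
  by move=> i; apply: compact_cont_bounded (@cV1 i); exact: compact_box.
pose I := \int[mu]_t `|P t|; have I0 : 0 <= I by apply: Rintegral_ge0.
pose D := n%:R * M * B; have D0 : 0 <= D by rewrite !mulr_ge0// ltW.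
have convB x (t : R) : 0 <= t -> `|conv x t| <= D * I.
  move=> t0; have iPn : rint mu setT (fun t => `|P t|) by exact: rint_norm.
  have i0 : rint mu `[0, t] (fun s => `|P s|) by apply: rintS iPn.
  have [] := Rintegral_reflect_itv t i0; rewrite subr0 subrr => i1 e1.
  apply: (@le_trans _ _ (D * \int[mu]_(s in `[0, t]) `|P (t - s)|)); last first.
    by rewrite ler_wpM2l// e1; apply: Rintegral_subset_ge0.
  rewrite -(RintZ _ i1); apply: Rintegral_norm_le => //.
  - apply: rint_itv; apply: contM; last by apply: cont2_1; exact: jH.
    by apply: (contcomp cP); apply: contB; [exact: contcst|move=> ?; exact: cvg_id].
  - exact: rintZ.
  - by move=> s _; rewrite normrM mulrC ler_wpM2r//; apply: HB => //; exact: ltW.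
exists (\sum_i Ai i + `|P 0| * M + D * I + 1).
  have SA : 0 <= \sum_i Ai i by rewrite sumr_ge0// => i _; exact: ltW.
  by rewrite ltr_wpDl//; apply: addr_ge0; [apply: addr_ge0 => //; rewrite mulr_ge0// ltW|exact: mulr_ge0].
move=> x t t0; have gvB : `|gv x t| <= \sum_i Ai i.
  apply: le_trans (AiP x.2 _ (QP x.1 t t0)) _.
  by rewrite (bigD1 x.2)//= lerDl sumr_ge0// => i _; exact: ltW.
have fB : `|f x t| <= \sum_i Ai i + `|P 0| * M.
  by apply: le_trans (ler_normD _ _) _; rewrite normrM lerD// ler_wpM2l.
have := residual_bound x t0; have := convB x t t0; have := ler_normB (r x t) (f x t).
rewrite -/(a x t); move: fB.
by move: `|conv x t| `|a x t| `|r x t| `|f x t| (\sum_i Ai i) (`|P 0| * M) (D * I) (nP t) => *; lra.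
Qed.

Let residual_average x (e : R) : 0 < e -> exists T : R, forall t, T <= t ->
  `|\int[mu]_(s in `[t, t + 1]) r x s| <= e.
Proof.
move=> e0; have e20 : 0 < e / 2 by rewrite divr_gt0.
have [B B0 vB] := velocity_bound; have [Q QP] := position_bounds; have [A A0 aA] := accel_bound.
have nM : 0 <= n%:R * M by rewrite mulr_ge0// ltW.
have [T1 T10 TP1] := memory_vanish cS bS S_ge0 S_supp dq cv da QP (fun k i t _ => vB k i t)
  A0 ca aA nP0 inP increments cP iP nM (@jH x) (@HB x) e20.
have [T2 T20 TP2] := nn_tail nP0 inP e20.
exists (T1 + T2) => t Tt; have tt : t <= t + 1 by lra.
have i1 : rint mu `[t, t + 1] nP.
  by apply: rintS inP => // s /=; rewrite !in_itv/= => /andP[ts _]; rewrite andbT; lra.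
have i2 : rint mu `[t, t + 1] (fun s => nP s + e / 2) by apply: rintD => //; exact: rint_cst.
apply: (@le_trans _ _ (\int[mu]_(s in `[t, t + 1]) (nP s + e / 2))).
  apply: Rintegral_norm_le => //; first exact: rint_itv.
  move=> s /=; rewrite in_itv/= => /andP[ts _].
  apply: le_trans (residual_bound x _) _; first lra.
  by rewrite lerD2l; apply: TP1; lra.
have ic : rint mu `[t, t + 1] (fun _ => e / 2) by exact: rint_cst.
have -> : \int[mu]_(s in `[t, t + 1]) (nP s + e / 2) =
    \int[mu]_(s in `[t, t + 1]) nP s + \int[mu]_(s in `[t, t + 1]) (e / 2) by rewrite RintegralD.
rewrite Rintegral_itv_cst//.
have := TP2 t (t + 1) _ tt; set J := \int[mu]_(s in _) _ => h.
have {}h : J <= e / 2 by apply: h; lra.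
lra.
Qed.

Let force_slow x (e : R) : 0 < e ->
  exists T : R, forall t s, T <= t -> t <= s <= t + 1 -> `|f x s - f x t| <= e.
Proof.
move=> e0; have [B B0 vB] := velocity_bound; have [Q QP] := position_bounds; have [A A0 aA] := accel_bound.
pose e1 := e / (2 * (`|P 0| + 1)).
have d0 : 0 < `|P 0| + 1 by rewrite ltr_wpDl.
have e10 : 0 < e1 by rewrite divr_gt0// mulr_gt0.
have e20 : 0 < e / 2 by rewrite divr_gt0.
have pslow k := position_slow cS bS S_ge0 S_supp dq cv da QP (fun k i t _ => vB k i t)
  A0 ca aA nP0 inP increments k.
have dslow k j := distance_slow cS bS S_ge0 S_supp dq cv da QP (fun k i t _ => vB k i t)
  A0 ca aA nP0 inP increments k j.
have [T1 TP1] := slowly_varying (@cV1 x.2) (QP x.1) (@pslow x.1) e20.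
have dQ j (t : R) : 0 <= t -> box 0 (Q + Q) (q x.1 t - q j t).
  move=> t0 i; rewrite !mxE subr0; apply: le_trans (ler_normB _ _) _.
  have := QP x.1 t t0 i; have := QP j t t0 i; rewrite !mxE !subr0 => ? ?; exact: lerD.
have /fin_all_exists[T2 TP2] : forall j, exists T : R, forall t s, T <= t -> t <= s <= t + 1 ->
    `|'D_(e_ x.2) Sigma (q x.1 s - q j s) - 'D_(e_ x.2) Sigma (q x.1 t - q j t)| <= e1.
  by move=> j; exact: (@slowly_varying R n _ (fun t => q x.1 t - q j t) (Q + Q) e1 (@cS1 x.2) (dQ j) (@dslow x.1 j) e10).
exists (`|T1| + \sum_j `|T2 j|) => t s Tt ts.
have S0 : 0 <= \sum_j `|T2 j| by rewrite sumr_ge0.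
have t1 : T1 <= t by have := ler_norm T1; lra.
have t2 j : T2 j <= t.
  apply: le_trans (ler_norm _) _; apply: le_trans Tt; rewrite (bigD1 j)//= addrCA lerDl.
  by rewrite addr_ge0// sumr_ge0.
have gb : `|g x s s - g x t t| <= e1.
  rewrite /g /pair_force -mulrBr -sumrB.
  by apply: average_bound; [exact: ltW|move=> j; exact: TP2].
rewrite /f (_ : _ - _ = (gv x s - gv x t) + P 0 * (g x s s - g x t t)); last by ring.
apply: le_trans (ler_normD _ _) _; rewrite [leRHS]splitr; apply: lerD; first exact: TP1.
rewrite normrM; apply: (@le_trans _ _ ((`|P 0| + 1) * e1)).
  by apply: ler_pM => //; rewrite lerDl.
by rewrite le_eqVlt; apply/orP; left; apply/eqP; rewrite /e1; field; rewrite gt_eqF.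
Qed.

Let force_vanish x (e : R) : 0 < e -> exists T : R, forall t, T <= t -> `|f x t| <= e.
Proof.
have [B B0 vB] := velocity_bound; have [Q QP] := position_bounds; have [A A0 aA] := accel_bound.
apply: (residual_vanish cS bS S_ge0 S_supp dq cv da QP (fun k i t _ => vB k i t)
  A0 ca aA nP0 inP increments (@cf x) (@cr x)) => //.
- exact: force_slow.
- exact: residual_average.
Qed.

Let velocity_small (e : R) : 0 < e -> exists2 T : R, 0 < T & forall k i t, T <= t -> `|v k t 0 i| <= e.
Proof.
have [B B0 vB] := velocity_bound; have [Q QP] := position_bounds; have [A A0 aA] := accel_bound.
exact: (velocities_vanish cS bS S_ge0 S_supp dq cv da QP (fun k i t _ => vB k i t)
  A0 ca aA nP0 inP increments).
Qed.

(** Otherwise the phase points stay away from the equilibria along some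
ultrafilter of times; there the positions converge, the velocities and the
forces tend to 0, and the limit is an equilibrium. *)
Lemma trajectories_converge (e : R) : 0 < e -> exists T : R, forall t, T <= t ->
  (edist_set (fun k => (q k t, v k t)) (equilibria V Sigma (- P 0%R)%R) <= e%:E)%E.
Proof.
set EQ := equilibria V Sigma (- P 0%R)%R.
move=> e0; apply: contrapT => nT.
have [|S [US SB ST]] := @ultra_unbounded R
    [set t | (e%:E < edist_set (fun k => (q k t, v k t)) EQ)%E].
  move=> T; apply: contrapT => nB; apply: nT; exists T => t Tt.
  by rewrite leNgt; apply/negP => h; apply: nB; exists t.
have PS : ProperFilter S by exact: ultra_proper.
have [Q QP] := position_bounds.
have qc k : exists l : rV, q k t @[t --> S] --> l.
  by apply: (@ultra_cvg_box R n (q k) S Q) => //; apply: filterS (ST 0) => t; exact: QP.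
have [y yP] := choice qc.
have vanish (h : R -> R) : (forall e : R, 0 < e -> exists T : R, forall t, T <= t -> `|h t| <= e) ->
    h t @[t --> S] --> (0 : R).
  move=> hh; apply/cvgrPdist_le => e1 e10; have [T TP] := hh e1 e10.
  by apply: filterS (ST T) => t Tt; rewrite sub0r normrN; exact: TP.
have fx x : f x t @[t --> S] --> (0 : R) by apply: vanish; exact: force_vanish.
have vx k i : v k t 0 i @[t --> S] --> (0 : R).
  by apply: vanish => e1 e10; have [T _ TP] := velocity_small e10; exists T => t; exact: TP.
have fE x : 'D_(e_ x.2) V (y x.1) + P 0 * (c * \sum_j 'D_(e_ x.2) Sigma (y x.1 - y j)) = 0.
  have c1 : gv x t @[t --> S] --> 'D_(e_ x.2) V (y x.1).
    exact: (@continuous_cvg _ _ _ _ _ (q x.1) (fun z => 'D_(e_ x.2) V z) _ (@cV1 x.2 _) (yP x.1)).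
  have qq k j : q k t - q j t @[t --> S] --> y k - y j.
    apply: cvg_rV => i.
    have -> : (fun t => (q k t - q j t) 0 i) = (fun t => q k t 0 i - q j t 0 i).
      by apply/funext => t; rewrite !mxE.
    by rewrite !mxE; apply: cvgB; [exact: cvg_coord (yP k)|exact: cvg_coord (yP j)].
  have c2 : g x t t @[t --> S] --> c * \sum_j 'D_(e_ x.2) Sigma (y x.1 - y j).
    apply: cvgM; first exact: cvg_cst.
    apply: cvg_sumr => j.
    exact: (@continuous_cvg _ _ _ _ _ (fun t => q x.1 t - q j t) (fun z => 'D_(e_ x.2) Sigma z) _ (@cS1 x.2 _) (qq x.1 j)).
  have c3 : f x t @[t --> S] --> 'D_(e_ x.2) V (y x.1) + P 0 * (c * \sum_j 'D_(e_ x.2) Sigma (y x.1 - y j)).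
    by apply: cvgD => //; apply: cvgM => //; exact: cvg_cst.
  by apply: (cvg_unique _ c3 (fx x)); exact: Rhausdorff.
pose z : phase := fun k => (y k, 0 : rV).
have zE : EQ z.
  move=> k; split => //=; apply/rowP => i; rewrite !mxE summxE.
  have -> : \sum_j grad Sigma (y k - y j) 0 i = \sum_j 'D_(e_ i) Sigma (y k - y j).
    by apply: eq_bigr => j _; rewrite mxE.
  by rewrite -[RHS](fE (k, i)) /c; ring.
have dE : Defs.edist (fun k => (q k t, v k t)) z @[t --> S] --> (0 : R).
  have s1 : \sum_k (\sum_i (q k t 0 i - y k 0 i) * (q k t 0 i - y k 0 i) + \sum_i v k t 0 i * v k t 0 i)
      @[t --> S] --> \sum_(k < N) (\sum_(i < n) ((y k 0 i - y k 0 i) * (y k 0 i - y k 0 i)) + \sum_(i < n) (0 : R) * (0 : R)).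
    apply: cvg_sumr => k; apply: cvgD; apply: cvg_sumr => i; last by apply: cvgM; exact: vx.
    have cd : q k t 0 i - y k 0 i @[t --> S] --> y k 0 i - y k 0 i.
      by apply: cvgB; [exact: cvg_coord (yP k)|exact: cvg_cst].
    exact: cvgM.
  have z1 : \sum_(k < N) (\sum_(i < n) ((y k 0 i - y k 0 i) * (y k 0 i - y k 0 i)) + \sum_(i < n) (0 : R) * (0 : R)) = 0.
    rewrite big1// => k _; rewrite !big1 ?addr0// => i _; first by rewrite mulr0.
    by rewrite subrr mulr0.
  rewrite z1 in s1.
  move: s1; set sq := (fun t => \sum_k _) => s1.
  have s2 : Num.sqrt (sq t) @[t --> S] --> (Num.sqrt 0 : R).
    by apply: continuous_cvg s1; exact: sqrt_continuous.
  rewrite sqrtr0 in s2; apply: eq_fcvg s2 => t; rewrite /sq; congr (Num.sqrt _); apply: eq_bigr => k _.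
  rewrite !enorm_sqr /dotr; congr (_ + _); apply: eq_bigr => i _; first by rewrite !mxE.
  by rewrite !mxE subr0.
have : S set0.
  have h : S [set t | Defs.edist (fun k => (q k t, v k t)) z < e] by exact: (cvgr_lt _ dE).
  apply: (filterS _ (filterI SB h)) => t [] /= far close.
  have h4 : (edist_set (fun k => (q k t, v k t)) EQ <=
      (Defs.edist (fun k => (q k t, v k t)) z)%:E)%E by apply: ereal_inf_lbound; exists z.
  by have := lt_le_trans far h4; rewrite lte_fin ltNge (ltW close).
exact: filter_not_empty.
Qed.

End trajectories.

Lemma le_double_sum (R : realType) (I J : finType) (b : I -> J -> R) k i :
  (forall k i, 0 <= b k i) -> b k i <= \sum_k \sum_i b k i.
Proof.
move=> b0; apply: (@le_trans _ _ (\sum_i b k i)).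
  by rewrite (bigD1 i)//= lerDl sumr_ge0.
by rewrite (bigD1 k)//= lerDl sumr_ge0// => k' _; exact: sumr_ge0.
Qed.

Theorem proposition5p5 (R : realType) (d N : nat)
    (V : 'rV[R]_d -> R) (Phi0 : R -> 'rV[R]_d -> R) (p P : R -> R)
    (Sigma : 'rV[R]_d -> R) (q v : 'I_N -> R -> 'rV[R]_d)
    (hd : (0 < d)%N)
    (hN : (0 < N)%N)
    (p_odd : forall t, 0 < t -> p (- t) = - p t)
    (h2 : hypH2 Phi0 p Sigma V)
    (h3 : hypH3 Phi0 p P Sigma)
    (h4 : hypH4 Phi0 P V)
    (h5 : hypH5 P Sigma)
    (hsol : solution V Phi0 p Sigma q v)
    (hconf : V @ at_infty d --> +oo%R \/
       forall k, bounded_continuous_ge0 (q k) /\ bounded_continuous_ge0 (v k)) :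
  edist_set (fun k => (q k t, v k t)) (equilibria V Sigma (- P 0))
    @[t --> +oo%R] --> 0%E.
Proof.
set EQ := equilibria V Sigma (- P 0).
pose Fs k t := - grad (fun x => V x + Phi0 t x) (q k t) + memory_force p Sigma q k t.
have ext k : exists z : (R -> 'rV[R]_d) * (R -> 'rV[R]_d) * (R -> 'rV[R]_d),
  [/\ forall t, 0 <= t -> [/\ z.1.1 t = q k t, z.1.2 t = v k t & z.2 t = Fs k t],
      forall t i, is_derive t (1 : R) (fun t => z.1.1 t 0 i) (z.1.2 t 0 i),
      forall t i, is_derive t (1 : R) (fun t => z.1.2 t 0 i) (z.2 t 0 i) &
      forall t i, t < 0 -> `|z.1.2 t 0 i| <= `|v k 0 0 i| + `|Fs k 0 0 i|].
  have dqk t : 0 <= t -> derive_ge0 (q k) t (v k t) by move=> t0; have [] := hsol t k t0.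
  have dvk t : 0 <= t -> derive_ge0 (v k) t (Fs k t) by move=> t0; have [] := hsol t k t0.
  have [qx [vx [Fx [H1 H2 H3 H4]]]] := curve_extension dqk dvk.
  by exists (qx, vx, Fx); split => // t i t0; have [] := H4 t i t0.
have [z zP] := choice ext.
pose qx k := (z k).1.1; pose vx k := (z k).1.2; pose Fx k := (z k).2.
have qE k t : 0 <= t -> qx k t = q k t by move=> t0; have [H _ _ _] := zP k; have [] := H t t0.
have vE k t : 0 <= t -> vx k t = v k t by move=> t0; have [H _ _ _] := zP k; have [] := H t t0.
have FE k t : 0 <= t -> Fx k t = Fs k t by move=> t0; have [H _ _ _] := zP k; have [] := H t t0.
have [M M0 [bS bS1 bS2]] : exists2 M : R, 0 < M &
  [/\ forall x, `|Sigma x| <= M, forall i x, `|'D_(basis_rV i) Sigma x| <= M &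
      forall i j x, `|'D_(basis_rV j) (fun x => 'D_(basis_rV i) Sigma x) x| <= M].
  by apply: C0m2_bounds; case: h2.
have VC1 : (forall x i, derivable V x (basis_rV i)) /\ (forall i, continuous (fun x => 'D_(basis_rV i) V x)).
  by case: h2 => _ _ _ _ [cV sV _]; exact: sobolev_loc_C1.
have FxE k t i : 0 <= t -> Fx k t 0 i =
    - ('D_(basis_rV i) V (qx k t) + 'D_(basis_rV i) (Phi0 t) (qx k t)) +
    \int[lebesgue_measure]_(s in `[0, t]) (p (t - s) * pair_force Sigma qx (k, i) t s).
  move=> t0; have [dPhi _] : (forall x i, derivable (Phi0 t) x (basis_rV i)) /\
      (forall i, continuous (fun x => 'D_(basis_rV i) (Phi0 t) x)).
    by apply: external_C1 => //; case: h2.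
  rewrite FE// /Fs qE// gradD; [|by move=> j; case: VC1 => H _; exact: H|exact: dPhi].
  rewrite !mxE; congr (_ + _); apply: Rintegral_ext => s /=; rewrite in_itv/= => /andP[s0 _].
  rewrite !mxE summxE /pair_force/= (qE _ _ t0); congr (_ * (_ * _)).
  by apply: eq_bigr => j _; rewrite mxE qE.
pose Bm := \sum_k \sum_i (`|v k 0 0 i| + `|Fs k 0 0 i|).
have vneg k t i : t < 0 -> `|vx k t 0 i| <= Bm.
  move=> t0; have [_ _ _ H] := zP k; apply: le_trans (H t i t0) _.
  have g0 k' i' : 0 <= `|v k' 0 0 i'| + `|Fs k' 0 0 i'| by rewrite addr_ge0.
  exact: (le_double_sum (b := fun k i => `|v k 0 0 i| + `|Fs k 0 0 i|)).
have conf : V @ at_infty d --> +oo%R \/ exists Q : R, forall k t, 0 <= t -> enorm (qx k t) <= Q.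
  case: hconf => [Voo|bq]; [by left|right].
  have /fin_all_exists[Q QP] : forall k, exists Q : R, forall t, 0 <= t -> enorm (q k t) <= Q.
    by move=> k; have [[_ [Q QP]] _] := bq k; exists Q.
  exists (\sum_k `|Q k|) => k t t0; rewrite qE//; apply: le_trans (QP k t t0) _.
  by apply: le_trans (ler_norm _) _; rewrite (bigD1 k)//= lerDl sumr_ge0.
have dqx k t i : is_derive t (1 : R) (fun t => qx k t 0 i) (vx k t 0 i).
  by have [_ H _ _] := zP k; exact: H.
have dvx k t i : is_derive t (1 : R) (fun t => vx k t 0 i) (Fx k t 0 i).
  by have [_ _ H _] := zP k; exact: H.
have key := trajectories_converge hN p_odd h2 h3 h5 dqx dvx FxE vneg conf M0 bS bS1 bS2.
have set_ge0 (t : R) : (0 <= edist_set (fun k => (q k t, v k t)) EQ)%E.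
  by apply: le_ereal_inf_tmp => _ [w _ <-]; rewrite lee_fin sqrtr_ge0.
have near_le (e : R) : 0 < e -> \forall t \near +oo%R,
    (edist_set (fun k => (q k t, v k t)) EQ <= e%:E)%E.
  move=> e0; have [T TP] := key e e0; near=> t.
  have t0 : 0 <= t by near: t; exact: nbhs_pinfty_ge.
  have -> : (fun k => (q k t, v k t)) = (fun k => (qx k t, vx k t)).
    by apply/funext => k; rewrite qE// vE.
  by apply: TP; near: t; exact: (nbhs_pinfty_ge (num_real T)).
apply/fine_cvgP; split.
  near=> t; rewrite ge0_fin_numE//; apply: le_lt_trans (ltry 1%R).
  by near: t; exact: near_le.
apply/cvgrPdist_le => e e0; near=> t; rewrite sub0r normrN ger0_norm ?fine_ge0//=.
have h : (edist_set (fun k => (q k t, v k t)) EQ <= e%:E)%E.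
  by near: t; exact: near_le.
rewrite -lee_fin fineK// ge0_fin_numE//; exact: le_lt_trans h (ltry e).
Unshelve. all: by end_near.
Qed.
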